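(* There exist absolute constants $C>0$ and $K_1>0$ such that the following holds. Let $t_0\in\mathbb{R}$ with $|t_0|>1$, let $\chi$ be a non-principal Dirichlet character modulo $q$ with $q\ge e^{|t_0|}+4$, and let $\delta$ be a real number with $$\frac{1}{\log(|t_0|+4)}\le\delta\le\frac12 .$$ If $L(\sigma+it,\chi)\neq 0$ for all real $\sigma,t$ with $$1-\delta<\sigma<1,\qquad |t|\le K_1|t_0|^2\log q,$$ then $$n(\chi)<C\left(K_1|t_0|^2\,\frac{\log q}{\delta}\right)^{1/\delta}.$$
   Context: For a non-principal Dirichlet character $\chi$ modulo $q$, $n(\chi)$ denotes the least character non-residue of $\chi$: the least positive integer $n$ such that $\gcd(n,q)=1$ (so that $\chi(n)\neq 0$) and $\chi(n)\neq 1$. $L(s,\chi)$ denotes the Dirichlet $L$-function of $\chi$ (analytically continued to the whole complex plane), with $s=\sigma+it$. *)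

(* Defs.v *)
From Stdlib Require Import Reals.
From Coquelicot Require Import Coquelicot.
Open Scope R_scope.

(* A character is given by its values on the nonnegative integers; by
   periodicity they determine it on Z.  The normalisation chi 1 = 1 follows
   from the other conditions, since chi 1 <> 0. *)
Record dirichlet_character (q : nat) (chi : nat -> C) : Prop := {
  dchar_modulus_pos : (0 < q)%nat;
  dchar_periodic : forall n : nat, chi (n + q)%nat = chi n;
  dchar_mult : forall m n : nat, chi (m * n)%nat = (chi m * chi n)%C;
  dchar_support : forall n : nat, chi n <> RtoC 0 <-> Nat.gcd n q = 1%nat
}.

Definition principal (q : nat) (chi : nat -> C) : Prop :=
  forall n : nat, Nat.gcd n q = 1%nat -> chi n = RtoC 1.

Definition nonresidue (q : nat) (chi : nat -> C) (n : nat) : Prop :=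
  (0 < n)%nat /\ Nat.gcd n q = 1%nat /\ chi n <> RtoC 1.

Definition least_nonresidue (q : nat) (chi : nat -> C) (n : nat) : Prop :=
  nonresidue q chi n /\ forall m : nat, nonresidue q chi m -> (n <= m)%nat.

Definition Cexp (z : C) : C := (RtoC (exp (Re z)) * (cos (Im z), sin (Im z)))%C.

(* n^{-s}, meaningful for n >= 1. *)
Definition npow_opp (n : nat) (s : C) : C := Cexp (- (s * RtoC (ln (INR n))))%C.

(* Complex differentiability: the scalars and the target are both C. *)
Definition entire (f : C -> C) : Prop :=
  forall s : C, @ex_derive C_AbsRing C_NormedModule f s.

(* L is the analytic continuation to C of the Dirichlet series of chi, for chi
   non-principal (otherwise there would be a pole at 1); by the identity
   theorem it is unique.  The term of index n is the one of the integer n + 1. *)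
Definition is_dirichlet_L (chi : nat -> C) (L : C -> C) : Prop :=
  entire L /\
  forall s : C, 1 < Re s ->
    @is_series C_AbsRing C_NormedModule
      (fun n : nat => (chi (S n) * npow_opp (S n) s)%C) (L s).

(* Main.v *)
Require Import Defs.
From Stdlib Require Import Reals Lra Lia Psatz ClassicalEpsilon List Arith Permutation.
From Coquelicot Require Import Coquelicot.
Open Scope R_scope.

(** Below [n] the character takes the value 1 at every integer prime to [q], so as far as the
    integers up to [n] can tell, [- L'/L] behaves like [- zeta'/zeta] near its pole at [s = 1],
    although [L] has no pole.  This could only be reconciled by zeros of [L] close to the line [Re
    s = 1], and the hypothesis excludes them.  To make this quantitative, one Taylor coefficient
    of [L'/L] at the point [1 + eta] is computed in two ways, with [U = ln n - 128], [k] the first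
    integer above [U ^ 2 / 64] and [eta = k / U].

    Over the primes, the [k]-th coefficient is, up to sign, the sum of [Lam m * chi m * m ^ (- 1 -
    eta) * (ln m) ^ k / k!] ([coef_series]).  The factor [m ^ (- eta) * (ln m) ^ k] peaks at [ln m
    = U], and the peak has a width of about 8 in [ln m].  Hence nearly all of the sum comes from
    [m < n], where [chi m = 1]: a window just below the peak has a mass bounded below by Mertens'
    estimate, the integers beyond [n] are sixteen widths away, and there are few prime powers
    sharing a factor with [q] ([power_sum_lower]).

    Over the zeros, [L] is first bounded in a disc of radius [eta + 3 / 4] about [1 + eta], which
    extends to the left of [Re s = 1 / 2].  Partial summation bounds the partial sums of the
    series there; they are compared with [L] on a smaller circle only, but Taylor coefficients can be
    computed on either circle, so the bound passes to [L] ([approx_bound], [L_growth]).  Dividing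
    out the zeros by Blaschke factors and applying the Borel-Caratheodory inequality to the
    logarithm of the quotient expresses the coefficient as a sum over zeros with a small error
    ([log_deriv_coef]).  After multiplication by [eta ^ (k + 1)], a zero [beta + i gamma]
    contributes at most about [exp (- (1 - beta) U) / (1 + gamma ^ 2)], and the sum of [1 / (1 +
    gamma ^ 2)] is [O(log q)] by Jensen's inequality at [s = 2].  As [n < q], all heights in the
    disc are below [2 log q], so that [1 - beta >= delta] except on the line [Re s = 1]; there the
    inequality [3 + 4 cos x + cos 2x >= 0] excludes [gamma <> 0] ([L_nonzero_line]), and a zero at
    [s = 1] would contribute with a favourable sign.  Altogether the coefficient is [O(log q * exp
    (- delta U))] ([power_sum_upper]).

    If [n] were at least [(K1 * t0 ^ 2 * log q / delta) ^ (1 / delta)], then [exp (- delta * ln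
    n)] would be at most [1 / (K1 * log q)]; since [delta <= 1 / 2], the shift by 128 costs only a
    factor [exp 64], and for a large [K1] the upper bound falls below the lower one.

    The complex analysis starts from Goursat's theorem.  Applied in the coordinate [log z] it
    shows that the mean over a circle about 0 does not depend on the radius ([mean_annulus]), from
    which Cauchy's formula, Taylor coefficients, Weierstrass' theorem and the Borel-Caratheodory
    inequality follow.  The arithmetic of the series rests on the divisor sum [Lam * 1 = log],
    which gives [- D' = D * P] for the Dirichlet series and hence its logarithm ([DS_product],
    [DS_exp]). *)

(** * Complex numbers and complex differentiability *)

Lemma Cmod_le_sum (x y : R) : Cmod (x, y) <= Rabs x + Rabs y.
Proof.
  replace ((x, y) : C) with (RtoC x + Ci * RtoC y)%C
    by (unfold RtoC, Ci, Cmult, Cplus; simpl; f_equal; ring).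
  eapply Rle_trans; [apply Cmod_triangle|].
  rewrite Cmod_mult, Cmod_Ci, !Cmod_R; lra.
Qed.

Lemma im_le_Cmod (z : C) : Rabs (Im z) <= Cmod z.
Proof.
  eapply Rle_trans; [apply Rmax_r|apply (Rmax_Cmod z)].
Qed.

Lemma Cmod_triangle_minus (x y : C) : Cmod (x - y) <= Cmod x + Cmod y.
Proof. unfold Cminus. rewrite <- (Cmod_opp y). apply Cmod_triangle. Qed.

Lemma Cmod_triangle_rev (x y : C) : Cmod x - Cmod y <= Cmod (x - y).
Proof.
  assert (H := Cmod_triangle (x - y) y).
  replace (x - y + y)%C with x in H by ring. lra.
Qed.

Lemma Cmod_minus_sym (x y : C) : Cmod (x - y) = Cmod (y - x).
Proof. rewrite <- Cmod_opp. f_equal; ring. Qed.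

Definition CD (f : C -> C) (z l : C) : Prop :=
  @is_derive C_AbsRing C_NormedModule f z l.

Lemma locally_Cmod (z : C) (P : C -> Prop) :
  @locally C_UniformSpace z P <->
  exists d, 0 < d /\ forall w, Cmod (w - z) < d -> P w.
Proof.
  split.
  - intros H.
    destruct (@locally_norm_le_locally C_AbsRing C_NormedModule z P H) as [d Hd].
    exists d; split; [apply cond_pos|]. intros w Hw. apply Hd. exact Hw.
  - intros [d [Hd H]].
    apply (@locally_le_locally_norm C_AbsRing C_NormedModule z P).
    exists (mkposreal d Hd). intros w Hw. apply H. exact Hw.
Qed.

(** Derivatives are taken along the uniformity of the modulus, continuity along the one of the
    product; the two have the same neighbourhoods. *)
Lemma locally_abs_Cmod (z : C) (P : C -> Prop) :
  @locally (AbsRing_UniformSpace C_AbsRing) z P <->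
  exists d, 0 < d /\ forall w, Cmod (w - z) < d -> P w.
Proof.
  split.
  - intros [d Hd]. exists d; split; [apply cond_pos|exact Hd].
  - intros [d [Hd H]]. exists (mkposreal d Hd). exact H.
Qed.

Lemma CD_eps (f : C -> C) (z l : C) :
  CD f z l <->
  forall eps, 0 < eps -> exists d, 0 < d /\ forall w, Cmod (w - z) < d ->
    Cmod (f w - f z - l * (w - z)) <= eps * Cmod (w - z).
Proof.
  split.
  - intros [_ H] eps Heps.
    specialize (H z (fun P HP => HP) (mkposreal eps Heps)).
    apply (locally_abs_Cmod z) in H. destruct H as [d [Hd H]].
    exists d; split; auto. intros w Hw. specialize (H w Hw).
    rewrite (Cmult_comm l). exact H.
  - intros H. split.
    + apply (@is_linear_scal_l C_AbsRing C_NormedModule l).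
    + intros x Hx eps.
      assert (z = x) as <-.
      { apply (@is_filter_lim_locally_unique C_AbsRing (AbsRing_NormedModule C_AbsRing) z x Hx). }
      apply (locally_abs_Cmod z). destruct (H eps (cond_pos eps)) as [d [Hd H']].
      exists d; split; auto. intros w Hw. specialize (H' w Hw).
      rewrite (Cmult_comm l) in H'. exact H'.
Qed.

Lemma CD_ext (f g : C -> C) (z l : C) :
  (forall w, f w = g w) -> CD f z l -> CD g z l.
Proof. intros H. apply is_derive_ext. exact H. Qed.

Lemma CD_ext_loc (f g : C -> C) (z l : C) (d : R) : 0 < d ->
  (forall w, Cmod (w - z) < d -> f w = g w) -> CD f z l -> CD g z l.
Proof.
  intros Hd H Hf. apply (is_derive_ext_loc f); auto.
  apply (locally_abs_Cmod z). exists d; auto.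
Qed.

Lemma CD_const (c z : C) : CD (fun _ => c) z 0.
Proof. apply (@is_derive_const C_AbsRing C_NormedModule). Qed.

Lemma CD_id (z : C) : CD (fun w => w) z 1.
Proof.
  apply CD_eps. intros eps Heps. exists 1; split; [lra|]. intros w _.
  replace (w - z - 1 * (w - z))%C with (RtoC 0) by ring. rewrite Cmod_0.
  apply Rmult_le_pos; [lra|apply Cmod_ge_0].
Qed.

Lemma CD_plus (f g : C -> C) (z a b : C) :
  CD f z a -> CD g z b -> CD (fun w => f w + g w)%C z (a + b).
Proof. apply (@is_derive_plus C_AbsRing C_NormedModule). Qed.

Lemma CD_minus (f g : C -> C) (z a b : C) :
  CD f z a -> CD g z b -> CD (fun w => f w - g w)%C z (a - b).
Proof. apply (@is_derive_minus C_AbsRing C_NormedModule). Qed.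

Lemma CD_opp (f : C -> C) (z a : C) :
  CD f z a -> CD (fun w => - f w)%C z (- a).
Proof. apply (@is_derive_opp C_AbsRing C_NormedModule). Qed.

Lemma CD_eq (f : C -> C) (z l l' : C) : l = l' -> CD f z l -> CD f z l'.
Proof. now intros <-. Qed.

Lemma CD_cont (f : C -> C) (z l : C) : CD f z l ->
  forall eps, 0 < eps -> exists d, 0 < d /\ forall w, Cmod (w - z) < d ->
    Cmod (f w - f z) < eps.
Proof.
  intros H eps Heps. destruct (proj1 (CD_eps f z l) H 1 Rlt_0_1) as [d [Hd H1]].
  assert (Hl := Cmod_ge_0 l).
  exists (Rmin d (eps / (Cmod l + 1))); split.
  { apply Rmin_pos; auto. apply Rdiv_lt_0_compat; lra. }
  intros w Hw. assert (Cmod (w - z) < d) as Hw1 by (eapply Rlt_le_trans; [exact Hw|apply Rmin_l]).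
  assert (Cmod (w - z) < eps / (Cmod l + 1)) as Hw2 by (eapply Rlt_le_trans; [exact Hw|apply Rmin_r]).
  specialize (H1 w Hw1).
  replace (f w - f z)%C with ((f w - f z - l * (w - z)) + l * (w - z))%C by ring.
  eapply Rle_lt_trans; [apply Cmod_triangle|]. rewrite Cmod_mult.
  apply Rlt_div_r in Hw2; [|lra]. nra.
Qed.

Lemma CD_mult (f g : C -> C) (z a b : C) :
  CD f z a -> CD g z b -> CD (fun w => f w * g w)%C z (a * g z + f z * b).
Proof.
  intros Hf Hg. apply CD_eps. intros eps Heps.
  assert (Hfz := Cmod_ge_0 (f z)). assert (Hgz := Cmod_ge_0 (g z)).
  assert (Ha := Cmod_ge_0 a).
  set (e1 := eps / (3 * (Cmod (g z) + 1))).
  set (e2 := eps / (3 * (Cmod (f z) + 1))).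
  set (e3 := eps / (3 * (Cmod a + 1))).
  assert (He1 : 0 < e1) by (apply Rdiv_lt_0_compat; lra).
  assert (He2 : 0 < e2) by (apply Rdiv_lt_0_compat; lra).
  assert (He3 : 0 < e3) by (apply Rdiv_lt_0_compat; lra).
  destruct (proj1 (CD_eps f z a) Hf e1 He1) as [d1 [Hd1 H1]].
  destruct (proj1 (CD_eps g z b) Hg e2 He2) as [d2 [Hd2 H2]].
  destruct (CD_cont g z b Hg (Rmin 1 e3)) as [d3 [Hd3 H3]]; [apply Rmin_pos; lra|].
  exists (Rmin d1 (Rmin d2 d3)); split; [repeat apply Rmin_pos; auto|]. intros w Hw.
  assert (L := Rmin_l d1 (Rmin d2 d3)). assert (L1 := Rmin_r d1 (Rmin d2 d3)).
  assert (L2 := Rmin_l d2 d3). assert (L3 := Rmin_r d2 d3).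
  specialize (H1 w ltac:(lra)). specialize (H2 w ltac:(lra)). specialize (H3 w ltac:(lra)).
  assert (M1 := Rmin_l 1 e3). assert (M2 := Rmin_r 1 e3).
  assert (Hgw : Cmod (g w) <= Cmod (g z) + 1)
    by (generalize (Cmod_triangle_rev (g w) (g z)); lra).
  replace (f w * g w - f z * g z - (a * g z + f z * b) * (w - z))%C with
    ((f w - f z - a * (w - z)) * g w + f z * (g w - g z - b * (w - z))
     + a * ((g w - g z) * (w - z)))%C by ring.
  eapply Rle_trans; [apply Cmod_triangle|].
  eapply Rle_trans; [apply Rplus_le_compat_r, Cmod_triangle|]. rewrite !Cmod_mult.
  set (D := Cmod (w - z)) in *. assert (0 <= D) by apply Cmod_ge_0.
  replace (eps * D) with (e1 * D * (Cmod (g z) + 1) + (Cmod (f z) + 1) * (e2 * D)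
     + (Cmod a + 1) * (e3 * D)) by (unfold e1, e2, e3; field; lra).
  assert (0 <= Cmod (g w)) by apply Cmod_ge_0.
  assert (0 <= Cmod (g w - g z)) by apply Cmod_ge_0.
  repeat apply Rplus_le_compat.
  - apply Rmult_le_compat; auto; apply Cmod_ge_0.
  - apply Rmult_le_compat; auto; try apply Cmod_ge_0; lra.
  - apply Rmult_le_compat; auto; try lra. nra. apply Rmult_le_compat_r; lra.
Qed.

Lemma CD_scal (f : C -> C) (z a c : C) :
  CD f z a -> CD (fun w => c * f w)%C z (c * a).
Proof.
  intros Hf. eapply CD_eq; [|apply (CD_mult (fun _ => c) f z 0 a (CD_const _ _) Hf)].
  ring.
Qed.

Lemma CD_comp (f g : C -> C) (z a b : C) :
  CD g z b -> CD f (g z) a -> CD (fun w => f (g w)) z (a * b).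
Proof.
  intros Hg Hf. apply CD_eps. intros eps Heps.
  assert (Ha := Cmod_ge_0 a). assert (Hb := Cmod_ge_0 b).
  set (e1 := eps / (2 * (Cmod b + 1))).
  assert (He1 : 0 < e1) by (apply Rdiv_lt_0_compat; lra).
  set (e2 := Rmin 1 (eps / (2 * (Cmod a + 1)))).
  assert (He2 : 0 < e2) by (apply Rmin_pos; [lra|]; apply Rdiv_lt_0_compat; lra).
  destruct (proj1 (CD_eps f (g z) a) Hf e1 He1) as [d1 [Hd1 H1]].
  destruct (proj1 (CD_eps g z b) Hg e2 He2) as [d2 [Hd2 H2]].
  exists (Rmin d2 (d1 / (Cmod b + 1))); split.
  { apply Rmin_pos; auto. apply Rdiv_lt_0_compat; lra. }
  intros w Hu.
  assert (Hu1 : Cmod (w - z) < d2) by (eapply Rlt_le_trans; [exact Hu|apply Rmin_l]).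
  assert (Hu2 : Cmod (w - z) < d1 / (Cmod b + 1)) by (eapply Rlt_le_trans; [exact Hu|apply Rmin_r]).
  specialize (H2 w Hu1). apply Rlt_div_r in Hu2; [|lra].
  assert (Hpos := Cmod_ge_0 (w - z)).
  assert (e2 <= 1) by apply Rmin_l. assert (e2 <= eps / (2 * (Cmod a + 1))) as Hea by apply Rmin_r.
  assert (Hgu : Cmod (g w - g z) <= (Cmod b + 1) * Cmod (w - z)).
  { replace (g w - g z)%C with ((g w - g z - b * (w - z)) + b * (w - z))%C by ring.
    eapply Rle_trans; [apply Cmod_triangle|]. rewrite Cmod_mult. nra. }
  assert (Hl : Cmod (g w - g z) < d1) by (eapply Rle_lt_trans; [exact Hgu|]; lra).
  specialize (H1 (g w) Hl).
  replace (f (g w) - f (g z) - a * b * (w - z))%C with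
    ((f (g w) - f (g z) - a * (g w - g z)) + a * (g w - g z - b * (w - z)))%C by ring.
  eapply Rle_trans; [apply Cmod_triangle|]. rewrite Cmod_mult.
  replace (eps * Cmod (w - z)) with
    (e1 * ((Cmod b + 1) * Cmod (w - z)) + (eps / (2 * (Cmod a + 1)) * (Cmod a + 1)) * Cmod (w - z))
    by (unfold e1; field; lra).
  apply Rplus_le_compat.
  - eapply Rle_trans; [exact H1|]. apply Rmult_le_compat_l; lra.
  - eapply Rle_trans; [apply Rmult_le_compat_l; [auto|exact H2]|].
    assert (e2 * Cmod (w - z) <= eps / (2 * (Cmod a + 1)) * Cmod (w - z)) by (apply Rmult_le_compat_r; lra).
    assert (0 <= e2 * Cmod (w - z)) by nra. nra.
Qed.

Lemma CD_inv_id (z : C) : z <> 0 -> CD Cinv z (- / (z * z)).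
Proof.
  intros Hz. apply CD_eps. intros eps Heps.
  assert (Hm : 0 < Cmod z) by (now apply Cmod_gt_0).
  exists (Rmin (Cmod z / 2) (eps * (Cmod z * Cmod z * Cmod z) / 2)); split.
  { apply Rmin_pos; [lra|]. apply Rdiv_lt_0_compat; [|lra].
    repeat apply Rmult_lt_0_compat; auto. }
  intros w Hw.
  assert (Hw1 : Cmod (w - z) < Cmod z / 2) by (eapply Rlt_le_trans; [exact Hw|apply Rmin_l]).
  assert (Hw2 : Cmod (w - z) < eps * (Cmod z * Cmod z * Cmod z) / 2)
    by (eapply Rlt_le_trans; [exact Hw|apply Rmin_r]).
  assert (Hwz : Cmod z / 2 <= Cmod w).
  { assert (H := Cmod_triangle_rev z w). rewrite Cmod_minus_sym in H. lra. }
  assert (w <> 0) as Hw0 by (apply Cmod_gt_0; lra).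
  replace (/ w - / z - - / (z * z) * (w - z))%C with ((w - z) * (w - z) * / (z * z * w))%C
    by (field; auto).
  rewrite !Cmod_mult, Cmod_inv, !Cmod_mult.
  2:{ repeat apply Cmult_neq_0; auto. }
  rewrite Rmult_assoc. rewrite (Rmult_comm eps).
  apply Rmult_le_compat_l; [apply Cmod_ge_0|].
  apply Rle_div_l; [apply Rmult_lt_0_compat; [nra|lra]|].
  eapply Rle_trans; [apply Rlt_le, Hw2|].
  replace (eps * (Cmod z * Cmod z * Cmod z) / 2) with
    (eps * (Cmod z * Cmod z) * (Cmod z / 2)) by field.
  assert (0 <= eps * (Cmod z * Cmod z)) by (repeat apply Rmult_le_pos; lra).
  nra.
Qed.

Lemma CD_inv (f : C -> C) (z a : C) : f z <> 0 ->
  CD f z a -> CD (fun w => / f w)%C z (- a / (f z * f z)).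
Proof.
  intros H0 Hf. eapply CD_eq; [|apply (CD_comp Cinv f z _ a Hf (CD_inv_id _ H0))].
  field; auto.
Qed.

Lemma CD_div (f g : C -> C) (z a b : C) : g z <> 0 ->
  CD f z a -> CD g z b -> CD (fun w => f w / g w)%C z ((a * g z - f z * b) / (g z * g z)).
Proof.
  intros H0 Hf Hg. eapply CD_eq; [|apply (CD_mult f _ z a _ Hf (CD_inv g z b H0 Hg))].
  field; auto.
Qed.

(** * The complex exponential *)

Lemma Cexp_plus (z w : C) : Cexp (z + w) = (Cexp z * Cexp w)%C.
Proof.
  unfold Cexp. destruct z as [a b], w as [c d].
  unfold Cplus, Cmult, RtoC; simpl. rewrite exp_plus, cos_plus, sin_plus.
  f_equal; ring.
Qed.

Lemma Cexp_0 : Cexp 0 = 1.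
Proof.
  unfold Cexp, RtoC, Cmult; simpl. rewrite exp_0, cos_0, sin_0.
  f_equal; ring.
Qed.

Lemma Cmod_Cexp (z : C) : Cmod (Cexp z) = exp (Re z).
Proof.
  unfold Cexp. rewrite Cmod_mult, Cmod_R.
  replace (Cmod (cos (Im z), sin (Im z))) with 1.
  - rewrite Rmult_1_r. apply Rabs_pos_eq, Rlt_le, exp_pos.
  - unfold Cmod; simpl. rewrite !Rmult_1_r.
    rewrite Rplus_comm. change (1 = sqrt (Rsqr (sin (Im z)) + Rsqr (cos (Im z)))).
    now rewrite sin2_cos2, sqrt_1.
Qed.

Lemma Cexp_neq_0 (z : C) : Cexp z <> 0.
Proof. apply Cmod_gt_0. rewrite Cmod_Cexp. apply exp_pos. Qed.

Lemma Cexp_opp (z : C) : (Cexp (- z) * Cexp z)%C = 1.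
Proof. rewrite <- Cexp_plus. replace (- z + z)%C with (RtoC 0) by ring. apply Cexp_0. Qed.

Lemma Cexp_RtoC (x : R) : Cexp (RtoC x) = RtoC (exp x).
Proof.
  unfold Cexp, RtoC, Cmult; simpl. rewrite cos_0, sin_0. f_equal; ring.
Qed.

Lemma abs_sin_le (y : R) : Rabs (sin y) <= Rabs y.
Proof.
  destruct (MVT_gen sin 0 y cos) as [c [_ Hc]].
  - intros x _. apply is_derive_sin.
  - intros x _. apply continuity_sin.
  - rewrite sin_0, !Rminus_0_r in Hc. rewrite Hc, Rabs_mult.
    assert (Rabs (cos c) <= 1) by (apply Rabs_le; generalize (COS_bound c); lra).
    assert (0 <= Rabs y) by apply Rabs_pos. nra.
Qed.

Lemma one_minus_cos_le (y : R) : 0 <= 1 - cos y <= y ^ 2 / 2.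
Proof.
  split; [generalize (COS_bound y); lra|].
  replace (cos y) with (1 - 2 * sin (y / 2) * sin (y / 2)).
  2:{ rewrite <- cos_2a_sin. f_equal; field. }
  assert (H := abs_sin_le (y / 2)).
  assert (sin (y/2) ^ 2 <= (y/2) ^ 2) by (rewrite <- (pow2_abs (sin _)), <- (pow2_abs (y / 2)); apply pow_incr; split; [apply Rabs_pos|auto]).
  lra.
Qed.

Lemma sin_minus_id_le (y : R) : Rabs (sin y - y) <= Rabs y * (y ^ 2 / 2).
Proof.
  destruct (MVT_gen (fun t => sin t - t) 0 y (fun t => cos t - 1)) as [c [Hc1 Hc]].
  - intros x _. auto_derive; auto. ring.
  - intros x _. apply continuity_pt_minus; [apply continuity_sin|apply derivable_continuous, derivable_id].
  - rewrite sin_0, !Rminus_0_r in Hc. rewrite Hc, Rabs_mult, Rmult_comm.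
    apply Rmult_le_compat_l; [apply Rabs_pos|].
    generalize (one_minus_cos_le c); intros H.
    rewrite Rabs_minus_sym, Rabs_pos_eq by lra.
    enough (c ^ 2 <= y ^ 2) by lra.
    rewrite <- (pow2_abs c), <- (pow2_abs y). apply pow_incr. split; [apply Rabs_pos|].
    unfold Rmin, Rmax in Hc1. destruct (Rle_dec 0 y); unfold Rabs; repeat destruct Rcase_abs; lra.
Qed.

Lemma exp_taylor1 (x : R) : Rabs x <= 1 / 2 -> 0 <= exp x - 1 - x <= 2 * x ^ 2.
Proof.
  intros H. apply Rabs_le_between in H. split.
  - generalize (exp_ineq1_le x); lra.
  - assert (H1 := exp_ineq1_le (- x)). rewrite exp_Ropp in H1.
    assert (H2 := exp_pos x).
    assert (H3 : exp x * (1 - x) <= 1).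
    { apply Rle_trans with (exp x * / exp x); [apply Rmult_le_compat_l; lra|].
      right; field; lra. }
    assert (exp x * (1 - x) <= (1 + x + 2 * x ^ 2) * (1 - x)).
    { eapply Rle_trans; [exact H3|]. nra. }
    apply Rmult_le_reg_r in H0; lra.
Qed.

(** The real and the imaginary part reduce to first-order Taylor bounds for the exponential, sine
    and cosine of reals. *)
Lemma Cexp_taylor1 (h : C) : Cmod h <= 1 / 2 ->
  Cmod (Cexp h - 1 - h) <= 10 * Cmod h ^ 2.
Proof.
  intros H. destruct h as [x y].
  assert (Hx : Rabs x <= 1 / 2) by (eapply Rle_trans; [apply (re_le_Cmod (x, y))|auto]).
  assert (Hy : Rabs y <= 1 / 2) by (eapply Rle_trans; [apply (im_le_Cmod (x, y))|auto]).
  assert (He := exp_taylor1 x Hx).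
  assert (Hc := one_minus_cos_le y). assert (Hs := sin_minus_id_le y).
  assert (Hs' := abs_sin_le y).
  rewrite Cmod2_alt; simpl Re; simpl Im.
  replace (Cexp (x, y) - 1 - (x, y))%C with
    (((exp x - 1 - x) * cos y + (1 + x) * (cos y - 1), (exp x - 1) * sin y + (sin y - y)) : C).
  2:{ unfold Cexp, Cminus, Cplus, Copp, Cmult, RtoC; simpl. f_equal; ring. }
  eapply Rle_trans; [apply Cmod_le_sum|].
  assert (Hxx : Rabs x ^ 2 = x ^ 2) by apply pow2_abs.
  assert (Hyy : Rabs y ^ 2 = y ^ 2) by apply pow2_abs.
  assert (0 <= Rabs x) by apply Rabs_pos. assert (0 <= Rabs y) by apply Rabs_pos.
  assert (Rabs ((exp x - 1 - x) * cos y + (1 + x) * (cos y - 1)) <= 2 * x ^ 2 + 2 * (y ^ 2 / 2)).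
  { eapply Rle_trans; [apply Rabs_triang|]. rewrite !Rabs_mult.
    apply Rplus_le_compat; [|apply Rmult_le_compat; try apply Rabs_pos].
    - rewrite (Rabs_pos_eq (exp x - 1 - x)) by lra.
      assert (Rabs (cos y) <= 1) by (apply Rabs_le; generalize (COS_bound y); lra).
      assert (0 <= Rabs (cos y)) by apply Rabs_pos. nra.
    - apply Rabs_le; apply Rabs_le_between in Hx; lra.
    - rewrite Rabs_minus_sym, Rabs_pos_eq; lra. }
  assert (Rabs ((exp x - 1) * sin y + (sin y - y)) <= 2 * Rabs x * Rabs y + Rabs y * (y ^ 2 / 2)).
  { eapply Rle_trans; [apply Rabs_triang|]. rewrite Rabs_mult.
    apply Rplus_le_compat; auto.
    apply Rmult_le_compat; try apply Rabs_pos; auto.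
    replace (exp x - 1) with ((exp x - 1 - x) + x) by ring.
    eapply Rle_trans; [apply Rabs_triang|]. rewrite (Rabs_pos_eq (exp x - 1 - x)) by lra. nra. }
  assert (0 <= (Rabs x - Rabs y) ^ 2) by apply pow2_ge_0.
  assert (Rabs y * (y ^ 2 / 2) <= 1 / 2 * (y ^ 2 / 2)).
  { apply Rmult_le_compat_r; [generalize (pow2_ge_0 y); lra|auto]. }
  generalize (pow2_ge_0 x) (pow2_ge_0 y). nra.
Qed.

Lemma CD_Cexp (z : C) : CD Cexp z (Cexp z).
Proof.
  apply CD_eps. intros eps Heps.
  assert (He := exp_pos (Re z)).
  exists (Rmin (1 / 2) (eps / (10 * exp (Re z)))); split.
  { apply Rmin_pos; [lra|]. apply Rdiv_lt_0_compat; lra. }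
  intros w Hw.
  assert (Hw1 : Cmod (w - z) < 1 / 2) by (eapply Rlt_le_trans; [exact Hw|apply Rmin_l]).
  assert (Hw2 : Cmod (w - z) < eps / (10 * exp (Re z)))
    by (eapply Rlt_le_trans; [exact Hw|apply Rmin_r]).
  replace (Cexp w) with (Cexp z * Cexp (w - z))%C by (rewrite <- Cexp_plus; f_equal; ring).
  replace (Cexp z * Cexp (w - z) - Cexp z - Cexp z * (w - z))%C with
    (Cexp z * (Cexp (w - z) - 1 - (w - z)))%C by ring.
  rewrite Cmod_mult, Cmod_Cexp.
  assert (H := Cexp_taylor1 (w - z) (Rlt_le _ _ Hw1)).
  apply Rlt_div_r in Hw2; [|lra].
  assert (0 <= Cmod (w - z)) by apply Cmod_ge_0.
  eapply Rle_trans; [apply Rmult_le_compat_l; [lra|exact H]|]. nra.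
Qed.

(** * Curves in the complex plane *)

Definition RD (f : R -> C) (t : R) (l : C) : Prop :=
  @is_derive R_AbsRing C_R_NormedModule f t l.

Definition rcont (f : R -> C) (t : R) : Prop :=
  @continuous R_UniformSpace C_UniformSpace f t.

Lemma RD_eps (f : R -> C) (t : R) (l : C) :
  RD f t l <->
  forall eps, 0 < eps -> exists d, 0 < d /\ forall u, Rabs (u - t) < d ->
    Cmod (f u - f t - l * RtoC (u - t)) <= eps * Rabs (u - t).
Proof.
  split.
  - intros [_ H] eps Heps.
    specialize (H t (fun P HP => HP) (mkposreal eps Heps)).
    destruct H as [d H].
    exists d; split; [apply cond_pos|]. intros u Hu. specialize (H u Hu).
    rewrite (Cmult_comm l). rewrite <- scal_R_Cmult. rewrite Cmod_norm. exact H.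
  - intros H. split.
    + apply (@is_linear_scal_l R_AbsRing C_R_NormedModule l).
    + intros x Hx eps.
      assert (t = x) as <-.
      { apply (@is_filter_lim_locally_unique R_AbsRing R_NormedModule t x Hx). }
      destruct (H eps (cond_pos eps)) as [d [Hd H']].
      exists (mkposreal d Hd). intros u Hu. specialize (H' u Hu).
      rewrite (Cmult_comm l) in H'. rewrite <- scal_R_Cmult, Cmod_norm in H'. exact H'.
Qed.

Lemma RD_comp (f : C -> C) (g : R -> C) (t : R) (a b : C) :
  RD g t b -> CD f (g t) a -> RD (fun u => f (g u)) t (a * b).
Proof.
  intros Hg Hf. apply RD_eps. intros eps Heps.
  assert (Ha := Cmod_ge_0 a). assert (Hb := Cmod_ge_0 b).
  set (e1 := eps / (2 * (Cmod b + 1))).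
  assert (He1 : 0 < e1) by (apply Rdiv_lt_0_compat; lra).
  set (e2 := Rmin 1 (eps / (2 * (Cmod a + 1)))).
  assert (He2 : 0 < e2) by (apply Rmin_pos; [lra|]; apply Rdiv_lt_0_compat; lra).
  destruct (proj1 (CD_eps f (g t) a) Hf e1 He1) as [d1 [Hd1 H1]].
  destruct (proj1 (RD_eps g t b) Hg e2 He2) as [d2 [Hd2 H2]].
  exists (Rmin d2 (d1 / (Cmod b + 1))); split.
  { apply Rmin_pos; auto. apply Rdiv_lt_0_compat; lra. }
  intros u Hu.
  assert (Hu1 : Rabs (u - t) < d2) by (eapply Rlt_le_trans; [exact Hu|apply Rmin_l]).
  assert (Hu2 : Rabs (u - t) < d1 / (Cmod b + 1)) by (eapply Rlt_le_trans; [exact Hu|apply Rmin_r]).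
  specialize (H2 u Hu1). apply Rlt_div_r in Hu2; [|lra].
  assert (Hpos := Rabs_pos (u - t)).
  assert (e2 <= 1) by apply Rmin_l. assert (e2 <= eps / (2 * (Cmod a + 1))) as Hea by apply Rmin_r.
  assert (Hgu : Cmod (g u - g t) <= (Cmod b + 1) * Rabs (u - t)).
  { replace (g u - g t)%C with ((g u - g t - b * RtoC (u - t)) + b * RtoC (u - t))%C by ring.
    eapply Rle_trans; [apply Cmod_triangle|]. rewrite Cmod_mult, Cmod_R. nra. }
  assert (Hl : Cmod (g u - g t) < d1) by (eapply Rle_lt_trans; [exact Hgu|]; lra).
  specialize (H1 (g u) Hl).
  replace (f (g u) - f (g t) - a * b * RtoC (u - t))%C with
    ((f (g u) - f (g t) - a * (g u - g t)) + a * (g u - g t - b * RtoC (u - t)))%C by ring.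
  eapply Rle_trans; [apply Cmod_triangle|]. rewrite Cmod_mult.
  replace (eps * Rabs (u - t)) with
    (e1 * ((Cmod b + 1) * Rabs (u - t)) + (eps / (2 * (Cmod a + 1)) * (Cmod a + 1)) * Rabs (u - t))
    by (unfold e1; field; lra).
  apply Rplus_le_compat.
  - eapply Rle_trans; [exact H1|]. apply Rmult_le_compat_l; lra.
  - eapply Rle_trans; [apply Rmult_le_compat_l; [auto|exact H2]|].
    assert (e2 * Rabs (u - t) <= eps / (2 * (Cmod a + 1)) * Rabs (u - t)) by (apply Rmult_le_compat_r; lra).
    assert (0 <= e2 * Rabs (u - t)) by nra. nra.
Qed.

Lemma RD_affine (z w : C) (t : R) : RD (fun u => z + RtoC u * w)%C t w.
Proof.
  apply RD_eps. intros eps Heps. exists 1; split; [lra|]. intros u _.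
  replace (z + u * w - (z + t * w) - w * RtoC (u - t))%C with (RtoC 0).
  - rewrite Cmod_0. apply Rmult_le_pos; [lra|apply Rabs_pos].
  - rewrite RtoC_minus. ring.
Qed.

Lemma rcont_eps (f : R -> C) (t : R) :
  rcont f t <->
  forall eps, 0 < eps -> exists d, 0 < d /\ forall u, Rabs (u - t) < d -> Cmod (f u - f t) < eps.
Proof.
  split.
  - intros H eps Heps.
    assert (L : @locally C_UniformSpace (f t) (fun w => Cmod (w - f t) < eps)).
    { apply (locally_Cmod (f t)). exists eps; auto. }
    specialize (H _ L). destruct H as [d H]. exists d; split; [apply cond_pos|exact H].
  - intros H P HP. apply (locally_Cmod (f t)) in HP. destruct HP as [e [He HP]].
    destruct (H e He) as [d [Hd H']]. exists (mkposreal d Hd). intros u Hu.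
    apply HP, H', Hu.
Qed.

Lemma RD_rcont (f : R -> C) (t : R) (l : C) : RD f t l -> rcont f t.
Proof.
  intros H. apply (@ex_derive_continuous R_AbsRing C_R_NormedModule). now exists l.
Qed.

Definition ccont (f : C -> C) (z : C) : Prop :=
  forall eps, 0 < eps -> exists d, 0 < d /\ forall w, Cmod (w - z) < d -> Cmod (f w - f z) < eps.

Lemma rcont_comp (f : C -> C) (g : R -> C) (t : R) :
  rcont g t -> ccont f (g t) -> rcont (fun u => f (g u)) t.
Proof.
  intros Hg Hf. apply rcont_eps. intros eps Heps.
  destruct (Hf eps Heps) as [d1 [Hd1 H1]].
  destruct (proj1 (rcont_eps g t) Hg d1 Hd1) as [d2 [Hd2 H2]].
  exists d2; split; auto.
Qed.

Lemma rcont_mult (f g : R -> C) (t : R) : rcont f t -> rcont g t -> rcont (fun u => f u * g u)%C t.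
Proof.
  intros Hf Hg. apply rcont_eps. intros eps Heps.
  assert (Hft := Cmod_ge_0 (f t)). assert (Hgt := Cmod_ge_0 (g t)).
  set (e1 := Rmin 1 (eps / (2 * (Cmod (g t) + 1)))).
  set (e2 := eps / (2 * (Cmod (f t) + 1))).
  assert (He1 : 0 < e1) by (apply Rmin_pos; [lra|]; apply Rdiv_lt_0_compat; lra).
  assert (He2 : 0 < e2) by (apply Rdiv_lt_0_compat; lra).
  destruct (proj1 (rcont_eps f t) Hf e1 He1) as [d1 [Hd1 H1]].
  destruct (proj1 (rcont_eps g t) Hg e2 He2) as [d2 [Hd2 H2]].
  exists (Rmin d1 d2); split; [now apply Rmin_pos|]. intros u Hu.
  specialize (H1 u (Rlt_le_trans _ _ _ Hu (Rmin_l _ _))).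
  specialize (H2 u (Rlt_le_trans _ _ _ Hu (Rmin_r _ _))).
  replace (f u * g u - f t * g t)%C with ((f u) * (g u - g t) + (f u - f t) * g t)%C by ring.
  eapply Rle_lt_trans; [apply Cmod_triangle|]. rewrite !Cmod_mult.
  assert (Cmod (f u) <= Cmod (f t) + 1).
  { assert (H := Cmod_triangle_rev (f u) (f t)). assert (e1 <= 1) by apply Rmin_l. lra. }
  assert (e1 <= eps / (2 * (Cmod (g t) + 1))) by apply Rmin_r.
  assert (0 <= Cmod (f u)) by apply Cmod_ge_0.
  assert (0 <= Cmod (g u - g t)) by apply Cmod_ge_0.
  assert (0 <= Cmod (f u - f t)) by apply Cmod_ge_0.
  replace eps with ((Cmod (f t) + 1) * e2 + eps / (2 * (Cmod (g t) + 1)) * (Cmod (g t) + 1))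
    by (unfold e2; field; lra).
  apply Rplus_lt_le_compat; [nra|]. apply Rmult_le_compat; lra.
Qed.

Lemma rcont_plus (f g : R -> C) (t : R) : rcont f t -> rcont g t -> rcont (fun u => f u + g u)%C t.
Proof. apply (@continuous_plus R_UniformSpace R_AbsRing C_R_NormedModule). Qed.

Lemma rcont_const (c : C) (t : R) : rcont (fun _ => c) t.
Proof. apply continuous_const. Qed.

(** * Integrals of complex-valued functions of a real variable *)

Definition is_CI (f : R -> C) (a b : R) (l : C) : Prop := @is_RInt C_R_NormedModule f a b l.
Definition ex_CI (f : R -> C) (a b : R) : Prop := @ex_RInt C_R_NormedModule f a b.
Definition CI (f : R -> C) (a b : R) : C := @RInt C_R_CompleteNormedModule f a b.

Lemma CI_correct (f : R -> C) (a b : R) : ex_CI f a b -> is_CI f a b (CI f a b).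
Proof. apply (@RInt_correct C_R_CompleteNormedModule). Qed.

Lemma is_CI_unique (f : R -> C) (a b : R) (l : C) : is_CI f a b l -> CI f a b = l.
Proof. apply (@is_RInt_unique C_R_CompleteNormedModule). Qed.

Lemma ex_CI_cont (f : R -> C) (a b : R) :
  (forall t, Rmin a b <= t <= Rmax a b -> rcont f t) -> ex_CI f a b.
Proof. apply (@ex_RInt_continuous C_R_CompleteNormedModule). Qed.

Lemma CI_ext (f g : R -> C) (a b : R) :
  (forall t, Rmin a b < t < Rmax a b -> f t = g t) -> CI f a b = CI g a b.
Proof. apply (@RInt_ext C_R_CompleteNormedModule). Qed.

Lemma CI_Chasles (f : R -> C) (a b c : R) :
  ex_CI f a b -> ex_CI f b c -> (CI f a b + CI f b c)%C = CI f a c.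
Proof. apply (@RInt_Chasles C_R_CompleteNormedModule). Qed.

Lemma CI_plus (f g : R -> C) (a b : R) : ex_CI f a b -> ex_CI g a b ->
  CI (fun t => f t + g t)%C a b = (CI f a b + CI g a b)%C.
Proof. apply (@RInt_plus C_R_CompleteNormedModule). Qed.

Lemma CI_minus (f g : R -> C) (a b : R) : ex_CI f a b -> ex_CI g a b ->
  CI (fun t => f t - g t)%C a b = (CI f a b - CI g a b)%C.
Proof. apply (@RInt_minus C_R_CompleteNormedModule). Qed.

(** The integral is linear over the reals only; multiplication by [Ci] exchanges the components of
    the integrand. *)
Lemma is_CI_mult_Ci (f : R -> C) (a b : R) (l : C) :
  is_CI f a b l -> is_CI (fun t => Ci * f t)%C a b (Ci * l)%C.
Proof.
  intros H.
  assert (H1 := @is_RInt_fct_extend_fst R_NormedModule R_NormedModule f a b l H).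
  assert (H2 := @is_RInt_fct_extend_snd R_NormedModule R_NormedModule f a b l H).
  replace (Ci * l)%C with (- snd l, fst l)
    by (destruct l; unfold Ci, Cmult; simpl; f_equal; ring).
  apply (@is_RInt_fct_extend_pair R_NormedModule R_NormedModule).
  - eapply is_RInt_ext; [|apply (@is_RInt_opp R_NormedModule _ _ _ _ H2)].
    intros x _. unfold Ci, Cmult, opp; simpl. ring.
  - eapply is_RInt_ext; [|apply H1].
    intros x _. unfold Ci, Cmult; simpl. ring.
Qed.

Lemma is_CI_scal (f : R -> C) (a b : R) (c l : C) :
  is_CI f a b l -> is_CI (fun t => c * f t)%C a b (c * l)%C.
Proof.
  intros H. assert (H1 := is_CI_mult_Ci f a b l H).
  assert (E : forall z : C, (c * z)%C = (RtoC (Re c) * z + RtoC (Im c) * (Ci * z))%C).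
  { intros [x y]. destruct c as [u v]. unfold RtoC, Ci, Cmult, Cplus; simpl. f_equal; ring. }
  rewrite E.
  eapply (@is_RInt_ext C_R_NormedModule).
  { intros t _. symmetry. apply E. }
  apply (@is_RInt_plus C_R_NormedModule).
  - rewrite <- scal_R_Cmult.
    eapply (@is_RInt_ext C_R_NormedModule); [|apply (@is_RInt_scal C_R_NormedModule f a b (Re c) l H)].
    intros t _. apply scal_R_Cmult.
  - rewrite <- scal_R_Cmult.
    eapply (@is_RInt_ext C_R_NormedModule); [|apply (@is_RInt_scal C_R_NormedModule _ a b (Im c) _ H1)].
    intros t _. apply scal_R_Cmult.
Qed.

Lemma CI_scal (f : R -> C) (a b : R) (c : C) : ex_CI f a b ->
  CI (fun t => c * f t)%C a b = (c * CI f a b)%C.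
Proof. intros H. apply is_CI_unique, is_CI_scal, CI_correct, H. Qed.

Lemma ex_CI_minus (f g : R -> C) (a b : R) :
  ex_CI f a b -> ex_CI g a b -> ex_CI (fun t => f t - g t)%C a b.
Proof. apply (@ex_RInt_minus C_R_NormedModule). Qed.

Lemma CI_bound (f : R -> C) (a b M : R) : a <= b -> ex_CI f a b ->
  (forall t, a <= t <= b -> Cmod (f t) <= M) -> Cmod (CI f a b) <= M * (b - a).
Proof.
  intros Hab Hex HM. rewrite Cmod_norm, Rmult_comm.
  apply (@norm_RInt_le_const C_R_NormedModule f a b (CI f a b) M Hab).
  - intros t Ht. generalize (HM t Ht). now rewrite Cmod_norm.
  - now apply CI_correct.
Qed.

Lemma CI_swap (f : R -> C) (a b : R) : ex_CI f a b -> CI f b a = (- CI f a b)%C.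
Proof.
  intros H. apply is_CI_unique, (@is_RInt_swap C_R_NormedModule). now apply CI_correct.
Qed.

Lemma CI_FTC (F f : R -> C) (a b : R) :
  (forall t, Rmin a b <= t <= Rmax a b -> RD F t (f t)) ->
  (forall t, Rmin a b <= t <= Rmax a b -> rcont f t) ->
  CI f a b = (F b - F a)%C.
Proof.
  intros H1 H2. apply is_CI_unique.
  apply (@is_RInt_derive C_R_CompleteNormedModule F f a b H1 H2).
Qed.

Lemma CI_const (c : C) (a b : R) : CI (fun _ => c) a b = (RtoC (b - a) * c)%C.
Proof.
  apply is_CI_unique. rewrite <- scal_R_Cmult. apply (@is_RInt_const C_R_NormedModule).
Qed.

Lemma ex_CI_const (c : C) (a b : R) : ex_CI (fun _ => c) a b.
Proof. apply (@ex_RInt_const C_R_NormedModule). Qed.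

(** * Goursat's theorem for rectangles, and primitives *)

Definition hline (y x : R) : C := (x, y).
Definition vline (x y : R) : C := (x, y).

Lemma RD_hline (y t : R) : RD (hline y) t 1.
Proof.
  apply (@is_derive_ext R_AbsRing C_R_NormedModule (fun u => RtoC 0 + (0, y) + RtoC u * 1)%C).
  - intros u. unfold hline, RtoC, Cplus, Cmult; simpl. f_equal; ring.
  - apply RD_affine.
Qed.

Lemma RD_vline (x t : R) : RD (vline x) t Ci.
Proof.
  apply (@is_derive_ext R_AbsRing C_R_NormedModule (fun u => RtoC x + RtoC u * Ci)%C).
  - intros u. unfold vline, RtoC, Cplus, Cmult, Ci; simpl. f_equal; ring.
  - apply RD_affine.
Qed.

Definition rect_int (f : C -> C) (a b c d : R) : C :=
  (CI (fun x => f (hline c x)) a b - CI (fun x => f (hline d x)) a b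
   + Ci * (CI (fun y => f (vline b y)) c d - CI (fun y => f (vline a y)) c d))%C.

Definition in_rect (a b c d : R) (z : C) : Prop := a <= Re z <= b /\ c <= Im z <= d.

Lemma ccont_ex_h (f : C -> C) (a b y : R) : a <= b ->
  (forall x, a <= x <= b -> ccont f (x, y)) -> ex_CI (fun x => f (hline y x)) a b.
Proof.
  intros Hab H. apply ex_CI_cont. intros t Ht. rewrite Rmin_left, Rmax_right in Ht by auto.
  apply rcont_comp; [apply (RD_rcont _ _ _ (RD_hline y t))|apply H, Ht].
Qed.

Lemma ccont_ex_v (f : C -> C) (c d x : R) : c <= d ->
  (forall y, c <= y <= d -> ccont f (x, y)) -> ex_CI (fun y => f (vline x y)) c d.
Proof.
  intros Hab H. apply ex_CI_cont. intros t Ht. rewrite Rmin_left, Rmax_right in Ht by auto.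
  apply rcont_comp; [apply (RD_rcont _ _ _ (RD_vline x t))|apply H, Ht].
Qed.

Lemma rect_int_bound (f : C -> C) (a b c d M : R) : a <= b -> c <= d ->
  (forall z, in_rect a b c d z -> ccont f z) ->
  (forall z, in_rect a b c d z -> Cmod (f z) <= M) ->
  Cmod (rect_int f a b c d) <= 2 * M * ((b - a) + (d - c)).
Proof.
  intros Hab Hcd Hc HM.
  assert (Eh : forall y, c <= y <= d -> Cmod (CI (fun x => f (hline y x)) a b) <= M * (b - a)).
  { intros y Hy. apply CI_bound; auto.
    - apply ccont_ex_h; auto. intros x Hx. apply Hc. split; simpl; lra.
    - intros t Ht. apply HM. split; simpl; lra. }
  assert (Ev : forall x, a <= x <= b -> Cmod (CI (fun y => f (vline x y)) c d) <= M * (d - c)).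
  { intros x Hx. apply CI_bound; auto.
    - apply ccont_ex_v; auto. intros y Hy. apply Hc. split; simpl; lra.
    - intros t Ht. apply HM. split; simpl; lra. }
  unfold rect_int. eapply Rle_trans; [apply Cmod_triangle|].
  rewrite Cmod_mult, Cmod_Ci, Rmult_1_l.
  assert (H1 := Eh c ltac:(lra)). assert (H2 := Eh d ltac:(lra)).
  assert (H3 := Ev a ltac:(lra)). assert (H4 := Ev b ltac:(lra)).
  assert (G1 := Cmod_triangle_minus (CI (fun x => f (hline c x)) a b) (CI (fun x => f (hline d x)) a b)).
  assert (G2 := Cmod_triangle_minus (CI (fun y => f (vline b y)) c d) (CI (fun y => f (vline a y)) c d)).
  lra.
Qed.

Lemma rect_int_primitive (F f : C -> C) (a b c d : R) : a <= b -> c <= d ->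
  (forall z, in_rect a b c d z -> CD F z (f z)) ->
  (forall z, in_rect a b c d z -> ccont f z) ->
  rect_int f a b c d = 0.
Proof.
  intros Hab Hcd HF Hf.
  assert (Eh : forall y, c <= y <= d -> CI (fun x => f (hline y x)) a b = (F (b, y) - F (a, y))%C).
  { intros y Hy. apply (CI_FTC (fun x => F (hline y x))); intros t Ht;
      rewrite Rmin_left, Rmax_right in Ht by auto.
    - replace (f (hline y t)) with (f (hline y t) * 1)%C by ring.
      apply RD_comp; [apply RD_hline|]. apply HF; split; simpl; lra.
    - apply rcont_comp; [apply (RD_rcont _ _ _ (RD_hline y t))|apply Hf; split; simpl; lra]. }
  assert (Ev : forall x, a <= x <= b -> (Ci * CI (fun y => f (vline x y)) c d)%C = (F (x, d) - F (x, c))%C).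
  { intros x Hx. rewrite <- CI_scal.
    2:{ apply ccont_ex_v; auto. intros y Hy. apply Hf; split; simpl; lra. }
    apply (CI_FTC (fun y => F (vline x y))); intros t Ht;
      rewrite Rmin_left, Rmax_right in Ht by auto.
    - rewrite Cmult_comm. apply RD_comp; [apply RD_vline|]. apply HF; split; simpl; lra.
    - apply rcont_mult; [apply rcont_const|].
      apply rcont_comp; [apply (RD_rcont _ _ _ (RD_vline x t))|apply Hf; split; simpl; lra]. }
  unfold rect_int.
  replace (Ci * (CI (fun y => f (vline b y)) c d - CI (fun y => f (vline a y)) c d))%C with
    (Ci * CI (fun y => f (vline b y)) c d - Ci * CI (fun y => f (vline a y)) c d)%C by ring.
  rewrite !Eh, !Ev by lra. ring.
Qed.

Lemma rect_int_minus (f g : C -> C) (a b c d : R) : a <= b -> c <= d ->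
  (forall z, in_rect a b c d z -> ccont f z) ->
  (forall z, in_rect a b c d z -> ccont g z) ->
  rect_int (fun z => f z - g z)%C a b c d = (rect_int f a b c d - rect_int g a b c d)%C.
Proof.
  intros Hab Hcd Hf Hg. unfold rect_int.
  rewrite (CI_minus (fun x => f (hline c x)) (fun x => g (hline c x))).
  2,3: apply ccont_ex_h; auto; intros; (apply Hf || apply Hg); split; simpl; lra.
  rewrite (CI_minus (fun x => f (hline d x)) (fun x => g (hline d x))).
  2,3: apply ccont_ex_h; auto; intros; (apply Hf || apply Hg); split; simpl; lra.
  rewrite (CI_minus (fun x => f (vline a x)) (fun x => g (vline a x))).
  2,3: apply ccont_ex_v; auto; intros; (apply Hf || apply Hg); split; simpl; lra.
  rewrite (CI_minus (fun x => f (vline b x)) (fun x => g (vline b x))).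
  2,3: apply ccont_ex_v; auto; intros; (apply Hf || apply Hg); split; simpl; lra.
  ring.
Qed.

Lemma rect_int_split (f : C -> C) (a m b c n d : R) : a <= m <= b -> c <= n <= d ->
  (forall z, in_rect a b c d z -> ccont f z) ->
  rect_int f a b c d =
  (rect_int f a m c n + rect_int f m b c n + rect_int f a m n d + rect_int f m b n d)%C.
Proof.
  intros Hm Hn Hf. unfold rect_int.
  assert (Eh : forall y, c <= y <= d -> CI (fun x => f (hline y x)) a b =
    (CI (fun x => f (hline y x)) a m + CI (fun x => f (hline y x)) m b)%C).
  { intros y Hy. symmetry. apply CI_Chasles; apply ccont_ex_h; try lra;
      intros; apply Hf; split; simpl; lra. }
  assert (Ev : forall x, a <= x <= b -> CI (fun y => f (vline x y)) c d =
    (CI (fun y => f (vline x y)) c n + CI (fun y => f (vline x y)) n d)%C).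
  { intros x Hx. symmetry. apply CI_Chasles; apply ccont_ex_v; try lra;
      intros; apply Hf; split; simpl; lra. }
  rewrite !Eh, !Ev by lra. ring.
Qed.

Lemma CD_ccont (f : C -> C) (z l : C) : CD f z l -> ccont f z.
Proof. intros H eps He. now apply (CD_cont f z l). Qed.

(** The affine approximation has a primitive, so only its error contributes to the integral. *)
Lemma rect_int_local (f : C -> C) (a b c d eps : R) (p l : C) : a <= b -> c <= d ->
  in_rect a b c d p ->
  (forall z, in_rect a b c d z -> ccont f z) ->
  (forall z, in_rect a b c d z -> Cmod (f z - f p - l * (z - p)) <= eps * Cmod (z - p)) ->
  0 <= eps ->
  Cmod (rect_int f a b c d) <= 2 * eps * ((b - a) + (d - c)) ^ 2.
Proof.
  intros Hab Hcd Hp Hf Hl He.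
  set (g := fun z => (f p + l * (z - p))%C).
  assert (Hg : forall z, CD g z l).
  { intros z. eapply CD_eq; [|apply (CD_plus _ _ z _ _ (CD_const (f p) z)
      (CD_scal _ z _ l (CD_minus _ _ z _ _ (CD_id z) (CD_const p z))))]. ring. }
  assert (Hg0 : rect_int g a b c d = 0).
  { apply (rect_int_primitive (fun z => f p * z + (l * (z - p)) * (z - p) / 2)%C); auto.
    - intros z _.
      assert (H1 : CD (fun w => w - p)%C z 1).
      { eapply CD_eq; [|apply (CD_minus _ _ z _ _ (CD_id z) (CD_const p z))]. ring. }
      assert (H2 := CD_mult _ _ z _ _ (CD_scal _ z _ l H1) H1).
      assert (H3 := CD_plus _ _ z _ _ (CD_scal _ z _ (f p) (CD_id z)) (CD_scal _ z _ (/2)%C H2)).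
      eapply CD_eq; [|eapply CD_ext; [|exact H3]].
      + unfold g. field.
      + intros w. simpl. field.
    - intros z _. eapply CD_ccont, Hg. }
  replace (rect_int f a b c d) with (rect_int (fun z => f z - g z)%C a b c d).
  2:{ rewrite rect_int_minus; auto. rewrite Hg0; ring. intros z _; eapply CD_ccont, Hg. }
  eapply Rle_trans.
  - apply rect_int_bound with (M := eps * ((b - a) + (d - c))); auto.
    + intros z Hz eta Heta.
      destruct (Hf z Hz (eta / 2)) as [d1 [Hd1 H1]]; [lra|].
      destruct (CD_ccont g z l (Hg z) (eta / 2)) as [d2 [Hd2 H2]]; [lra|].
      exists (Rmin d1 d2); split; [now apply Rmin_pos|]. intros w Hw.
      specialize (H1 w (Rlt_le_trans _ _ _ Hw (Rmin_l _ _))).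
      specialize (H2 w (Rlt_le_trans _ _ _ Hw (Rmin_r _ _))).
      replace (f w - g w - (f z - g z))%C with ((f w - f z) - (g w - g z))%C by ring.
      eapply Rle_lt_trans; [apply Cmod_triangle_minus|]. lra.
    + intros z Hz. unfold g.
      replace (f z - (f p + l * (z - p)))%C with (f z - f p - l * (z - p))%C by ring.
      eapply Rle_trans; [apply Hl, Hz|]. apply Rmult_le_compat_l; auto.
      destruct z as [z1 z2], p as [p1 p2]. destruct Hz as [Hz1 Hz2], Hp as [Hp1 Hp2]; simpl in *.
      eapply Rle_trans; [apply (Cmod_le_sum (z1 - p1) (z2 - p2))|].
      apply Rplus_le_compat; apply Rabs_le; lra.
  - right; ring.
Qed.

(** The inner sides cancel in pairs, so the integral is the sum over the four quarters, and these
    cannot all be smaller than [B]. *)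
Lemma rect_int_bisect (f : C -> C) (x y w h B : R) : 0 <= w -> 0 <= h ->
  (forall z, in_rect x (x + 2 * w) y (y + 2 * h) z -> ccont f z) ->
  4 * B <= Cmod (rect_int f x (x + 2 * w) y (y + 2 * h)) ->
  exists x' y', (x <= x' <= x + w) /\ (y <= y' <= y + h) /\
    B <= Cmod (rect_int f x' (x' + w) y' (y' + h)).
Proof.
  intros Hw Hh Hf HB.
  rewrite (rect_int_split f x (x + w) (x + 2 * w) y (y + h) (y + 2 * h)) in HB by (lra || auto).
  destruct (Rle_dec B (Cmod (rect_int f x (x + w) y (y + h)))) as [H1|H1].
  { exists x, y. repeat split; lra. }
  destruct (Rle_dec B (Cmod (rect_int f (x + w) (x + 2 * w) y (y + h)))) as [H2|H2].
  { exists (x + w), y. repeat split; try lra.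
    replace (x + w + w) with (x + 2 * w) by ring. exact H2. }
  destruct (Rle_dec B (Cmod (rect_int f x (x + w) (y + h) (y + 2 * h)))) as [H3|H3].
  { exists x, (y + h). repeat split; try lra.
    replace (y + h + h) with (y + 2 * h) by ring. exact H3. }
  exists (x + w), (y + h). repeat split; try lra.
  replace (x + w + w) with (x + 2 * w) by ring.
  replace (y + h + h) with (y + 2 * h) by ring.
  assert (T1 := Cmod_triangle (rect_int f x (x + w) y (y + h)) (rect_int f (x + w) (x + 2 * w) y (y + h))).
  assert (T2 := Cmod_triangle (rect_int f x (x + w) y (y + h) + rect_int f (x + w) (x + 2 * w) y (y + h)) (rect_int f x (x + w) (y + h) (y + 2 * h))).
  assert (T3 := Cmod_triangle (rect_int f x (x + w) y (y + h) + rect_int f (x + w) (x + 2 * w) y (y + h) + rect_int f x (x + w) (y + h) (y + 2 * h)) (rect_int f (x + w) (x + 2 * w) (y + h) (y + 2 * h))).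
  lra.
Qed.

Lemma pow2_eventually (K d : R) : 0 < d -> exists n : nat, K / 2 ^ n < d.
Proof.
  intros Hd.
  destruct (Pow_x_infinity 2 ltac:(rewrite Rabs_pos_eq; lra) (Rabs K / d + 1)) as [N HN].
  exists N. specialize (HN N (le_n N)).
  assert (0 < 2 ^ N) by (apply pow_lt; lra).
  rewrite Rabs_pos_eq in HN by lra.
  apply Rlt_div_l; auto.
  assert (Rabs K <= d * (2 ^ N - 1)).
  { apply Rle_trans with (d * (Rabs K / d)); [right; field; lra|].
    apply Rmult_le_compat_l; lra. }
  generalize (Rle_abs K). nra.
Qed.

(** The left ends increase and the right ends [u n + W / 2 ^ n] decrease, so the supremum of the
    left ends lies in all the intervals. This is applied to each coordinate of the corners of
    bisected rectangles. *)
Lemma nested_limit (u : nat -> R) (W : R) :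
  (forall n, u n <= u (S n) <= u n + W / 2 ^ (S n)) ->
  exists X, forall n, u n <= X <= u n + W / 2 ^ n.
Proof.
  intros H.
  assert (E : forall n, W / 2 ^ n = 2 * (W / 2 ^ (S n))).
  { intros n. simpl. field. apply pow_nonzero; lra. }
  assert (U : forall n m, u n <= u (n + m)%nat).
  { intros n m. induction m; [rewrite Nat.add_0_r; lra|].
    rewrite Nat.add_succ_r. generalize (H (n + m)%nat); lra. }
  assert (V : forall n m, u (n + m)%nat + W / 2 ^ (n + m) <= u n + W / 2 ^ n).
  { intros n m. induction m; [rewrite Nat.add_0_r; lra|].
    rewrite Nat.add_succ_r. generalize (H (n + m)%nat) (E (n + m)%nat); lra. }
  assert (W0 : forall n, 0 <= W / 2 ^ n).
  { intros n. generalize (H n) (E n); lra. }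
  assert (UV : forall n m, u m <= u n + W / 2 ^ n).
  { intros n m. destruct (le_lt_dec n m).
    - replace m with (n + (m - n))%nat by lia. generalize (V n (m - n)%nat) (W0 (n + (m - n))%nat); lra.
    - generalize (U m (n - m)%nat) (W0 n). replace (m + (n - m))%nat with n by lia. lra. }
  destruct (completeness (fun x => exists n, x = u n)) as [X [HX1 HX2]].
  - exists (u O + W / 2 ^ 0). intros x [n ->]. apply UV.
  - exists (u O), O. reflexivity.
  - exists X. intros n. split.
    + apply HX1. now exists n.
    + apply HX2. intros x [m ->]. apply UV.
Qed.

(** Were the integral nonzero, bisection would produce rectangles shrinking to a point at which
    [f] cannot be differentiable. *)
Theorem Goursat (f : C -> C) (a b c d : R) : a <= b -> c <= d ->
  (forall z, in_rect a b c d z -> exists l, CD f z l) ->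
  rect_int f a b c d = 0.
Proof.
  intros Hab Hcd Hf.
  assert (Hc : forall z, in_rect a b c d z -> ccont f z).
  { intros z Hz. destruct (Hf z Hz) as [l Hl]. eapply CD_ccont, Hl. }
  destruct (Ceq_dec (rect_int f a b c d) 0) as [E|E]; auto. exfalso.
  set (B := Cmod (rect_int f a b c d)). assert (HB : 0 < B) by (now apply Cmod_gt_0).
  set (W := b - a). set (H := d - c).
  assert (HW : 0 <= W) by (unfold W; lra). assert (HH : 0 <= H) by (unfold H; lra).
  assert (P2 : forall n, 0 < 2 ^ n) by (intros; apply pow_lt; lra).
  (* After [n] bisections, the rectangle with lower left corner [p] still carries the [4 ^ n]-th
     part of the integral. *)
  set (Q := fun (n : nat) (p : R * R) =>
    a <= fst p /\ fst p + W / 2 ^ n <= b /\ c <= snd p /\ snd p + H / 2 ^ n <= d /\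
    B / 4 ^ n <= Cmod (rect_int f (fst p) (fst p + W / 2 ^ n) (snd p) (snd p + H / 2 ^ n))).
  assert (step : forall n p, exists p', Q n p ->
    Q (S n) p' /\ fst p <= fst p' <= fst p + W / 2 ^ S n /\ snd p <= snd p' <= snd p + H / 2 ^ S n).
  { intros n [x y]. destruct (classic (Q n (x, y))) as [[Q1 [Q2 [Q3 [Q4 Q5]]]]|nQ].
    2:{ exists (0, 0). intros; contradiction. }
    simpl in Q1, Q2, Q3, Q4, Q5.
    assert (EW : W / 2 ^ n = 2 * (W / 2 ^ S n)) by (simpl; field; apply pow_nonzero; lra).
    assert (EH : H / 2 ^ n = 2 * (H / 2 ^ S n)) by (simpl; field; apply pow_nonzero; lra).
    assert (HWn : 0 <= W / 2 ^ S n) by (apply Rdiv_le_0_compat; auto).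
    assert (HHn : 0 <= H / 2 ^ S n) by (apply Rdiv_le_0_compat; auto).
    rewrite EW in Q2, Q5. rewrite EH in Q4, Q5.
    destruct (rect_int_bisect f x y (W / 2 ^ S n) (H / 2 ^ S n) (B / 4 ^ S n))
      as [x' [y' [Hx [Hy HQ]]]]; auto.
    - intros z [Z1 Z2]. apply Hc. split; lra.
    - eapply Rle_trans; [|exact Q5]. right. simpl. field. apply pow_nonzero; lra.
    - exists (x', y'). intros _. unfold Q. simpl fst; simpl snd. repeat split; auto; lra. }
  set (next := fun n p => proj1_sig (constructive_indefinite_description _ (step n p))).
  assert (Hnext : forall n p, Q n p -> Q (S n) (next n p) /\ fst p <= fst (next n p) <= fst p + W / 2 ^ S n
     /\ snd p <= snd (next n p) <= snd p + H / 2 ^ S n).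
  { intros n p. unfold next. destruct (constructive_indefinite_description _ (step n p)); auto. }
  set (p := fix p n := match n with O => (a, c) | S n => next n (p n) end).
  assert (HQ : forall n, Q n (p n)).
  { induction n.
    - unfold Q; simpl. rewrite !Rdiv_1_r. replace (a + W) with b by (unfold W; ring).
      replace (c + H) with d by (unfold H; ring).
      repeat split; try lra. unfold B; lra.
    - apply (Hnext n (p n) IHn). }
  destruct (nested_limit (fun n => fst (p n)) W) as [X HX].
  { intros n. apply (Hnext n (p n) (HQ n)). }
  destruct (nested_limit (fun n => snd (p n)) H) as [Y HY].
  { intros n. apply (Hnext n (p n) (HQ n)). }
  assert (HXY : in_rect a b c d (X, Y)).
  { destruct (HQ O) as [Q1 [Q2 [Q3 [Q4 _]]]]. specialize (HX O). specialize (HY O).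
    split; simpl Re; simpl Im; lra. }
  destruct (Hf _ HXY) as [l Hl].
  set (D := W + H + 1).
  assert (HD : 0 < D) by (unfold D; lra).
  (* With this precision the local bound is half of what the invariant guarantees. *)
  set (eps := B / (4 * D ^ 2)).
  assert (Heps : 0 < eps) by (apply Rdiv_lt_0_compat; [auto|generalize (pow_lt D 2 HD); lra]).
  destruct (proj1 (CD_eps _ _ _) Hl eps Heps) as [del [Hdel Hd]].
  destruct (pow2_eventually D del Hdel) as [n Hn].
  destruct (HQ n) as [Q1 [Q2 [Q3 [Q4 Q5]]]]. specialize (HX n). specialize (HY n). simpl in HX, HY.
  set (x := fst (p n)) in *. set (y := snd (p n)) in *.
  assert (HWn : 0 <= W / 2 ^ n) by (apply Rdiv_le_0_compat; auto).
  assert (HHn : 0 <= H / 2 ^ n) by (apply Rdiv_le_0_compat; auto).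
  assert (EWH : W / 2 ^ n + H / 2 ^ n <= D / 2 ^ n).
  { unfold D. unfold Rdiv. rewrite <- Rmult_plus_distr_r. apply Rmult_le_compat_r; [|lra].
    apply Rlt_le, Rinv_0_lt_compat; auto. }
  assert (HR := rect_int_local f x (x + W / 2 ^ n) y (y + H / 2 ^ n) eps (X, Y) l).
  assert (HR' : Cmod (rect_int f x (x + W / 2 ^ n) y (y + H / 2 ^ n)) <=
      2 * eps * (x + W / 2 ^ n - x + (y + H / 2 ^ n - y)) ^ 2).
  { apply HR; try lra.
    - split; simpl; lra.
    - intros z [Z1 Z2]. apply Hc; split; lra.
    - intros [z1 z2] [Z1 Z2]; simpl in Z1, Z2. apply Hd.
      eapply Rle_lt_trans; [apply (Cmod_le_sum (z1 - X) (z2 - Y))|].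
      eapply Rle_lt_trans; [|exact Hn]. eapply Rle_trans; [|exact EWH].
      apply Rplus_le_compat; apply Rabs_le; lra. }
  assert (Hsq : (x + W / 2 ^ n - x + (y + H / 2 ^ n - y)) ^ 2 <= (D / 2 ^ n) ^ 2).
  { apply pow_incr. lra. }
  assert (2 * eps * (D / 2 ^ n) ^ 2 = B / 4 ^ n / 2).
  { unfold eps. replace (4 ^ n) with (2 ^ n * 2 ^ n).
    - field. split; [apply pow_nonzero|]; lra.
    - rewrite <- Rpow_mult_distr. f_equal; ring. }
  assert (0 < B / 4 ^ n) by (apply Rdiv_lt_0_compat; auto; apply pow_lt; lra).
  assert (2 * eps * (x + W / 2 ^ n - x + (y + H / 2 ^ n - y)) ^ 2 <= 2 * eps * (D / 2 ^ n) ^ 2)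
    by (apply Rmult_le_compat_l; lra).
  lra.
Qed.

(** * Circle means and the local theory of holomorphic functions *)

Lemma exp_le (x y : R) : x <= y -> exp x <= exp y.
Proof. intros [H| ->]; [left; now apply exp_increasing|lra]. Qed.

(** Discs about 0 suffice throughout: other centres are reached by translating the function. *)
Definition holo (f : C -> C) (R : R) : Prop :=
  forall w, Cmod w < R -> exists l, CD f w l.

Definition circ (r t : R) : C := (RtoC r * Cexp (Ci * RtoC t))%C.

Definition mean (F : C -> C) (r : R) : C :=
  (RtoC (/ (2 * PI)) * CI (fun t => F (circ r t)) 0 (2 * PI))%C.

Definition ccirc (F : C -> C) (r : R) : Prop := forall w, Cmod w = r -> ccont F w.

Lemma two_PI_pos : 0 < 2 * PI.
Proof. generalize PI_RGT_0; lra. Qed.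

Lemma two_PI_C : RtoC (2 * PI) <> 0.
Proof. intros H. apply RtoC_inj in H. generalize two_PI_pos; lra. Qed.

Lemma Cmod_circ (r t : R) : 0 <= r -> Cmod (circ r t) = r.
Proof.
  intros Hr. unfold circ. rewrite Cmod_mult, Cmod_Cexp, Cmod_R, Rabs_pos_eq by auto.
  unfold Ci, RtoC, Cmult; simpl. replace (0 * t - 1 * 0) with 0 by ring.
  rewrite exp_0; ring.
Qed.

Lemma Cexp_Ci_2PI : Cexp (Ci * RtoC (2 * PI)) = 1.
Proof.
  unfold Cexp, Ci, RtoC, Cmult; simpl.
  replace (0 * (2 * PI) - 1 * 0) with 0 by ring.
  replace (0 * 0 + 1 * (2 * PI)) with (2 * PI) by ring.
  rewrite exp_0, cos_2PI, sin_2PI. f_equal; ring.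
Qed.

Lemma circ_2PI (r : R) : circ r (2 * PI) = circ r 0.
Proof.
  unfold circ. rewrite Cexp_Ci_2PI. replace (Ci * 0)%C with (RtoC 0) by ring.
  now rewrite Cexp_0.
Qed.

Lemma RD_circ (r t : R) : RD (circ r) t (Ci * circ r t)%C.
Proof.
  unfold circ.
  replace (Ci * (r * Cexp (Ci * t)))%C with (r * Cexp (Ci * t) * Ci)%C by ring.
  apply (RD_comp (fun z => r * Cexp z)%C (fun t => Ci * RtoC t)%C t).
  - eapply (@is_derive_ext R_AbsRing C_R_NormedModule (fun u => RtoC 0 + RtoC u * Ci)%C).
    + intros u. change (RtoC 0 + RtoC u * Ci = Ci * RtoC u)%C. ring.
    + apply RD_affine.
  - apply CD_scal, CD_Cexp.
Qed.

Lemma rcont_circ (F : C -> C) (r t : R) : 0 <= r -> ccirc F r -> rcont (fun t => F (circ r t)) t.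
Proof.
  intros Hr HF. apply rcont_comp; [apply (RD_rcont _ _ _ (RD_circ r t))|].
  apply HF, Cmod_circ, Hr.
Qed.

Lemma ex_CI_circ (F : C -> C) (r : R) : 0 <= r -> ccirc F r ->
  ex_CI (fun t => F (circ r t)) 0 (2 * PI).
Proof. intros Hr HF. apply ex_CI_cont. intros t _. now apply rcont_circ. Qed.

Lemma mean_ext (F G : C -> C) (r : R) : 0 <= r ->
  (forall w, Cmod w = r -> F w = G w) -> mean F r = mean G r.
Proof.
  intros Hr H. unfold mean. f_equal. apply CI_ext. intros t _. apply H, Cmod_circ, Hr.
Qed.

Lemma mean_plus (F G : C -> C) (r : R) : 0 <= r -> ccirc F r -> ccirc G r ->
  mean (fun z => F z + G z)%C r = (mean F r + mean G r)%C.
Proof.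
  intros Hr HF HG. unfold mean.
  rewrite (CI_plus (fun t => F (circ r t)) (fun t => G (circ r t))) by now apply ex_CI_circ.
  ring.
Qed.

Lemma mean_minus (F G : C -> C) (r : R) : 0 <= r -> ccirc F r -> ccirc G r ->
  mean (fun z => F z - G z)%C r = (mean F r - mean G r)%C.
Proof.
  intros Hr HF HG. unfold mean.
  rewrite (CI_minus (fun t => F (circ r t)) (fun t => G (circ r t))) by now apply ex_CI_circ.
  ring.
Qed.

Lemma mean_scal (F : C -> C) (r : R) (c : C) : 0 <= r -> ccirc F r ->
  mean (fun z => c * F z)%C r = (c * mean F r)%C.
Proof.
  intros Hr HF. unfold mean.
  rewrite (CI_scal (fun t => F (circ r t))) by now apply ex_CI_circ. ring.
Qed.

Lemma mean_const (c : C) (r : R) : mean (fun _ => c) r = c.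
Proof.
  unfold mean. rewrite CI_const, Rminus_0_r, RtoC_inv by (generalize two_PI_pos; lra).
  field. apply two_PI_C.
Qed.

Lemma mean_bound (F : C -> C) (r M : R) : 0 <= r -> ccirc F r ->
  (forall w, Cmod w = r -> Cmod (F w) <= M) -> Cmod (mean F r) <= M.
Proof.
  intros Hr HF HM. unfold mean. assert (HP := two_PI_pos).
  rewrite Cmod_mult, Cmod_R, Rabs_pos_eq by (apply Rlt_le, Rinv_0_lt_compat; lra).
  rewrite Rmult_comm. apply Rle_div_l; [lra|].
  rewrite <- (Rminus_0_r (2 * PI)) at 2. apply CI_bound; [lra|now apply ex_CI_circ|].
  intros t _. apply HM, Cmod_circ, Hr.
Qed.

Lemma mean_dist (F G : C -> C) (r e : R) : 0 <= r -> ccirc F r -> ccirc G r ->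
  (forall w, Cmod w = r -> Cmod (F w - G w) <= e) -> Cmod (mean F r - mean G r) <= e.
Proof.
  intros Hr HF HG He. rewrite <- mean_minus by auto. apply mean_bound; auto.
  intros w Hw eps Heps.
  destruct (HF w Hw (eps / 2)) as [d1 [Hd1 H1]]; [lra|].
  destruct (HG w Hw (eps / 2)) as [d2 [Hd2 H2]]; [lra|].
  exists (Rmin d1 d2); split; [now apply Rmin_pos|]. intros v Hv.
  specialize (H1 v (Rlt_le_trans _ _ _ Hv (Rmin_l _ _))).
  specialize (H2 v (Rlt_le_trans _ _ _ Hv (Rmin_r _ _))).
  replace (F v - G v - (F w - G w))%C with ((F v - F w) - (G v - G w))%C by ring.
  eapply Rle_lt_trans; [apply Cmod_triangle_minus|]. lra.
Qed.

Lemma holo_ccont (F : C -> C) (R : R) (w : C) : holo F R -> Cmod w < R -> ccont F w.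
Proof. intros H Hw. destruct (H w Hw) as [l Hl]. eapply CD_ccont, Hl. Qed.

Lemma holo_ccirc (F : C -> C) (R r : R) : holo F R -> r < R -> ccirc F r.
Proof. intros H Hr w Hw. apply (holo_ccont F R); auto. lra. Qed.

Lemma ccont_mult (F G : C -> C) (w : C) : ccont F w -> ccont G w -> ccont (fun z => F z * G z)%C w.
Proof.
  intros Hf Hg eps Heps.
  assert (Hft := Cmod_ge_0 (F w)). assert (Hgt := Cmod_ge_0 (G w)).
  set (e1 := Rmin 1 (eps / (2 * (Cmod (G w) + 1)))).
  set (e2 := eps / (2 * (Cmod (F w) + 1))).
  assert (He1 : 0 < e1) by (apply Rmin_pos; [lra|]; apply Rdiv_lt_0_compat; lra).
  assert (He2 : 0 < e2) by (apply Rdiv_lt_0_compat; lra).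
  destruct (Hf e1 He1) as [d1 [Hd1 H1]].
  destruct (Hg e2 He2) as [d2 [Hd2 H2]].
  exists (Rmin d1 d2); split; [now apply Rmin_pos|]. intros u Hu.
  specialize (H1 u (Rlt_le_trans _ _ _ Hu (Rmin_l _ _))).
  specialize (H2 u (Rlt_le_trans _ _ _ Hu (Rmin_r _ _))).
  replace (F u * G u - F w * G w)%C with ((F u) * (G u - G w) + (F u - F w) * G w)%C by ring.
  eapply Rle_lt_trans; [apply Cmod_triangle|]. rewrite !Cmod_mult.
  assert (Cmod (F u) <= Cmod (F w) + 1).
  { assert (H := Cmod_triangle_rev (F u) (F w)). assert (e1 <= 1) by apply Rmin_l. lra. }
  assert (e1 <= eps / (2 * (Cmod (G w) + 1))) by apply Rmin_r.
  assert (0 <= Cmod (F u)) by apply Cmod_ge_0.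
  assert (0 <= Cmod (G u - G w)) by apply Cmod_ge_0.
  assert (0 <= Cmod (F u - F w)) by apply Cmod_ge_0.
  replace eps with ((Cmod (F w) + 1) * e2 + eps / (2 * (Cmod (G w) + 1)) * (Cmod (G w) + 1))
    by (unfold e2; field; lra).
  apply Rplus_lt_le_compat; [nra|]. apply Rmult_le_compat; lra.
Qed.

Lemma ccirc_mult (F G : C -> C) (r : R) : ccirc F r -> ccirc G r -> ccirc (fun z => F z * G z)%C r.
Proof. intros HF HG w Hw. apply ccont_mult; auto. Qed.

Lemma ccirc_CD (F : C -> C) (r : R) : (forall w, Cmod w = r -> exists l, CD F w l) -> ccirc F r.
Proof. intros H w Hw. destruct (H w Hw) as [l Hl]. eapply CD_ccont, Hl. Qed.

Lemma ccont_ext (F G : C -> C) (w : C) (d : R) : 0 < d ->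
  (forall z, Cmod (z - w) < d -> F z = G z) -> ccont F w -> ccont G w.
Proof.
  intros Hd H HF eps Heps. destruct (HF eps Heps) as [d1 [Hd1 H1]].
  exists (Rmin d d1); split; [now apply Rmin_pos|]. intros z Hz.
  assert (Hz1 := Rlt_le_trans _ _ _ Hz (Rmin_l _ _)).
  assert (Hz2 := Rlt_le_trans _ _ _ Hz (Rmin_r _ _)).
  rewrite <- (H z Hz1), <- (H w).
  - auto.
  - replace (w - w)%C with (RtoC 0) by ring. now rewrite Cmod_0.
Qed.

(** Goursat for a rectangle in the coordinate [log z]: the two horizontal sides cancel by
    periodicity of the exponential, which leaves the two circles. *)
Lemma mean_annulus (F : C -> C) (r1 r2 : R) : 0 < r1 <= r2 ->
  (forall w, r1 <= Cmod w <= r2 -> exists l, CD F w l) -> mean F r1 = mean F r2.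
Proof.
  intros [Hr1 Hr2] HF.
  assert (HP := two_PI_pos).
  assert (Hl : ln r1 <= ln r2) by (apply ln_le; auto).
  assert (E : rect_int (fun z => F (Cexp z)) (ln r1) (ln r2) 0 (2 * PI) = 0).
  { apply Goursat; auto; [lra|]. intros z [Hz _].
    destruct (HF (Cexp z)) as [l H].
    - rewrite Cmod_Cexp. rewrite <- (exp_ln r1) at 1 by auto. rewrite <- (exp_ln r2) by lra.
      split; apply exp_le; lra.
    - exists (l * Cexp z)%C. apply CD_comp; [apply CD_Cexp|exact H]. }
  assert (EV : forall r, 0 < r -> CI (fun y => F (Cexp (vline (ln r) y))) 0 (2 * PI)
     = CI (fun t => F (circ r t)) 0 (2 * PI)).
  { intros r Hr. apply CI_ext. intros t _. f_equal. unfold circ, vline.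
    replace ((ln r, t) : C) with (RtoC (ln r) + Ci * RtoC t)%C
      by (unfold RtoC, Ci, Cplus, Cmult; simpl; f_equal; ring).
    rewrite Cexp_plus, Cexp_RtoC, exp_ln by auto. reflexivity. }
  unfold rect_int in E. rewrite !EV in E by lra.
  replace (CI (fun x => F (Cexp (hline (2 * PI) x))) (ln r1) (ln r2)) with
    (CI (fun x => F (Cexp (hline 0 x))) (ln r1) (ln r2)) in E.
  2:{ apply CI_ext. intros t _. f_equal. unfold hline.
      replace ((t, 2 * PI) : C) with (RtoC t + Ci * RtoC (2 * PI))%C
        by (unfold RtoC, Ci, Cplus, Cmult; simpl; f_equal; ring).
      rewrite Cexp_plus, Cexp_Ci_2PI, Cmult_1_r. reflexivity. }
  unfold mean. f_equal. apply Ceq_minus.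
  match type of E with (?h - ?h + Ci * (?B - ?A) = _)%C =>
    replace (A - B)%C with (Ci * (h - h + Ci * (B - A)))%C end.
  - rewrite E. ring.
  - match goal with |- (Ci * (?h - ?h + Ci * (?B - ?A)) = _)%C =>
      replace (Ci * (h - h + Ci * (B - A)))%C with (Ci * Ci * (B - A))%C by ring end.
    replace (Ci * Ci)%C with (- (1))%C; [ring|].
    unfold Ci, Cmult, Copp, RtoC; simpl. f_equal; ring.
Qed.

(** Uniform continuity on the circle, in the form that compares it with circles of nearby radii:
    the second point need not lie on the circle. *)
Lemma circle_uniform (F : C -> C) (r e : R) : 0 <= r -> 0 < e -> ccirc F r ->
  exists d, 0 < d /\ forall t w, 0 <= t <= 2 * PI -> Cmod (w - circ r t) < d ->
    Cmod (F w - F (circ r t)) < e.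
Proof.
  intros Hr He HF.
  assert (D : forall t, exists dl : posreal, exists eta,
     dl <= eta /\ (forall u, Rabs (u - t) < dl -> Cmod (circ r u - circ r t) < eta) /\
     forall w, Cmod (w - circ r t) < 2 * eta -> Cmod (F w - F (circ r t)) < e / 2).
  { intros t. destruct (HF (circ r t) (Cmod_circ r t Hr) (e / 2)) as [d [Hd H]]; [lra|].
    destruct (proj1 (rcont_eps _ _) (RD_rcont _ _ _ (RD_circ r t)) (d / 2)) as [tau [Ht H']]; [lra|].
    assert (Hm : 0 < Rmin (d / 2) tau) by (apply Rmin_pos; lra).
    exists (mkposreal _ Hm), (d / 2). simpl. split; [apply Rmin_l|]. split.
    - intros u Hu. apply H'. eapply Rlt_le_trans; [exact Hu|apply Rmin_r].
    - intros w Hw. apply H. lra. }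
  set (delta := fun t => proj1_sig (constructive_indefinite_description _ (D t))).
  assert (Hdelta : forall t, exists eta, delta t <= eta /\
     (forall u, Rabs (u - t) < delta t -> Cmod (circ r u - circ r t) < eta) /\
     forall w, Cmod (w - circ r t) < 2 * eta -> Cmod (F w - F (circ r t)) < e / 2).
  { intros t. unfold delta. destruct (constructive_indefinite_description _ (D t)); auto. }
  destruct (compactness_value_1d 0 (2 * PI) delta) as [d Hd].
  exists d; split; [apply cond_pos|]. intros t w Ht Hw.
  apply NNPP. intros N. apply (Hd t Ht). intros [t0 [_ [Ht0 Hdt]]]. apply N.
  destruct (Hdelta t0) as [eta [G1 [G2 G3]]].
  assert (K1 := G2 t Ht0).
  assert (Hw' : Cmod (w - circ r t0) < 2 * eta).
  { replace (w - circ r t0)%C with ((w - circ r t) + (circ r t - circ r t0))%C by ring.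
    eapply Rle_lt_trans; [apply Cmod_triangle|]. lra. }
  assert (M1 := G3 w Hw'). assert (M2 := G3 (circ r t) ltac:(assert (0 <= Cmod (circ r t - circ r t0)) by apply Cmod_ge_0; lra)).
  replace (F w - F (circ r t))%C with ((F w - F (circ r t0)) - (F (circ r t) - F (circ r t0)))%C by ring.
  eapply Rle_lt_trans; [apply Cmod_triangle_minus|]. lra.
Qed.

Lemma mean_dist_circ (F : C -> C) (r r0 e : R) : 0 <= r -> 0 <= r0 -> ccirc F r -> ccirc F r0 ->
  (forall t, 0 <= t <= 2 * PI -> Cmod (F (circ r t) - F (circ r0 t)) <= e) ->
  Cmod (mean F r - mean F r0) <= e.
Proof.
  intros Hr Hr0 HF HF0 He. unfold mean.
  assert (E1 := ex_CI_circ F r Hr HF). assert (E2 := ex_CI_circ F r0 Hr0 HF0).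
  match goal with |- Cmod (?c * ?a - ?c * ?b) <= _ =>
    replace (c * a - c * b)%C with (c * (a - b))%C by ring end.
  rewrite <- CI_minus by auto.
  assert (HP := two_PI_pos).
  rewrite Cmod_mult, Cmod_R, Rabs_pos_eq by (apply Rlt_le, Rinv_0_lt_compat; lra).
  rewrite Rmult_comm. apply Rle_div_l; [lra|].
  rewrite <- (Rminus_0_r (2 * PI)) at 2. apply CI_bound; auto; [lra|].
  now apply ex_CI_minus.
Qed.

Lemma mean_cont (F : C -> C) (r0 e : R) : 0 < r0 -> 0 < e -> ccirc F r0 ->
  exists d, 0 < d /\ forall r, 0 <= r -> Rabs (r - r0) < d -> ccirc F r ->
    Cmod (mean F r - mean F r0) <= e.
Proof.
  intros Hr0 He HF.
  destruct (circle_uniform F r0 e ltac:(lra) He HF) as [d [Hd H]].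
  exists d; split; auto. intros r Hr Hrd HFr.
  apply mean_dist_circ; auto; [lra|]. intros t Ht. apply Rlt_le, H; auto.
  unfold circ. replace (r * Cexp (Ci * t) - r0 * Cexp (Ci * t))%C with
    (circ 1 t * (RtoC r - RtoC r0))%C by (unfold circ; ring).
  rewrite Cmod_mult, Cmod_circ, <- RtoC_minus, Cmod_R by lra. lra.
Qed.

(** The mean does not depend on the radius on either side of the exceptional circle [Cmod w =
    rho], is continuous across it, and tends to the value at the centre. The exceptional circle is
    what lets a divided difference be integrated before it is known to be differentiable at its
    base point. *)
Lemma mean_value (F : C -> C) (R rho r : R) :
  (forall w, Cmod w < R -> ccont F w) ->
  (forall w, 0 < Cmod w < R -> Cmod w <> rho -> exists l, CD F w l) ->
  0 < r < R -> mean F r = F 0.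
Proof.
  intros Hc Hd Hr.
  assert (Cc : forall r, r < R -> ccirc F r) by (intros r' Hr' w Hw; apply Hc; lra).
  assert (Small : forall s, 0 < s < R -> (forall s', 0 < s' <= s -> s' <> rho) -> mean F s = F 0).
  { intros s Hs Hs'. apply Ceq_minus, Cmod_eq_0.
    apply Rle_antisym; [|apply Cmod_ge_0]. apply Rnot_lt_le. intros Hpos.
    set (e := Cmod (mean F s - F 0) / 2).
    destruct (Hc 0 ltac:(rewrite Cmod_0; lra) e) as [d [Hdp Hd']]; [unfold e; lra|].
    set (s1 := Rmin s (d / 2)).
    assert (0 < s1) by (apply Rmin_pos; lra).
    assert (s1 <= s) by apply Rmin_l. assert (s1 <= d / 2) by apply Rmin_r.
    assert (E : mean F s1 = mean F s).
    { apply mean_annulus; [lra|]. intros w Hw. apply Hd; [lra|]. apply Hs'; lra. }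
    assert (Cmod (mean F s1 - mean (fun _ => F 0) s1) <= e).
    { apply mean_dist; try lra; [apply Cc; lra| |].
      - apply ccirc_CD. intros w _. eexists. apply CD_const.
      - intros w Hw. apply Rlt_le, Hd'. replace (w - 0)%C with w by ring. lra. }
    rewrite mean_const, E in H2. unfold e in H2. lra. }
  destruct (Rlt_dec r rho) as [H1|H1].
  { apply Small; auto. intros; lra. }
  destruct (Rle_dec rho 0) as [H0|H0].
  { apply Small; auto. intros; lra. }
  assert (Hrho : mean F rho = F 0).
  { apply Ceq_minus, Cmod_eq_0.
    apply Rle_antisym; [|apply Cmod_ge_0]. apply Rnot_lt_le. intros Hpos.
    destruct (mean_cont F rho (Cmod (mean F rho - F 0) / 2)) as [d [Hdp Hd']];
      [lra|lra|apply Cc; lra|].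
    set (s := Rmax (rho / 2) (rho - d / 2)).
    assert (rho / 2 <= s) by apply Rmax_l. assert (rho - d / 2 <= s) by apply Rmax_r.
    assert (s < rho) by (apply Rmax_lub_lt; lra).
    assert (Q := Hd' s ltac:(lra) ltac:(rewrite Rabs_left; lra) ltac:(apply Cc; lra)).
    rewrite (Small s) in Q by (try lra; intros; lra).
    rewrite Cmod_minus_sym in Q. lra. }
  destruct (Req_dec r rho) as [->|H2]; [exact Hrho|].
  rewrite <- Hrho. apply Ceq_minus, Cmod_eq_0.
  apply Rle_antisym; [|apply Cmod_ge_0]. apply Rnot_lt_le. intros Hpos.
  destruct (mean_cont F rho (Cmod (mean F r - mean F rho) / 2)) as [d [Hdp Hd']];
      [lra|lra|apply Cc; lra|].
  set (s := Rmin r (rho + d / 2)).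
  assert (s <= r) by apply Rmin_l. assert (s <= rho + d / 2) by apply Rmin_r.
  assert (rho < s) by (apply Rmin_glb_lt; lra).
  assert (Q := Hd' s ltac:(lra) ltac:(rewrite Rabs_pos_eq; lra) ltac:(apply Cc; lra)).
  rewrite (mean_annulus F s r) in Q; [lra|lra|].
  intros w Hw. apply Hd; lra.
Qed.

(** The mean does not depend on the radius and tends to 1 as the circle grows. *)
Lemma mean_Cauchy_kernel (w : C) (r : R) : Cmod w < r -> mean (fun z => z / (z - w))%C r = 1.
Proof.
  intros Hw. assert (Hw0 := Cmod_ge_0 w).
  assert (HD : forall s, Cmod w < s -> forall z, Cmod z = s -> exists l, CD (fun z => z / (z - w))%C z l).
  { intros s Hs z Hz. eexists. apply CD_div; [|apply CD_id|apply CD_minus; [apply CD_id|apply CD_const]].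
    intros E. apply Ceq_minus in E. subst. lra. }
  apply Ceq_minus, Cmod_eq_0. apply Rle_antisym; [|apply Cmod_ge_0]. apply Rnot_lt_le. intros Hpos.
  set (e := Cmod (mean (fun z => z / (z - w))%C r - 1)) in *.
  set (s := Cmod w + r + 2 * (Cmod w + 1) / e).
  assert (0 < 2 * (Cmod w + 1) / e) by (apply Rdiv_lt_0_compat; lra).
  assert (E : mean (fun z => z / (z - w))%C r = mean (fun z => z / (z - w))%C s).
  { apply mean_annulus; [unfold s; lra|]. intros z Hz. apply (HD (Cmod z)); lra. }
  assert (Q : Cmod (mean (fun z => z / (z - w))%C s - mean (fun _ => RtoC 1) s) <= e / 2).
  { apply mean_dist; [unfold s; lra| | |].
    - apply ccirc_CD. apply HD. unfold s; lra.
    - apply ccirc_CD. intros z _. eexists. apply CD_const.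
    - intros z Hz.
      assert (Hzw : 2 * (Cmod w + 1) / e <= Cmod (z - w)).
      { generalize (Cmod_triangle_rev z w). unfold s in Hz. lra. }
      assert (Hn : (z - w)%C <> 0) by (apply Cmod_gt_0; lra).
      replace (z / (z - w) - 1)%C with (w / (z - w))%C by (field; auto).
      rewrite Cmod_div by auto. apply Rle_div_l; [lra|].
      apply Rle_trans with (e / 2 * (2 * (Cmod w + 1) / e)).
      + replace (e / 2 * (2 * (Cmod w + 1) / e)) with (Cmod w + 1) by (field; lra). lra.
      + apply Rmult_le_compat_l; lra. }
  rewrite mean_const, <- E in Q. fold e in Q. lra.
Qed.

(** * Cauchy's formula *)

Lemma CD_unique (f : C -> C) (z l l' : C) : CD f z l -> CD f z l' -> l = l'.
Proof.
  intros H H'. apply Ceq_minus, Cmod_eq_0.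
  apply Rle_antisym; [|apply Cmod_ge_0]. apply Rnot_lt_le. intros Hpos.
  set (e := Cmod (l - l') / 3) in *.
  destruct (proj1 (CD_eps f z l) H e) as [d [Hd H1]]; [unfold e; lra|].
  destruct (proj1 (CD_eps f z l') H' e) as [d' [Hd' H2]]; [unfold e; lra|].
  set (h := Rmin (d / 2) (d' / 2)). assert (Hh : 0 < h) by (apply Rmin_pos; lra).
  assert (h <= d / 2) by apply Rmin_l. assert (h <= d' / 2) by apply Rmin_r.
  assert (E : Cmod (z + RtoC h - z) = h).
  { replace (z + h - z)%C with (RtoC h) by ring. rewrite Cmod_R. apply Rabs_pos_eq; lra. }
  specialize (H1 (z + RtoC h)%C ltac:(lra)). specialize (H2 (z + RtoC h)%C ltac:(lra)).
  assert (T := Cmod_triangle_minus (f (z + RtoC h)%C - f z - l' * (z + h - z)) (f (z + RtoC h)%C - f z - l * (z + h - z))).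
  match type of T with Cmod ?a <= _ => replace a with ((l - l') * RtoC h)%C in T by ring end.
  rewrite Cmod_mult, Cmod_R, Rabs_pos_eq in T by lra.
  rewrite E in H1, H2.
  assert (Cmod (l - l') * h <= 2 * e * h) by lra.
  apply Rmult_le_reg_r in H4; unfold e in *; lra.
Qed.

(** Total, and meaningless at points where [f] is not differentiable. *)
Definition Der (f : C -> C) (z : C) : C := epsilon (inhabits (RtoC 0)) (fun l => CD f z l).

Lemma Der_spec (f : C -> C) (z : C) : (exists l, CD f z l) -> CD f z (Der f z).
Proof. intros H. unfold Der. now apply epsilon_spec. Qed.

Lemma ccont_inv (f : C -> C) (z : C) : f z <> 0 -> ccont f z -> ccont (fun w => / f w)%C z.
Proof.
  intros H0 Hf eps Heps.
  destruct (CD_ccont Cinv (f z) _ (CD_inv_id _ H0) eps Heps) as [d1 [Hd1 H1]].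
  destruct (Hf d1 Hd1) as [d [Hd H]]. exists d; split; auto.
Qed.

Lemma ccont_minus (F G : C -> C) (w : C) : ccont F w -> ccont G w -> ccont (fun z => F z - G z)%C w.
Proof.
  intros HF HG e He.
  destruct (HF (e / 2)) as [d1 [Hd1 H1]]; [lra|].
  destruct (HG (e / 2)) as [d2 [Hd2 H2]]; [lra|].
  exists (Rmin d1 d2); split; [now apply Rmin_pos|]. intros u Hu.
  specialize (H1 u (Rlt_le_trans _ _ _ Hu (Rmin_l _ _))).
  specialize (H2 u (Rlt_le_trans _ _ _ Hu (Rmin_r _ _))).
  replace (F u - G u - (F w - G w))%C with ((F u - F w) - (G u - G w))%C by ring.
  eapply Rle_lt_trans; [apply Cmod_triangle_minus|]. lra.
Qed.

Lemma ccont_const (c w : C) : ccont (fun _ => c) w.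
Proof. apply (CD_ccont _ _ _ (CD_const c w)). Qed.

Lemma ccont_id (w : C) : ccont (fun z => z) w.
Proof. apply (CD_ccont _ _ _ (CD_id w)). Qed.

(** The mean value property of [z * (F z - F w) / (z - w)], which vanishes at the centre; its
    differentiability is in doubt only at 0 and at [w]. At the centre [F] itself is only required
    to be continuous, so that removable singularities are covered. *)
Lemma Cauchy_formula (F : C -> C) (R r : R) (w : C) :
  (forall z, Cmod z < R -> ccont F z) ->
  (forall z, 0 < Cmod z < R -> exists l, CD F z l) ->
  Cmod w < r < R -> F w = mean (fun z => F z * (z / (z - w)))%C r.
Proof.
  intros Hc Hd Hr. assert (Hw0 := Cmod_ge_0 w).
  destruct (Ceq_dec w 0) as [->|Hw].
  { rewrite Cmod_0 in Hr.
    rewrite (mean_ext _ F r); [|lra|].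
    - symmetry. apply (mean_value F R 0 r); auto; lra.
    - intros z Hz. assert (z <> 0) by (intros ->; rewrite Cmod_0 in Hz; lra).
      replace (z - 0)%C with z by ring. field. auto. }
  assert (Hwp : 0 < Cmod w) by (now apply Cmod_gt_0).
  destruct (Hd w ltac:(lra)) as [l Hl].
  set (g := fun z => if Ceq_dec z w then l else ((F z - F w) / (z - w))%C).
  assert (Hgne : forall z, z <> w -> exists d, 0 < d /\ forall v, Cmod (v - z) < d ->
     ((F v - F w) / (v - w))%C = g v).
  { intros z Hz. exists (Cmod (z - w)). split.
    - apply Cmod_gt_0. intros E. apply Hz. now apply Ceq_minus.
    - intros v Hv. unfold g. destruct (Ceq_dec v w) as [->|]; auto.
      rewrite Cmod_minus_sym in Hv. lra. }
  assert (Hne : forall z, z <> w -> (z - w)%C <> 0).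
  { intros z Hz E. apply Hz. now apply Ceq_minus. }
  assert (Hgc : forall z, Cmod z < R -> ccont (fun z => z * g z)%C z).
  { intros z Hz. apply ccont_mult; [apply ccont_id|].
    destruct (Ceq_dec z w) as [->|Hzw].
    - intros e He. destruct (proj1 (CD_eps F w l) Hl (e / 2)) as [d [Hdp H]]; [lra|].
      exists d; split; auto. intros v Hv. specialize (H v Hv).
      unfold g. destruct (Ceq_dec w w) as [_|]; [|easy].
      destruct (Ceq_dec v w) as [->|Hvw].
      + replace (l - l)%C with (RtoC 0) by ring. rewrite Cmod_0; auto.
      + assert (Hvw' := Hne v Hvw).
        replace ((F v - F w) / (v - w) - l)%C with ((F v - F w - l * (v - w)) / (v - w))%C
          by (field; auto).
        rewrite Cmod_div by auto. apply Cmod_gt_0 in Hvw'.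
        apply Rlt_div_l; auto. nra.
    - destruct (Hgne z Hzw) as [d [Hdp H]].
      apply (ccont_ext _ _ z d Hdp H). apply ccont_mult.
      + apply ccont_minus; [apply Hc; auto|apply ccont_const].
      + apply (ccont_inv (fun v => v - w)%C); [auto|].
        apply ccont_minus; [apply ccont_id|apply ccont_const]. }
  assert (Hgd : forall z, 0 < Cmod z < R -> Cmod z <> Cmod w -> exists l, CD (fun z => z * g z)%C z l).
  { intros z Hz Hzw. assert (Hz' : z <> w) by congruence.
    destruct (Hd z Hz) as [l' Hl'].
    destruct (Hgne z Hz') as [d [Hdp H]].
    eexists. apply CD_mult; [apply CD_id|].
    eapply (CD_ext_loc _ _ _ _ d Hdp H).
    apply CD_div; [auto| |]; apply CD_minus; eauto using CD_id, CD_const. }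
  assert (M := mean_value (fun z => z * g z)%C R (Cmod w) r Hgc Hgd ltac:(lra)).
  simpl in M. rewrite Cmult_0_l in M.
  assert (CF : ccirc F r) by (intros z Hz; apply Hc; lra).
  assert (CK : ccirc (fun z => z / (z - w))%C r).
  { apply ccirc_CD. intros z Hz. eexists. apply CD_div;
      [|apply CD_id|apply CD_minus; [apply CD_id|apply CD_const]].
    apply Hne. intros ->. lra. }
  assert (E : mean (fun z => z * g z)%C r =
     mean (fun z => F z * (z / (z - w)) - F w * (z / (z - w)))%C r).
  { apply mean_ext; [lra|]. intros z Hz. assert (z <> w) by (intros ->; lra).
    unfold g. destruct (Ceq_dec z w); [easy|]. field. auto. }
  rewrite mean_minus, mean_scal, mean_Cauchy_kernel, M in E; auto; try lra.
  - symmetry. apply Ceq_minus. rewrite Cmult_1_r in E. now symmetry.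
  - apply ccirc_mult; auto.
  - apply ccirc_mult; auto. intros z _; apply ccont_const.
Qed.

(** Continuity along the parametrisation gives the bound; what remains is that the parametrisation
    reaches every point of the circle. *)
Lemma circle_bounded (F : C -> C) (r : R) : 0 <= r -> ccirc F r ->
  exists M, 0 <= M /\ forall w, Cmod w = r -> Cmod (F w) <= M.
Proof.
  intros Hr HF.
  destruct (continuity_ab_maj (fun t => Cmod (F (circ r t))) 0 (2 * PI)) as [tm [Hm _]].
  - generalize two_PI_pos; lra.
  - intros t _. apply continuity_pt_locally. intros eps.
    destruct (proj1 (rcont_eps _ _) (rcont_circ F r t Hr HF) eps (cond_pos eps)) as [d [Hd H]].
    exists (mkposreal d Hd). intros u Hu. eapply Rle_lt_trans; [|apply (H u Hu)].
    apply Rabs_le. split; [|apply Cmod_triangle_rev].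
    generalize (Cmod_triangle_rev (F (circ r t)) (F (circ r u))).
    rewrite (Cmod_minus_sym (F (circ r u))). lra.
  - exists (Cmod (F (circ r tm))). split; [apply Cmod_ge_0|].
    intros w Hw.
    assert (exists t, 0 <= t <= 2 * PI /\ w = circ r t) as [t [Ht ->]]; [|now apply Hm].
    destruct (Req_dec r 0) as [->|Hr0].
    { exists 0. split; [generalize two_PI_pos; lra|]. apply Cmod_eq_0 in Hw. subst.
      unfold circ. ring. }
    destruct w as [x y].
    assert (Hxy : x ^ 2 + y ^ 2 = r ^ 2).
    { rewrite <- Hw. rewrite Cmod2_alt. reflexivity. }
    assert (HP := PI_RGT_0).
    assert (Hb : -1 <= x / r <= 1).
    { split; [apply Rle_div_r|apply Rle_div_l]; try lra; nra. }
    assert (Ex : x = r * cos (acos (x / r))) by (rewrite cos_acos by auto; field; auto).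
    assert (Es : sin (acos (x / r)) ^ 2 = (y / r) ^ 2).
    { assert (G := sin2_cos2 (acos (x / r))). unfold Rsqr in G. rewrite cos_acos in G by auto.
      replace (sin (acos (x / r)) ^ 2) with (1 - x / r * (x / r)) by (simpl; lra).
      replace ((y / r) ^ 2) with (y ^ 2 / r ^ 2) by (field; auto).
      replace (y ^ 2) with (r ^ 2 - x ^ 2) by lra.
      field; auto. }
    assert (Ac := acos_bound (x / r)).
    assert (Sp : 0 <= sin (acos (x / r))) by (apply sin_ge_0; lra).
    destruct (Rle_dec 0 y) as [Hy|Hy].
    + exists (acos (x / r)). split; [lra|].
      assert (sin (acos (x / r)) = y / r).
      { apply Rsqr_inj; auto; [apply Rdiv_le_0_compat; lra|]. unfold Rsqr. lra. }
      unfold circ, Cexp, Ci, RtoC, Cmult; simpl.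
      replace (0 * acos (x / r) - 1 * 0) with 0 by ring.
      replace (0 * 0 + 1 * acos (x / r)) with (acos (x / r)) by ring.
      rewrite exp_0, H, cos_acos by auto. f_equal; field; auto.
    + exists (2 * PI - acos (x / r)). split; [lra|].
      assert (sin (acos (x / r)) = - y / r).
      { apply Rsqr_inj; auto; [apply Rdiv_le_0_compat; lra|]. unfold Rsqr.
        replace (- y / r * (- y / r)) with ((y / r) ^ 2) by (field; auto). lra. }
      unfold circ, Cexp, Ci, RtoC, Cmult; simpl.
      replace (0 * (2 * PI - acos (x / r)) - 1 * 0) with 0 by ring.
      replace (0 * 0 + 1 * (2 * PI - acos (x / r))) with (- acos (x / r) + 2 * INR 1 * PI) by (simpl; ring).
      rewrite cos_period, sin_period, cos_neg, sin_neg, exp_0, H, cos_acos by auto.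
      f_equal; field; auto.
Qed.

(** For holomorphic [F] this is [F^(j-1) w / (j-1)!], but it makes sense and can be differentiated
    in [w] for any [F] that is continuous on the circle. *)
Definition kernel (F : C -> C) (r : R) (j : nat) (w : C) : C :=
  mean (fun z => F z * (z / (z - w) ^ j))%C r.

Lemma ccirc_kernel (F : C -> C) (r : R) (j : nat) (w : C) : ccirc F r -> Cmod w < r ->
  ccirc (fun z => F z * (z / (z - w) ^ j))%C r.
Proof.
  intros HF Hw. apply ccirc_mult; auto. intros z Hz.
  apply ccont_mult; [apply ccont_id|]. apply (ccont_inv (fun v => (v - w) ^ j)%C).
  - apply Cpow_nz. intros E. apply Ceq_minus in E. subst. lra.
  - assert (H1 : ccont (fun v => v - w)%C z) by (apply ccont_minus; [apply ccont_id|apply ccont_const]).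
    clear HF Hz. induction j; [exact (ccont_const 1 z)|].
    apply (ccont_mult (fun v => v - w)%C (fun v => (v - w) ^ j)%C); auto.
Qed.

(** Differentiation under the integral sign: the hypothesis bounds the second-order remainder of
    the integrand uniformly on the circle. *)
Lemma kernel_CD_aux (F : C -> C) (r : R) (w c : C) (i j : nat) (K : R) :
  0 < r -> ccirc F r -> Cmod w < r -> 0 <= K ->
  (forall z h, Cmod z = r -> Cmod h <= (r - Cmod w) / 2 ->
    Cmod (z / (z - (w + h)) ^ i - z / (z - w) ^ i - c * h * (z / (z - w) ^ j)) <= K * Cmod h ^ 2) ->
  CD (kernel F r i) w (c * kernel F r j w).
Proof.
  intros Hr HF Hw HK H. apply CD_eps. intros eps Heps.
  destruct (circle_bounded F r ltac:(lra) HF) as [M [HM HFM]].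
  exists (Rmin ((r - Cmod w) / 2) (eps / (M * K + 1))). split.
  { apply Rmin_pos; [lra|]. apply Rdiv_lt_0_compat; nra. }
  intros v Hv.
  assert (Hv1 := Rlt_le_trans _ _ _ Hv (Rmin_l _ _)).
  assert (Hv2 := Rlt_le_trans _ _ _ Hv (Rmin_r _ _)).
  set (h := (v - w)%C) in *.
  assert (Hvr : Cmod v < r).
  { replace v with (w + h)%C by (unfold h; ring). eapply Rle_lt_trans; [apply Cmod_triangle|]. lra. }
  unfold kernel.
  assert (C1 := ccirc_kernel F r i v HF Hvr).
  assert (C2 := ccirc_kernel F r i w HF Hw).
  assert (C3 := ccirc_kernel F r j w HF Hw).
  assert (C3' : ccirc (fun z => c * h * (F z * (z / (z - w) ^ j)))%C r).
  { apply ccirc_mult; auto. intros z _; apply ccont_const. }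
  assert (C4 : ccirc (fun z => F z * (z / (z - v) ^ i) - F z * (z / (z - w) ^ i))%C r)
    by (intros z Hz; apply ccont_minus; [now apply C1|now apply C2]).
  match goal with |- Cmod ?a <= _ => replace a with
    (mean (fun z => F z * (z / (z - v) ^ i) - F z * (z / (z - w) ^ i)
                    - c * h * (F z * (z / (z - w) ^ j)))%C r) end.
  2:{ rewrite (mean_minus (fun z => F z * (z / (z - v) ^ i) - F z * (z / (z - w) ^ i))%C) by (auto; lra).
      rewrite (mean_minus (fun z => F z * (z / (z - v) ^ i))%C) by (auto; lra).
      rewrite (mean_scal (fun z => F z * (z / (z - w) ^ j))%C) by (auto; lra). ring. }
  apply Rle_trans with (M * (K * Cmod h ^ 2)).
  - apply mean_bound; [lra| |].
    + intros z Hz; apply ccont_minus; [now apply C4|now apply C3'].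
    + intros z Hz.
      replace (F z * (z / (z - v) ^ i) - F z * (z / (z - w) ^ i) - c * h * (F z * (z / (z - w) ^ j)))%C
        with (F z * (z / (z - (w + h)) ^ i - z / (z - w) ^ i - c * h * (z / (z - w) ^ j)))%C.
      * rewrite Cmod_mult. apply Rmult_le_compat; auto; try apply Cmod_ge_0. apply H; auto. lra.
      * replace (w + h)%C with v by (unfold h; ring). ring.
  - apply Rlt_div_r in Hv2; [|nra].
    assert (0 <= Cmod h) by apply Cmod_ge_0. nra.
Qed.

Lemma kernel_CD_1 (F : C -> C) (r : R) (w : C) : ccirc F r -> Cmod w < r ->
  CD (kernel F r 1) w (kernel F r 2 w).
Proof.
  intros HF Hw. assert (Hw0 := Cmod_ge_0 w).
  set (d := r - Cmod w). assert (Hd : 0 < d) by (unfold d; lra).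
  replace (kernel F r 2 w) with (1 * kernel F r 2 w)%C by ring.
  apply (kernel_CD_aux F r w 1 1 2 (r * (2 / d ^ 3))); auto; [lra| |].
  { apply Rmult_le_pos; [lra|]. apply Rdiv_le_0_compat; [lra|]. now apply pow_lt. }
  intros z h Hz Hh. fold d in Hh.
  assert (H1 : d <= Cmod (z - w)) by (generalize (Cmod_triangle_rev z w); unfold d; lra).
  assert (H2 : d / 2 <= Cmod (z - w - h)) by (generalize (Cmod_triangle_rev (z - w) h); lra).
  assert (N1 : (z - w)%C <> 0) by (apply Cmod_gt_0; lra).
  assert (N2 : (z - w - h)%C <> 0) by (apply Cmod_gt_0; lra).
  assert (N2' : (z - (w + h))%C <> 0) by (replace (z - (w + h))%C with (z - w - h)%C by ring; auto).
  replace (z / (z - (w + h)) ^ 1 - z / (z - w) ^ 1 - 1 * h * (z / (z - w) ^ 2))%C with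
    (z * (h * h) / ((z - w) * (z - w) * (z - w - h)))%C by (field; auto).
  assert (Q : d * d * (d / 2) <= Cmod (z - w) * Cmod (z - w) * Cmod (z - w - h)).
  { repeat apply Rmult_le_compat; try nra; try lra. }
  assert (Qp : 0 < d * d * (d / 2)) by (repeat apply Rmult_lt_0_compat; lra).
  rewrite Cmod_div by (repeat apply Cmult_neq_0; auto). rewrite !Cmod_mult, Hz.
  assert (0 <= Cmod h) by apply Cmod_ge_0.
  apply Rle_trans with (r * (Cmod h * Cmod h) / (d * d * (d / 2))).
  - apply Rmult_le_compat_l; [apply Rmult_le_pos; nra|]. now apply Rinv_le_contravar.
  - right. field. lra.
Qed.

Lemma kernel_CD_2 (F : C -> C) (r : R) (w : C) : ccirc F r -> Cmod w < r ->
  CD (kernel F r 2) w (2 * kernel F r 3 w).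
Proof.
  intros HF Hw. assert (Hw0 := Cmod_ge_0 w).
  set (d := r - Cmod w). assert (Hd : 0 < d) by (unfold d; lra).
  apply (kernel_CD_aux F r w 2 2 3 (r * (3 * r * 2 + 2 * r) / (d ^ 3 * (d / 2) ^ 2))); auto; [lra| |].
  { apply Rdiv_le_0_compat; [nra|]. apply Rmult_lt_0_compat; apply pow_lt; lra. }
  intros z h Hz Hh. fold d in Hh.
  assert (H1 : d <= Cmod (z - w)) by (generalize (Cmod_triangle_rev z w); unfold d; lra).
  assert (H2 : d / 2 <= Cmod (z - w - h)) by (generalize (Cmod_triangle_rev (z - w) h); lra).
  assert (N1 : (z - w)%C <> 0) by (apply Cmod_gt_0; lra).
  assert (N2 : (z - w - h)%C <> 0) by (apply Cmod_gt_0; lra).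
  assert (N2' : (z - (w + h))%C <> 0) by (replace (z - (w + h))%C with (z - w - h)%C by ring; auto).
  replace (z / (z - (w + h)) ^ 2 - z / (z - w) ^ 2 - 2 * h * (z / (z - w) ^ 3))%C with
    (z * (h * h * (3 * (z - w) - 2 * h)) / ((z - w) ^ 3 * (z - w - h) ^ 2))%C by (field; auto).
  assert (Q : d ^ 3 * (d / 2) ^ 2 <= Cmod (z - w) ^ 3 * Cmod (z - w - h) ^ 2).
  { apply Rmult_le_compat; try (apply pow_le; lra); apply pow_incr; lra. }
  assert (Qp : 0 < d ^ 3 * (d / 2) ^ 2) by (apply Rmult_lt_0_compat; apply pow_lt; lra).
  rewrite Cmod_div by (apply Cmult_neq_0; apply Cpow_nz; auto).
  rewrite !Cmod_mult, !Cmod_pow, Hz.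
  assert (Hh0 : 0 <= Cmod h) by apply Cmod_ge_0.
  assert (Hn : Cmod (3 * (z - w) - 2 * h) <= 3 * r * 2 + 2 * r).
  { eapply Rle_trans; [apply Cmod_triangle_minus|]. rewrite !Cmod_mult, !Cmod_R.
    rewrite !Rabs_pos_eq by lra. generalize (Cmod_triangle_minus z w). unfold d in Hh. lra. }
  assert (Hn0 := Cmod_ge_0 (3 * (z - w) - 2 * h)).
  apply Rle_trans with (r * (Cmod h * Cmod h * (3 * r * 2 + 2 * r)) / (d ^ 3 * (d / 2) ^ 2)).
  - apply Rmult_le_compat.
    + apply Rmult_le_pos; [lra|]. apply Rmult_le_pos; nra.
    + apply Rlt_le, Rinv_0_lt_compat. lra.
    + apply Rmult_le_compat_l; [lra|]. apply Rmult_le_compat_l; nra.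
    + now apply Rinv_le_contravar.
  - right. field. lra.
Qed.

Lemma Cauchy_kernel (F : C -> C) (R r : R) (w : C) :
  (forall z, Cmod z < R -> ccont F z) ->
  (forall z, 0 < Cmod z < R -> exists l, CD F z l) ->
  Cmod w < r < R -> F w = kernel F r 1 w.
Proof.
  intros Hc Hd Hr. rewrite (Cauchy_formula F R r w) at 1 by auto.
  unfold kernel. apply mean_ext; [generalize (Cmod_ge_0 w); lra|].
  intros z _. now rewrite Cpow_1_r.
Qed.

(** Cauchy's formula holds across the centre, and its right-hand side is differentiable there. *)
Lemma removable (F : C -> C) (R : R) :
  (forall z, Cmod z < R -> ccont F z) ->
  (forall z, 0 < Cmod z < R -> exists l, CD F z l) -> holo F R.
Proof.
  intros Hc Hd w Hw. set (r := (Cmod w + R) / 2).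
  exists (kernel F r 2 w).
  apply (CD_ext_loc (kernel F r 1) F w _ ((r - Cmod w))); [unfold r; lra| |].
  - intros z Hz. symmetry. apply (Cauchy_kernel F R); auto.
    split; [|unfold r; lra]. generalize (Cmod_triangle_rev z w); lra.
  - apply kernel_CD_1; [|unfold r; lra]. intros z Hz. apply Hc. rewrite Hz. unfold r; lra.
Qed.

Lemma holo_kernel (F : C -> C) (R r : R) (w : C) : holo F R -> Cmod w < r < R ->
  F w = kernel F r 1 w.
Proof.
  intros HF Hr. apply (Cauchy_kernel F R); auto.
  - intros z Hz. now apply (holo_ccont F R).
  - intros z Hz. apply HF; lra.
Qed.

Lemma holo_CD_kernel (F : C -> C) (R r : R) (w : C) : holo F R -> Cmod w < r < R ->
  CD F w (kernel F r 2 w).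
Proof.
  intros HF Hr.
  apply (CD_ext_loc (kernel F r 1) F w _ ((r - Cmod w))); [lra| |].
  - intros z Hz. symmetry. apply (holo_kernel F R); auto.
    split; [|lra]. generalize (Cmod_triangle_rev z w); lra.
  - apply kernel_CD_1; [|lra]. apply (holo_ccirc F R); auto; lra.
Qed.

(** The derivative is itself given by a Cauchy integral, which can be differentiated once more. *)
Lemma holo_Der (F F' : C -> C) (R : R) :
  (forall w, Cmod w < R -> CD F w (F' w)) -> holo F' R.
Proof.
  intros HF w Hw. set (r := (Cmod w + R) / 2).
  assert (H : holo F R) by (intros z Hz; exists (F' z); auto).
  exists (2 * kernel F r 3 w)%C.
  apply (CD_ext_loc (kernel F r 2) F' w _ ((r - Cmod w))); [unfold r; lra| |].
  - intros z Hz. assert (Cmod z < r) by (generalize (Cmod_triangle_rev z w); lra).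
    eapply CD_unique; [apply (holo_CD_kernel F R r z H)|apply HF]; unfold r in *; lra.
  - apply kernel_CD_2; [|unfold r; lra]. apply (holo_ccirc F R); auto. unfold r; lra.
Qed.

(** * Finite sums *)

Fixpoint Csum (f : nat -> C) (n : nat) : C :=
  match n with O => RtoC 0 | S n => (Csum f n + f n)%C end.

Fixpoint Rsum (f : nat -> R) (n : nat) : R :=
  match n with O => 0 | S n => Rsum f n + f n end.

Lemma Csum_ext (f g : nat -> C) (n : nat) :
  (forall k, (k < n)%nat -> f k = g k) -> Csum f n = Csum g n.
Proof. induction n; intros H; simpl; [auto|]. rewrite IHn, H; auto. Qed.

Lemma Rsum_ext (f g : nat -> R) (n : nat) :
  (forall k, (k < n)%nat -> f k = g k) -> Rsum f n = Rsum g n.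
Proof. induction n; intros H; simpl; [auto|]. rewrite IHn, H; auto. Qed.

Lemma Rsum_le (f g : nat -> R) (n : nat) :
  (forall k, (k < n)%nat -> f k <= g k) -> Rsum f n <= Rsum g n.
Proof. induction n; intros H; simpl; [lra|]. apply Rplus_le_compat; auto. Qed.

Lemma Rsum_scal (c : R) (f : nat -> R) (n : nat) : Rsum (fun k => c * f k) n = c * Rsum f n.
Proof. induction n; simpl; [ring|]. rewrite IHn; ring. Qed.

Lemma Csum_scal (c : C) (f : nat -> C) (n : nat) : Csum (fun k => c * f k)%C n = (c * Csum f n)%C.
Proof. induction n; simpl; [ring|]. rewrite IHn; ring. Qed.

Lemma Rsum_plus (f g : nat -> R) (n : nat) : Rsum (fun k => f k + g k) n = Rsum f n + Rsum g n.
Proof. induction n; simpl; [ring|]. rewrite IHn; ring. Qed.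

Lemma Csum_plus (f g : nat -> C) (n : nat) : Csum (fun k => f k + g k)%C n = (Csum f n + Csum g n)%C.
Proof. induction n; simpl; [ring|]. rewrite IHn; ring. Qed.

Lemma Csum_minus (f g : nat -> C) (n : nat) : Csum (fun k => f k - g k)%C n = (Csum f n - Csum g n)%C.
Proof. induction n; simpl; [ring|]. rewrite IHn; ring. Qed.

Lemma Csum_le (f : nat -> C) (g : nat -> R) (n : nat) :
  (forall k, (k < n)%nat -> Cmod (f k) <= g k) -> Cmod (Csum f n) <= Rsum g n.
Proof.
  induction n; intros H; simpl; [rewrite Cmod_0; lra|].
  eapply Rle_trans; [apply Cmod_triangle|]. apply Rplus_le_compat; auto.
Qed.

Lemma Rsum_nonneg (f : nat -> R) (n : nat) : (forall k, (k < n)%nat -> 0 <= f k) -> 0 <= Rsum f n.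
Proof.
  intros H. apply Rle_trans with (Rsum (fun _ => 0 * 0) n).
  - rewrite Rsum_scal. lra.
  - apply Rsum_le. intros k Hk. specialize (H k Hk). lra.
Qed.

Lemma Rsum_split (f : nat -> R) (m k : nat) : Rsum f (m + k) = Rsum f m + Rsum (fun i => f (m + i)%nat) k.
Proof.
  induction k; [rewrite Nat.add_0_r; simpl; ring|].
  rewrite Nat.add_succ_r. simpl. rewrite IHk. ring.
Qed.

Lemma Rsum_mono (f : nat -> R) (n m : nat) : (n <= m)%nat ->
  (forall k, (n <= k < m)%nat -> 0 <= f k) -> Rsum f n <= Rsum f m.
Proof.
  induction 1; intros H'; [lra|]. simpl. generalize (H' m ltac:(lia)).
  assert (Rsum f n <= Rsum f m) by (apply IHle; intros; apply H'; lia). lra.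
Qed.

Lemma Rsum_const (c : R) (n : nat) : Rsum (fun _ => c) n = INR n * c.
Proof. induction n; [simpl; ring|]. rewrite S_INR. simpl. rewrite IHn; ring. Qed.

Lemma Csum_CD (f : nat -> C -> C) (l : nat -> C) (z : C) (n : nat) :
  (forall k, (k < n)%nat -> CD (f k) z (l k)) -> CD (fun w => Csum (fun k => f k w) n) z (Csum l n).
Proof.
  induction n; intros H; simpl; [apply CD_const|]. apply CD_plus; auto.
Qed.

Lemma ccont_plus (F G : C -> C) (w : C) : ccont F w -> ccont G w -> ccont (fun z => F z + G z)%C w.
Proof.
  intros HF HG. apply (ccont_ext (fun z => F z - (0 - G z))%C _ _ 1); [lra|intros; ring|].
  apply ccont_minus; auto. apply ccont_minus; auto using ccont_const.
Qed.

Lemma Csum_ccont (f : nat -> C -> C) (z : C) (n : nat) :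
  (forall k, (k < n)%nat -> ccont (f k) z) -> ccont (fun w => Csum (fun k => f k w) n) z.
Proof.
  induction n; intros H; simpl; [apply ccont_const|]. apply ccont_plus; auto.
Qed.

Lemma mean_Csum (f : nat -> C -> C) (r : R) (n : nat) : 0 <= r ->
  (forall k, (k < n)%nat -> ccirc (f k) r) ->
  mean (fun w => Csum (fun k => f k w) n) r = Csum (fun k => mean (f k) r) n.
Proof.
  intros Hr. induction n; intros H; simpl; [apply mean_const|].
  rewrite mean_plus, IHn; auto. intros w Hw. apply Csum_ccont. intros k Hk. apply H; auto.
Qed.

(** * Taylor coefficients *)

(** Cauchy's integral for the [k]-th Taylor coefficient at 0. The radius stays visible because
    linearity and bounds only use continuity on the circle, while independence of the radius uses
    holomorphy between the circles. *)
Definition coef (F : C -> C) (k : nat) (r : R) : C := mean (fun z => F z / z ^ k)%C r.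

Lemma CD_pow (k : nat) (z : C) : exists l, CD (fun w => w ^ k)%C z l.
Proof.
  induction k as [|k [l Hl]].
  - exists 0. apply (CD_const 1).
  - eexists. apply (CD_mult (fun w => w) (fun w => w ^ k)%C z 1 l (CD_id z) Hl).
Qed.

Lemma ccont_inv_pow (k : nat) (z : C) : z <> 0 -> ccont (fun w => / w ^ k)%C z.
Proof.
  intros Hz. destruct (CD_pow k z) as [l Hl].
  apply (CD_ccont _ _ _ (CD_inv _ z l (Cpow_nz z k Hz) Hl)).
Qed.

Lemma nz_circ (z : C) (r : R) : 0 < r -> Cmod z = r -> z <> 0.
Proof. intros Hr Hz. apply Cmod_gt_0. lra. Qed.

Lemma ccirc_coef (F : C -> C) (k : nat) (r : R) : 0 < r -> ccirc F r ->
  ccirc (fun z => F z / z ^ k)%C r.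
Proof.
  intros Hr HF z Hz. apply ccont_mult; [auto|]. apply ccont_inv_pow. now apply (nz_circ z r).
Qed.

Lemma coef_annulus (F : C -> C) (k : nat) (r1 r2 : R) : 0 < r1 <= r2 ->
  (forall w, r1 <= Cmod w <= r2 -> exists l, CD F w l) -> coef F k r1 = coef F k r2.
Proof.
  intros Hr HF. apply mean_annulus; auto. intros w Hw. destruct (HF w Hw) as [l Hl].
  destruct (CD_pow k w) as [m Hm]. eexists. apply CD_div; eauto.
  apply Cpow_nz. apply Cmod_gt_0; lra.
Qed.

Lemma coef_holo (F : C -> C) (R r1 r2 : R) (k : nat) : holo F R -> 0 < r1 < R -> 0 < r2 < R ->
  coef F k r1 = coef F k r2.
Proof.
  intros HF H1 H2. destruct (Rle_dec r1 r2).
  - apply coef_annulus; [lra|]. intros w Hw; apply HF; lra.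
  - symmetry. apply coef_annulus; [lra|]. intros w Hw; apply HF; lra.
Qed.

Lemma coef_ext (F G : C -> C) (k : nat) (r : R) : 0 <= r ->
  (forall w, Cmod w = r -> F w = G w) -> coef F k r = coef G k r.
Proof. intros Hr H. apply mean_ext; auto. intros w Hw. now rewrite H. Qed.

Lemma coef_dist (F G : C -> C) (k : nat) (r e : R) : 0 < r -> ccirc F r -> ccirc G r ->
  (forall w, Cmod w = r -> Cmod (F w - G w) <= e) ->
  Cmod (coef F k r - coef G k r) <= e / r ^ k.
Proof.
  intros Hr HF HG He. apply mean_dist; try apply ccirc_coef; auto; try lra.
  intros w Hw. assert (Hn := nz_circ w r Hr Hw).
  replace (F w / w ^ k - G w / w ^ k)%C with ((F w - G w) / w ^ k)%C by (field; now apply Cpow_nz).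
  rewrite Cmod_div, Cmod_pow, Hw by now apply Cpow_nz.
  apply Rmult_le_compat_r; auto. apply Rlt_le, Rinv_0_lt_compat, pow_lt, Hr.
Qed.

Lemma coef_bound (F : C -> C) (k : nat) (r M : R) : 0 < r -> ccirc F r ->
  (forall w, Cmod w = r -> Cmod (F w) <= M) -> Cmod (coef F k r) <= M / r ^ k.
Proof.
  intros Hr HF HM.
  replace (coef F k r) with (coef F k r - coef (fun _ => RtoC 0) k r)%C.
  - apply coef_dist; auto. intros w _; apply ccont_const. intros w Hw.
    replace (F w - 0)%C with (F w) by ring. auto.
  - unfold coef at 2. rewrite (mean_ext _ (fun _ => RtoC 0) r) by (try lra; intros; unfold Cdiv; ring).
    rewrite mean_const. ring.
Qed.

Lemma coef_plus (F G : C -> C) (k : nat) (r : R) : 0 < r -> ccirc F r -> ccirc G r ->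
  coef (fun z => F z + G z)%C k r = (coef F k r + coef G k r)%C.
Proof.
  intros Hr HF HG. unfold coef.
  rewrite <- mean_plus by (try apply ccirc_coef; auto; lra).
  apply mean_ext; [lra|]. intros w Hw. unfold Cdiv; ring.
Qed.

Lemma coef_scal (F : C -> C) (c : C) (k : nat) (r : R) : 0 < r -> ccirc F r ->
  coef (fun z => c * F z)%C k r = (c * coef F k r)%C.
Proof.
  intros Hr HF. unfold coef.
  rewrite <- mean_scal by (try apply ccirc_coef; auto; lra).
  apply mean_ext; [lra|]. intros w Hw. unfold Cdiv; ring.
Qed.

Lemma coef_Csum (f : nat -> C -> C) (k : nat) (r : R) (n : nat) : 0 < r ->
  (forall j, (j < n)%nat -> ccirc (f j) r) ->
  coef (fun w => Csum (fun j => f j w) n) k r = Csum (fun j => coef (f j) k r) n.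
Proof.
  intros Hr. induction n; intros H; simpl.
  - unfold coef. rewrite (mean_ext _ (fun _ => RtoC 0) r) by (try lra; intros; unfold Cdiv; ring).
    apply mean_const.
  - rewrite coef_plus, IHn; auto. intros w Hw. apply Csum_ccont. intros; apply H; auto.
Qed.

Lemma coef_0 (F : C -> C) (R r : R) : holo F R -> 0 < r < R -> coef F 0 r = F 0.
Proof.
  intros HF Hr. unfold coef. rewrite (mean_ext _ F r).
  - apply (mean_value F R (-1)); auto.
    + intros w Hw; now apply (holo_ccont F R).
    + intros w Hw _; apply HF; lra.
  - lra.
  - intros w _. simpl. field.
Qed.

(** Integrate the finite geometric expansion of the Cauchy kernel together with its remainder. *)
Lemma taylor_remainder (F : C -> C) (R r M : R) (w : C) (K : nat) : holo F R ->
  Cmod w < r < R -> (forall z, Cmod z = r -> Cmod (F z) <= M) ->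
  Cmod (F w - Csum (fun k => coef F k r * w ^ k)%C K) <= M * (Cmod w / r) ^ K * (r / (r - Cmod w)).
Proof.
  intros HF Hr HM. assert (Hw := Cmod_ge_0 w). assert (Hr0 : 0 < r) by lra.
  assert (HFc := holo_ccirc F R r HF ltac:(lra)).
  rewrite (Cauchy_formula F R r w); [|intros; now apply (holo_ccont F R)|intros; apply HF; lra|lra].
  assert (E : Csum (fun k => coef F k r * w ^ k)%C K =
     mean (fun z => Csum (fun k => w ^ k * (F z / z ^ k)) K)%C r).
  { rewrite (mean_Csum (fun k z => w ^ k * (F z / z ^ k))%C); [|lra|].
    - apply Csum_ext. intros k _. unfold coef. rewrite mean_scal; [ring|lra|].
      now apply ccirc_coef.
    - intros k _. apply ccirc_mult; [intros z _; apply ccont_const|now apply ccirc_coef]. }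
  rewrite E. apply mean_dist; [lra| | |].
  - apply (ccirc_mult F); auto. apply ccirc_CD. intros z Hz. eexists.
    apply CD_div; [|apply CD_id|apply CD_minus; [apply CD_id|apply CD_const]].
    intros N. apply Ceq_minus in N. subst. lra.
  - intros z Hz. apply Csum_ccont. intros k _. apply ccont_mult; [apply ccont_const|].
    apply (ccirc_coef F k r); auto.
  - intros z Hz. assert (Hz0 := nz_circ z r Hr0 Hz).
    assert (Hzw : r - Cmod w <= Cmod (z - w)) by (generalize (Cmod_triangle_rev z w); lra).
    assert (Hn : (z - w)%C <> 0) by (apply Cmod_gt_0; lra).
    replace (F z * (z / (z - w)) - Csum (fun k => w ^ k * (F z / z ^ k)) K)%C with
      (F z * (w / z) ^ K * (z / (z - w)))%C.
    + rewrite !Cmod_mult, Cmod_pow, !Cmod_div, Hz by auto.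
      assert (A2 : 0 <= (Cmod w / r) ^ K) by (apply pow_le, Rdiv_le_0_compat; lra).
      apply Rmult_le_compat.
      * apply Rmult_le_pos; auto using Cmod_ge_0.
      * apply Rdiv_le_0_compat; lra.
      * apply Rmult_le_compat_r; auto.
      * apply Rmult_le_compat_l; [lra|]. apply Rinv_le_contravar; lra.
    + clear E. induction K.
      * simpl. ring.
      * simpl Csum. replace (F z * (z / (z - w)) - (Csum (fun k => w ^ k * (F z / z ^ k)) K + w ^ K * (F z / z ^ K)))%C
          with ((F z * (z / (z - w)) - Csum (fun k => w ^ k * (F z / z ^ k)) K) - w ^ K * (F z / z ^ K))%C by ring.
        rewrite <- IHK. rewrite Cpow_S. unfold Cdiv. rewrite !Cpow_mult_l, Cpow_inv by auto.
        field. split; auto. now apply Cpow_nz.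
Qed.

Lemma pow_eventually (x K d : R) : 0 <= x < 1 -> 0 < d -> exists N : nat, forall n, (N <= n)%nat -> K * x ^ n < d.
Proof.
  intros Hx Hd.
  destruct (pow_lt_1_zero x ltac:(rewrite Rabs_pos_eq; lra) (d / (Rabs K + 1))) as [N HN].
  { apply Rdiv_lt_0_compat; auto. generalize (Rabs_pos K); lra. }
  exists N. intros n Hn. specialize (HN n Hn). rewrite Rabs_pos_eq in HN by (apply pow_le; lra).
  assert (HK := Rabs_pos K). apply Rlt_div_r in HN; [|lra].
  generalize (Rle_abs K) (pow_le x n ltac:(lra)). nra.
Qed.

(** The Taylor coefficients can be computed on either circle: the small one transfers them from
    the approximants to [f], the large one bounds them. In this way estimates for the partial sums
    of a series reach its continuation where the series is not known to converge. *)
Lemma approx_bound (f : C -> C) (R r0 r B : R) (w : C) :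
  holo f R -> 0 < r0 < r -> r < R -> Cmod w < r ->
  (forall e, 0 < e -> exists p, holo p R /\ (forall z, Cmod z = r -> Cmod (p z) <= B) /\
     forall z, Cmod z = r0 -> Cmod (f z - p z) <= e) ->
  Cmod (f w) <= B * (r / (r - Cmod w)).
Proof.
  intros Hf Hr0 Hr Hw Happ. assert (Hw0 := Cmod_ge_0 w).
  assert (Hc : forall k, Cmod (coef f k r) <= B / r ^ k).
  { intros k. apply Rnot_lt_le. intros N.
    set (e := (Cmod (coef f k r) - B / r ^ k) / 2).
    assert (Hp : 0 < r0 ^ k) by (apply pow_lt; lra).
    destruct (Happ (e * r0 ^ k)) as [p [Hp1 [Hp2 Hp3]]].
    { apply Rmult_lt_0_compat; [unfold e; lra|auto]. }
    assert (H1 := coef_dist f p k r0 (e * r0 ^ k) ltac:(lra) (holo_ccirc f R r0 Hf ltac:(lra))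
      (holo_ccirc p R r0 Hp1 ltac:(lra)) Hp3).
    rewrite (coef_holo f R r0 r), (coef_holo p R r0 r) in H1 by (auto; lra).
    assert (H2 := coef_bound p k r B ltac:(lra) (holo_ccirc p R r Hp1 Hr) Hp2).
    replace (e * r0 ^ k / r0 ^ k) with e in H1 by (field; lra).
    generalize (Cmod_triangle_rev (coef f k r) (coef p k r)). unfold e in *. lra. }
  assert (HB : 0 <= B).
  { destruct (Happ 1 Rlt_0_1) as [p [_ [Hp _]]]. specialize (Hp (RtoC r)).
    rewrite Cmod_R, Rabs_pos_eq in Hp by lra. generalize (Cmod_ge_0 (p (RtoC r))) (Hp eq_refl). lra. }
  destruct (circle_bounded f r ltac:(lra) (holo_ccirc f R r Hf Hr)) as [M [HM HMf]].
  apply Rnot_lt_le. intros N.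
  set (x := Cmod w / r).
  assert (Hx : 0 <= x < 1).
  { split; [apply Rdiv_le_0_compat; lra|]. apply Rlt_div_l; lra. }
  destruct (pow_eventually x (M * (r / (r - Cmod w))) _ Hx (Rlt_Rminus _ _ N)) as [K HK].
  specialize (HK K (le_n K)).
  assert (T := taylor_remainder f R r M w K Hf ltac:(lra) HMf). fold x in T.
  assert (S : Cmod (Csum (fun k => coef f k r * w ^ k)%C K) <= B * (r / (r - Cmod w))).
  { apply Rle_trans with (Rsum (fun k => B * x ^ k) K).
    - apply Csum_le. intros k _. rewrite Cmod_mult, Cmod_pow.
      apply Rle_trans with (B / r ^ k * Cmod w ^ k).
      + apply Rmult_le_compat_r; auto. now apply pow_le.
      + right. unfold x, Rdiv. rewrite Rpow_mult_distr, pow_inv. ring.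
    - rewrite Rsum_scal. apply Rmult_le_compat_l; auto.
      assert (G : Rsum (fun k => x ^ k) K * (1 - x) <= 1).
      { replace (Rsum (fun k => x ^ k) K * (1 - x)) with (1 - x ^ K).
        - generalize (pow_le x K ltac:(lra)); lra.
        - clear. induction K; simpl; [ring|]. rewrite Rmult_plus_distr_r, <- IHK. ring. }
      replace (r / (r - Cmod w)) with (1 / (1 - x)) by (unfold x; field; lra).
      apply (Rmult_le_reg_r (1 - x)); [lra|].
      replace (1 / (1 - x) * (1 - x)) with 1 by (field; lra). exact G. }
  generalize (Cmod_triangle_rev (f w) (Csum (fun k => coef f k r * w ^ k)%C K)). lra.
Qed.

Lemma unif_limit_ccont (f : nat -> C -> C) (F : C -> C) (R : R) :
  (forall n, holo (f n) R) ->
  (forall e, 0 < e -> exists N, forall n, (N <= n)%nat -> forall w, Cmod w < R -> Cmod (f n w - F w) <= e) ->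
  forall w, Cmod w < R -> ccont F w.
Proof.
  intros Hf Hu w Hw e He. destruct (Hu (e / 4)) as [N HN]; [lra|].
  destruct (holo_ccont (f N) R w (Hf N) Hw (e / 4)) as [d [Hd H]]; [lra|].
  exists (Rmin d (R - Cmod w)); split; [apply Rmin_pos; lra|]. intros v Hv.
  assert (Hv1 := Rlt_le_trans _ _ _ Hv (Rmin_l _ _)).
  assert (Hv2 := Rlt_le_trans _ _ _ Hv (Rmin_r _ _)).
  assert (A1 := HN N (le_n N) w Hw).
  assert (A2 := HN N (le_n N) v ltac:(generalize (Cmod_triangle_rev v w); lra)).
  specialize (H v Hv1).
  replace (F v - F w)%C with ((f N v - f N w) + ((f N w - F w) - (f N v - F v)))%C by ring.
  eapply Rle_lt_trans; [apply Cmod_triangle|].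
  generalize (Cmod_triangle_minus (f N w - F w) (f N v - F v)). lra.
Qed.

Lemma kernel_dist (F G : C -> C) (r e : R) (j : nat) (w : C) : ccirc F r -> ccirc G r ->
  Cmod w < r -> (forall z, Cmod z = r -> Cmod (F z - G z) <= e) ->
  Cmod (kernel F r j w - kernel G r j w) <= e * (r / (r - Cmod w) ^ j).
Proof.
  intros HF HG Hw He. assert (Hw0 := Cmod_ge_0 w).
  apply mean_dist; try apply ccirc_kernel; auto; [lra|]. intros z Hz.
  assert (Hzw : r - Cmod w <= Cmod (z - w)) by (generalize (Cmod_triangle_rev z w); lra).
  assert (Hn : (z - w)%C <> 0) by (apply Cmod_gt_0; lra).
  replace (F z * (z / (z - w) ^ j) - G z * (z / (z - w) ^ j))%C with
    ((F z - G z) * (z / (z - w) ^ j))%C by ring.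
  rewrite Cmod_mult, Cmod_div, Cmod_pow, Hz by now apply Cpow_nz.
  apply Rmult_le_compat; auto; try apply Cmod_ge_0.
  - apply Rdiv_le_0_compat; [lra|]. apply pow_lt; lra.
  - apply Rmult_le_compat_l; [lra|]. apply Rinv_le_contravar; [apply pow_lt; lra|].
    apply pow_incr; lra.
Qed.

(** Uniform limits can be taken under Cauchy's formula and under its derivative. *)
Theorem Weierstrass (f : nat -> C -> C) (F : C -> C) (R : R) :
  (forall n, holo (f n) R) ->
  (forall e, 0 < e -> exists N, forall n, (N <= n)%nat -> forall w, Cmod w < R -> Cmod (f n w - F w) <= e) ->
  forall w, Cmod w < R -> exists l, CD F w l /\
    forall e, 0 < e -> exists N, forall n, (N <= n)%nat -> forall m, CD (f n) w m -> Cmod (m - l) < e.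
Proof.
  intros Hf Hu.
  assert (HFc := unif_limit_ccont f F R Hf Hu).
  assert (K1 : forall v r, Cmod v < r < R -> F v = kernel F r 1 v).
  { intros v r Hr. assert (Hv0 := Cmod_ge_0 v). apply Ceq_minus, Cmod_eq_0.
    apply Rle_antisym; [|apply Cmod_ge_0]. apply Rnot_lt_le. intros Hpos.
    set (e := Cmod (F v - kernel F r 1 v)) in *.
    set (A := r / (r - Cmod v) ^ 1).
    assert (HA : 0 < A) by (apply Rdiv_lt_0_compat; [|apply pow_lt]; lra).
    destruct (Hu (e / (2 * (1 + A)))) as [N HN].
    { apply Rdiv_lt_0_compat; lra. }
    specialize (HN N (le_n N)).
    assert (E := holo_kernel (f N) R r v (Hf N) Hr).
    assert (Q := kernel_dist (f N) F r (e / (2 * (1 + A))) 1 v (holo_ccirc (f N) R r (Hf N) ltac:(lra))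
      ltac:(intros z Hz; apply HFc; lra) ltac:(lra) ltac:(intros z Hz; apply HN; lra)).
    fold A in Q. rewrite <- E in Q. assert (Q' := HN v ltac:(lra)).
    assert (T := Cmod_triangle_minus (f N v - kernel F r 1 v) (f N v - F v)).
    replace (f N v - kernel F r 1 v - (f N v - F v))%C with (F v - kernel F r 1 v)%C in T by ring.
    fold e in T.
    assert (e / (2 * (1 + A)) * A + e / (2 * (1 + A)) = e / 2) by (field; lra). lra. }
  intros w Hw. set (r := (Cmod w + R) / 2). assert (Hr : Cmod w < r < R) by (unfold r; lra).
  assert (Hw0 := Cmod_ge_0 w).
  assert (HFr : ccirc F r) by (intros z Hz; apply HFc; lra).
  exists (kernel F r 2 w). split.
  - apply (CD_ext_loc (kernel F r 1) F w _ (r - Cmod w)); [lra| |apply kernel_CD_1; auto; lra].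
    intros z Hz. symmetry. apply K1. generalize (Cmod_triangle_rev z w); lra.
  - intros e He. set (A := r / (r - Cmod w) ^ 2).
    assert (HA : 0 < A) by (apply Rdiv_lt_0_compat; [|apply pow_lt]; lra).
    destruct (Hu (e / (2 * A))) as [N HN]; [apply Rdiv_lt_0_compat; lra|].
    exists N. intros n Hn m Hm.
    rewrite (CD_unique _ _ _ _ Hm (holo_CD_kernel (f n) R r w (Hf n) Hr)).
    eapply Rle_lt_trans.
    + apply (kernel_dist (f n) F r (e / (2 * A)) 2 w); [apply (holo_ccirc _ R); auto; lra|auto|lra|].
      intros z Hz. apply HN; auto; lra.
    + fold A. replace (e / (2 * A) * A) with (e / 2) by (field; lra). lra.
Qed.

(** * Primitives, logarithms and the Borel-Caratheodory inequality *)

(** Exchanging the ends of a side only changes the sign. Both orders occur for primitives, which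
    are integrals from 0 to points of all four quadrants. *)
Lemma Goursat_signed (f : C -> C) (a b c d : R) :
  (forall x y, (a <= x <= b \/ b <= x <= a) -> (c <= y <= d \/ d <= y <= c) ->
    exists l, CD f (x, y) l) ->
  rect_int f a b c d = 0.
Proof.
  intros Hf.
  assert (Hc : forall x y, (a <= x <= b \/ b <= x <= a) -> (c <= y <= d \/ d <= y <= c) -> ccont f (x, y)).
  { intros x y Hx Hy. destruct (Hf x y Hx Hy) as [l Hl]. eapply CD_ccont, Hl. }
  assert (G : rect_int f (Rmin a b) (Rmax a b) (Rmin c d) (Rmax c d) = 0).
  { apply Goursat; [apply Rmin_Rmax|apply Rmin_Rmax|].
    intros [x y] [Hx Hy]; simpl in Hx, Hy. apply Hf;
      [unfold Rmin, Rmax in Hx; destruct (Rle_dec a b)|unfold Rmin, Rmax in Hy; destruct (Rle_dec c d)]; lra. }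
  assert (Sh : forall y, (c <= y <= d \/ d <= y <= c) -> b <= a ->
     CI (fun x => f (hline y x)) a b = (- CI (fun x => f (hline y x)) b a)%C).
  { intros y Hy Hab. apply CI_swap. apply ccont_ex_h; auto. }
  assert (Sv : forall x, (a <= x <= b \/ b <= x <= a) -> d <= c ->
     CI (fun y => f (vline x y)) c d = (- CI (fun y => f (vline x y)) d c)%C).
  { intros y Hy Hab. apply CI_swap. apply ccont_ex_v; auto. }
  unfold Rmin, Rmax in G. unfold rect_int in *.
  destruct (Rle_dec a b) as [Hab|Hab], (Rle_dec c d) as [Hcd|Hcd].
  - exact G.
  - rewrite !Sv by lra. rewrite <- Copp_0, <- G. ring.
  - rewrite !Sh by lra. rewrite <- Copp_0, <- G. ring.
  - rewrite !Sh, !Sv by lra. rewrite <- G. ring.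
Qed.

Lemma CI_bound_signed (f : R -> C) (a b M : R) : (forall t, (a <= t <= b \/ b <= t <= a) -> rcont f t) ->
  (forall t, (a <= t <= b \/ b <= t <= a) -> Cmod (f t) <= M) -> Cmod (CI f a b) <= M * Rabs (b - a).
Proof.
  intros Hc HM. destruct (Rle_dec a b).
  - rewrite Rabs_pos_eq by lra. apply CI_bound; auto. apply ex_CI_cont.
    intros t Ht. rewrite Rmin_left, Rmax_right in Ht by auto. auto.
  - rewrite Rabs_left by lra.
    assert (ex_CI f b a).
    { apply ex_CI_cont. intros t Ht. rewrite Rmin_left, Rmax_right in Ht by lra. auto. }
    rewrite (CI_swap f b a), Cmod_opp by auto.
    replace (- (b - a)) with (a - b) by ring. apply CI_bound; auto; lra.
Qed.

Lemma ex_CI_signed (f : R -> C) (a b : R) : (forall t, (a <= t <= b \/ b <= t <= a) -> rcont f t) ->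
  ex_CI f a b.
Proof.
  intros H. apply ex_CI_cont. intros t Ht. apply H. unfold Rmin, Rmax in Ht.
  destruct (Rle_dec a b); lra.
Qed.

Lemma Cmod_le_abs (x y x' y' : R) : Rabs x <= Rabs x' -> Rabs y <= Rabs y' -> Cmod (x, y) <= Cmod (x', y').
Proof.
  intros Hx Hy. unfold Cmod; simpl fst; simpl snd. apply sqrt_le_1_alt.
  rewrite <- (pow2_abs x), <- (pow2_abs y), <- (pow2_abs x'), <- (pow2_abs y').
  apply Rplus_le_compat; apply pow_incr; split; auto using Rabs_pos.
Qed.

Lemma between_abs (t x : R) : (0 <= t <= x \/ x <= t <= 0) -> Rabs t <= Rabs x.
Proof. intros H. unfold Rabs. destruct (Rcase_abs t), (Rcase_abs x); lra. Qed.

(** The primitive is the integral along a horizontal leg followed by a vertical one. Goursat moves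
    the increment of the horizontal leg to the height of the end point, so that both increments
    only involve values of [f] near [w]. *)
Theorem holo_primitive (f : C -> C) (R : R) : holo f R ->
  exists F, forall w, Cmod w < R -> CD F w (f w).
Proof.
  intros Hf.
  exists (fun w => CI (fun t => f (hline 0 t)) 0 (Re w) + Ci * CI (fun t => f (vline (Re w) t)) 0 (Im w))%C.
  intros w Hw. apply CD_eps. intros eps Heps.
  destruct (holo_ccont f R w Hf Hw (eps / 2)) as [d1 [Hd1 Hcont]]; [lra|].
  exists (Rmin d1 (R - Cmod w)); split; [apply Rmin_pos; lra|]. intros v Hv.
  assert (Hv1 := Rlt_le_trans _ _ _ Hv (Rmin_l _ _)).
  assert (Hv2 := Rlt_le_trans _ _ _ Hv (Rmin_r _ _)).
  destruct w as [x y], v as [x' y']. simpl Re. simpl Im.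
  assert (Hrow : forall s t, (x <= s <= x' \/ x' <= s <= x) -> (y <= t <= y' \/ y' <= t <= y) ->
     Cmod ((s, t) - (x, y)) <= Cmod ((x', y') - (x, y))).
  { intros s t Hs Ht. apply (Cmod_le_abs (s - x) (t - y) (x' - x) (y' - y));
      unfold Rabs; repeat destruct Rcase_abs; lra. }
  assert (Hin : forall s t, (x <= s <= x' \/ x' <= s <= x) -> (y <= t <= y' \/ y' <= t <= y) ->
     Cmod (s, t) < R).
  { intros s t Hs Ht. generalize (Hrow s t Hs Ht) (Cmod_triangle_rev (s, t) (x, y)). lra. }
  assert (Hin0 : forall s t u, (x <= s <= x' \/ x' <= s <= x) -> (y <= t <= y' \/ y' <= t <= y) ->
     (0 <= u <= t \/ t <= u <= 0) -> Cmod (s, u) < R).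
  { intros s t u Hs Ht Hu. eapply Rle_lt_trans; [|apply (Hin s t Hs Ht)].
    apply Cmod_le_abs; [lra|now apply between_abs]. }
  assert (HinX : forall s u, (x <= s <= x' \/ x' <= s <= x) ->
     (0 <= u <= s \/ s <= u <= 0) -> Cmod (u, 0) < R).
  { intros s u Hs Hu. eapply Rle_lt_trans; [|apply (Hin s y Hs ltac:(lra))].
    apply Cmod_le_abs; [now apply between_abs|]. rewrite Rabs_R0. apply Rabs_pos. }
  assert (Hch : forall s t, Cmod (s, t) < R -> rcont (fun u => f (hline t u)) s).
  { intros s t H. apply rcont_comp; [apply (RD_rcont _ _ _ (RD_hline t s))|].
    now apply (holo_ccont f R). }
  assert (Hcv : forall s t, Cmod (s, t) < R -> rcont (fun u => f (vline s u)) t).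
  { intros s t H. apply rcont_comp; [apply (RD_rcont _ _ _ (RD_vline s t))|].
    now apply (holo_ccont f R). }
  assert (G : rect_int f x x' 0 y = 0).
  { apply Goursat_signed. intros s u Hs Hu. apply Hf. apply (Hin0 s y u); lra. }
  unfold rect_int in G.
  assert (E1 : (CI (fun t => f (hline 0 t)) 0 x + CI (fun t => f (hline 0 t)) x x')%C =
     CI (fun t => f (hline 0 t)) 0 x').
  { apply CI_Chasles; apply ex_CI_signed; intros t Ht; apply Hch.
    - apply (HinX x t); lra.
    - apply (HinX t t); lra. }
  assert (E2 : (CI (fun t => f (vline x' t)) 0 y + CI (fun t => f (vline x' t)) y y')%C =
     CI (fun t => f (vline x' t)) 0 y').
  { apply CI_Chasles; apply ex_CI_signed; intros t Ht; apply Hcv.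
    - apply (Hin0 x' y t); lra.
    - apply (Hin x' t); lra. }
  rewrite <- E1, <- E2.
  set (A := CI (fun t => f (hline 0 t)) 0 x) in *.
  set (B := CI (fun t => f (hline 0 t)) x x') in *.
  set (D := CI (fun t => f (vline x' t)) 0 y) in *.
  set (E := CI (fun t => f (vline x' t)) y y') in *.
  set (V := CI (fun t => f (vline x t)) 0 y) in *.
  set (H := CI (fun t => f (hline y t)) x x') in *.
  assert (GB : B = (H - Ci * (D - V))%C).
  { apply Ceq_minus. replace (B - (H - Ci * (D - V)))%C with (B - H + Ci * (D - V))%C by ring.
    exact G. }
  rewrite GB.
  set (c := f (x, y)).
  replace (A + (H - Ci * (D - V)) + Ci * (D + E) - (A + Ci * V) - c * ((x', y') - (x, y)))%C with
    ((H - RtoC (x' - x) * c) + Ci * (E - RtoC (y' - y) * c))%C.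
  2:{ assert (Ed : ((x', y') - (x, y))%C = (RtoC (x' - x) + Ci * RtoC (y' - y))%C)
        by (apply injective_projections; simpl; ring).
      rewrite Ed. match goal with |- ?a = ?b => change (@eq C a b) end. ring. }
  assert (EH : (H - RtoC (x' - x) * c)%C = CI (fun t => f (hline y t) - c)%C x x').
  { rewrite (CI_minus (fun t => f (hline y t)) (fun _ => c) x x'); [now rewrite CI_const| |apply ex_CI_const].
    apply ex_CI_signed; intros t Ht; apply Hch, Hin; lra. }
  assert (EE : (E - RtoC (y' - y) * c)%C = CI (fun t => f (vline x' t) - c)%C y y').
  { rewrite (CI_minus (fun t => f (vline x' t)) (fun _ => c) y y'); [now rewrite CI_const| |apply ex_CI_const].
    apply ex_CI_signed; intros t Ht; apply Hcv, Hin; lra. }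
  rewrite EH, EE. clear EH EE.
  eapply Rle_trans; [apply Cmod_triangle|]. rewrite Cmod_mult, Cmod_Ci, Rmult_1_l.
  apply Rle_trans with (eps / 2 * Rabs (x' - x) + eps / 2 * Rabs (y' - y)).
  - apply Rplus_le_compat; apply CI_bound_signed; intros t Ht.
    + apply (rcont_plus (fun t => f (hline y t)) (fun _ => - c)%C); [apply Hch, Hin; lra|apply rcont_const].
    + apply Rlt_le, Hcont. eapply Rle_lt_trans; [apply Hrow; lra|auto].
    + apply (rcont_plus (fun t => f (vline x' t)) (fun _ => - c)%C); [apply Hcv, Hin; lra|apply rcont_const].
    + apply Rlt_le, Hcont. eapply Rle_lt_trans; [apply Hrow; lra|auto].
  - assert (N1 := re_le_Cmod ((x', y') - (x, y))). assert (N2 := im_le_Cmod ((x', y') - (x, y))).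
    unfold Cminus, Cplus, Copp in N1, N2; simpl in N1, N2. unfold Cminus, Cplus, Copp; simpl.
    unfold Rminus. nra.
Qed.

Lemma holo_CD_zero (h : C -> C) (R : R) (w : C) :
  (forall z, Cmod z < R -> CD h z 0) -> Cmod w < R -> h w = h 0.
Proof.
  intros Hh Hw.
  assert (E := @eq_is_derive C_R_NormedModule (fun t => h (RtoC 0 + RtoC t * w)%C) 0 1).
  assert (E' : h (RtoC 0 + RtoC 0 * w)%C = h (RtoC 0 + RtoC 1 * w)%C).
  { apply E; [|lra]. intros t Ht.
    assert (HD : RD (fun t => h (RtoC 0 + RtoC t * w)%C) t (0 * w)%C).
    { apply (RD_comp h (fun t => RtoC 0 + RtoC t * w)%C t); [apply RD_affine|]. apply Hh.
      rewrite Cplus_0_l, Cmod_mult, Cmod_R, Rabs_pos_eq by lra.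
      generalize (Cmod_ge_0 w); nra. }
    replace (0 * w)%C with (RtoC 0) in HD by ring. exact HD. }
  replace (RtoC 0 + RtoC 0 * w)%C with (RtoC 0) in E' by ring.
  replace (RtoC 0 + RtoC 1 * w)%C with w in E' by ring. now symmetry.
Qed.

(** A primitive [phi] of [g' / g] works, because [g * exp (- phi)] has derivative 0. *)
Theorem holo_log (g : C -> C) (R : R) : 0 < R -> holo g R -> (forall w, Cmod w < R -> g w <> 0) ->
  exists phi : C -> C, phi 0 = 0 /\ forall w, Cmod w < R ->
    CD phi w (Der g w / g w)%C /\ g w = (g 0 * Cexp (phi w))%C.
Proof.
  intros HR Hg H0.
  assert (HD : forall w, Cmod w < R -> CD g w (Der g w)) by (intros; apply Der_spec; auto).
  assert (HF : holo (fun w => Der g w / g w)%C R).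
  { intros w Hw. destruct (holo_Der g (Der g) R HD w Hw) as [l Hl].
    eexists. apply CD_div; eauto. }
  destruct (holo_primitive _ R HF) as [P HP].
  exists (fun w => P w - P 0)%C. split; [ring|].
  assert (HP' : forall w, Cmod w < R -> CD (fun w => P w - P 0)%C w (Der g w / g w)%C).
  { intros w Hw. eapply CD_eq; [|apply CD_minus; [apply HP; auto|apply CD_const]]. ring. }
  intros w Hw. split; auto.
  set (phi := fun w => (P w - P 0)%C) in *.
  assert (E : (g w * Cexp (- phi w))%C = (g 0 * Cexp (- phi 0))%C).
  { apply (holo_CD_zero (fun w => g w * Cexp (- phi w))%C R w); auto. intros z Hz.
    eapply CD_eq; [|apply (CD_mult _ _ z _ _ (HD z Hz)
       (CD_comp Cexp _ z _ _ (CD_opp _ _ _ (HP' z Hz)) (CD_Cexp _)))].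
    field. auto. }
  replace (phi 0) with (RtoC 0) in E by (unfold phi; ring).
  rewrite Copp_0, Cexp_0, Cmult_1_r in E. rewrite <- E.
  change (P w - P 0)%C with (phi w).
  rewrite <- Cmult_assoc, Cexp_opp. ring.
Qed.

Lemma CI_conj (f : R -> C) (a b : R) : ex_CI f a b ->
  CI (fun t => Cconj (f t)) a b = Cconj (CI f a b).
Proof.
  intros H. apply is_CI_unique. assert (H' := CI_correct f a b H).
  assert (H1 := @is_RInt_fct_extend_fst R_NormedModule R_NormedModule f a b _ H').
  assert (H2 := @is_RInt_fct_extend_snd R_NormedModule R_NormedModule f a b _ H').
  unfold Cconj at 2. apply (@is_RInt_fct_extend_pair R_NormedModule R_NormedModule).
  - exact H1.
  - apply (@is_RInt_opp R_NormedModule _ _ _ _ H2).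
Qed.

Lemma mean_conj (F : C -> C) (r : R) : 0 <= r -> ccirc F r ->
  mean (fun z => Cconj (F z)) r = Cconj (mean F r).
Proof.
  intros Hr HF. unfold mean. rewrite (CI_conj (fun t => F (circ r t))) by now apply ex_CI_circ.
  rewrite Cmult_conj. f_equal. unfold Cconj, RtoC; simpl. f_equal; ring.
Qed.

Lemma ccont_conj (F : C -> C) (w : C) : ccont F w -> ccont (fun z => Cconj (F z)) w.
Proof.
  intros H e He. destruct (H e He) as [d [Hd H']]. exists d; split; auto. intros v Hv.
  rewrite <- Cminus_conj, Cmod_conj. auto.
Qed.

Lemma mean_bound_Re (F G : C -> C) (r : R) : 0 <= r -> ccirc F r -> ccirc G r ->
  (forall z, Cmod z = r -> Cmod (F z) <= Re (G z)) -> Cmod (mean F r) <= Re (mean G r).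
Proof.
  intros Hr HF HG H. unfold mean. assert (HP := two_PI_pos).
  assert (Hi : 0 <= / (2 * PI)) by (apply Rlt_le, Rinv_0_lt_compat; lra).
  rewrite Cmod_mult, Cmod_R, Rabs_pos_eq, re_scal_l by auto.
  apply Rmult_le_compat_l; auto. rewrite Cmod_norm.
  assert (E1 := CI_correct _ _ _ (ex_CI_circ F r Hr HF)).
  assert (E2 := CI_correct _ _ _ (ex_CI_circ G r Hr HG)).
  assert (E3 := @is_RInt_fct_extend_fst R_NormedModule R_NormedModule _ _ _ _ E2).
  apply (@norm_RInt_le C_R_NormedModule (fun t => F (circ r t)) (fun t => Re (G (circ r t))) 0 (2 * PI)).
  - lra.
  - intros t _. rewrite <- Cmod_norm. apply H, Cmod_circ, Hr.
  - exact E1.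
  - exact E3.
Qed.

Lemma conj_circ (z : C) (k : nat) (r : R) : 0 < r -> Cmod z = r ->
  Cconj (z ^ k)%C = (RtoC (r ^ (2 * k)) / z ^ k)%C.
Proof.
  intros Hr Hz. assert (Hn := nz_circ z r Hr Hz).
  assert (E : (z ^ k * Cconj (z ^ k))%C = RtoC (r ^ (2 * k))).
  { rewrite <- Cmod2_conj, Cmod_pow, Hz. f_equal. rewrite <- pow_mult. f_equal. lia. }
  rewrite <- E. field. now apply Cpow_nz.
Qed.

(** On the circle [conj (z ^ k) = r ^ (2 k) / z ^ k], so the coefficient is a multiple of the
    conjugate of the mean of [F z * z ^ k], and this function vanishes at the centre. *)
Lemma coef_conj (F : C -> C) (R r : R) (k : nat) : holo F R -> 0 < r < R -> (0 < k)%nat ->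
  coef (fun z => Cconj (F z)) k r = 0.
Proof.
  intros HF Hr Hk.
  assert (HG : holo (fun z => F z * z ^ k)%C R).
  { intros w Hw. destruct (HF w Hw) as [l Hl], (CD_pow k w) as [m Hm].
    eexists. apply CD_mult; eauto. }
  assert (M := mean_value _ R (-1) r (fun w Hw => holo_ccont _ R w HG Hw)
    (fun w Hw _ => HG w (proj2 Hw)) Hr). simpl in M.
  assert (r ^ (2 * k) <> 0) by (apply pow_nonzero; lra).
  unfold coef. rewrite (mean_ext _ (fun z => RtoC (/ r ^ (2 * k)) * Cconj (F z * z ^ k))%C r).
  - rewrite mean_scal; [|lra|].
    + rewrite (mean_conj (fun z => F z * z ^ k)%C) by (try apply (holo_ccirc _ R); auto; lra).
      rewrite M. destruct k; [lia|]. simpl.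
      replace (F 0 * (0 * 0 ^ k))%C with (RtoC 0) by ring.
      unfold Cconj, RtoC, Cmult; simpl. f_equal; ring.
    + intros w Hw. apply ccont_conj. apply (holo_ccont _ R); auto. lra.
  - lra.
  - intros w Hw. rewrite Cmult_conj, (conj_circ w k r) by (auto; lra).
    rewrite RtoC_inv by auto. field. split.
    + apply Cpow_nz, (nz_circ w r); auto; lra.
    + intros E. apply RtoC_inj in E. auto.
Qed.

(** Adding the vanishing coefficient of the conjugate turns the coefficient of [phi] into one of
    [2 Re phi - 2 A]; this has a constant sign, so nothing is lost when the modulus is taken
    inside the mean. *)
Theorem Borel_Caratheodory (phi : C -> C) (R r A : R) (k : nat) :
  holo phi R -> 0 < r < R -> (0 < k)%nat -> phi 0 = 0 ->
  (forall z, Cmod z = r -> Re (phi z) <= A) -> Cmod (coef phi k r) <= 2 * A / r ^ k.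
Proof.
  intros Hphi Hr Hk H0 HA.
  assert (Hc := holo_ccirc phi R r Hphi ltac:(lra)).
  assert (Hcc : ccirc (fun z => Cconj (phi z)) r) by (intros z Hz; apply ccont_conj, Hc, Hz).
  assert (HcA : ccirc (fun _ => RtoC (2 * A)) r) by (intros z _; apply ccont_const).
  assert (HholA : holo (fun _ => RtoC (2 * A)) R) by (intros w _; eexists; apply CD_const).
  assert (HA0 : coef (fun _ => RtoC (2 * A)) k r = 0).
  { rewrite <- (coef_conj _ R r k HholA Hr Hk). apply coef_ext; [lra|]. intros w _.
    unfold Cconj, RtoC; simpl. f_equal; ring. }
  set (G := fun z => (RtoC (2 * A) + (- (1)) * (phi z + Cconj (phi z)))%C).
  assert (Hcs : ccirc (fun z => phi z + Cconj (phi z))%C r)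
    by (intros z Hz; apply ccont_plus; auto).
  assert (E : coef phi k r = (- coef G k r)%C).
  { unfold G. rewrite coef_plus; auto; [|lra|].
    - rewrite HA0, coef_scal by (auto; lra).
      rewrite coef_plus, (coef_conj phi R r k) by (auto; lra). ring.
    - intros z Hz. apply ccont_mult; [apply ccont_const|auto]. }
  assert (HGc : ccirc G r).
  { intros z Hz. apply ccont_plus; [apply ccont_const|].
    apply ccont_mult; [apply ccont_const|auto]. }
  assert (HGr : forall z, G z = RtoC (2 * (A - Re (phi z)))).
  { intros z. unfold G. destruct (phi z) as [a b].
    unfold RtoC, Cconj, Cmult, Cplus, Copp; simpl. f_equal; ring. }
  rewrite E, Cmod_opp.
  assert (Hp : 0 < r ^ k) by (apply pow_lt; lra).
  apply Rle_trans with (Re (mean (fun z => RtoC (/ r ^ k) * G z)%C r)).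
  - apply mean_bound_Re; [lra|now apply ccirc_coef| |].
    + intros z Hz. apply ccont_mult; [apply ccont_const|auto].
    + intros z Hz. rewrite Cmod_div, Cmod_pow, Hz by (apply Cpow_nz, (nz_circ z r); auto; lra).
      rewrite HGr, Cmod_R, Rabs_pos_eq, <- RtoC_mult, re_RtoC by (generalize (HA z Hz); lra).
      right. field. lra.
  - rewrite mean_scal by (auto; lra). rewrite re_scal_l.
    assert (EM : mean G r = RtoC (2 * A)).
    { unfold G. rewrite mean_plus; [|lra|auto|].
      - rewrite mean_const, mean_scal by (auto; lra).
        rewrite mean_plus, mean_conj by (auto; lra).
        rewrite (mean_value phi R (-1)).
        + rewrite H0. unfold Cconj, RtoC, Cplus, Cmult, Copp; simpl. f_equal; ring.
        + intros w Hw; now apply (holo_ccont phi R).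
        + intros w Hw _. apply Hphi; lra.
        + lra.
      - intros z Hz. apply ccont_mult; [apply ccont_const|auto]. }
    rewrite EM, re_RtoC. right. field. lra.
Qed.

(** Integration by parts: the derivative of [F z / z ^ (k + 1)] integrates to 0 around the circle.
    *)
Lemma coef_deriv (F F' : C -> C) (k : nat) (r : R) : 0 < r ->
  (forall w, Cmod w = r -> CD F w (F' w)) -> ccirc F' r ->
  coef F' k r = (RtoC (INR (S k)) * coef F (S k) r)%C.
Proof.
  intros Hr HF HF'.
  assert (HFc : ccirc F r) by (apply ccirc_CD; intros w Hw; exists (F' w); auto).
  assert (HDp : forall (j : nat) (w : C), w <> 0 -> CD (fun w => / w ^ j)%C w (- RtoC (INR j) / w ^ S j)%C).
  { intros j; induction j as [|j IHj]; intros w Hw.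
    - simpl. eapply CD_eq; [|apply (CD_ext (fun _ => RtoC 1)); [intros; simpl; field|apply CD_const]].
      field. auto.
    - apply (CD_ext_loc (fun w => / w ^ j * / w)%C _ w _ (Cmod w)).
      + now apply Cmod_gt_0.
      + intros v Hv. assert (v <> 0).
        { intros ->. rewrite Cmod_minus_sym in Hv. replace (w - 0)%C with w in Hv by ring. lra. }
        rewrite Cpow_S. field. split; auto. now apply Cpow_nz.
      + eapply CD_eq; [|apply (CD_mult _ _ w _ _ (IHj w Hw) (CD_inv_id w Hw))].
        rewrite S_INR, RtoC_plus, !Cpow_S. field. split; auto. now apply Cpow_nz. }
  set (H := fun z => (F z * / z ^ S k)%C).
  set (H' := fun z => (F' z * / z ^ S k + F z * (- RtoC (INR (S k)) / z ^ S (S k)))%C).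
  assert (HH : forall z, Cmod z = r -> CD H z (H' z)).
  { intros z Hz. exact (CD_mult F _ z _ _ (HF z Hz) (HDp (S k) z (nz_circ z r Hr Hz))). }
  assert (HcH : ccirc H' r).
  { intros z Hz. apply ccont_plus.
    - apply ccont_mult; [auto|apply ccont_inv_pow, (nz_circ z r); auto].
    - apply ccont_mult; [auto|]. apply ccont_mult; [apply ccont_const|].
      apply ccont_inv_pow, (nz_circ z r); auto. }
  assert (E : mean (fun z => z * H' z)%C r = 0).
  { assert (I : CI (fun t => H' (circ r t) * (Ci * circ r t))%C 0 (2 * PI) = 0).
    { rewrite (CI_FTC (fun t => H (circ r t))).
      - rewrite circ_2PI. ring.
      - intros t _. apply (RD_comp H (circ r)); [apply RD_circ|apply HH, Cmod_circ; lra].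
      - intros t _. apply rcont_mult; [apply rcont_circ; auto; lra|].
        apply rcont_mult; [apply rcont_const|apply (RD_rcont _ _ _ (RD_circ r t))]. }
    unfold mean.
    replace (CI (fun t => circ r t * H' (circ r t))%C 0 (2 * PI)) with
      (CI (fun t => (- Ci) * (H' (circ r t) * (Ci * circ r t)))%C 0 (2 * PI)).
    - rewrite CI_scal, I; [ring|]. apply ex_CI_cont. intros t _. apply rcont_mult; [apply rcont_circ; auto; lra|].
        apply rcont_mult; [apply rcont_const|apply (RD_rcont _ _ _ (RD_circ r t))].
    - apply CI_ext. intros t _.
      replace (- Ci * (H' (circ r t) * (Ci * circ r t)))%C with
        (- (Ci * Ci) * (H' (circ r t) * circ r t))%C by ring.
      replace (Ci * Ci)%C with (- (1))%C; [ring|].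
      unfold Ci, Cmult, Copp, RtoC; simpl. f_equal; ring. }
  rewrite (mean_ext _ (fun z => F' z / z ^ k - RtoC (INR (S k)) * (F z / z ^ S k))%C) in E.
  - rewrite mean_minus in E; [|lra|now apply ccirc_coef|].
    + rewrite mean_scal in E by (try apply ccirc_coef; auto; lra).
      apply Ceq_minus. exact E.
    + intros z Hz. apply ccont_mult; [apply ccont_const|]. now apply (ccirc_coef F (S k) r).
  - lra.
  - intros z Hz. unfold H'. assert (Hn := nz_circ z r Hr Hz). rewrite !Cpow_S.
    field. split; auto. now apply Cpow_nz.
Qed.

(** * Zeros in a disc and the Taylor coefficients of the logarithmic derivative *)

Definition ent (f : C -> C) : Prop := forall w, exists l, CD f w l.

Lemma ent_holo (f : C -> C) (R : R) : ent f -> holo f R.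
Proof. intros H w _. apply H. Qed.

Lemma CD_shift (f : C -> C) (a z l : C) : CD f (a + z) l -> CD (fun w => f (a + w)%C) z l.
Proof.
  intros H. replace l with (l * 1)%C by ring. apply (CD_comp f (fun w => a + w)%C z l 1); auto.
  eapply CD_eq; [|apply (CD_plus (fun _ => a) (fun w => w) z 0 1 (CD_const _ _) (CD_id z))]. ring.
Qed.

(** With the value of the derivative at [rho], the quotient is continuous there, and the
    singularity is removable. *)
Lemma ent_div_root (f : C -> C) (rho : C) : ent f -> f rho = 0 ->
  exists h, ent h /\ forall z, f z = ((z - rho) * h z)%C.
Proof.
  intros Hf H0. destruct (Hf rho) as [l Hl].
  set (h := fun z => if Ceq_dec z rho then l else (f z / (z - rho))%C).
  exists h. split.
  2:{ intros z. unfold h. destruct (Ceq_dec z rho) as [->|Hz].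
      - rewrite H0. ring.
      - field. intros E. apply Hz. now apply Ceq_minus. }
  assert (Hne : forall z, z <> rho -> exists l, CD h z l).
  { intros z Hz. destruct (Hf z) as [m Hm].
    assert (Hz' : (z - rho)%C <> 0) by (intros E; apply Hz; now apply Ceq_minus).
    eexists. apply (CD_ext_loc (fun z => f z / (z - rho))%C h z _ (Cmod (z - rho))).
    - now apply Cmod_gt_0.
    - intros w Hw. unfold h. destruct (Ceq_dec w rho) as [->|]; auto.
      rewrite Cmod_minus_sym in Hw. lra.
    - apply CD_div; [auto|exact Hm|apply CD_minus; [apply CD_id|apply CD_const]]. }
  assert (Hat : holo (fun w => h (rho + w)%C) 1).
  { assert (Hd : forall z : C, z <> 0 -> exists l, CD (fun w => h (rho + w)%C) z l).
    { intros z Hz. destruct (Hne (rho + z)%C) as [m Hm].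
      - intros E. apply Hz. replace z with (rho + z - rho)%C by ring. rewrite E. ring.
      - exists m. now apply CD_shift. }
    apply removable.
    - intros z Hz. destruct (Ceq_dec z 0) as [->|Hz0].
      + intros e He. destruct (proj1 (CD_eps f rho l) Hl (e / 2)) as [d [Hdp H]]; [lra|].
        exists d; split; auto. intros v Hv.
        replace (v - 0)%C with v in Hv by ring. rewrite Cplus_0_r.
        unfold h. destruct (Ceq_dec rho rho) as [_|]; [|easy].
        destruct (Ceq_dec (rho + v) rho) as [E|E].
        * replace (l - l)%C with (RtoC 0) by ring. rewrite Cmod_0; auto.
        * assert (Hv0 : v <> 0) by (intros ->; apply E; ring).
          specialize (H (rho + v)%C). replace (rho + v - rho)%C with v in * by ring.
          specialize (H Hv). rewrite H0 in H.
          replace (f (rho + v)%C / v - l)%C with ((f (rho + v)%C - 0 - l * v) / v)%C by (field; auto).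
          rewrite Cmod_div by auto. apply Cmod_gt_0 in Hv0.
          apply Rlt_div_l; auto. nra.
      + destruct (Hd z Hz0) as [m Hm]. apply (CD_ccont _ _ _ Hm).
    - intros z Hz. apply Hd. apply Cmod_gt_0. lra. }
  intros z. destruct (Ceq_dec z rho) as [->|Hz]; [|auto].
  destruct (Hat 0 ltac:(rewrite Cmod_0; lra)) as [m Hm].
  exists m. apply (CD_ext (fun z => h (rho + (- rho + z))%C)).
  { intros w. f_equal. ring. }
  apply (CD_shift (fun w => h (rho + w)%C) (- rho)%C rho m).
  replace (- rho + rho)%C with (RtoC 0) by ring. exact Hm.
Qed.

(** [bnum R l z / bden R l z] is the Blaschke product with zeros [l] for the disc of radius [R].
    Numerator and denominator are kept apart, so that identities need no exception at the zeros.
    *)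
Definition bnum (R : R) (l : list C) (z : C) : C :=
  fold_right (fun rho acc => RtoC R * (z - rho) * acc)%C (RtoC 1) l.
Definition bden (R : R) (l : list C) (z : C) : C :=
  fold_right (fun rho acc => (RtoC (R ^ 2) - Cconj rho * z) * acc)%C (RtoC 1) l.

Definition lsum (F : C -> C) (l : list C) : C := fold_right (fun rho acc => F rho + acc)%C (RtoC 0) l.
Definition lsumR (F : C -> R) (l : list C) : R := fold_right (fun rho acc => F rho + acc) 0 l.

Lemma bnum_cons (R : R) (rho : C) (l : list C) (z : C) :
  bnum R (rho :: l) z = (RtoC R * (z - rho) * bnum R l z)%C.
Proof. reflexivity. Qed.

Lemma bden_cons (R : R) (rho : C) (l : list C) (z : C) :
  bden R (rho :: l) z = ((RtoC (R ^ 2) - Cconj rho * z) * bden R l z)%C.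
Proof. reflexivity. Qed.

Lemma lsum_cons (F : C -> C) (rho : C) (l : list C) : lsum F (rho :: l) = (F rho + lsum F l)%C.
Proof. reflexivity. Qed.

Lemma bfactor_circle (R : R) (rho z : C) : 0 < R -> Cmod z = R ->
  Cmod (RtoC R * (z - rho)) = Cmod (RtoC (R ^ 2) - Cconj rho * z).
Proof.
  intros HR Hz.
  replace (RtoC (R ^ 2)) with (z * Cconj z)%C by (rewrite <- Cmod2_conj, Hz; reflexivity).
  replace (z * Cconj z - Cconj rho * z)%C with (Cconj (z - rho) * z)%C by (rewrite Cminus_conj; ring).
  rewrite !Cmod_mult, Cmod_conj, Cmod_R, Rabs_pos_eq, Hz by lra. ring.
Qed.

Lemma bden_factor_neq (R : R) (rho z : C) : 0 < R -> Cmod rho < R -> Cmod z <= R ->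
  (RtoC (R ^ 2) - Cconj rho * z)%C <> 0.
Proof.
  intros HR Hrho Hz. apply Cmod_gt_0.
  assert (H := Cmod_triangle_rev (RtoC (R ^ 2)) (Cconj rho * z)).
  rewrite Cmod_mult, Cmod_conj, Cmod_R, Rabs_pos_eq in H by (apply pow_le; lra).
  assert (Cmod rho * Cmod z < R ^ 2).
  { generalize (Cmod_ge_0 rho) (Cmod_ge_0 z). simpl. nra. }
  lra.
Qed.

Lemma bden_neq (R : R) (l : list C) (z : C) : 0 < R -> (forall rho, In rho l -> Cmod rho < R) ->
  Cmod z <= R -> bden R l z <> 0.
Proof.
  intros HR Hl Hz. induction l as [|rho l IH]; simpl.
  - exact C1_nz.
  - apply Cmult_neq_0; [apply bden_factor_neq; auto using in_eq|].
    apply IH. intros; apply Hl; now right.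
Qed.

Lemma bnum_bden_circle (R : R) (l : list C) (z : C) : 0 < R -> Cmod z = R ->
  Cmod (bnum R l z) = Cmod (bden R l z).
Proof.
  intros HR Hz. induction l as [|rho l IH]; [reflexivity|].
  rewrite bnum_cons, bden_cons, !(Cmod_mult _ (_ R l z)), IH.
  f_equal. now apply bfactor_circle.
Qed.

Lemma bnum_CD (R : R) (l : list C) (z : C) : 0 < R -> (forall rho, In rho l -> z <> rho) ->
  CD (bnum R l) z (bnum R l z * lsum (fun rho => / (z - rho)) l)%C.
Proof.
  intros HR Hl. induction l as [|rho l IH].
  - eapply CD_eq; [|apply (CD_const 1)]. unfold lsum; simpl. ring.
  - assert (Hz : (z - rho)%C <> 0) by (intros E; apply (Hl rho (in_eq _ _)); now apply Ceq_minus).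
    assert (IH' := IH (fun r Hr => Hl r (or_intror Hr))).
    eapply CD_eq; [|apply (CD_mult (fun z => RtoC R * (z - rho))%C (bnum R l) z _ _
      (CD_scal _ z _ (RtoC R) (CD_minus _ _ z _ _ (CD_id z) (CD_const rho z))) IH')].
    simpl. field. auto.
Qed.

Lemma bden_CD (R : R) (l : list C) (z : C) :
  (forall rho, In rho l -> (RtoC (R ^ 2) - Cconj rho * z)%C <> 0) ->
  CD (bden R l) z (bden R l z * lsum (fun rho => - (Cconj rho / (RtoC (R ^ 2) - Cconj rho * z))) l)%C.
Proof.
  intros Hl. induction l as [|rho l IH].
  - eapply CD_eq; [|apply (CD_const 1)]. unfold lsum; simpl. ring.
  - assert (Hz := Hl rho (in_eq _ _)).
    assert (IH' := IH (fun r Hr => Hl r (or_intror Hr))).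
    eapply CD_eq; [|apply (CD_mult (fun z => RtoC (R ^ 2) - Cconj rho * z)%C (bden R l) z _ _
      (CD_minus _ _ z _ _ (CD_const _ z) (CD_scal _ z _ (Cconj rho) (CD_id z))) IH')].
    rewrite bden_cons, lsum_cons. field. exact Hz.
Qed.

Lemma holo_bound (g : C -> C) (R r M : R) (w : C) : holo g R -> Cmod w < r < R ->
  (forall z, Cmod z = r -> Cmod (g z) <= M) -> Cmod (g w) <= M * (r / (r - Cmod w)).
Proof.
  intros Hg Hr HM. assert (T := taylor_remainder g R r M w 0 Hg Hr HM). simpl in T.
  replace (g w - 0)%C with (g w) in T by ring. lra.
Qed.

Lemma bnum_0 (R : R) (l : list C) (R1 : Rdefinitions.R) : 0 < R -> (forall rho, In rho l -> Cmod rho <= R1) ->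
  Cmod (bnum R l 0) <= (R * R1) ^ length l.
Proof.
  intros HR Hl. induction l as [|rho l IH]; [simpl; rewrite Cmod_1; lra|].
  simpl. rewrite !Cmod_mult, Cmod_R, Rabs_pos_eq by lra.
  assert (IH' := IH (fun r Hr => Hl r (or_intror Hr))).
  assert (Cmod (0 - rho) <= R1).
  { replace (0 - rho)%C with (- rho)%C by ring. rewrite Cmod_opp. apply Hl, in_eq. }
  apply Rmult_le_compat; auto using Cmod_ge_0.
  - apply Rmult_le_pos; [lra|apply Cmod_ge_0].
  - apply Rmult_le_compat_l; lra.
Qed.

Lemma bnum_le_bden_0 (R : R) (l : list C) : 0 < R -> (forall rho, In rho l -> Cmod rho <= R) ->
  Cmod (bnum R l 0) <= Cmod (bden R l 0).
Proof.
  intros HR Hl. induction l as [|rho l IH]; [simpl; lra|].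
  rewrite bnum_cons, bden_cons, !Cmod_mult.
  apply Rmult_le_compat; try (apply Rmult_le_pos); try apply Cmod_ge_0.
  - replace (RtoC (R ^ 2) - Cconj rho * 0)%C with (RtoC R * RtoC R)%C
      by (rewrite RtoC_pow; ring).
    rewrite Cmod_mult, Cmod_R, Rabs_pos_eq by lra. apply Rmult_le_compat_l; [lra|].
    replace (0 - rho)%C with (- rho)%C by ring. rewrite Cmod_opp. apply Hl, in_eq.
  - apply IH. intros; apply Hl; now right.
Qed.

Lemma bden_0 (R : R) (l : list C) : 0 < R -> Cmod (bden R l 0) = (R * R) ^ length l.
Proof.
  intros HR. induction l as [|rho l IH]; [simpl; apply Cmod_1|].
  rewrite bden_cons, Cmod_mult, IH.
  replace (RtoC (R ^ 2) - Cconj rho * 0)%C with (RtoC (R * R))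
      by (rewrite RtoC_mult, RtoC_pow; ring).
  rewrite Cmod_R, Rabs_pos_eq by nra. simpl. ring.
Qed.

(** The zeros in the smaller disc are divided out one at a time. This stops because each of them
    multiplies the quotient at the centre by at least [R / R1], while the bound on the circle of
    radius [R] is unaffected. *)
Theorem zero_extraction (f : C -> C) (R1 R M : R) : ent f -> 0 < R1 < R -> f 0 <> 0 ->
  (forall z, Cmod z = R -> Cmod (f z) <= M) ->
  exists l g, ent g /\ (forall rho, In rho l -> Cmod rho <= R1 /\ f rho = 0) /\
    (forall z, f z * bden R l z = g z * bnum R l z)%C /\
    (forall z, Cmod z <= R1 -> g z <> 0) /\
    (forall z, Cmod z = R -> Cmod (g z) <= M).
Proof.
  intros Hf HR H0 HM.
  assert (HMg : forall l g, (forall rho, In rho l -> Cmod rho <= R1 /\ f rho = 0) ->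
    (forall z, f z * bden R l z = g z * bnum R l z)%C ->
    forall z, Cmod z = R -> Cmod (g z) <= M).
  { intros l g Hl Hfg z Hz. assert (Hd : bden R l z <> 0).
    { apply bden_neq; [lra| |lra]. intros rho Hr. generalize (proj1 (Hl rho Hr)); lra. }
    apply Cmod_gt_0 in Hd.
    assert (E : Cmod (f z) * Cmod (bden R l z) = Cmod (g z) * Cmod (bden R l z)).
    { rewrite <- (bnum_bden_circle R l z) at 2 by (auto; lra). rewrite <- !Cmod_mult.
      now rewrite Hfg. }
    apply Rmult_eq_reg_r in E; [|lra]. rewrite <- E. auto. }
  (* Either the zeros are exhausted, or [N] of them have been divided out. *)
  assert (Step : forall N : nat, exists l g, ent g /\
    (forall rho, In rho l -> Cmod rho <= R1 /\ f rho = 0) /\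
    (forall z, f z * bden R l z = g z * bnum R l z)%C /\
    ((forall z, Cmod z <= R1 -> g z <> 0) \/ length l = N)).
  { induction N as [|N [l [g [Hg [Hl [Hfg [Hn|HN]]]]]]].
    - exists nil, f. repeat split; auto; try easy.
    - exists l, g. auto.
    - destruct (classic (forall z, Cmod z <= R1 -> g z <> 0)) as [Hn|Hn].
      { exists l, g. auto. }
      apply not_all_ex_not in Hn. destruct Hn as [rho Hn].
      apply imply_to_and in Hn. destruct Hn as [Hr Hn]. apply NNPP in Hn.
      destruct (ent_div_root g rho Hg Hn) as [h [Hh Hgh]].
      exists (rho :: l), (fun z => h z * ((RtoC (R ^ 2) - Cconj rho * z) / RtoC R))%C.
      assert (HR0 : RtoC R <> 0) by (intros E; apply RtoC_inj in E; lra).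
      split; [|split; [|split]].
      + intros w. destruct (Hh w) as [m Hm]. eexists. apply CD_mult; [exact Hm|].
        apply CD_div; [auto| |apply CD_const].
        apply CD_minus; [apply CD_const|apply CD_scal, CD_id].
      + intros r [<-|Hin]; [|auto]. split; auto.
        assert (Hd : bden R l rho <> 0).
        { apply bden_neq; [lra| |lra]. intros r Hr'. generalize (proj1 (Hl r Hr')); lra. }
        assert (E := Hfg rho). rewrite Hn, Cmult_0_l in E.
        replace (f rho) with (f rho * bden R l rho * / bden R l rho)%C by (field; auto).
        rewrite E. ring.
      + intros z. rewrite bnum_cons, bden_cons.
        replace (f z * ((RtoC (R ^ 2) - Cconj rho * z) * bden R l z))%C with
          ((f z * bden R l z) * (RtoC (R ^ 2) - Cconj rho * z))%C by ring.
        rewrite Hfg, Hgh. field. auto.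
      + right. simpl. now rewrite HN. }
  assert (Hf0 : 0 < Cmod (f 0)) by (now apply Cmod_gt_0).
  destruct (pow_eventually (R1 / R) M (Cmod (f 0))) as [N HN]; auto.
  { split; [apply Rdiv_le_0_compat; lra|]. apply Rlt_div_l; lra. }
  specialize (HN N (le_n N)).
  destruct (Step N) as [l [g [Hg [Hl [Hfg [Hn|HlN]]]]]].
  { exists l, g. repeat split; auto; try apply Hl; auto. now apply (HMg l g). }
  exfalso.
  assert (HMg' := HMg l g Hl Hfg).
  assert (Hg0 : Cmod (g 0) <= M).
  { assert (B := holo_bound g (R + 1) R M 0 (ent_holo g _ Hg)). rewrite Cmod_0 in B.
    replace (M * (R / (R - 0))) with M in B by (field; lra). apply B; auto. lra. }
  assert (E : Cmod (f 0) * Cmod (bden R l 0) = Cmod (g 0) * Cmod (bnum R l 0))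
    by (rewrite <- !Cmod_mult; now rewrite Hfg).
  rewrite bden_0 in E by lra.
  assert (B := bnum_0 R l R1 ltac:(lra) (fun r Hr => proj1 (Hl r Hr))).
  rewrite HlN in *.
  assert (HRN : 0 < (R * R) ^ N) by (apply pow_lt; nra).
  assert (Q : Cmod (f 0) * (R * R) ^ N <= M * (R * R1) ^ N).
  { rewrite E. apply Rmult_le_compat; auto using Cmod_ge_0. }
  replace ((R * R1) ^ N) with ((R1 / R) ^ N * (R * R) ^ N) in Q.
  - rewrite <- Rmult_assoc in Q. apply Rmult_le_reg_r in Q; auto. lra.
  - rewrite <- Rpow_mult_distr. f_equal. field. lra.
Qed.

Lemma coef_const (c : C) (k : nat) (r : R) : 0 < r -> (0 < k)%nat -> coef (fun _ => c) k r = 0.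
Proof.
  intros Hr Hk. rewrite <- (coef_conj (fun _ => Cconj c) (r + 1) r k); auto; try lra.
  - apply coef_ext; [lra|]. intros w _. now rewrite Cconj_conj.
  - intros w _. eexists. apply CD_const.
Qed.

Lemma coef_geom (p : C) (k : nat) (r : R) : 0 < r < Cmod p ->
  coef (fun z => / (p - z))%C k r = (/ p ^ S k)%C.
Proof.
  intros Hr. assert (Hp : p <> 0) by (apply Cmod_gt_0; lra).
  assert (Hne : forall z, Cmod z < Cmod p -> (p - z)%C <> 0).
  { intros z Hz E. apply Ceq_minus in E. subst. lra. }
  assert (Hh : holo (fun z => / (p - z))%C (Cmod p)).
  { intros z Hz. eexists. apply CD_inv; [auto|apply CD_minus; [apply CD_const|apply CD_id]]. }
  induction k as [|k IH].
  - rewrite (coef_0 _ (Cmod p)) by auto. rewrite Cpow_1_r. f_equal. ring.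
  - assert (Hcc := holo_ccirc _ (Cmod p) r Hh (proj2 Hr)).
    assert (E : coef (fun z => / (p - z))%C (S k) r =
      mean (fun z => / p * (1 / z ^ S k) + / p * (/ (p - z) / z ^ k))%C r).
    { apply mean_ext; [lra|]. intros z Hz. assert (z <> 0) by (apply (nz_circ z r); auto; lra).
      assert (p - z <> 0)%C by (apply Hne; lra).
      rewrite Cpow_S. field. repeat split; auto. now apply Cpow_nz. }
    rewrite E.
    assert (C1 : ccirc (fun z => 1 / z ^ S k)%C r)
      by (apply (ccirc_coef (fun _ => RtoC 1)); [lra|intros z _; apply ccont_const]).
    assert (C2 : ccirc (fun z => / (p - z) / z ^ k)%C r)
      by (apply (ccirc_coef (fun z => / (p - z))%C); [lra|auto]).
    rewrite mean_plus; [|lra| |].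
    2,3: apply ccirc_mult; auto; intros z _; apply ccont_const.
    rewrite !mean_scal by (auto; lra).
    change (mean (fun z => 1 / z ^ S k)%C r) with (coef (fun _ => RtoC 1) (S k) r).
    change (mean (fun z => / (p - z) / z ^ k)%C r) with (coef (fun z => / (p - z))%C k r).
    rewrite coef_const, IH by (lra || lia). rewrite (Cpow_S p (S k)). field.
    split; auto. now apply (Cpow_nz p (S k)).
Qed.

Lemma coef_lsum (F : C -> C -> C) (l : list C) (k : nat) (r : R) : 0 < r ->
  (forall rho, In rho l -> ccirc (F rho) r) ->
  ccirc (fun z => lsum (fun rho => F rho z) l) r /\
  coef (fun z => lsum (fun rho => F rho z) l) k r = lsum (fun rho => coef (F rho) k r) l.
Proof.
  intros Hr. induction l as [|rho l IH]; intros HF.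
  - split; [intros z _; exact (ccont_const 0 z)|].
    unfold lsum; simpl. unfold coef. rewrite (mean_ext _ (fun _ => RtoC 0) r)
      by (try lra; intros; unfold Cdiv; ring). apply mean_const.
  - destruct (IH (fun r0 Hr0 => HF r0 (or_intror Hr0))) as [I1 I2].
    split.
    + intros z Hz. apply (ccont_plus (F rho)); [apply HF; auto using in_eq|apply I1, Hz].
    + unfold lsum in *. simpl. rewrite (coef_plus (F rho)), I2; auto. apply HF, in_eq.
Qed.

(** The zeros contribute their power sums, and the zero-free quotient is controlled by
    Borel-Caratheodory applied to its logarithm. The second conclusion bounds the quotient inside
    the disc: evaluated at a point where [f] is not small, it is Jensen's inequality. *)
Theorem log_deriv_coef (f : C -> C) (r2 R1 R M : R) : ent f -> 0 < r2 < R1 -> R1 < R -> f 0 <> 0 ->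
  (forall z, Cmod z = R -> Cmod (f z) <= M) ->
  exists l, (forall rho, In rho l -> Cmod rho <= R1 /\ f rho = 0) /\
    (forall z, Cmod z < R -> Cmod (f z) * Cmod (bden R l z) <= M * (R / (R - Cmod z)) * Cmod (bnum R l z)) /\
    forall k r0, 0 < r0 <= r2 -> (forall z, Cmod z <= r0 -> f z <> 0) ->
      Cmod (coef (fun z => Der f z / f z)%C k r0 -
        lsum (fun rho => - / rho ^ S k + (Cconj rho / RtoC (R ^ 2)) ^ S k)%C l)
      <= INR (S k) * (2 * ln (M * (R / (R - r2)) / Cmod (f 0)) / r2 ^ S k).
Proof.
  intros Hf Hr2 HR1 H0 HM.
  destruct (zero_extraction f R1 R M Hf ltac:(lra) H0 HM) as [l [g [Hg [Hl [Hfg [Hgn HgM]]]]]].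
  assert (HlR : forall rho, In rho l -> Cmod rho < R) by (intros rho Hr; generalize (proj1 (Hl rho Hr)); lra).
  exists l. split; [auto|split].
  { intros z Hz. rewrite <- Cmod_mult, Hfg, Cmod_mult. apply Rmult_le_compat_r; [apply Cmod_ge_0|].
    apply (holo_bound g (R + 1)); auto; [now apply ent_holo|lra]. }
  intros k r0 Hr0 Hfr0.
  assert (HDf : forall z, CD f z (Der f z)) by (intros z; apply Der_spec, Hf).
  assert (HDg : forall z, CD g z (Der g z)) by (intros z; apply Der_spec, Hg).
  assert (Hrho0 : forall rho, In rho l -> r0 < Cmod rho).
  { intros rho Hr. apply Rnot_le_lt. intros N. apply (Hfr0 rho N). apply (Hl rho Hr). }
  set (FF := fun rho z => (- / (rho - z) + Cconj rho / (RtoC (R ^ 2) - Cconj rho * z))%C).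
  assert (Hlog : forall z, Cmod z = r0 ->
    (Der f z / f z)%C = (lsum (fun rho => FF rho z) l + Der g z / g z)%C).
  { intros z Hz.
    assert (Hzr : forall rho, In rho l -> z <> rho) by (intros rho Hr E; generalize (Hrho0 rho Hr); subst; lra).
    assert (Hdz : forall rho, In rho l -> (RtoC (R ^ 2) - Cconj rho * z)%C <> 0).
    { intros rho Hr. apply bden_factor_neq; [lra|auto|lra]. }
    assert (Hden : bden R l z <> 0) by (apply bden_neq; auto; lra).
    assert (Hfz : f z <> 0) by (apply Hfr0; lra).
    assert (Hgz : g z <> 0) by (apply Hgn; lra).
    assert (D1 := CD_mult f (bden R l) z _ _ (HDf z) (bden_CD R l z Hdz)).
    assert (D2 := CD_mult g (bnum R l) z _ _ (HDg z) (bnum_CD R l z ltac:(lra) Hzr)).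
    assert (E := CD_unique _ z _ _ (CD_ext _ _ _ _ Hfg D1) D2).
    assert (Hnum : bnum R l z <> 0).
    { intros E'. assert (E2 := Hfg z). rewrite E', Cmult_0_r in E2.
      revert E2. now apply Cmult_neq_0. }
    assert (Sum : lsum (fun rho => FF rho z) l = (lsum (fun rho => / (z - rho)) l
        - lsum (fun rho => - (Cconj rho / (RtoC (R ^ 2) - Cconj rho * z))) l)%C).
    { clear -Hzr Hdz. induction l as [|rho l IH]; [unfold lsum; simpl; ring|].
      rewrite !lsum_cons.
      rewrite IH by (intros; (apply Hzr || apply Hdz); now right).
      unfold FF. field. split; [apply (Hdz rho), in_eq|].
      split; intros E; [apply (Hzr rho (in_eq _ _))|apply (Hzr rho (in_eq _ _)); symmetry]; now apply Ceq_minus. }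
    rewrite Sum. set (A := lsum (fun rho => / (z - rho))%C l) in *.
    set (B := lsum (fun rho => - (Cconj rho / (RtoC (R ^ 2) - Cconj rho * z)))%C l) in *.
    assert (E2 := Hfg z).
    replace (Der f z / f z)%C with ((Der f z * bden R l z + f z * (bden R l z * B)) / (f z * bden R l z) - B)%C
      by (field; auto).
    rewrite E, E2. field. auto. }
  assert (Hglog : exists phi : C -> C, phi 0 = 0 /\ forall w, Cmod w < R1 ->
    CD phi w (Der g w / g w)%C /\ g w = (g 0 * Cexp (phi w))%C).
  { apply holo_log; [lra|now apply ent_holo|]. intros w Hw. apply Hgn. lra. }
  destruct Hglog as [phi [Hphi0 Hphi]].
  assert (Hphih : holo phi R1) by (intros w Hw; eexists; apply (Hphi w Hw)).
  assert (HG : holo (fun z => Der g z / g z)%C R1) by (apply (holo_Der phi); intros; now apply Hphi).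
  assert (HccFF : forall rho, In rho l -> ccirc (FF rho) r0).
  { intros rho Hr. apply ccirc_CD. intros z Hz. eexists. apply CD_plus.
    - apply CD_opp, CD_inv; [|apply CD_minus; [apply CD_const|apply CD_id]].
      intros E. apply Ceq_minus in E. generalize (Hrho0 rho Hr). subst. lra.
    - apply CD_div; [apply bden_factor_neq; auto; lra|apply CD_const|].
      apply CD_minus; [apply CD_const|apply CD_scal, CD_id]. }
  destruct (coef_lsum FF l k r0 ltac:(lra) HccFF) as [L1 L2].
  rewrite (coef_ext _ (fun z => lsum (fun rho => FF rho z) l + Der g z / g z)%C) by (auto; lra).
  rewrite coef_plus; [|lra|auto|apply (holo_ccirc _ R1); auto; lra].
  rewrite L2.
  replace (lsum (fun rho => coef (FF rho) k r0) l) with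
    (lsum (fun rho => - / rho ^ S k + (Cconj rho / RtoC (R ^ 2)) ^ S k)%C l).
  2:{ clear L1 L2 Hlog Hfg. induction l as [|rho l IH]; [reflexivity|].
      rewrite !lsum_cons.
      rewrite IH by (intros; (apply Hl || apply HlR || apply Hrho0 || apply HccFF); now right).
      f_equal.
      assert (Hp := Hrho0 rho (in_eq _ _)). assert (HpR := HlR rho (in_eq _ _)).
      assert (Hr0' : rho <> 0) by (apply Cmod_gt_0; lra).
      assert (Hcr : Cconj rho <> 0) by (apply Cmod_gt_0; rewrite Cmod_conj; lra).
      assert (HR2 : RtoC (R ^ 2) <> 0) by (intros E; apply RtoC_inj in E; generalize (pow_lt R 2); lra).
      set (p := (RtoC (R ^ 2) / Cconj rho)%C).
      assert (Hpm : r0 < Cmod p).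
      { unfold p. rewrite Cmod_div, Cmod_R, Cmod_conj, Rabs_pos_eq by (auto; apply pow_le; lra).
        apply Rlt_div_r; [lra|]. simpl. nra. }
      assert (Hne : forall q z, r0 < Cmod q -> Cmod z = r0 -> (q - z)%C <> 0).
      { intros q z Hq Hz E. apply Ceq_minus in E. subst. lra. }
      assert (Hcq : forall q, r0 < Cmod q -> ccirc (fun z => / (q - z))%C r0).
      { intros q Hq. apply ccirc_CD. intros z Hz. eexists. apply CD_inv; [now apply Hne|].
        apply CD_minus; [apply CD_const|apply CD_id]. }
      rewrite (coef_ext (FF rho) (fun z => (- (1)) * / (rho - z) + / (p - z))%C).
      - rewrite coef_plus, coef_scal, !coef_geom; auto; try lra.
        + f_equal; [ring|]. unfold p. rewrite <- Cpow_inv by (intros E; assert (Hq : Cmod p = 0) by (unfold p; rewrite E; apply Cmod_0); lra).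
          f_equal. field. auto.
        + apply ccirc_mult; auto. intros z _; apply ccont_const.
      - lra.
      - intros z Hz. unfold FF, p. assert (E1 := Hne rho z Hp Hz). assert (E2 := Hne p z Hpm Hz).
        assert (E3 : (RtoC (R ^ 2) - Cconj rho * z)%C <> 0) by (apply bden_factor_neq; lra).
        field. rewrite (Cmult_comm z). auto. }
  match goal with |- Cmod (?a + ?b - ?a) <= _ => replace (a + b - a)%C with b by ring end.
  rewrite (coef_holo _ R1 r0 r2) by (auto; lra).
  rewrite (coef_deriv phi) by (try (apply (holo_ccirc _ R1); auto); try lra; intros w Hw; apply Hphi; lra).
  rewrite Cmod_mult, Cmod_R, Rabs_pos_eq by apply pos_INR.
  apply Rmult_le_compat_l; [apply pos_INR|].
  apply (Borel_Caratheodory phi R1 r2 _ (S k) Hphih ltac:(lra) ltac:(lia) Hphi0).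
  intros z Hz.
  assert (HM0 : Cmod (g z) <= M * (R / (R - r2))).
  { rewrite <- Hz. apply (holo_bound g (R + 1)); auto; [now apply ent_holo|lra]. }
  destruct (Hphi z ltac:(lra)) as [_ Egz].
  assert (Eg : Cmod (g z) = Cmod (g 0) * exp (Re (phi z))) by (rewrite Egz, Cmod_mult, Cmod_Cexp; auto).
  assert (Hf0 : 0 < Cmod (f 0)) by (now apply Cmod_gt_0).
  assert (Hg0 : Cmod (f 0) <= Cmod (g 0)).
  { assert (E : Cmod (f 0) * Cmod (bden R l 0) = Cmod (g 0) * Cmod (bnum R l 0))
      by (rewrite <- !Cmod_mult; now rewrite Hfg).
    assert (Hd : 0 < Cmod (bden R l 0)) by (rewrite bden_0 by lra; apply pow_lt; nra).
    assert (B := bnum_le_bden_0 R l ltac:(lra) (fun r Hr => Rlt_le _ _ (HlR r Hr))).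
    apply (Rmult_le_reg_r (Cmod (bden R l 0))); auto. rewrite E.
    apply Rmult_le_compat_l; auto using Cmod_ge_0. }
  rewrite <- (ln_exp (Re (phi z))). apply ln_le; [apply exp_pos|].
  apply Rle_div_r; [auto|]. rewrite Eg in HM0.
  eapply Rle_trans; [|exact HM0]. rewrite Rmult_comm. apply Rmult_le_compat_r; auto.
  apply Rlt_le, exp_pos.
Qed.

(** * The von Mangoldt function and Chebyshev-Mertens estimates *)

Definition nprime (p : nat) : Prop :=
  (2 <= p)%nat /\ forall d, Nat.divide d p -> d = 1%nat \/ d = p.

Definition prime_power_of (n p : nat) : Prop := nprime p /\ exists k, (0 < k)%nat /\ n = (p ^ k)%nat.

Definition Lam (n : nat) : R :=
  if excluded_middle_informative (exists p, prime_power_of n p)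
  then ln (INR (epsilon (inhabits O) (prime_power_of n))) else 0.

Lemma nprime_gcd (p a : nat) : nprime p -> ~ Nat.divide p a -> Nat.gcd p a = 1%nat.
Proof.
  intros [Hp H] Ha. destruct (H (Nat.gcd p a) (Nat.gcd_divide_l _ _)) as [E|E]; auto.
  exfalso. apply Ha. rewrite <- E. apply Nat.gcd_divide_r.
Qed.

Lemma nprime_mult (p a b : nat) : nprime p -> Nat.divide p (a * b) -> Nat.divide p a \/ Nat.divide p b.
Proof.
  intros Hp H. destruct (classic (Nat.divide p a)) as [Ha|Ha]; auto.
  right. apply (Nat.gauss p a b H). now apply nprime_gcd.
Qed.

Lemma nprime_pow (p a k : nat) : nprime p -> Nat.divide p (a ^ k) -> Nat.divide p a.
Proof.
  intros Hp. induction k as [|k IH]; simpl; intros H.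
  - destruct Hp as [Hp _]. apply Nat.divide_1_r in H. lia.
  - destruct (nprime_mult p _ _ Hp H); auto.
Qed.

Lemma nprime_eq (p q : nat) : nprime p -> nprime q -> Nat.divide p q -> p = q.
Proof. intros [Hp _] [_ Hq] H. destruct (Hq p H); lia. Qed.

Lemma prime_power_unique (n p q : nat) : prime_power_of n p -> prime_power_of n q -> p = q.
Proof.
  intros [Hp [k [Hk E]]] [Hq [j [Hj E']]]. apply nprime_eq; auto.
  apply (nprime_pow p q j Hp). rewrite <- E', E. destruct k; [lia|]. simpl. now exists (p ^ k)%nat; lia.
Qed.

Lemma Lam_pp (n p : nat) : prime_power_of n p -> Lam n = ln (INR p).
Proof.
  intros H. unfold Lam. destruct (excluded_middle_informative _) as [E|E].
  - f_equal. f_equal. apply (prime_power_unique n); auto. now apply epsilon_spec.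
  - exfalso. apply E. now exists p.
Qed.

Lemma Lam_not_pp (n : nat) : ~ (exists p, prime_power_of n p) -> Lam n = 0.
Proof. intros H. unfold Lam. destruct (excluded_middle_informative _); easy. Qed.

Lemma Lam_nonneg (n : nat) : 0 <= Lam n.
Proof.
  destruct (classic (exists p, prime_power_of n p)) as [[p Hp]|H].
  - rewrite (Lam_pp n p Hp). rewrite <- ln_1. apply ln_le; [lra|].
    destruct Hp as [[Hp _] _]. apply le_INR in Hp. simpl in Hp. lra.
  - rewrite Lam_not_pp; auto. lra.
Qed.

Lemma nprime_exists (n : nat) : (2 <= n)%nat -> exists p, nprime p /\ Nat.divide p n.
Proof.
  induction n as [n IH] using lt_wf_ind. intros Hn.
  destruct (classic (nprime n)) as [H|H].
  - exists n. split; auto. apply Nat.divide_refl.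
  - assert (exists d, Nat.divide d n /\ d <> 1%nat /\ d <> n) as [d [Hd [H1 H2]]].
    { apply NNPP. intros N. apply H. split; auto. intros d Hd.
      destruct (Nat.eq_dec d 1); auto. destruct (Nat.eq_dec d n); auto.
      exfalso. apply N. now exists d. }
    assert (d <= n)%nat by (apply Nat.divide_pos_le; auto; lia).
    assert (d <> 0)%nat by (intros ->; apply Nat.divide_0_l in Hd; lia).
    destruct (IH d) as [p [Hp Hpd]]; try lia. exists p. split; auto.
    eapply Nat.divide_trans; eauto.
Qed.

Lemma p_adic (p m : nat) : nprime p -> (0 < m)%nat ->
  exists v m', m = (p ^ v * m')%nat /\ ~ Nat.divide p m'.
Proof.
  intros Hp. induction m as [m IH] using lt_wf_ind. intros Hm.
  destruct (classic (Nat.divide p m)) as [[c Hc]|H].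
  - destruct Hp as [Hp2 Hp']. destruct (IH c) as [v [m' [E Hm']]]; [nia|nia|].
    exists (S v), m'. split; auto. rewrite Hc, E. simpl. ring.
  - exists O, m. split; auto. simpl. lia.
Qed.

Definition dv (d n : nat) : R := if Nat.eqb (n mod d) 0 then 1 else 0.

Lemma dv_1 (d n : nat) : d <> O -> Nat.divide d n -> dv d n = 1.
Proof. intros H0 H. unfold dv. apply Nat.Lcm0.mod_divide in H. now rewrite H. Qed.

Lemma dv_0 (d n : nat) : d <> O -> ~ Nat.divide d n -> dv d n = 0.
Proof.
  intros H0 H. unfold dv. destruct (Nat.eqb_spec (n mod d) 0) as [E|]; auto.
  exfalso. apply H. now apply Nat.Lcm0.mod_divide.
Qed.

Lemma Rsum_single (f : nat -> R) (d0 N : nat) : (d0 < N)%nat ->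
  (forall d, (d < N)%nat -> d <> d0 -> f d = 0) -> Rsum f N = f d0.
Proof.
  intros Hd H. induction N as [|N IH]; [lia|]. simpl.
  destruct (Nat.eq_dec d0 N) as [->|Hne].
  - rewrite (Rsum_ext f (fun _ => 0 * 0)) by (intros k Hk; rewrite H by lia; ring).
    rewrite Rsum_scal. ring.
  - rewrite IH by (auto with zarith). rewrite (H N) by lia. ring.
Qed.

Lemma pow_pos_nat (p k : nat) : nprime p -> (0 < p ^ k)%nat.
Proof. intros [H _]. assert (p ^ k <> 0)%nat by (apply Nat.pow_nonzero; lia). lia. Qed.

Lemma pow_divide_pow (p v k m' : nat) : nprime p -> ~ Nat.divide p m' ->
  Nat.divide (p ^ k) (p ^ v * m') -> (k <= v)%nat.
Proof.
  intros Hp Hm H. destruct (le_lt_dec k v); auto. exfalso.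
  replace k with (v + S (k - v - 1))%nat in H by lia. rewrite Nat.pow_add_r in H.
  apply Nat.mul_divide_cancel_l in H; [|generalize (pow_pos_nat p v Hp); lia].
  apply Hm. eapply Nat.divide_trans; [|exact H]. simpl. now exists (p ^ (k - v - 1))%nat; lia.
Qed.

(** By induction on [n]: passing from [m] to [p m], exactly one prime power divisor is gained, the
    next power of [p]. *)
Theorem sum_Lam_divisors (n N : nat) : (0 < n < N)%nat -> Rsum (fun d => dv d n * Lam d) N = ln (INR n).
Proof.
  revert N. induction n as [n IH] using lt_wf_ind. intros N HnN.
  destruct (Nat.eq_dec n 1) as [->|Hn1].
  - simpl. rewrite ln_1. rewrite (Rsum_ext _ (fun _ => 0 * 0)); [rewrite Rsum_scal; ring|].
    intros d _. destruct (Nat.eq_dec d 0) as [->|Hd0].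
    { rewrite Lam_not_pp; [ring|]. intros [p [Hp [k [Hk E]]]]. generalize (pow_pos_nat p k Hp). lia. }
    destruct (classic (Nat.divide d 1)) as [Hd|Hd]; [|rewrite dv_0; auto; ring].
    apply Nat.divide_1_r in Hd. subst. rewrite Lam_not_pp; [ring|].
    intros [p [Hp [k [Hk E]]]]. assert (Nat.divide p 1).
    { rewrite E. destruct k; [lia|]. simpl. now exists (p ^ k)%nat; lia. }
    apply Nat.divide_1_r in H. destruct Hp; lia.
  - destruct (nprime_exists n) as [p [Hp [m Hm]]]; [lia|].
    assert (Hp2 : (2 <= p)%nat) by apply Hp.
    assert (Hm0 : (0 < m)%nat) by nia.
    destruct (p_adic p m Hp Hm0) as [v [m' [Ev Hm']]].
    assert (Hmn : (m < n)%nat) by nia.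
    replace (INR n) with (INR m * INR p) by (now rewrite Hm, mult_INR).
    rewrite ln_mult by (apply lt_0_INR; lia).
    rewrite <- (IH m ltac:(lia) N ltac:(lia)).
    enough (D : Rsum (fun d => dv d n * Lam d + (-1) * (dv d m * Lam d)) N = ln (INR p)).
    { rewrite Rsum_plus, Rsum_scal in D. lra. }
    assert (En : n = (p ^ S v * m')%nat) by (rewrite Hm, Ev; simpl; ring).
    assert (Hd0 : Nat.divide (p ^ S v) n) by (rewrite En; exists m'; ring).
    assert (Hpos := pow_pos_nat p (S v) Hp).
    rewrite (Rsum_single _ (p ^ S v)%nat).
    + rewrite dv_1 by (auto; lia). rewrite dv_0; [|lia|].
      2:{ rewrite Ev. intros H. apply pow_divide_pow in H; auto. lia. }
      rewrite (Lam_pp _ p); [ring|]. split; auto. exists (S v). split; [lia|auto].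
    + apply Nat.divide_pos_le in Hd0; lia.
    + intros d _ Hd. destruct (classic (exists q, prime_power_of d q)) as [[q Hq]|Hq].
      2:{ rewrite (Lam_not_pp d Hq). ring. }
      destruct Hq as [Hq [k [Hk Ed]]].
      assert (Hdpos : d <> O) by (rewrite Ed; generalize (pow_pos_nat q k Hq); lia).
      destruct (classic (Nat.divide d m)) as [Hdm|Hdm].
      { rewrite !dv_1; auto; [ring|]. rewrite Hm. now apply Nat.divide_mul_l. }
      rewrite (dv_0 d m) by auto.
      destruct (classic (Nat.divide d n)) as [Hdn|Hdn]; [|rewrite dv_0; auto; ring].
      exfalso. destruct (Nat.eq_dec q p) as [->|Hqp].
      * rewrite Ed, En in Hdn. apply pow_divide_pow in Hdn; auto.
        apply Hdm. rewrite Ed, Ev. apply Nat.divide_mul_l.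
        assert (k <> S v) by (intros ->; auto).
        exists (p ^ (v - k))%nat. rewrite <- Nat.pow_add_r. f_equal. lia.
      * apply Hdm. rewrite Hm, Nat.mul_comm in Hdn.
        apply (Nat.gauss d p m Hdn). rewrite Nat.gcd_comm. apply nprime_gcd; auto.
        intros H. rewrite Ed in H. apply nprime_pow in H; auto.
        apply Hqp. symmetry. now apply nprime_eq.
Qed.

Definition psi (N : nat) : R := Rsum Lam (S N).
Definition Mert (N : nat) : R := Rsum (fun d => Lam d / INR d) (S N).
Definition log_fact (N : nat) : R := Rsum (fun k => ln (INR (S k))) N.

Lemma Lam_0 : Lam 0 = 0.
Proof.
  apply Lam_not_pp. intros [p [Hp [k [Hk E]]]]. generalize (pow_pos_nat p k Hp). lia.
Qed.

Lemma Rsum_swap (f : nat -> nat -> R) (n m : nat) :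
  Rsum (fun i => Rsum (fun j => f i j) m) n = Rsum (fun j => Rsum (fun i => f i j) n) m.
Proof.
  induction n; simpl.
  - rewrite (Rsum_ext _ (fun _ => 0 * 0)) by (intros; ring). rewrite Rsum_scal. ring.
  - rewrite IHn, <- Rsum_plus. reflexivity.
Qed.

Lemma sum_dv (d N : nat) : d <> O -> Rsum (fun k => dv d (S k)) N = INR (N / d).
Proof.
  intros Hd. induction N as [|N IH].
  - simpl. rewrite Nat.Div0.div_0_l. reflexivity.
  - simpl Rsum. rewrite IH.
    assert (E1 := Nat.div_mod N d Hd). assert (E2 := Nat.div_mod (S N) d Hd).
    assert (B1 := Nat.mod_upper_bound N d Hd). assert (B2 := Nat.mod_upper_bound (S N) d Hd).
    unfold dv. destruct (Nat.eqb_spec (S N mod d) 0) as [E|E].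
    + assert (S N / d = S (N / d))%nat by nia. rewrite H, S_INR. ring.
    + assert (S N / d = N / d)%nat by nia. rewrite H. ring.
Qed.

Lemma log_fact_Lam (N T : nat) : (N < T)%nat -> log_fact N = Rsum (fun d => Lam d * INR (N / d)) T.
Proof.
  intros HT. unfold log_fact.
  rewrite (Rsum_ext _ (fun k => Rsum (fun d => dv d (S k) * Lam d) T)).
  - rewrite Rsum_swap. apply Rsum_ext. intros d _.
    destruct (Nat.eq_dec d 0) as [->|Hd].
    + rewrite Lam_0. rewrite (Rsum_ext _ (fun _ => 0 * 0)) by (intros; ring). rewrite Rsum_scal. ring.
    + rewrite <- sum_dv by auto. rewrite <- Rsum_scal. apply Rsum_ext. intros; ring.
  - intros k Hk. symmetry. apply sum_Lam_divisors. lia.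
Qed.

Lemma ln2_bounds : 0 < ln 2 <= 1.
Proof.
  split; [rewrite <- ln_1; apply ln_increasing; lra|].
  rewrite <- (ln_exp 1). apply ln_le; [lra|]. generalize (exp_ineq1_le 1). lra.
Qed.

Lemma log_fact_double (n : nat) : log_fact (2 * n) <= INR (2 * n) * ln 2 + 2 * log_fact n.
Proof.
  induction n as [|n IH]; [simpl; unfold log_fact; simpl; lra|].
  replace (2 * S n)%nat with (S (S (2 * n))) by lia.
  assert (E : forall k, log_fact (S k) = log_fact k + ln (INR (S k))) by reflexivity.
  rewrite !E, !S_INR.
  assert (HI : 0 <= INR (2 * n)) by apply pos_INR.
  assert (H1 : ln (INR (2 * n) + 1) <= ln (INR (2 * n) + 1 + 1)) by (apply ln_le; lra).
  assert (H2 : ln (INR (2 * n) + 1 + 1) = ln 2 + ln (INR n + 1)).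
  { rewrite <- ln_mult; [|lra|generalize (pos_INR n); lra]. f_equal. rewrite mult_INR. simpl. ring. }
  lra.
Qed.

Lemma psi_mono (n m : nat) : (n <= m)%nat -> psi n <= psi m.
Proof. intros H. apply Rsum_mono; [lia|]. intros; apply Lam_nonneg. Qed.

(** In [ln (2n)! - 2 ln n!] the term [Lam d] has the coefficient [2n / d - 2 (n / d)] (integer
    quotients), which is nonnegative, and equal to 1 for [n < d <= 2n]. *)
Lemma psi_double (n : nat) : psi (2 * n) - psi n <= INR (2 * n) * ln 2.
Proof.
  apply Rle_trans with (log_fact (2 * n) - 2 * log_fact n); [|generalize (log_fact_double n); lra].
  rewrite (log_fact_Lam (2 * n) (S (2 * n))), (log_fact_Lam n (S (2 * n))) by lia.
  unfold psi.
  assert (E : Rsum Lam (S n) = Rsum (fun d => if le_lt_dec d n then Lam d else 0) (S (2 * n))).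
  { assert (G : forall T, (n <= T)%nat -> Rsum Lam (S n) = Rsum (fun d => if le_lt_dec d n then Lam d else 0) (S T)).
    { induction 1.
      - apply Rsum_ext. intros k Hk. destruct (le_lt_dec k n); [auto|lia].
      - set (g := fun d => if le_lt_dec d n then Lam d else 0) in *.
        change (Rsum g (S (S m))) with (Rsum g (S m) + g (S m)). rewrite <- IHle.
        unfold g. destruct (le_lt_dec (S m) n); [lia|ring]. }
    apply G. lia. }
  rewrite E. rewrite <- !Rsum_scal.
  assert (Rsum Lam (S (2 * n)) - Rsum (fun d => if le_lt_dec d n then Lam d else 0) (S (2 * n)) =
    Rsum (fun d => Lam d + (-1) * (if le_lt_dec d n then Lam d else 0)) (S (2 * n)))
    by (rewrite Rsum_plus, Rsum_scal; ring).
  rewrite H.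
  assert (Rsum (fun d => Lam d * INR (2 * n / d)) (S (2 * n)) - Rsum (fun d => 2 * (Lam d * INR (n / d))) (S (2 * n)) =
    Rsum (fun d => Lam d * INR (2 * n / d) + (-1) * (2 * (Lam d * INR (n / d)))) (S (2 * n)))
    by (rewrite Rsum_plus, !Rsum_scal; ring).
  rewrite H0. apply Rsum_le. intros d Hd. assert (HL := Lam_nonneg d).
  destruct (Nat.eq_dec d 0) as [->|Hd0]; [rewrite Lam_0; destruct (le_lt_dec 0 n); lra|].
  destruct (le_lt_dec d n) as [Hdn|Hdn].
  - assert (2 * (n / d) <= 2 * n / d)%nat.
    { apply Nat.div_le_lower_bound; auto. generalize (Nat.Div0.mul_div_le n d). nia. }
    apply le_INR in H1. rewrite mult_INR in H1. change (INR 2) with (1 + 1) in H1.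
    assert (0 <= Lam d * (INR (2 * n / d) - 2 * INR (n / d))) by (apply Rmult_le_pos; lra). lra.
  - rewrite (Nat.div_small n d) by auto.
    assert (1 <= 2 * n / d)%nat by (apply Nat.div_le_lower_bound; lia).
    apply le_INR in H1. change (INR 1) with 1 in H1. change (INR 0) with 0.
    assert (0 <= Lam d * (INR (2 * n / d) - 1)) by (apply Rmult_le_pos; lra). lra.
Qed.

(** Chebyshev's bound, by repeated halving of [N]. *)
Theorem psi_upper (N : nat) : psi N <= 4 * INR N.
Proof.
  induction N as [N IH] using lt_wf_ind.
  assert (L2 := ln2_bounds).
  assert (P0 : psi 0 = 0) by (unfold psi; simpl; rewrite Lam_0; ring).
  assert (P1 : psi 1 = 0).
  { unfold psi; simpl. rewrite Lam_0, Lam_not_pp; [ring|]. intros [p [[Hp _] [k [Hk E]]]].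
    assert (p ^ 1 <= p ^ k)%nat by (apply Nat.pow_le_mono_r; lia). rewrite Nat.pow_1_r in H. lia. }
  destruct (Nat.Even_or_Odd N) as [[n Hn]|[n Hn]].
  - destruct (Nat.eq_dec n 0) as [->|Hn0]; [subst; simpl; rewrite P0; lra|].
    assert (G := psi_double n). rewrite <- Hn in G. assert (I := IH n ltac:(lia)).
    assert (E : INR N = 2 * INR n) by (rewrite Hn, mult_INR; simpl; ring).
    rewrite E in *. generalize (pos_INR n). nra.
  - destruct (Nat.eq_dec n 0) as [->|Hn0]; [rewrite Hn; simpl; rewrite P1; lra|].
    assert (G := psi_double (S n)). assert (I := IH (S n) ltac:(lia)).
    assert (psi N <= psi (2 * S n)) by (apply psi_mono; lia).
    assert (E : INR N = 2 * INR n + 1) by (rewrite Hn, plus_INR, mult_INR; simpl; ring).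
    assert (E2 : INR (2 * S n) = 2 * INR n + 2) by (rewrite mult_INR, (S_INR n); change (INR 2) with 2; ring).
    rewrite E2 in G. rewrite S_INR in I. rewrite E.
    assert (1 <= INR n) by (apply (le_INR 1); lia). nra.
Qed.

Lemma ln_ge_1_minus_inv (x : R) : 0 < x -> 1 - / x <= ln x.
Proof.
  intros Hx. assert (H := exp_ineq1_le (- ln x)).
  rewrite exp_Ropp, exp_ln in H by auto. lra.
Qed.

Lemma ln_le_minus_1 (x : R) : 0 < x -> ln x <= x - 1.
Proof. intros Hx. assert (H := exp_ineq1_le (ln x)). rewrite exp_ln in H by auto. lra. Qed.

Lemma log_fact_bounds (N : nat) : (0 < N)%nat -> INR N * ln (INR N) - INR N <= log_fact N <= INR N * ln (INR N).
Proof.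
  induction N as [|N IH]; [lia|]. intros _.
  destruct (Nat.eq_dec N 0) as [->|HN0]; [unfold log_fact; simpl; rewrite ln_1; lra|].
  assert (E : log_fact (S N) = log_fact N + ln (INR (S N))) by reflexivity. rewrite E, S_INR.
  specialize (IH ltac:(lia)). set (x := INR N) in *.
  assert (Hx : 1 <= x) by (apply (le_INR 1); lia).
  assert (A : ln x <= ln (x + 1)) by (apply ln_le; lra).
  split.
  - assert (B : ln ((x + 1) / x) <= (x + 1) / x - 1) by (apply ln_le_minus_1, Rdiv_lt_0_compat; lra).
    rewrite ln_div in B by lra. assert (x * (ln (x + 1) - ln x) <= 1).
    { apply Rle_trans with (x * ((x + 1) / x - 1)); [apply Rmult_le_compat_l; lra|]. right; field; lra. }
    nra.
  - nra.
Qed.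

(** The identity [ln N! = sum of Lam d * (N / d)] is compared with the same sum without rounding
    of the quotients; the difference is at most [psi N]. *)
Theorem Mertens (N : nat) : (0 < N)%nat -> ln (INR N) - 1 <= Mert N <= ln (INR N) + 4.
Proof.
  intros HN. assert (B := log_fact_bounds N HN). rewrite (log_fact_Lam N (S N)) in B by lia.
  assert (HN0 : 0 < INR N) by (apply lt_0_INR; lia).
  assert (U : Rsum (fun d => Lam d * INR (N / d)) (S N) <= INR N * Mert N).
  { unfold Mert. rewrite <- Rsum_scal. apply Rsum_le. intros d Hd. assert (HL := Lam_nonneg d).
    destruct (Nat.eq_dec d 0) as [->|Hd0]; [rewrite Lam_0; unfold Rdiv; lra|].
    assert (Hd1 : 0 < INR d) by (apply lt_0_INR; lia).
    replace (INR N * (Lam d / INR d)) with (Lam d * (INR N / INR d)) by (field; lra).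
    apply Rmult_le_compat_l; auto. apply Rle_div_r; auto. rewrite <- mult_INR. apply le_INR.
    generalize (Nat.Div0.mul_div_le N d). lia. }
  assert (L : INR N * Mert N - psi N <= Rsum (fun d => Lam d * INR (N / d)) (S N)).
  { unfold Mert, psi. rewrite <- Rsum_scal.
    apply Rle_trans with (Rsum (fun d => INR N * (Lam d / INR d) + (-1) * Lam d) (S N)).
    - rewrite Rsum_plus, !Rsum_scal. lra.
    - apply Rsum_le. intros d Hd. assert (HL := Lam_nonneg d).
      destruct (Nat.eq_dec d 0) as [->|Hd0]; [rewrite Lam_0; unfold Rdiv; lra|].
      assert (Hd1 : 0 < INR d) by (apply lt_0_INR; lia).
      replace (INR N * (Lam d / INR d)) with (Lam d * (INR N / INR d)) by (field; lra).
      assert (INR N / INR d <= INR (N / d) + 1).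
      { apply Rle_div_l; auto. rewrite <- S_INR, <- mult_INR. apply le_INR.
        generalize (Nat.div_mod N d Hd0) (Nat.mod_upper_bound N d Hd0). nia. }
      nra. }
  assert (P := psi_upper N).
  split; apply (Rmult_le_reg_l (INR N)); auto; lra.
Qed.

(** The [J]-th dyadic block has mass at most [8 / 2 ^ J]. *)
Theorem Lam_tail (n N : nat) : (0 < n)%nat ->
  Rsum (fun i => Lam (n + i) * (INR n / INR (n + i) ^ 2)) N <= 16.
Proof.
  intros Hn.
  assert (Hn0 : 0 < INR n) by (apply lt_0_INR; lia).
  assert (Hpos : forall i, 0 <= Lam (n + i) * (INR n / INR (n + i) ^ 2)).
  { intros i. apply Rmult_le_pos; [apply Lam_nonneg|]. apply Rdiv_le_0_compat; [lra|].
    apply pow_lt, lt_0_INR. lia. }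
  assert (D : forall J, Rsum (fun i => Lam (n + i) * (INR n / INR (n + i) ^ 2)) (2 ^ J * n - n) <= 16 * (1 - / 2 ^ J)).
  { induction J as [|J IH].
    - replace (2 ^ 0 * n - n)%nat with O by (simpl; lia). simpl. lra.
    - set (a := (2 ^ J * n)%nat) in *.
      assert (Ha : (n <= a)%nat) by (unfold a; generalize (Nat.pow_nonzero 2 J); nia).
      assert (Ea : (2 ^ S J * n = 2 * a)%nat) by (unfold a; simpl; ring).
      rewrite Ea.
      assert (Ha0 : 0 < INR a) by (apply lt_0_INR; lia).
      replace (2 * a - n)%nat with ((a - n) + a)%nat by lia. rewrite Rsum_split.
      assert (Bl : Rsum (fun i => Lam (n + (a - n + i)) * (INR n / INR (n + (a - n + i)) ^ 2)) a <= 8 * / 2 ^ J).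
      { apply Rle_trans with (Rsum (fun i => INR n / INR a ^ 2 * Lam (a + i)) a).
        - apply Rsum_le. intros i _. replace (n + (a - n + i))%nat with (a + i)%nat by lia.
          rewrite Rmult_comm. apply Rmult_le_compat_r; [apply Lam_nonneg|].
          apply Rmult_le_compat_l; [lra|]. apply Rinv_le_contravar; [now apply pow_lt|].
          apply pow_incr. split; [lra|]. apply le_INR. lia.
        - rewrite Rsum_scal.
          assert (P : Rsum (fun i => Lam (a + i)) a <= psi (2 * a)).
          { apply Rle_trans with (Rsum Lam a + Rsum (fun i => Lam (a + i)) a).
            - generalize (Rsum_nonneg Lam a (fun k _ => Lam_nonneg k)). lra.
            - rewrite <- Rsum_split. unfold psi. apply Rsum_mono; [lia|]. intros; apply Lam_nonneg. }
          assert (P2 := psi_upper (2 * a)). rewrite mult_INR in P2. simpl (INR 2) in P2.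
          assert (EJ : INR a = 2 ^ J * INR n).
          { unfold a. rewrite mult_INR, pow_INR. reflexivity. }
          assert (HJ : 0 < 2 ^ J) by (apply pow_lt; lra).
          apply Rle_trans with (INR n / INR a ^ 2 * (8 * INR a)).
          + apply Rmult_le_compat_l; [|lra]. apply Rdiv_le_0_compat; [lra|now apply pow_lt].
          + right. rewrite EJ. field. lra. }
      assert (EJ : / 2 ^ J = 2 * / 2 ^ S J) by (simpl; field; apply pow_nonzero; lra).
      rewrite EJ in *. lra. }
  eapply Rle_trans; [|apply Rle_trans with (1 := D N)].
  - apply Rsum_mono; auto.
    assert (N + 1 <= 2 ^ N)%nat by (clear; induction N; simpl; lia). nia.
  - assert (0 < / 2 ^ N) by (apply Rinv_0_lt_compat, pow_lt; lra). lra.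
Qed.

(** * Dirichlet series in the half-plane of absolute convergence *)

Definition Clim (u : nat -> C) (l : C) : Prop :=
  forall e, 0 < e -> exists N, forall n, (N <= n)%nat -> Cmod (u n - l) < e.

Lemma Clim_unique (u : nat -> C) (l l' : C) : Clim u l -> Clim u l' -> l = l'.
Proof.
  intros H H'. apply Ceq_minus, Cmod_eq_0.
  apply Rle_antisym; [|apply Cmod_ge_0]. apply Rnot_lt_le. intros Hpos.
  destruct (H (Cmod (l - l') / 2)) as [N HN]; [lra|].
  destruct (H' (Cmod (l - l') / 2)) as [N' HN']; [lra|].
  specialize (HN (N + N')%nat ltac:(lia)). specialize (HN' (N + N')%nat ltac:(lia)).
  assert (T := Cmod_triangle_minus (u (N + N')%nat - l') (u (N + N')%nat - l)).
  replace (u (N + N')%nat - l' - (u (N + N')%nat - l))%C with (l - l')%C in T by ring. lra.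
Qed.

Lemma C_complete_seq (u : nat -> C) :
  (forall e, 0 < e -> exists N, forall n m, (N <= n)%nat -> (N <= m)%nat -> Cmod (u n - u m) < e) ->
  exists l, Clim u l.
Proof.
  intros H.
  destruct (Rcomplete.R_complete (fun n => Re (u n))) as [x Hx].
  { intros e He. destruct (H e He) as [N HN]. exists N. intros n m Hn Hm.
    eapply Rle_lt_trans; [|apply (HN n m Hn Hm)]. apply (re_le_Cmod (u n - u m)). }
  destruct (Rcomplete.R_complete (fun n => Im (u n))) as [y Hy].
  { intros e He. destruct (H e He) as [N HN]. exists N. intros n m Hn Hm.
    eapply Rle_lt_trans; [|apply (HN n m Hn Hm)]. apply (im_le_Cmod (u n - u m)). }
  exists (x, y). intros e He.
  destruct (Hx (e / 2)) as [N1 H1]; [lra|]. destruct (Hy (e / 2)) as [N2 H2]; [lra|].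
  exists (N1 + N2)%nat. intros n Hn.
  specialize (H1 n ltac:(lia)). specialize (H2 n ltac:(lia)). unfold Rdist in *.
  destruct (u n) as [p q]. simpl in *.
  eapply Rle_lt_trans; [apply (Cmod_le_sum (p - x) (q - y))|]. lra.
Qed.

Lemma Clim_le (u : nat -> C) (l c : C) (B : R) (N : nat) : Clim u l ->
  (forall n, (N <= n)%nat -> Cmod (u n - c) <= B) -> Cmod (l - c) <= B.
Proof.
  intros H HB. apply Rnot_lt_le. intros Hlt.
  destruct (H (Cmod (l - c) - B)) as [N' HN']; [lra|].
  specialize (HN' (N + N')%nat ltac:(lia)). specialize (HB (N + N')%nat ltac:(lia)).
  assert (T := Cmod_triangle_minus (u (N + N')%nat - c) (u (N + N')%nat - l)).
  replace (u (N + N')%nat - c - (u (N + N')%nat - l))%C with (l - c)%C in T by ring. lra.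
Qed.

(** The modulus of [n ^ (- s)] when [Re s = x]. *)
Definition pw (x : R) (n : nat) : R := exp (- (x * ln (INR n))).

Lemma pw_pos (x : R) (n : nat) : 0 < pw x n.
Proof. apply exp_pos. Qed.

Lemma ln_INR_nonneg (n : nat) : 0 <= ln (INR n).
Proof.
  destruct n as [|n].
  - simpl. unfold ln. destruct (Rlt_dec 0 0); [exfalso|]; lra.
  - rewrite <- ln_1. apply ln_le; [lra|]. apply (le_INR 1). lia.
Qed.

Lemma pw_le (x y : R) (n : nat) : x <= y -> pw y n <= pw x n.
Proof.
  intros H. apply exp_le. generalize (ln_INR_nonneg n). nra.
Qed.

Lemma Cmod_npow (n : nat) (s : C) : Cmod (npow_opp n s) = pw (Re s) n.
Proof.
  unfold npow_opp, pw. rewrite Cmod_Cexp, re_opp, re_scal_r. reflexivity.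
Qed.

Lemma npow_mult (m n : nat) (s : C) : (0 < m)%nat -> (0 < n)%nat ->
  npow_opp (m * n) s = (npow_opp m s * npow_opp n s)%C.
Proof.
  intros Hm Hn. unfold npow_opp. rewrite <- Cexp_plus. f_equal.
  rewrite mult_INR, ln_mult, RtoC_plus by (apply lt_0_INR; auto). ring.
Qed.

Lemma npow_polar (n : nat) (sigma t : R) :
  npow_opp n (sigma, t) = (RtoC (pw sigma n) * Cexp (Ci * RtoC (- (t * ln (INR n)))))%C.
Proof.
  unfold npow_opp, pw. rewrite <- Cexp_RtoC, <- Cexp_plus. f_equal.
  unfold RtoC, Ci, Cmult, Copp, Cplus; simpl. f_equal; ring.
Qed.

Lemma npow_1 (s : C) : npow_opp 1 s = 1.
Proof.
  unfold npow_opp. simpl. rewrite ln_1. replace (- (s * 0))%C with (RtoC 0) by ring. apply Cexp_0.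
Qed.

Lemma npow_CD (n : nat) (s : C) : CD (npow_opp n) s (- RtoC (ln (INR n)) * npow_opp n s)%C.
Proof.
  unfold npow_opp. rewrite Cmult_comm. apply (CD_comp Cexp (fun s => - (s * RtoC (ln (INR n))))%C).
  - eapply CD_eq; [|apply CD_opp, (CD_mult (fun s => s) (fun _ => RtoC (ln (INR n))) s _ _ (CD_id s) (CD_const _ s))].
    ring.
  - apply CD_Cexp.
Qed.

(** The discrete counterpart of integrating [x ^ (- 1 - t)]. *)
Lemma pw_telescope (t : R) (n : nat) : 0 < t -> (0 < n)%nat ->
  t * pw (1 + t) (S n) <= pw t n - pw t (S n).
Proof.
  intros Ht Hn. unfold pw.
  assert (Hn0 : 0 < INR n) by (apply lt_0_INR; auto).
  assert (HS0 : 0 < INR (S n)) by (apply lt_0_INR; lia).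
  set (d := ln (INR (S n)) - ln (INR n)).
  assert (E1 : exp (- (t * ln (INR n))) = exp (- (t * ln (INR (S n)))) * exp (t * d)).
  { rewrite <- exp_plus. f_equal. unfold d. ring. }
  assert (E2 : exp (- ((1 + t) * ln (INR (S n)))) = exp (- (t * ln (INR (S n)))) * / INR (S n)).
  { replace (- ((1 + t) * ln (INR (S n)))) with (- (t * ln (INR (S n))) + - ln (INR (S n))) by ring.
    rewrite exp_plus. f_equal. rewrite exp_Ropp, exp_ln; auto. }
  rewrite E1, E2.
  assert (Hd : / INR (S n) <= d).
  { unfold d. rewrite <- ln_div by auto.
    eapply Rle_trans; [|apply ln_ge_1_minus_inv, Rdiv_lt_0_compat; auto].
    rewrite S_INR in *. right. field. lra. }
  assert (He := exp_ineq1_le (t * d)). assert (Hp := exp_pos (- (t * ln (INR (S n))))).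
  assert (t * / INR (S n) <= t * d) by (apply Rmult_le_compat_l; lra).
  replace (t * (exp (- (t * ln (INR (S n)))) * / INR (S n))) with
    (exp (- (t * ln (INR (S n)))) * (t * / INR (S n))) by ring.
  replace (exp (- (t * ln (INR (S n)))) * exp (t * d) - exp (- (t * ln (INR (S n))))) with
    (exp (- (t * ln (INR (S n)))) * (exp (t * d) - 1)) by ring.
  apply Rmult_le_compat_l; lra.
Qed.

Lemma pw_sum_bound (t : R) (N k : nat) : 0 < t -> (0 < N)%nat ->
  Rsum (fun i => pw (1 + t) (S (N + i))) k <= pw t N / t.
Proof.
  intros Ht HN. apply Rle_div_r; auto.
  apply Rle_trans with (pw t N - pw t (N + k)).
  - induction k as [|k IH].
    + simpl. rewrite Nat.add_0_r. lra.
    + simpl. assert (T := pw_telescope t (N + k) Ht ltac:(lia)).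
      replace (N + S k)%nat with (S (N + k)) by lia. lra.
  - generalize (pw_pos t (N + k)). lra.
Qed.

Lemma pw_lim (t e : R) : 0 < t -> 0 < e -> exists N, (0 < N)%nat /\ forall n, (N <= n)%nat -> pw t n < e.
Proof.
  intros Ht He. destruct (INR_unbounded (exp (- ln e / t))) as [N HN].
  assert (Hp := exp_pos (- ln e / t)).
  assert (HN0 : (0 < N)%nat) by (apply INR_lt; simpl; lra).
  exists N. split; auto. intros n Hn. unfold pw.
  rewrite <- (exp_ln e) by auto. apply exp_increasing.
  assert (INR N <= INR n) by (now apply le_INR).
  assert (- ln e / t < ln (INR n)).
  { rewrite <- (ln_exp (- ln e / t)). apply ln_increasing; lra. }
  apply Rlt_div_l in H0; auto. lra.
Qed.

(** The coefficient of index [i] belongs to the integer [i + 1]. *)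
Definition Dpart (b : nat -> C) (N : nat) (s : C) : C :=
  Csum (fun i => b i * npow_opp (S i) s)%C N.

Definition DS (b : nat -> C) (s : C) : C :=
  epsilon (inhabits (RtoC 0)) (fun l => Clim (fun N => Dpart b N s) l).

(** Logarithmic growth is what the coefficients of [L], [L'], [L' / L] and [log L] have in common.
    *)
Definition dbound (b : nat -> C) : Prop := forall i, Cmod (b i) <= 1 + ln (INR (S i)).

(** Bound for the remainder after [N] terms in the half-plane [Re s >= 1 + t]. One half of [t]
    pays for the growth of the coefficients, the other for convergence. *)
Definition Tail (t : R) (N : nat) : R := (1 + 2 / t) * (pw (t / 2) N / (t / 2)).

Lemma Csum_split (f : nat -> C) (m k : nat) : Csum f (m + k) = (Csum f m + Csum (fun i => f (m + i)%nat) k)%C.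
Proof.
  induction k; [rewrite Nat.add_0_r; simpl; ring|].
  rewrite Nat.add_succ_r. simpl. rewrite IHk. ring.
Qed.

Lemma dterm_bound (b : nat -> C) (t : R) (s : C) (i : nat) : dbound b -> 0 < t -> 1 + t <= Re s ->
  Cmod (b i * npow_opp (S i) s) <= (1 + 2 / t) * pw (1 + t / 2) (S i).
Proof.
  intros Hb Ht Hs. rewrite Cmod_mult, Cmod_npow. assert (HL := ln_INR_nonneg (S i)).
  set (x := ln (INR (S i))) in *.
  assert (E : pw (1 + t) (S i) = pw (1 + t / 2) (S i) * exp (- (t / 2 * x))).
  { unfold pw. rewrite <- exp_plus. f_equal. fold x. field. }
  assert (H1 : (1 + x) * exp (- (t / 2 * x)) <= 1 + 2 / t).
  { assert (Hx := exp_ineq1_le (t / 2 * x)). rewrite exp_Ropp.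
    assert (0 <= t / 2 * x) by (apply Rmult_le_pos; lra).
    apply Rle_div_l; [apply exp_pos|].
    apply Rle_trans with ((1 + 2 / t) * (1 + t / 2 * x)).
    - replace ((1 + 2 / t) * (1 + t / 2 * x)) with (1 + x + 2 / t + t / 2 * x) by (field; lra).
      assert (0 < 2 / t) by (apply Rdiv_lt_0_compat; lra). lra.
    - apply Rmult_le_compat_l; auto. assert (0 < 2 / t) by (apply Rdiv_lt_0_compat; lra). lra. }
  apply Rle_trans with ((1 + x) * pw (1 + t) (S i)).
  - apply Rmult_le_compat; auto using Cmod_ge_0; [apply Rlt_le, pw_pos|now apply pw_le].
  - rewrite E. assert (Hp := pw_pos (1 + t / 2) (S i)). nra.
Qed.

Lemma Dpart_tail (b : nat -> C) (t : R) (s : C) (N n : nat) : dbound b -> 0 < t -> 1 + t <= Re s ->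
  (0 < N <= n)%nat -> Cmod (Dpart b n s - Dpart b N s) <= Tail t N.
Proof.
  intros Hb Ht Hs HN. unfold Dpart. replace n with (N + (n - N))%nat by lia.
  rewrite Csum_split.
  match goal with |- Cmod (?a + ?b - ?a) <= _ => replace (a + b - a)%C with b by ring end.
  eapply Rle_trans; [apply (Csum_le _ (fun i => (1 + 2 / t) * pw (1 + t / 2) (S (N + i))))|].
  - intros i _. now apply dterm_bound.
  - rewrite Rsum_scal. apply Rmult_le_compat_l.
    + assert (0 < 2 / t) by (apply Rdiv_lt_0_compat; lra). lra.
    + apply pw_sum_bound; [lra|lia].
Qed.

Lemma Tail_lim (t e : R) : 0 < t -> 0 < e -> exists N, (0 < N)%nat /\ forall n, (N <= n)%nat -> Tail t n < e.
Proof.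
  intros Ht He. assert (0 < 2 / t) by (apply Rdiv_lt_0_compat; lra).
  destruct (pw_lim (t / 2) (e * (t / 2) / (1 + 2 / t))) as [N [HN0 HN]]; [lra| |].
  { apply Rdiv_lt_0_compat; [apply Rmult_lt_0_compat|]; lra. }
  exists N. split; auto. intros n Hn. specialize (HN n Hn). unfold Tail.
  apply Rlt_div_r in HN; [|lra].
  replace ((1 + 2 / t) * (pw (t / 2) n / (t / 2))) with (pw (t / 2) n * (1 + 2 / t) / (t / 2)) by (field; lra).
  apply Rlt_div_l; lra.
Qed.

Lemma DS_lim (b : nat -> C) (s : C) : dbound b -> 1 < Re s -> Clim (fun N => Dpart b N s) (DS b s).
Proof.
  intros Hb Hs. unfold DS. apply epsilon_spec. apply C_complete_seq. intros e He.
  set (t := Re s - 1). destruct (Tail_lim t (e / 2)) as [N [HN0 HN]]; [unfold t; lra|lra|].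
  exists N. intros n m Hn Hm. specialize (HN N (le_n N)).
  assert (A := Dpart_tail b t s N n Hb ltac:(unfold t; lra) ltac:(unfold t; lra) ltac:(lia)).
  assert (B := Dpart_tail b t s N m Hb ltac:(unfold t; lra) ltac:(unfold t; lra) ltac:(lia)).
  replace (Dpart b n s - Dpart b m s)%C with
    ((Dpart b n s - Dpart b N s) - (Dpart b m s - Dpart b N s))%C by ring.
  eapply Rle_lt_trans; [apply Cmod_triangle_minus|]. lra.
Qed.

Lemma DS_tail (b : nat -> C) (t : R) (s : C) (N : nat) : dbound b -> 0 < t -> 1 + t <= Re s ->
  (0 < N)%nat -> Cmod (DS b s - Dpart b N s) <= Tail t N.
Proof.
  intros Hb Ht Hs HN. apply (Clim_le _ _ _ _ N (DS_lim b s Hb ltac:(lra))).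
  intros n Hn. apply Dpart_tail; auto.
Qed.

Definition dlog (b : nat -> C) (i : nat) : C := (- RtoC (ln (INR (S i))) * b i)%C.

Lemma Dpart_CD (b : nat -> C) (N : nat) (s : C) : CD (Dpart b N) s (Dpart (dlog b) N s).
Proof.
  unfold Dpart. eapply CD_eq.
  2:{ apply (Csum_CD (fun i s => b i * npow_opp (S i) s)%C
       (fun i => b i * (- RtoC (ln (INR (S i))) * npow_opp (S i) s))%C).
      intros k _. apply CD_scal, npow_CD. }
  apply Csum_ext. intros k _. unfold dlog. ring.
Qed.

Lemma Re_shift_ge (s w : C) (r : R) : Cmod w < r -> Re s - r < Re (s + w).
Proof.
  intros Hw. rewrite re_plus. assert (H := re_le_Cmod w). apply Rabs_le_between in H. lra.
Qed.

(** The partial sums converge uniformly in a disc about [s], so Weierstrass' theorem applies. *)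
Lemma DS_CD (b : nat -> C) (s : C) : dbound b -> dbound (dlog b) -> 1 < Re s ->
  CD (DS b) s (DS (dlog b) s).
Proof.
  intros Hb Hb' Hs. set (t := (Re s - 1) / 2). assert (Ht : 0 < t) by (unfold t; lra).
  destruct (Weierstrass (fun n w => Dpart b n (s + w)%C) (fun w => DS b (s + w)%C) t) with (w := RtoC 0)
    as [l [Hl Hlim]].
  - intros n w _. eexists. apply CD_shift, Dpart_CD.
  - intros e He. destruct (Tail_lim t e Ht He) as [N [HN0 HN]]. exists N. intros n Hn w Hw.
    rewrite Cmod_minus_sym. apply Rlt_le. eapply Rle_lt_trans; [|apply (HN n Hn)].
    apply DS_tail; auto; [|lia]. generalize (Re_shift_ge s w t Hw). unfold t in *. lra.
  - now rewrite Cmod_0.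
  - assert (E : l = DS (dlog b) s).
    { apply (Clim_unique (fun N => Dpart (dlog b) N s)); [|now apply DS_lim].
      intros e He. destruct (Hlim e He) as [N HN]. exists N. intros n Hn. apply (HN n Hn).
      apply (CD_shift (Dpart b n) s 0). rewrite Cplus_0_r. apply Dpart_CD. }
    subst l. apply (CD_ext (fun z => DS b (s + (- s + z))%C)).
    { intros z. f_equal. ring. }
    apply (CD_shift (fun w => DS b (s + w)%C) (- s)%C s).
    replace (- s + s)%C with (RtoC 0) by ring. exact Hl.
Qed.

(** * Completely multiplicative coefficients *)

Record cmult (a : nat -> C) : Prop := {
  cm_mult : forall m n, a (m * n)%nat = (a m * a n)%C;
  cm_one : a 1%nat = 1;
  cm_bound : forall n, Cmod (a n) <= 1 }.

(** [cD], [cP] and [cQ] are the coefficients of [D], [- D' / D] and [log D], where [D] is the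
    Dirichlet series of [a]. *)
Definition cD (a : nat -> C) (i : nat) : C := a (S i).
Definition cP (a : nat -> C) (i : nat) : C := (RtoC (Lam (S i)) * a (S i))%C.
Definition cQ (a : nat -> C) (i : nat) : C := (RtoC (Lam (S i) / ln (INR (S i))) * a (S i))%C.

Lemma Lam_le_ln (n : nat) : (0 < n)%nat -> Lam n <= ln (INR n).
Proof.
  intros Hn. rewrite <- (sum_Lam_divisors n (S n)) by lia. simpl.
  rewrite (dv_1 n n) by (try lia; apply Nat.divide_refl).
  assert (0 <= Rsum (fun d => dv d n * Lam d) n).
  { apply Rsum_nonneg. intros k _. apply Rmult_le_pos; [|apply Lam_nonneg].
    unfold dv. destruct (_ =? _)%nat; lra. }
  lra.
Qed.

Lemma Lam_1 : Lam 1 = 0.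
Proof.
  apply Rle_antisym; [|apply Lam_nonneg]. eapply Rle_trans; [apply Lam_le_ln; lia|].
  simpl. rewrite ln_1. lra.
Qed.

Lemma cD_bound (a : nat -> C) : cmult a -> dbound (cD a).
Proof.
  intros Ha i. unfold cD. generalize (cm_bound a Ha (S i)) (ln_INR_nonneg (S i)). lra.
Qed.

Lemma cP_bound (a : nat -> C) : cmult a -> dbound (cP a).
Proof.
  intros Ha i. unfold cP. rewrite Cmod_mult, Cmod_R, Rabs_pos_eq by apply Lam_nonneg.
  generalize (cm_bound a Ha (S i)) (Cmod_ge_0 (a (S i))) (Lam_nonneg (S i)) (Lam_le_ln (S i) ltac:(lia)).
  nra.
Qed.

Lemma LamQ_bounds (i : nat) : 0 <= Lam (S i) / ln (INR (S i)) <= 1.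
Proof.
  destruct i as [|i]; [rewrite Lam_1; unfold Rdiv; lra|].
  assert (H : 0 < ln (INR (S (S i)))).
  { rewrite <- ln_1. apply ln_increasing; [lra|]. apply (lt_INR 1). lia. }
  split; [apply Rdiv_le_0_compat; auto using Lam_nonneg|].
  apply Rle_div_l; auto. rewrite Rmult_1_l. apply Lam_le_ln. lia.
Qed.

Lemma cQ_bound (a : nat -> C) : cmult a -> dbound (cQ a).
Proof.
  intros Ha i. unfold cQ. assert (B := LamQ_bounds i).
  rewrite Cmod_mult, Cmod_R, Rabs_pos_eq by lra.
  generalize (cm_bound a Ha (S i)) (Cmod_ge_0 (a (S i))) (ln_INR_nonneg (S i)). nra.
Qed.

Lemma dlog_cD_bound (a : nat -> C) : cmult a -> dbound (dlog (cD a)).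
Proof.
  intros Ha i. unfold dlog, cD.
  rewrite Cmod_mult, Cmod_opp, Cmod_R, Rabs_pos_eq by apply ln_INR_nonneg.
  generalize (cm_bound a Ha (S i)) (Cmod_ge_0 (a (S i))) (ln_INR_nonneg (S i)). nra.
Qed.

Lemma dlog_cQ (a : nat -> C) (i : nat) : dlog (cQ a) i = (- cP a i)%C.
Proof.
  unfold dlog, cQ, cP. destruct i as [|i].
  - rewrite Lam_1. unfold Rdiv. rewrite Rmult_0_l. ring.
  - assert (H : 0 < ln (INR (S (S i)))).
    { rewrite <- ln_1. apply ln_increasing; [lra|]. apply (lt_INR 1). lia. }
    rewrite RtoC_div by lra. field. intros E. apply RtoC_inj in E. lra.
Qed.

Lemma Csum_swap (f : nat -> nat -> C) (n m : nat) :
  Csum (fun i => Csum (fun j => f i j) m) n = Csum (fun j => Csum (fun i => f i j) n) m.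
Proof.
  induction n; simpl.
  - rewrite (Csum_ext _ (fun _ => 0 * 0)%C) by (intros; ring). rewrite Csum_scal. ring.
  - rewrite IHn, <- Csum_plus. reflexivity.
Qed.

Lemma Csum_multiples (g : nat -> C) (d X : nat) : d <> O ->
  Csum (fun i => RtoC (dv d (S i)) * g (S i))%C X = Csum (fun j => g (d * S j)%nat) (X / d).
Proof.
  intros Hd. induction X as [|X IH].
  - rewrite Nat.Div0.div_0_l. reflexivity.
  - simpl Csum at 1. rewrite IH.
    assert (E1 := Nat.div_mod X d Hd). assert (E2 := Nat.div_mod (S X) d Hd).
    assert (B1 := Nat.mod_upper_bound X d Hd). assert (B2 := Nat.mod_upper_bound (S X) d Hd).
    unfold dv. destruct (Nat.eqb_spec (S X mod d) 0) as [E|E].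
    + assert (S X / d = S (X / d))%nat by nia. rewrite H. simpl Csum at 2.
      replace (d * S (X / d))%nat with (S X) by nia. ring.
    + assert (S X / d = X / d)%nat by nia. rewrite H. ring.
Qed.

Lemma RtoC_Rsum (f : nat -> R) (n : nat) : RtoC (Rsum f n) = Csum (fun i => RtoC (f i)) n.
Proof. induction n; simpl; [auto|]. rewrite RtoC_plus, IHn. reflexivity. Qed.

Lemma Csum_shift (f : nat -> C) (n : nat) : Csum f (S n) = (f O + Csum (fun i => f (S i)) n)%C.
Proof.
  induction n; [simpl; ring|].
  change (Csum f (S (S n))) with (Csum f (S n) + f (S n))%C. rewrite IHn. simpl. ring.
Qed.

(** Write [ln n] as the sum of [Lam d] over the divisors of [n] and collect the terms with the
    same [d]; by complete multiplicativity [a n = a d * a (n / d)]. *)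
Lemma dirichlet_hyperbola (a : nat -> C) (s : C) (X : nat) : cmult a ->
  Dpart (dlog (cD a)) X s =
  (- Csum (fun j => cP a j * npow_opp (S j) s * Dpart (cD a) (X / S j) s) X)%C.
Proof.
  intros Ha. set (g := fun n => (a n * npow_opp n s)%C).
  transitivity (- Csum (fun i => Csum (fun j => RtoC (dv (S j) (S i) * Lam (S j)) * g (S i)) X) X)%C.
  - unfold Dpart. replace (Csum (fun i => dlog (cD a) i * npow_opp (S i) s)%C X) with
      (Csum (fun i => (- (1)) * Csum (fun j => RtoC (dv (S j) (S i) * Lam (S j)) * g (S i))%C X)%C X).
    + rewrite Csum_scal. ring.
    + apply Csum_ext. intros i Hi. unfold dlog, cD.
      rewrite <- (sum_Lam_divisors (S i) (S X)) by lia.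
      rewrite RtoC_Rsum, Csum_shift. rewrite Lam_0, Rmult_0_r, Cplus_0_l.
      rewrite (Csum_ext _ (fun j => g (S i) * RtoC (dv (S j) (S i) * Lam (S j)))%C) by (intros; ring).
      rewrite Csum_scal. unfold g. ring.
  - f_equal. rewrite Csum_swap. apply Csum_ext. intros j Hj.
    rewrite (Csum_ext _ (fun i => RtoC (Lam (S j)) * (RtoC (dv (S j) (S i)) * g (S i)))%C)
      by (intros; rewrite RtoC_mult; ring).
    rewrite Csum_scal, Csum_multiples by lia. unfold Dpart.
    rewrite <- Csum_scal, <- Csum_scal. apply Csum_ext. intros m _.
    unfold g, cP, cD. rewrite (cm_mult a Ha), npow_mult by lia. ring.
Qed.

Lemma DS_opp (b : nat -> C) (s : C) : dbound b -> 1 < Re s ->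
  DS (fun i => - b i)%C s = (- DS b s)%C.
Proof.
  intros Hb Hs. apply (Clim_unique (fun N => Dpart (fun i => - b i)%C N s)).
  - apply DS_lim; auto. intros i. rewrite Cmod_opp. apply Hb.
  - intros e He. destruct (DS_lim b s Hb Hs e He) as [N HN]. exists N. intros n Hn.
    specialize (HN n Hn). rewrite <- Cmod_opp.
    replace (- (Dpart (fun i => - b i) n s - - DS b s))%C with (Dpart b n s - DS b s)%C; auto.
    unfold Dpart. rewrite (Csum_ext (fun i => - b i * npow_opp (S i) s)%C (fun i => (- (1)) * (b i * npow_opp (S i) s))%C)
      by (intros; ring). rewrite Csum_scal. ring.
Qed.

Lemma DS_ext (b c : nat -> C) (s : C) : dbound b -> 1 < Re s -> (forall i, b i = c i) ->
  DS b s = DS c s.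
Proof.
  intros Hb Hs H. apply (Clim_unique (fun N => Dpart b N s)); [now apply DS_lim|].
  assert (Hc : dbound c) by (intros i; rewrite <- H; apply Hb).
  intros e He. destruct (DS_lim c s Hc Hs e He) as [N HN]. exists N. intros n Hn.
  replace (Dpart b n s) with (Dpart c n s); auto.
  apply Csum_ext. intros; now rewrite H.
Qed.

(** The convolution identity [Lam * 1 = log] reads [- D' = D P]. In the partial sums, those of [D]
    are evaluated at [X / d]; the error there is summable against the coefficients of [P]. *)
Lemma DS_product (a : nat -> C) (s : C) : cmult a -> 1 < Re s ->
  DS (dlog (cD a)) s = (- (DS (cD a) s * DS (cP a) s))%C.
Proof.
  intros Ha Hs. apply (Clim_unique (fun N => Dpart (dlog (cD a)) N s)).
  { apply DS_lim; auto. now apply dlog_cD_bound. }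
  set (t := Re s - 1). assert (Ht : 0 < t) by (unfold t; lra).
  assert (H2t : 0 < 2 / t) by (apply Rdiv_lt_0_compat; lra).
  set (D := DS (cD a) s). set (P := DS (cP a) s).
  set (u := t / 4). assert (Hu : 0 < u) by (unfold u; lra).
  assert (H2u : 0 < 2 / (t / 2)) by (apply Rdiv_lt_0_compat; lra).
  (* The tail of [D] beyond [X / d] is measured with half of the available exponent, which leaves
     the other half to make the sum over [d] converge. *)
  set (K := (1 + 2 / (t / 2)) * (exp (u * ln 2) / (t / 2 / 2))).
  assert (HK : 0 <= K).
  { unfold K. apply Rmult_le_pos; [lra|]. apply Rdiv_le_0_compat; [apply Rlt_le, exp_pos|lra]. }
  assert (HT : forall X d, (0 < d <= X)%nat -> Tail (t / 2) (X / d) <= K * (pw u X * exp (u * ln (INR d)))).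
  { intros X d Hd. unfold Tail, K. rewrite Rmult_assoc. apply Rmult_le_compat_l; [lra|].
    replace (exp (u * ln 2) / (t / 2 / 2) * (pw u X * exp (u * ln (INR d)))) with
      ((exp (u * ln 2) * (pw u X * exp (u * ln (INR d)))) / (t / 2 / 2)) by (field; lra).
    apply Rmult_le_compat_r; [apply Rlt_le, Rinv_0_lt_compat; lra|].
    unfold pw. rewrite <- !exp_plus. apply exp_le.
    assert (H1 : (1 <= X / d)%nat) by (apply Nat.div_le_lower_bound; lia).
    assert (H2 : (X <= 2 * (X / d) * d)%nat).
    { generalize (Nat.div_mod X d ltac:(lia)) (Nat.mod_upper_bound X d ltac:(lia)). nia. }
    apply le_INR in H2. rewrite !mult_INR in H2. change (INR 2) with 2 in H2.
    apply (le_INR 1) in H1. change (INR 1) with 1 in H1.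
    assert (HX : 0 < INR X) by (apply lt_0_INR; lia).
    assert (Hd0 : 0 < INR d) by (apply lt_0_INR; lia).
    apply ln_le in H2; auto. rewrite !ln_mult in H2 by lra.
    replace (t / 2 / 2) with u by (unfold u; field). nra. }
  set (S0 := (1 + 2 / t) * (1 + / u)).
  assert (HS0 : 0 <= S0).
  { unfold S0. apply Rmult_le_pos; [lra|]. generalize (Rinv_0_lt_compat u Hu); lra. }
  assert (HPs : forall X, Rsum (fun j => Cmod (cP a j * npow_opp (S j) s) * exp (u * ln (INR (S j)))) X <= S0).
  { intros X. apply Rle_trans with (Rsum (fun j => (1 + 2 / t) * pw (1 + u) (S j)) X).
    - apply Rsum_le. intros j _.
      assert (B := dterm_bound (cP a) t s j (cP_bound a Ha) Ht ltac:(unfold t; lra)).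
      replace (pw (1 + u) (S j)) with (pw (1 + t / 2) (S j) * exp (u * ln (INR (S j)))).
      + rewrite <- Rmult_assoc. apply Rmult_le_compat_r; auto. apply Rlt_le, exp_pos.
      + unfold pw. rewrite <- exp_plus. f_equal. unfold u. field.
    - rewrite Rsum_scal. apply Rmult_le_compat_l; [lra|].
      apply Rle_trans with (Rsum (fun j => pw (1 + u) (S j)) (1 + X)).
      + apply Rsum_mono; [lia|]. intros; apply Rlt_le, pw_pos.
      + rewrite Rsum_split. assert (B := pw_sum_bound u 1 X Hu ltac:(lia)).
        assert (E1 : forall x, pw x 1 = 1).
        { intros x. unfold pw. simpl. rewrite ln_1, Rmult_0_r, Ropp_0. apply exp_0. }
        rewrite E1 in B. simpl (Rsum _ 1). rewrite E1. unfold Rdiv in B.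
        simpl in B. simpl. lra. }
  assert (HDlim : forall X j, (j < X)%nat -> Cmod (Dpart (cD a) (X / S j) s - D) <=
     K * (pw u X * exp (u * ln (INR (S j))))).
  { intros X j Hj. rewrite Cmod_minus_sym. eapply Rle_trans; [|apply (HT X (S j)); lia].
    apply DS_tail; [now apply cD_bound|lra|unfold t; lra|].
    apply Nat.div_str_pos. lia. }
  intros e He.
  destruct (pw_lim u (e / (2 * (K * S0 + 1)))) as [N1 [HN10 HN1]]; auto.
  { apply Rdiv_lt_0_compat; [lra|]. assert (0 <= K * S0) by (now apply Rmult_le_pos). lra. }
  assert (HKS : 0 <= K * S0) by (now apply Rmult_le_pos).
  assert (HDm := Cmod_ge_0 D).
  destruct (DS_lim (cP a) s (cP_bound a Ha) Hs (e / (2 * (Cmod D + 1)))) as [N2 HN2].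
  { apply Rdiv_lt_0_compat; lra. }
  exists (N1 + N2)%nat. intros X HX. specialize (HN1 X ltac:(lia)). specialize (HN2 X ltac:(lia)).
  fold P in HN2.
  rewrite dirichlet_hyperbola by auto.
  replace (- Csum (fun j => cP a j * npow_opp (S j) s * Dpart (cD a) (X / S j) s) X - - (D * P))%C with
    (- (Csum (fun j => cP a j * npow_opp (S j) s * (Dpart (cD a) (X / S j) s - D)) X
        + D * (Dpart (cP a) X s - P)))%C.
  2:{ unfold Dpart at 2. replace (D * (Csum (fun i => cP a i * npow_opp (S i) s) X - P))%C with
        (Csum (fun i => D * (cP a i * npow_opp (S i) s)) X - D * P)%C by (rewrite Csum_scal; ring).
      replace (Csum (fun j => cP a j * npow_opp (S j) s * Dpart (cD a) (X / S j) s)%C X) with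
       (Csum (fun j => cP a j * npow_opp (S j) s * (Dpart (cD a) (X / S j) s - D) + D * (cP a j * npow_opp (S j) s)) X)%C
       by (apply Csum_ext; intros; ring).
      rewrite Csum_plus. ring. }
  rewrite Cmod_opp. eapply Rle_lt_trans; [apply Cmod_triangle|]. rewrite Cmod_mult.
  assert (A1 : Cmod (Csum (fun j => cP a j * npow_opp (S j) s * (Dpart (cD a) (X / S j) s - D))%C X)
     <= K * S0 * pw u X).
  { eapply Rle_trans; [apply (Csum_le _ (fun j : nat => K * pw u X *
       (Cmod (cP a j * npow_opp (S j) s)%C * exp (u * ln (INR (S j))))))|].
    - intros j Hj. rewrite Cmod_mult. specialize (HDlim X j Hj).
      generalize (Cmod_ge_0 (cP a j * npow_opp (S j) s)%C). intros G.
      apply Rle_trans with (Cmod (cP a j * npow_opp (S j) s) * (K * (pw u X * exp (u * ln (INR (S j)))))).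
      + now apply Rmult_le_compat_l.
      + right; ring.
    - rewrite Rsum_scal. specialize (HPs X).
      replace (K * S0 * pw u X) with (K * pw u X * S0) by ring.
      apply Rmult_le_compat_l; auto. apply Rmult_le_pos; auto. apply Rlt_le, pw_pos. }
  assert (A2 : K * S0 * pw u X < e / 2).
  { apply Rlt_div_r in HN1; [|lra]. assert (Hp := pw_pos u X). nra. }
  assert (A3 : Cmod D * Cmod (Dpart (cP a) X s - P) <= e / 2).
  { apply Rlt_div_r in HN2; [|lra]. generalize (Cmod_ge_0 (Dpart (cP a) X s - P)%C). nra. }
  lra.
Qed.

Lemma DS_leading (b : nat -> C) (t : R) (s : C) : dbound b -> 0 < t -> 1 + t <= Re s ->
  Cmod (DS b s - b O) <= (1 + 2 / t) * (2 / t).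
Proof.
  intros Hb Ht Hs. assert (H := DS_tail b t s 1 Hb Ht Hs ltac:(lia)).
  unfold Dpart, Tail in H. simpl Csum in H. rewrite npow_1 in H.
  replace (0 + b O * 1)%C with (b O) in H by ring.
  replace (pw (t / 2) 1 / (t / 2)) with (2 / t) in H; auto.
  unfold pw. simpl. rewrite ln_1, Rmult_0_r, Ropp_0, exp_0. field. lra.
Qed.

(** Both sides satisfy the same linear differential equation and tend to 1 far to the right. In
    particular the series has no zeros. *)
Theorem DS_exp (a : nat -> C) (s : C) : cmult a -> 1 < Re s ->
  DS (cD a) s = Cexp (DS (cQ a) s).
Proof.
  intros Ha Hs.
  assert (HQb : dbound (dlog (cQ a))).
  { intros i. rewrite dlog_cQ, Cmod_opp. now apply cP_bound. }
  assert (HQ' : forall z, 1 < Re z -> DS (dlog (cQ a)) z = (- DS (cP a) z)%C).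
  { intros z Hz. rewrite (DS_ext _ (fun i => - cP a i)%C) by (auto; apply dlog_cQ).
    apply DS_opp; auto. now apply cP_bound. }
  set (h := fun z => (DS (cD a) z * Cexp (- DS (cQ a) z))%C).
  assert (Hh : forall z, 1 < Re z -> CD h z 0).
  { intros z Hz.
    assert (D1 := DS_CD (cD a) z (cD_bound a Ha) (dlog_cD_bound a Ha) Hz).
    assert (D2 := DS_CD (cQ a) z (cQ_bound a Ha) HQb Hz).
    eapply CD_eq; [|apply (CD_mult _ _ z _ _ D1 (CD_comp Cexp _ z _ _ (CD_opp _ z _ D2) (CD_Cexp _)))].
    rewrite DS_product, HQ' by auto. ring. }
  assert (Hconst : forall u, 0 < u -> h (s + RtoC u)%C = h s).
  { intros u Hu.
    assert (E := @eq_is_derive C_R_NormedModule (fun x => h (s + RtoC x * RtoC 1)%C) 0 u).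
    assert (E' : h (s + RtoC 0 * RtoC 1)%C = h (s + RtoC u * RtoC 1)%C).
    { apply E; auto. intros x Hx.
      assert (HD : RD (fun x => h (s + RtoC x * RtoC 1)%C) x (0 * 1)%C).
      { apply (RD_comp h (fun x => s + RtoC x * RtoC 1)%C x); [apply RD_affine|]. apply Hh.
        rewrite re_plus, <- RtoC_mult, re_RtoC. lra. }
      replace (0 * 1)%C with (RtoC 0) in HD by ring. exact HD. }
    replace (s + RtoC 0 * RtoC 1)%C with s in E' by ring.
    replace (s + RtoC u * RtoC 1)%C with (s + RtoC u)%C in E' by ring. now symmetry. }
  assert (H1 : h s = 1).
  { apply Ceq_minus, Cmod_eq_0.
    apply Rle_antisym; [|apply Cmod_ge_0]. apply Rnot_lt_le. intros Hpos.
    set (e := Rmin (1 / 2) (Cmod (h s - 1) / 100)).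
    assert (He : 0 < e) by (apply Rmin_pos; lra).
    assert (He1 : e <= 1 / 2) by apply Rmin_l. assert (He2 : e <= Cmod (h s - 1) / 100) by apply Rmin_r.
    set (t := 4 / e + 2).
    assert (H4e : 0 < 4 / e) by (apply Rdiv_lt_0_compat; lra).
    assert (Hsmall : (1 + 2 / t) * (2 / t) <= e).
    { assert (2 / t <= e / 2).
      { apply Rle_div_l; [unfold t; lra|]. unfold t.
        replace (e / 2 * (4 / e + 2)) with (2 + e) by (field; lra). lra. }
      assert (0 <= 2 / t) by (apply Rdiv_le_0_compat; unfold t; lra). nra. }
    set (z := (s + RtoC t)%C).
    assert (Hz : 1 + t <= Re z) by (unfold z; rewrite re_plus, re_RtoC; lra).
    assert (Ht0 : 0 < t) by (unfold t; lra).
    assert (L1 := DS_leading (cD a) t z (cD_bound a Ha) Ht0 Hz).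
    assert (L2 := DS_leading (cQ a) t z (cQ_bound a Ha) Ht0 Hz).
    unfold cD at 2 in L1. rewrite (cm_one a Ha) in L1.
    unfold cQ at 2 in L2. rewrite Lam_1 in L2. unfold Rdiv at 1 in L2. rewrite Rmult_0_l in L2.
    replace (DS (cQ a) z - 0 * a 1%nat)%C with (DS (cQ a) z) in L2 by ring.
    assert (Hhz : h z = h s) by (apply Hconst; auto).
    assert (T := Cexp_taylor1 (- DS (cQ a) z) ltac:(rewrite Cmod_opp; lra)).
    rewrite Cmod_opp in T.
    assert (N1 : Cmod (Cexp (- DS (cQ a) z) - 1) <= 6 * e).
    { replace (Cexp (- DS (cQ a) z) - 1)%C with ((Cexp (- DS (cQ a) z) - 1 - - DS (cQ a) z) - DS (cQ a) z)%C by ring.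
      eapply Rle_trans; [apply Cmod_triangle_minus|].
      assert (Cmod (DS (cQ a) z) ^ 2 <= e ^ 2) by (apply pow_incr; split; [apply Cmod_ge_0|lra]).
      nra. }
    assert (N2 : Cmod (h z - 1) <= 6 * e * e + 7 * e).
    { unfold h. replace (DS (cD a) z * Cexp (- DS (cQ a) z) - 1)%C with
        ((DS (cD a) z - 1) * (Cexp (- DS (cQ a) z) - 1) + ((DS (cD a) z - 1) + (Cexp (- DS (cQ a) z) - 1)))%C by ring.
      eapply Rle_trans; [apply Cmod_triangle|]. rewrite Cmod_mult.
      assert (G := Cmod_triangle (DS (cD a) z - 1)%C (Cexp (- DS (cQ a) z) - 1)%C).
      generalize (Cmod_ge_0 (DS (cD a) z - 1)%C) (Cmod_ge_0 (Cexp (- DS (cQ a) z) - 1)%C). nra. }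
    rewrite Hhz in N2. nra. }
  unfold h in H1. rewrite <- (Cmult_1_l (Cexp (DS (cQ a) s))), <- H1, <- Cmult_assoc, Cexp_opp. ring.
Qed.

Lemma cmult_one : cmult (fun _ => RtoC 1).
Proof. split; [intros; ring|auto|intros; rewrite Cmod_1; lra]. Qed.

Lemma cmult_sq (a : nat -> C) : cmult a -> cmult (fun n => a n * a n)%C.
Proof.
  intros Ha. split.
  - intros m n. rewrite (cm_mult a Ha). ring.
  - rewrite (cm_one a Ha). ring.
  - intros n. rewrite Cmod_mult. generalize (cm_bound a Ha n) (Cmod_ge_0 (a n)). nra.
Qed.

Lemma Re_341 (z : C) : Cmod z <= 1 -> 0 <= 3 + 4 * Re z + Re (z * z).
Proof.
  intros Hz. assert (H := Cmod2_alt z). rewrite re_mult.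
  assert (Cmod z ^ 2 <= 1) by (generalize (Cmod_ge_0 z); simpl; nra). nra.
Qed.

(** The inequality [3 + 4 cos x + cos 2x >= 0], summed over the logarithms of the three series. *)
Theorem three_four_one (a : nat -> C) (sigma t : R) : cmult a -> 1 < sigma ->
  1 <= Cmod (DS (cD (fun _ => RtoC 1)) (RtoC sigma)) ^ 3 * Cmod (DS (cD a) (sigma, t)) ^ 4 *
       Cmod (DS (cD (fun n => a n * a n)%C) (sigma, 2 * t)).
Proof.
  intros Ha Hs. assert (Ha2 := cmult_sq a Ha). assert (H1 := cmult_one).
  rewrite !DS_exp, !Cmod_Cexp by auto.
  set (q1 := DS (cQ (fun _ => RtoC 1)) (RtoC sigma)).
  set (q2 := DS (cQ a) (sigma, t)).
  set (q3 := DS (cQ (fun n => a n * a n)%C) (sigma, 2 * t)).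
  assert (E : exp (Re q1) ^ 3 * exp (Re q2) ^ 4 * exp (Re q3) = exp (3 * Re q1 + 4 * Re q2 + Re q3)).
  { simpl. rewrite !Rmult_1_r, <- !exp_plus. f_equal. ring. }
  rewrite E. rewrite <- exp_0. apply exp_le.
  apply Rnot_lt_le. intros Hneg.
  set (e := - (3 * Re q1 + 4 * Re q2 + Re q3) / 8). assert (He : 0 < e) by (unfold e; lra).
  destruct (DS_lim (cQ (fun _ => RtoC 1)) (RtoC sigma) (cQ_bound _ H1) Hs e He) as [N1 HN1].
  destruct (DS_lim (cQ a) (sigma, t) (cQ_bound _ Ha) Hs e He) as [N2 HN2].
  destruct (DS_lim (cQ (fun n => a n * a n)%C) (sigma, 2 * t) (cQ_bound _ Ha2) Hs e He) as [N3 HN3].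
  set (N := (N1 + N2 + N3)%nat).
  specialize (HN1 N ltac:(unfold N; lia)). specialize (HN2 N ltac:(unfold N; lia)).
  specialize (HN3 N ltac:(unfold N; lia)). fold q1 in HN1. fold q2 in HN2. fold q3 in HN3.
  set (S1 := Dpart (cQ (fun _ => RtoC 1)) N (RtoC sigma)) in *.
  set (S2 := Dpart (cQ a) N (sigma, t)) in *.
  set (S3 := Dpart (cQ (fun n => a n * a n)%C) N (sigma, 2 * t)) in *.
  assert (Hpos : 0 <= 3 * Re S1 + 4 * Re S2 + Re S3).
  { unfold S1, S2, S3, Dpart. clear -Ha. induction N as [|N IH]; [simpl; lra|].
    simpl Csum. rewrite !re_plus.
    enough (0 <= 3 * Re (cQ (fun _ => RtoC 1) N * npow_opp (S N) sigma) +
      4 * Re (cQ a N * npow_opp (S N) (sigma, t)) +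
      Re (cQ (fun n => a n * a n)%C N * npow_opp (S N) (sigma, 2 * t))) by lra.
    assert (B := LamQ_bounds N). set (c := Lam (S N) / ln (INR (S N))) in *.
    set (w := Cexp (Ci * RtoC (- (t * ln (INR (S N)))))).
    set (z := (a (S N) * w)%C).
    assert (Ew : npow_opp (S N) (sigma, 2 * t) = (RtoC (pw sigma (S N)) * (w * w))%C).
    { rewrite npow_polar. f_equal. unfold w. rewrite <- Cexp_plus. f_equal.
      rewrite <- Cmult_plus_distr_l, <- RtoC_plus. do 2 f_equal. ring. }
    assert (Hz : Cmod z <= 1).
    { unfold z, w. rewrite Cmod_mult, Cmod_Cexp.
      replace (Re (Ci * RtoC (- (t * ln (INR (S N)))))) with 0 by (unfold Ci, RtoC, Cmult; simpl; ring).
      rewrite exp_0, Rmult_1_r. apply (cm_bound a Ha). }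
    assert (H := Re_341 z Hz). assert (Hp := pw_pos sigma (S N)).
    unfold cQ. fold c. rewrite Ew, (npow_polar (S N) sigma t). fold w.
    replace (npow_opp (S N) sigma) with (RtoC (pw sigma (S N))).
    2:{ unfold npow_opp, pw. rewrite <- RtoC_mult, <- RtoC_opp, Cexp_RtoC. reflexivity. }
    replace (RtoC c * a (S N) * (RtoC (pw sigma (S N)) * w))%C with (RtoC (c * pw sigma (S N)) * z)%C
      by (unfold z; rewrite RtoC_mult; ring).
    replace (RtoC c * (a (S N) * a (S N)) * (RtoC (pw sigma (S N)) * (w * w)))%C with
      (RtoC (c * pw sigma (S N)) * (z * z))%C by (unfold z; rewrite RtoC_mult; ring).
    replace (RtoC c * RtoC 1 * RtoC (pw sigma (S N)))%C with (RtoC (c * pw sigma (S N)))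
      by (rewrite RtoC_mult; ring).
    rewrite !re_scal_l, re_RtoC.
    assert (0 <= c * pw sigma (S N)) by (apply Rmult_le_pos; lra). nra. }
  assert (R1 := re_le_Cmod (S1 - q1)). assert (R2 := re_le_Cmod (S2 - q2)). assert (R3 := re_le_Cmod (S3 - q3)).
  unfold Cminus in R1, R2, R3. rewrite re_plus, re_opp in R1, R2, R3.
  unfold Cminus in HN1, HN2, HN3.
  apply Rabs_le_between in R1, R2, R3. unfold e in *. lra.
Qed.

(** * Dirichlet characters: growth and non-vanishing of the L-function *)

Lemma periodic_mod (q : nat) (f : nat -> C) (n : nat) : (0 < q)%nat ->
  (forall n, f (n + q)%nat = f n) -> f n = f (n mod q).
Proof.
  intros Hq Hf. rewrite (Nat.div_mod n q) at 1 by lia.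
  generalize (n mod q) as r. intros r.
  induction (n / q)%nat as [|k IH].
  - f_equal. lia.
  - replace (q * S k + r)%nat with (q * k + r + q)%nat by lia. now rewrite Hf.
Qed.

Lemma finite_bound (f : nat -> R) (q : nat) : exists B, 0 <= B /\ forall n, (n < q)%nat -> f n <= B.
Proof.
  induction q as [|q [B [HB0 HB]]].
  - exists 0. split; [lra|]. intros; lia.
  - exists (Rmax B (f q)). split; [eapply Rle_trans; [exact HB0|apply Rmax_l]|].
    intros n Hn. destruct (Nat.eq_dec n q) as [->|]; [apply Rmax_r|].
    eapply Rle_trans; [apply HB; lia|apply Rmax_l].
Qed.

(** A value of modulus above 1 would have unbounded powers among the finitely many values of
    [chi]. *)
Lemma char_cmult (q : nat) (chi : nat -> C) : dirichlet_character q chi -> cmult chi.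
Proof.
  intros [Hq Hper Hmult Hsup].
  assert (H1 : chi 1%nat = 1).
  { assert (N1 : chi 1%nat <> 0) by (apply Hsup, Nat.divide_1_r, Nat.gcd_divide_l).
    assert (E := Hmult 1%nat 1%nat). simpl in E.
    replace (chi 1%nat) with (chi 1%nat * chi 1%nat * / chi 1%nat)%C at 1 by (field; auto).
    rewrite <- E. field. auto. }
  split; auto. intros n. apply Rnot_lt_le. intros Hn.
  destruct (finite_bound (fun n => Cmod (chi n)) q) as [B [HB0 HB]].
  assert (HBn : forall m, Cmod (chi m) <= B).
  { intros m. rewrite (periodic_mod q chi m Hq Hper). apply HB, Nat.mod_upper_bound. lia. }
  assert (Hpow : forall k, chi (n ^ k)%nat = (chi n ^ k)%C).
  { induction k; simpl; [auto|]. now rewrite Hmult, IHk. }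
  destruct (Pow_x_infinity (Cmod (chi n)) ltac:(rewrite Rabs_pos_eq; lra) (B + 1)) as [N HN].
  specialize (HN N (le_n N)). rewrite Rabs_pos_eq in HN by (apply pow_le; lra).
  specialize (HBn (n ^ N)%nat). rewrite Hpow, Cmod_pow in HBn. lra.
Qed.

Definition lsumC (f : nat -> C) (l : list nat) : C := fold_right (fun n acc => f n + acc)%C (RtoC 0) l.

Lemma lsumC_perm (f : nat -> C) (l l' : list nat) : Permutation l l' -> lsumC f l = lsumC f l'.
Proof.
  induction 1; simpl; auto.
  - now rewrite IHPermutation.
  - ring.
  - congruence.
Qed.

Lemma lsumC_seq (f : nat -> C) (k : nat) : lsumC f (seq 0 k) = Csum f k.
Proof.
  induction k; [reflexivity|]. rewrite seq_S. simpl Csum. rewrite <- IHk. simpl.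
  generalize (seq 0 k). intros l. induction l; simpl; [ring|]. rewrite IHl. ring.
Qed.

Lemma lsumC_map (f : nat -> C) (g : nat -> nat) (l : list nat) :
  lsumC f (map g l) = lsumC (fun n => f (g n)) l.
Proof. induction l; simpl; [auto|]. now rewrite IHl. Qed.

(** Multiplication by a residue [m] with [chi m <> 1] permutes the residues but scales the sum. *)
Lemma char_period_sum (q : nat) (chi : nat -> C) : dirichlet_character q chi -> ~ principal q chi ->
  Csum chi q = 0.
Proof.
  intros [Hq Hper Hmult Hsup] Hnp.
  apply not_all_ex_not in Hnp. destruct Hnp as [m Hm]. apply imply_to_and in Hm.
  destruct Hm as [Hm Hm1].
  assert (E : (chi m * Csum chi q)%C = Csum chi q).
  { rewrite <- Csum_scal, <- !lsumC_seq.
    transitivity (lsumC (fun n => chi ((m * n) mod q)) (seq 0 q)).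
    - rewrite !lsumC_seq. apply Csum_ext. intros k _.
      rewrite <- Hmult. now apply periodic_mod.
    - rewrite <- (lsumC_map chi (fun n => (m * n) mod q)). apply lsumC_perm.
      apply NoDup_Permutation_bis.
      + assert (G : forall l, NoDup l -> (forall n, In n l -> (n < q)%nat) -> NoDup (map (fun n => (m * n) mod q) l)).
        { induction 1 as [|x l Hx Hl IH]; intros Hin; simpl; constructor.
          - intros Hc. apply in_map_iff in Hc. destruct Hc as [y [Hy Hyl]].
            assert (x < q)%nat by (apply Hin; now left). assert (y < q)%nat by (apply Hin; now right).
            assert (Inj : forall a b, (a <= b < q)%nat -> (m * b) mod q = (m * a) mod q -> a = b).
            { intros a b Hab Hmod.
              assert (D : Nat.divide q (m * (b - a))).
              { exists ((m * b) / q - (m * a) / q)%nat.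
                assert (E1 := Nat.div_mod (m * b) q ltac:(lia)). assert (E2 := Nat.div_mod (m * a) q ltac:(lia)).
                nia. }
              apply Nat.gauss in D; [|now rewrite Nat.gcd_comm].
              destruct (Nat.eq_dec a b); auto. apply Nat.divide_pos_le in D; lia. }
            apply Hx. destruct (le_lt_dec x y).
            + rewrite (Inj x y); auto; lia.
            + rewrite <- (Inj y x); auto; lia.
          - apply IH. intros; apply Hin; now right. }
        apply G; [apply seq_NoDup|]. intros n Hn. apply in_seq in Hn. lia.
      + rewrite length_map. lia.
      + intros x Hx. apply in_map_iff in Hx. destruct Hx as [y [<- _]].
        apply in_seq. generalize (Nat.mod_upper_bound (m * y) q). lia. }
  assert (Hz : (chi m - 1)%C <> 0) by (intros F; apply Hm1; now apply Ceq_minus).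
  replace (Csum chi q) with ((chi m * Csum chi q - Csum chi q) * / (chi m - 1))%C by (field; auto).
  rewrite E. ring.
Qed.

Lemma Csum_periodic (q : nat) (f : nat -> C) (k r : nat) :
  (forall n, f (n + q)%nat = f n) ->
  Csum f (k * q + r) = (RtoC (INR k) * Csum f q + Csum f r)%C.
Proof.
  intros Hf.
  assert (E : forall r, Csum f (q + r) = (Csum f q + Csum f r)%C).
  { intros r'. rewrite Csum_split. f_equal. apply Csum_ext. intros i _. rewrite Nat.add_comm. apply Hf. }
  induction k as [|k IH].
  - simpl. ring.
  - replace (S k * q + r)%nat with (q + (k * q + r))%nat by lia. rewrite E, IH, S_INR, RtoC_plus. ring.
Qed.

Lemma Csum_le_length (f : nat -> C) (n : nat) : (forall k, Cmod (f k) <= 1) -> Cmod (Csum f n) <= INR n.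
Proof.
  intros H. eapply Rle_trans; [apply (Csum_le f (fun _ => 1)); auto|]. rewrite Rsum_const. lra.
Qed.

Lemma cD_periodic (q : nat) (f : nat -> C) : (forall n, f (n + q)%nat = f n) ->
  forall n, cD f (n + q)%nat = cD f n.
Proof. intros H n. unfold cD. replace (S (n + q)) with (S n + q)%nat by lia. apply H. Qed.

Lemma char_partial_sums (q : nat) (chi : nat -> C) (N : nat) :
  dirichlet_character q chi -> ~ principal q chi -> Cmod (Csum (cD chi) N) <= INR q.
Proof.
  intros Hc Hnp. assert (Hq := dchar_modulus_pos q chi Hc).
  assert (Ha := char_cmult q chi Hc).
  assert (Hper := dchar_periodic q chi Hc).
  assert (E0 : Csum (cD chi) q = 0).
  { assert (E : (chi O + Csum (cD chi) q)%C = (Csum chi q + chi q)%C).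
    { unfold cD. rewrite <- Csum_shift. reflexivity. }
    rewrite (char_period_sum q chi Hc Hnp) in E.
    replace (chi q) with (chi O) in E by (symmetry; apply (Hper O)).
    replace (Csum (cD chi) q) with ((chi O + Csum (cD chi) q) - chi O)%C by ring. rewrite E. ring. }
  rewrite (Nat.div_mod N q) by lia. rewrite Nat.mul_comm, Csum_periodic by now apply cD_periodic.
  rewrite E0. replace (RtoC (INR (N / q)) * 0 + Csum (cD chi) (N mod q))%C with (Csum (cD chi) (N mod q)) by ring.
  eapply Rle_trans; [apply Csum_le_length; intros; apply (cm_bound _ Ha)|].
  apply le_INR. generalize (Nat.mod_upper_bound N q). lia.
Qed.

(** The left-hand side integrates [s * exp (- s x)] over [[a, b]], the right-hand side bounds its
    modulus. *)
Lemma exp_increment_bound (s : C) (a b : R) : a <= b -> 0 < Re s ->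
  Cmod (Cexp (- (s * RtoC a)) - Cexp (- (s * RtoC b))) <=
  Cmod s / Re s * (exp (- (Re s * a)) - exp (- (Re s * b))).
Proof.
  intros Hab Hs.
  assert (HD : forall t, RD (fun t => - Cexp (- (s * RtoC t)))%C t (s * Cexp (- (s * RtoC t)))%C).
  { intros t. replace (s * Cexp (- (s * t)))%C with (- (Cexp (- (s * t))) * - s)%C by ring.
    apply (RD_comp (fun z => - Cexp z)%C (fun t => - (s * RtoC t))%C).
    - apply (@is_derive_ext R_AbsRing C_R_NormedModule (fun u => RtoC 0 + RtoC u * - s)%C).
      + intros u. change (RtoC 0 + RtoC u * - s = - (s * RtoC u))%C. ring.
      + apply RD_affine.
    - apply CD_opp, CD_Cexp. }
  assert (HDc : forall t, rcont (fun t => s * Cexp (- (s * RtoC t)))%C t).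
  { intros t. apply rcont_mult; [apply rcont_const|].
    assert (R := RD_rcont _ _ _ (HD t)). apply rcont_eps. intros e He.
    destruct (proj1 (rcont_eps _ _) R e He) as [d [Hd H]]. exists d; split; auto. intros u Hu.
    specialize (H u Hu). rewrite <- Cmod_opp.
    replace (- (Cexp (- (s * u)) - Cexp (- (s * t))))%C with (- Cexp (- (s * u)) - - Cexp (- (s * t)))%C by ring.
    exact H. }
  replace (Cexp (- (s * a)) - Cexp (- (s * b)))%C with
    (CI (fun t => s * Cexp (- (s * RtoC t)))%C a b).
  2:{ rewrite (CI_FTC (fun t => - Cexp (- (s * RtoC t)))%C); [ring|auto|auto]. }
  rewrite Cmod_norm.
  set (F := fun t => - (Cmod s / Re s) * exp (- (Re s * t))).
  apply (@norm_RInt_le C_R_NormedModule (fun t => s * Cexp (- (s * RtoC t)))%C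
    (fun t => Cmod s * exp (- (Re s * t))) a b); auto.
  - intros t _. rewrite <- Cmod_norm, Cmod_mult, Cmod_Cexp, re_opp, re_scal_r. lra.
  - apply CI_correct, ex_CI_cont. intros; apply HDc.
  - replace (Cmod s / Re s * (exp (- (Re s * a)) - exp (- (Re s * b)))) with (minus (F b) (F a))
      by (unfold F, minus, plus, opp; simpl; ring).
    apply (is_RInt_derive F).
    + intros t _. unfold F. auto_derive; auto. field. lra.
    + intros t _. apply (@ex_derive_continuous R_AbsRing R_NormedModule). auto_derive. auto.
Qed.

(** Summation by parts: the increments of [n ^ (- s)] are dominated by [Cmod s / Re s] times those
    of [n ^ (- Re s)], which telescope. *)
Lemma Abel_bound (e : nat -> C) (B : R) (s : C) (N : nat) : 0 < Re s ->
  (forall n, Cmod (Csum e n) <= B) -> Cmod (Dpart e N s) <= B * (1 + Cmod s / Re s).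
Proof.
  intros Hs HB.
  assert (HB0 : 0 <= B) by (eapply Rle_trans; [apply Cmod_ge_0|apply (HB O)]).
  assert (Hss : 0 <= Cmod s / Re s) by (apply Rdiv_le_0_compat; auto using Cmod_ge_0).
  destruct N as [|N].
  { unfold Dpart; simpl. rewrite Cmod_0. apply Rmult_le_pos; lra. }
  assert (E : forall n, Dpart e (S n) s =
    (Csum e (S n) * npow_opp (S n) s +
     Csum (fun i => Csum e (S i) * (npow_opp (S i) s - npow_opp (S (S i)) s)) n)%C).
  { induction n as [|n IH].
    - unfold Dpart; simpl. ring.
    - unfold Dpart in *. change (Csum (fun i => e i * npow_opp (S i) s)%C (S (S n))) with
        (Csum (fun i => e i * npow_opp (S i) s)%C (S n) + e (S n) * npow_opp (S (S n)) s)%C.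
      rewrite IH. change (Csum e (S (S n))) with (Csum e (S n) + e (S n))%C.
      change (Csum (fun i => Csum e (S i) * (npow_opp (S i) s - npow_opp (S (S i)) s))%C (S n)) with
        (Csum (fun i => Csum e (S i) * (npow_opp (S i) s - npow_opp (S (S i)) s))%C n
         + Csum e (S n) * (npow_opp (S n) s - npow_opp (S (S n)) s))%C. ring. }
  rewrite E. eapply Rle_trans; [apply Cmod_triangle|].
  assert (P1 : pw (Re s) 1 = 1) by (unfold pw; simpl; rewrite ln_1, Rmult_0_r, Ropp_0; apply exp_0).
  assert (Hmono : forall i, pw (Re s) (S (S i)) <= pw (Re s) (S i)).
  { intros i. unfold pw. apply exp_le. apply Ropp_le_contravar, Rmult_le_compat_l; [lra|].
    apply ln_le; [apply lt_0_INR; lia|]. apply le_INR; lia. }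
  assert (Hle1 : forall i, pw (Re s) (S i) <= 1).
  { induction i; [lra|]. generalize (Hmono i); lra. }
  rewrite Rmult_plus_distr_l, Rmult_1_r. apply Rplus_le_compat.
  - rewrite Cmod_mult, Cmod_npow. rewrite <- (Rmult_1_r B).
    apply Rmult_le_compat; auto using Cmod_ge_0. apply Rlt_le, pw_pos.
  - apply Rle_trans with (Rsum (fun i => B * (Cmod s / Re s) * (pw (Re s) (S i) - pw (Re s) (S (S i)))) N).
    + apply Csum_le. intros i _. rewrite Cmod_mult, Rmult_assoc.
      apply Rmult_le_compat; auto using Cmod_ge_0.
      apply (exp_increment_bound s (ln (INR (S i))) (ln (INR (S (S i))))); auto.
      apply ln_le; [apply lt_0_INR; lia|]. apply le_INR; lia.
    + rewrite Rsum_scal.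
      assert (T : Rsum (fun i => pw (Re s) (S i) - pw (Re s) (S (S i))) N = 1 - pw (Re s) (S N)).
      { induction N; simpl Rsum; [rewrite P1; ring|]. rewrite IHN by auto. ring. }
      rewrite T. rewrite <- (Rmult_1_r (B * (Cmod s / Re s))) at 2.
      apply Rmult_le_compat_l; [now apply Rmult_le_pos|]. generalize (pw_pos (Re s) (S N)); lra.
Qed.

Lemma is_series_Clim (u : nat -> C) (l : C) :
  @is_series C_AbsRing C_NormedModule u l -> Clim (Csum u) l.
Proof.
  intros H e He.
  assert (Ll : @locally C_UniformSpace l (fun w => Cmod (w - l) < e)).
  { apply locally_Cmod. exists e; auto. }
  destruct (H _ Ll) as [N HN].
  exists (S N). intros n Hn. destruct n as [|n]; [lia|].
  specialize (HN n ltac:(lia)).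
  replace (Csum u (S n)) with (@sum_n C_AbelianMonoid u n); auto.
  clear. induction n as [|n IH].
  - rewrite sum_O. simpl. change (u O = (0 + u O)%C). ring.
  - rewrite sum_Sn, IH. reflexivity.
Qed.

Lemma L_DS (q : nat) (chi : nat -> C) (L : C -> C) (s : C) : dirichlet_character q chi ->
  is_dirichlet_L chi L -> 1 < Re s -> L s = DS (cD chi) s.
Proof.
  intros Hc [_ HL] Hs. apply (Clim_unique (fun N => Dpart (cD chi) N s)).
  - apply (is_series_Clim _ _ (HL s Hs)).
  - apply DS_lim; auto. apply cD_bound, (char_cmult q), Hc.
Qed.

(** The partial sums obey the bound by partial summation, and [approx_bound] passes it to the
    continuation from a circle in the half-plane of convergence. *)
Lemma L_growth (q : nat) (chi : nat -> C) (L : C -> C) (eta : R) (w : C) :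
  dirichlet_character q chi -> ~ principal q chi -> is_dirichlet_L chi L ->
  0 < eta -> Cmod w <= eta + 3 / 4 ->
  Cmod (L (RtoC (1 + eta) + w)%C) <= 200 * INR q * (eta + 1) ^ 2.
Proof.
  intros Hc Hnp HL Heta Hw. assert (Hw0 := Cmod_ge_0 w).
  assert (Hq : 0 <= INR q) by apply pos_INR.
  set (r := eta + 7 / 8).
  assert (Hent : ent (fun w => L (RtoC (1 + eta) + w)%C)).
  { intros z. destruct (proj1 HL (RtoC (1 + eta) + z)%C) as [l Hl]. exists l. now apply CD_shift. }
  apply Rle_trans with (INR q * (1 + 8 * (2 * eta + 2)) * (r / (r - Cmod w))).
  - apply (approx_bound (fun w => L (RtoC (1 + eta) + w)%C) (r + 1) (eta / 2) r);
      [now apply ent_holo|unfold r; lra|lra|unfold r; lra|].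
    intros e He. destruct (Tail_lim (eta / 2) e ltac:(lra) He) as [N [HN0 HN]].
    exists (fun w => Dpart (cD chi) N (RtoC (1 + eta) + w)%C). split; [|split].
    + intros z _. eexists. apply CD_shift, Dpart_CD.
    + intros z Hz.
      assert (Hre : 1 / 8 <= Re (RtoC (1 + eta) + z)).
      { rewrite re_plus, re_RtoC. assert (H := re_le_Cmod z). apply Rabs_le_between in H. unfold r in Hz. lra. }
      assert (Hmod : Cmod (RtoC (1 + eta) + z) <= 2 * eta + 2).
      { eapply Rle_trans; [apply Cmod_triangle|]. rewrite Cmod_R, Rabs_pos_eq, Hz by lra. unfold r. lra. }
      eapply Rle_trans; [apply (Abel_bound _ (INR q)); [lra|]|].
      * intros n. now apply char_partial_sums.
      * apply Rmult_le_compat_l; auto. apply Rplus_le_compat_l.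
        apply Rle_div_l; [lra|]. assert (0 <= Cmod (RtoC (1 + eta) + z)) by apply Cmod_ge_0. nra.
    + intros z Hz. rewrite (L_DS q chi L) by
        (auto; generalize (Re_shift_ge (RtoC (1 + eta)) z eta ltac:(lra)); rewrite re_RtoC; lra).
      apply Rlt_le. eapply Rle_lt_trans; [|apply (HN N (le_n N))].
      apply DS_tail; auto; [apply cD_bound, (char_cmult q), Hc|lra|].
      rewrite re_plus, re_RtoC. assert (H := re_le_Cmod z). apply Rabs_le_between in H. lra.
  - assert (r / (r - Cmod w) <= 8 * r).
    { apply Rle_div_l; unfold r in *; [lra|]. nra. }
    assert (0 <= INR q * (1 + 8 * (2 * eta + 2))) by (apply Rmult_le_pos; lra).
    apply Rle_trans with (INR q * (1 + 8 * (2 * eta + 2)) * (8 * r)).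
    + now apply Rmult_le_compat_l.
    + rewrite !Rmult_assoc, (Rmult_comm 200), !Rmult_assoc. apply Rmult_le_compat_l; auto. unfold r. nra.
Qed.

(** The coefficients of the series of [psi] multiplied by [1 - N ^ (1 - s)]. This factor removes
    the pole of a principal character: the new coefficients have mean zero over a period, whether
    or not [psi] is principal. *)
Definition twist (psi : nat -> C) (N n : nat) : C :=
  (psi n - RtoC (dv N n) * (RtoC (INR N) * psi (n / N)%nat))%C.

Lemma twist_partial_sums (psi : nat -> C) (q N : nat) : (0 < q)%nat -> (0 < N)%nat ->
  (forall n, psi (n + q)%nat = psi n) -> (forall n, Cmod (psi n) <= 1) ->
  exists B, forall X, Cmod (Csum (fun i => twist psi N (S i)) X) <= B.
Proof.
  intros Hq HN Hper Hb. exists (INR q + INR N * INR q + INR N * INR q).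
  intros X.
  assert (E : Csum (fun i => twist psi N (S i)) X =
    (Csum (cD psi) X - RtoC (INR N) * Csum (cD psi) (X / N))%C).
  { unfold twist. rewrite Csum_minus. f_equal.
    rewrite (Csum_multiples (fun n => RtoC (INR N) * psi (n / N)%nat)%C) by lia.
    rewrite <- Csum_scal. apply Csum_ext. intros j _. unfold cD. do 2 f_equal.
    rewrite Nat.mul_comm. apply Nat.div_mul. lia. }
  rewrite E.
  set (c := Csum (cD psi) q).
  assert (Hsplit : forall Y, Csum (cD psi) Y = (RtoC (INR (Y / q)) * c + Csum (cD psi) (Y mod q))%C).
  { intros Y. rewrite (Nat.div_mod Y q) at 1 by lia. rewrite Nat.mul_comm.
    apply Csum_periodic. now apply cD_periodic. }
  rewrite (Hsplit X), (Hsplit (X / N)%nat).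
  assert (Hmod : forall Y, Cmod (Csum (cD psi) (Y mod q)) <= INR q).
  { intros Y. eapply Rle_trans; [apply Csum_le_length; intros; apply Hb|].
    apply le_INR. generalize (Nat.mod_upper_bound Y q). lia. }
  assert (Hc : Cmod c <= INR q) by (apply Csum_le_length; intros; apply Hb).
  replace (RtoC (INR (X / q)) * c + Csum (cD psi) (X mod q) -
    RtoC (INR N) * (RtoC (INR (X / N / q)) * c + Csum (cD psi) ((X / N) mod q)))%C with
    (Csum (cD psi) (X mod q) + RtoC (INR (X / q) - INR N * INR (X / N / q)) * c
     - RtoC (INR N) * Csum (cD psi) ((X / N) mod q))%C
    by (rewrite RtoC_minus, RtoC_mult; ring).
  eapply Rle_trans; [apply Cmod_triangle_minus|].
  apply Rplus_le_compat; [eapply Rle_trans; [apply Cmod_triangle|]; apply Rplus_le_compat|].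
  - apply Hmod.
  - rewrite Cmod_mult, Cmod_R. apply Rmult_le_compat; auto using Rabs_pos, Cmod_ge_0.
    rewrite Nat.Div0.div_div.
    assert (H1 : (N * (X / (N * q)) <= X / q)%nat).
    { apply Nat.div_le_lower_bound; [lia|]. generalize (Nat.Div0.mul_div_le X (N * q)). nia. }
    assert (H2 : (X / q <= N * (X / (N * q)) + N)%nat).
    { generalize (Nat.div_mod X (N * q) ltac:(nia)) (Nat.mod_upper_bound X (N * q) ltac:(nia)). intros G1 G2.
      apply Nat.lt_succ_r. apply Nat.Div0.div_lt_upper_bound. nia. }
    apply le_INR in H1. apply le_INR in H2. rewrite plus_INR in H2. rewrite mult_INR in H1, H2.
    rewrite Rabs_pos_eq; lra.
  - rewrite Cmod_mult, Cmod_R, Rabs_pos_eq by apply pos_INR.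
    apply Rmult_le_compat_l; auto using pos_INR.
Qed.

Lemma twist_identity (psi : nat -> C) (N X : nat) (s : C) : (0 < N)%nat ->
  Dpart (fun i => twist psi N (S i)) (N * X) s =
  (Dpart (cD psi) (N * X) s - RtoC (INR N) * npow_opp N s * Dpart (cD psi) X s)%C.
Proof.
  intros HN. unfold Dpart, twist.
  rewrite (Csum_ext _ (fun i => cD psi i * npow_opp (S i) s -
     RtoC (dv N (S i)) * (RtoC (INR N) * psi (S i / N)%nat * npow_opp (S i) s))%C)
    by (intros; unfold cD; ring).
  rewrite Csum_minus. f_equal.
  rewrite (Csum_multiples (fun n => RtoC (INR N) * psi (n / N)%nat * npow_opp n s)%C) by lia.
  rewrite (Nat.mul_comm N X), Nat.div_mul by lia.
  rewrite <- Csum_scal. apply Csum_ext. intros j _. unfold cD.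
  rewrite npow_mult by lia. rewrite (Nat.mul_comm N (S j)), Nat.div_mul by lia. ring.
Qed.

Lemma DS_twist_bound (psi : nat -> C) (N : nat) (B : R) (s : C) : cmult psi -> (0 < N)%nat ->
  (forall X, Cmod (Csum (fun i => twist psi N (S i)) X) <= B) -> 1 < Re s ->
  Cmod (DS (cD psi) s * (1 - RtoC (INR N) * npow_opp N s)) <= B * (1 + Cmod s / Re s).
Proof.
  intros Hpsi HN HB Hs.
  set (c := (RtoC (INR N) * npow_opp N s)%C).
  replace (DS (cD psi) s * (1 - c))%C with (DS (cD psi) s * (1 - c) - 0)%C by ring.
  apply (Clim_le (fun X => Dpart (fun i => twist psi N (S i)) (N * X) s)) with (N := O).
  - intros e He. assert (Hc0 := Cmod_ge_0 c).
    destruct (DS_lim (cD psi) s (cD_bound _ Hpsi) Hs (e / (2 * (Cmod c + 1)))) as [M HM].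
    { apply Rdiv_lt_0_compat; lra. }
    exists M. intros X HX. rewrite twist_identity by auto. fold c.
    assert (H1 := HM X HX). assert (H2 := HM (N * X)%nat ltac:(nia)).
    replace (Dpart (cD psi) (N * X) s - c * Dpart (cD psi) X s - DS (cD psi) s * (1 - c))%C with
      ((Dpart (cD psi) (N * X) s - DS (cD psi) s) - c * (Dpart (cD psi) X s - DS (cD psi) s))%C by ring.
    eapply Rle_lt_trans; [apply Cmod_triangle_minus|]. rewrite Cmod_mult.
    apply Rlt_div_r in H1; [|lra]. apply Rlt_div_r in H2; [|lra].
    generalize (Cmod_ge_0 (Dpart (cD psi) X s - DS (cD psi) s)%C).
    generalize (Cmod_ge_0 (Dpart (cD psi) (N * X) s - DS (cD psi) s)%C). nra.
  - intros X _. rewrite <- (Cplus_0_r (Dpart _ _ _ - 0)).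
    replace (Dpart (fun i => twist psi N (S i)) (N * X) s - 0 + 0)%C with
      (Dpart (fun i => twist psi N (S i)) (N * X) s) by ring.
    apply Abel_bound; auto. lra.
Qed.

Lemma Cexp_neq_1 (x : R) : 0 < Rabs x <= 1 -> Cexp (Ci * RtoC x) <> 1.
Proof.
  intros Hx E.
  assert (Hs : sin x = 0).
  { assert (F := f_equal snd E). unfold Cexp, Ci, RtoC, Cmult in F. simpl in F.
    replace (0 * x - 1 * 0) with 0 in F by ring. replace (0 * 0 + 1 * x) with x in F by ring.
    rewrite exp_0 in F. lra. }
  assert (HP := PI2_3_2). unfold PI2 in HP.
  unfold Rabs in Hx. destruct (Rcase_abs x).
  - assert (0 < sin (- x)) by (apply sin_gt_0; lra). rewrite sin_neg in H. lra.
  - assert (0 < sin x) by (apply sin_gt_0; lra). lra.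
Qed.

(** The factor [1 - N ^ (1 - s)] has to be nonzero at [s = 1 + i tau]. Of two large consecutive
    integers at least one works: their ratio is so close to 1 that their powers with exponent [- i
    tau] differ. *)
Lemma twist_exists (tau : R) : tau <> 0 ->
  exists N, (0 < N)%nat /\ Cexp (Ci * RtoC (- (tau * ln (INR N)))) <> 1.
Proof.
  intros Ht. destruct (INR_unbounded (Rabs tau + 1)) as [M HM].
  assert (Hta : 0 < Rabs tau) by (now apply Rabs_pos_lt).
  assert (HM0 : (0 < M)%nat) by (apply INR_lt; simpl; lra).
  destruct (classic (Cexp (Ci * RtoC (- (tau * ln (INR M)))) <> 1)) as [H|H]; [exists M; auto|].
  apply NNPP in H. exists (S M). split; [lia|]. intros H'.
  set (x := tau * (ln (INR M) - ln (INR (S M)))).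
  apply (Cexp_neq_1 x).
  - assert (HMr : 0 < INR M) by lra.
    assert (HSr : 0 < INR (S M)) by (apply lt_0_INR; lia).
    assert (A : ln (INR M) < ln (INR (S M))) by (apply ln_increasing; auto; rewrite S_INR; lra).
    assert (Bd : ln (INR (S M)) - ln (INR M) <= / INR M).
    { rewrite <- ln_div by auto. eapply Rle_trans; [apply ln_le_minus_1, Rdiv_lt_0_compat; auto|].
      rewrite S_INR. right. field. lra. }
    unfold x. rewrite Rabs_mult, (Rabs_left (ln (INR M) - ln (INR (S M)))) by lra. split.
    + apply Rmult_lt_0_compat; lra.
    + apply Rle_trans with (Rabs tau * / INR M); [apply Rmult_le_compat_l; lra|].
      apply Rle_div_l; lra.
  - replace (Ci * RtoC x)%C with (Ci * RtoC (- (tau * ln (INR (S M)))) + - (Ci * RtoC (- (tau * ln (INR M)))))%C.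
    + assert (Q := Cexp_opp (Ci * RtoC (- (tau * ln (INR M))))). rewrite H, Cmult_1_r in Q.
      rewrite Cexp_plus, H', Q. ring.
    + replace x with (- (tau * ln (INR (S M))) - - (tau * ln (INR M))) by (unfold x; ring).
      rewrite RtoC_minus. ring.
Qed.

Lemma zeta_bound (h : R) : 0 < h <= 1 -> Cmod (DS (cD (fun _ => RtoC 1)) (RtoC (1 + h))) <= 2 / h.
Proof.
  intros Hh.
  replace (DS (cD (fun _ => RtoC 1)) (RtoC (1 + h))) with (DS (cD (fun _ => RtoC 1)) (RtoC (1 + h)) - 0)%C by ring.
  apply (Clim_le (fun N => Dpart (cD (fun _ => RtoC 1)) N (RtoC (1 + h)))) with (N := O).
  - apply DS_lim; [apply cD_bound, cmult_one|]. rewrite re_RtoC. lra.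
  - intros n _. replace (Dpart (cD (fun _ => RtoC 1)) n (RtoC (1 + h)) - 0)%C with
      (Dpart (cD (fun _ => RtoC 1)) n (RtoC (1 + h))) by ring.
    apply Rle_trans with (Rsum (fun i => pw (1 + h) (S i)) (1 + n)).
    + apply Rle_trans with (Rsum (fun i => pw (1 + h) (S i)) n).
      * apply Csum_le. intros k _. unfold cD. rewrite Cmult_1_l, Cmod_npow, re_RtoC. lra.
      * apply Rsum_mono; [lia|]. intros; apply Rlt_le, pw_pos.
    + rewrite Rsum_split. assert (B := pw_sum_bound h 1 n ltac:(lra) ltac:(lia)).
      assert (E1 : forall x, pw x 1 = 1).
      { intros x. unfold pw. simpl. rewrite ln_1, Rmult_0_r, Ropp_0. apply exp_0. }
      rewrite E1 in B. simpl (Rsum _ 1). rewrite E1.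
      assert (1 <= / h) by (rewrite <- Rinv_1; apply Rinv_le_contravar; lra).
      unfold Rdiv in *. simpl in *. lra.
Qed.

(** At distance [h] to the right of a zero [1 + i gam], the three factors of [three_four_one]
    would be [O (h ^ (- 3))], [O (h ^ 4)] and [O (1)]. The last one stays bounded because [gam <>
    0] keeps [1 + 2 i gam] away from the pole that [chi ^ 2] has when it is principal. *)
Theorem L_nonzero_line (q : nat) (chi : nat -> C) (L : C -> C) (gam : R) :
  dirichlet_character q chi -> is_dirichlet_L chi L -> gam <> 0 -> L (1, gam) <> 0.
Proof.
  intros Hc HL Hg H0.
  assert (Ha := char_cmult q chi Hc). assert (Ha2 := cmult_sq chi Ha).
  assert (Hq := dchar_modulus_pos q chi Hc).
  set (psi := fun n => (chi n * chi n)%C) in *.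
  set (tg := 2 * gam). assert (Htg : tg = 2 * gam) by reflexivity.
  destruct (twist_exists tg ltac:(lra)) as [N [HN HNe]].
  destruct (twist_partial_sums psi q N Hq HN) as [B HB].
  { intros n. unfold psi. now rewrite (dchar_periodic q chi Hc). }
  { apply (cm_bound _ Ha2). }
  assert (HB0 : 0 <= B) by (eapply Rle_trans; [apply Cmod_ge_0|apply (HB O)]).
  destruct (proj1 HL (1, gam)) as [l Hl].
  (* A zero of [L] makes [Cmod (L (1 + h + i gam)) <= (Cmod l + 1) * h] for small [h]. *)
  destruct (proj1 (CD_eps L (1, gam) l) Hl 1 Rlt_0_1) as [d1 [Hd1 HL1]].
  set (G := fun s : C => (1 - RtoC (INR N) * npow_opp N s)%C).
  assert (HNr : 0 < INR N) by (apply lt_0_INR; auto).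
  assert (G1 : G (1, tg) <> 0).
  { unfold G. rewrite npow_polar. intros E. apply HNe.
    replace (pw 1 N) with (/ INR N) in E.
    - rewrite RtoC_inv in E by lra.
      assert (RtoC (INR N) <> 0) by (intros F; apply RtoC_inj in F; lra).
      symmetry. apply Ceq_minus. rewrite <- E. field. auto.
    - unfold pw. rewrite Rmult_1_l, exp_Ropp, exp_ln; auto. }
  assert (GC : exists m, CD G (1, tg) m).
  { eexists. apply CD_minus; [apply CD_const|apply CD_scal, npow_CD]. }
  destruct GC as [m Hm].
  set (g := Cmod (G (1, tg)) / 2). assert (Hgp : 0 < g) by (apply Cmod_gt_0 in G1; unfold g; lra).
  destruct (CD_cont G (1, tg) m Hm g Hgp) as [d2 [Hd2 HG2]].
  set (A := Cmod l + 1). assert (HA : 1 <= A) by (generalize (Cmod_ge_0 l); unfold A; lra).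
  set (B' := B * (1 + (2 + 2 * Rabs gam)) / g).
  assert (HB' : 0 <= B').
  { apply Rdiv_le_0_compat; auto. apply Rmult_le_pos; auto. generalize (Rabs_pos gam); lra. }
  (* Besides both neighbourhoods, [h] has to beat the constant in [1 <= 8 * A ^ 4 * B' * h]. *)
  set (h := Rmin (Rmin (d1 / 2) (d2 / 2)) (Rmin 1 (/ (16 * A ^ 4 * (B' + 1))))).
  assert (HA4 : 0 < A ^ 4) by (apply pow_lt; lra).
  assert (HAB : 0 < 16 * A ^ 4 * (B' + 1)) by (apply Rmult_lt_0_compat; lra).
  assert (Hh : 0 < h) by (repeat apply Rmin_pos; try lra; now apply Rinv_0_lt_compat).
  assert (M1 := Rmin_l (Rmin (d1 / 2) (d2 / 2)) (Rmin 1 (/ (16 * A ^ 4 * (B' + 1))))).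
  assert (M2 := Rmin_r (Rmin (d1 / 2) (d2 / 2)) (Rmin 1 (/ (16 * A ^ 4 * (B' + 1))))). fold h in M1, M2.
  assert (M3 := Rmin_l (d1 / 2) (d2 / 2)). assert (M4 := Rmin_r (d1 / 2) (d2 / 2)).
  assert (M5 := Rmin_l 1 (/ (16 * A ^ 4 * (B' + 1)))). assert (M6 := Rmin_r 1 (/ (16 * A ^ 4 * (B' + 1)))).
  set (sg := 1 + h). assert (Hsg : sg = 1 + h) by reflexivity. clearbody sg.
  assert (Hd : forall t, Cmod ((sg, t) - (1, t)) = h).
  { intros t. replace ((sg, t) - (1, t))%C with (RtoC h).
    - rewrite Cmod_R. apply Rabs_pos_eq. lra.
    - apply injective_projections; simpl; lra. }
  assert (K := three_four_one chi sg gam Ha ltac:(lra)). fold psi tg in K.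
  assert (K1 := zeta_bound h ltac:(lra)). rewrite <- Hsg in K1.
  assert (K2 : Cmod (DS (cD chi) (sg, gam)) <= A * h).
  { rewrite <- (L_DS q chi L) by (auto; simpl; lra).
    specialize (HL1 (sg, gam) ltac:(rewrite Hd; lra)). rewrite Hd, H0 in HL1.
    replace (L (sg, gam)) with ((L (sg, gam) - 0 - l * ((sg, gam) - (1, gam))) + l * ((sg, gam) - (1, gam)))%C by ring.
    eapply Rle_trans; [apply Cmod_triangle|]. rewrite Cmod_mult, Hd. unfold A. lra. }
  assert (K3 : Cmod (DS (cD psi) (sg, tg)) <= B').
  { assert (Q := DS_twist_bound psi N B (sg, tg) Ha2 HN HB ltac:(simpl; lra)).
    fold (G (sg, tg)) in Q. rewrite Cmod_mult in Q.
    specialize (HG2 (sg, tg) ltac:(rewrite Hd; lra)).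
    assert (Hgl : g <= Cmod (G (sg, tg))).
    { generalize (Cmod_triangle_rev (G (1, tg)) (G (sg, tg))).
      rewrite Cmod_minus_sym. unfold g in *. lra. }
    unfold B'. apply Rle_div_r; auto.
    eapply Rle_trans; [|eapply Rle_trans; [exact Q|]].
    - apply Rmult_le_compat_l; [apply Cmod_ge_0|auto].
    - apply Rmult_le_compat_l; auto. apply Rplus_le_compat_l. simpl Re.
      apply Rle_div_l; [lra|].
      eapply Rle_trans; [apply Cmod_le_sum|]. rewrite Htg, (Rabs_pos_eq sg), Rabs_mult, (Rabs_pos_eq 2) by lra.
      generalize (Rabs_pos gam). nra. }
  assert (P1 := Cmod_ge_0 (DS (cD (fun _ => RtoC 1)) (RtoC sg))).
  assert (P2 := Cmod_ge_0 (DS (cD chi) (sg, gam))).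
  assert (P3 := Cmod_ge_0 (DS (cD psi) (sg, tg))).
  assert (K4 : 1 <= (2 / h) ^ 3 * (A * h) ^ 4 * B').
  { eapply Rle_trans; [exact K|]. apply Rmult_le_compat; auto.
    - apply Rmult_le_pos; apply pow_le; auto.
    - apply Rmult_le_compat; try (apply pow_le; auto); apply pow_incr; auto. }
  replace ((2 / h) ^ 3 * (A * h) ^ 4 * B') with (8 * A ^ 4 * B' * h) in K4 by (field; lra).
  assert (h * (16 * A ^ 4 * (B' + 1)) <= 1).
  { apply Rle_trans with (/ (16 * A ^ 4 * (B' + 1)) * (16 * A ^ 4 * (B' + 1))).
    - apply Rmult_le_compat_r; lra.
    - right. field. lra. }
  assert (0 <= A ^ 4 * B') by (apply Rmult_le_pos; lra).
  assert (0 < A ^ 4 * h) by (apply Rmult_lt_0_compat; lra).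
  nra.
Qed.

(** * Taylor coefficients of the logarithmic derivative as sums over prime powers *)

(** The function is its own derivative up to the factor [- ln n], so [coef_deriv] gives the
    coefficients recursively. *)
Lemma coef_npow (n k : nat) (s : C) (r : R) : 0 < r ->
  coef (fun w => npow_opp n (s + w)%C) k r =
  (npow_opp n s * RtoC ((- ln (INR n)) ^ k / INR (fact k)))%C.
Proof.
  intros Hr. set (F := fun w => npow_opp n (s + w)%C).
  assert (HF : forall w, CD F w (RtoC (- ln (INR n)) * F w)%C).
  { intros w. unfold F. apply CD_shift. rewrite RtoC_opp. apply npow_CD. }
  assert (Hh : forall R, holo F R) by (intros R w _; eexists; apply HF).
  assert (HcF : ccirc F r) by (apply (holo_ccirc F (r + 1)); [apply Hh|lra]).
  induction k as [|k IH].
  - rewrite (coef_0 F (r + 1)) by (auto; lra). unfold F. simpl.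
    replace (1 / 1) with 1 by field. rewrite Cplus_0_r. ring.
  - assert (E := coef_deriv F (fun w => RtoC (- ln (INR n)) * F w)%C k r Hr (fun w _ => HF w)
      ltac:(apply ccirc_mult; [intros z _; apply ccont_const|exact HcF])).
    rewrite coef_scal, IH in E by auto.
    assert (HS : INR (S k) <> 0) by (apply not_0_INR; lia).
    assert (HSC : RtoC (INR (S k)) <> 0) by (intros F0; apply RtoC_inj in F0; auto).
    replace (coef F (S k) r) with (/ RtoC (INR (S k)) * (RtoC (INR (S k)) * coef F (S k) r))%C by (field; auto).
    rewrite <- E. rewrite fact_simpl, mult_INR.
    assert (Hf : INR (fact k) <> 0) by apply INR_fact_neq_0.
    replace ((- ln (INR n)) ^ S k / (INR (S k) * INR (fact k))) with
      (/ INR (S k) * ((- ln (INR n)) * ((- ln (INR n)) ^ k / INR (fact k)))) by (simpl; field; auto).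
    rewrite !RtoC_mult, RtoC_inv by auto. ring.
Qed.

Definition shiftL (L : C -> C) (eta : R) (w : C) : C := L (RtoC (1 + eta) + w)%C.

(** Up to sign, the coefficient of [chi (i + 1)] in the [k]-th Taylor coefficient of [L' / L] at
    [1 + eta]. *)
Definition weight (eta : R) (k i : nat) : R :=
  Lam (S i) * (pw (1 + eta) (S i) * (ln (INR (S i)) ^ k / INR (fact k))).

(** On a circle inside the half-plane of convergence, [L' / L] is a uniform limit of Dirichlet
    polynomials, whose Taylor coefficients are explicit. *)
Lemma coef_series (q : nat) (chi : nat -> C) (L : C -> C) (eta r : R) (k : nat) :
  dirichlet_character q chi -> is_dirichlet_L chi L -> 0 < r < eta ->
  Clim (fun N => Csum (fun i => RtoC (weight eta k i) * chi (S i))%C N)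
    (RtoC ((-1) ^ S k) * coef (fun z => Der (shiftL L eta) z / shiftL L eta z)%C k r)%C.
Proof.
  intros Hc HL Hr.
  assert (Ha := char_cmult q chi Hc).
  set (s0 := RtoC (1 + eta)).
  set (f := shiftL L eta).
  assert (Hre : forall w, Cmod w < eta -> 1 < Re (s0 + w)).
  { intros w Hw. generalize (Re_shift_ge s0 w eta Hw). unfold s0. rewrite re_RtoC. lra. }
  assert (Hlog : forall w, Cmod w < eta -> (Der f w / f w)%C = (- DS (cP chi) (s0 + w))%C).
  { intros w Hw. assert (H1 := Hre w Hw).
    assert (D1 : CD f w (Der f w)).
    { apply Der_spec. destruct (proj1 HL (s0 + w)%C) as [l Hl]. exists l. now apply CD_shift. }
    assert (D2 : CD f w (DS (dlog (cD chi)) (s0 + w)%C)).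
    { apply (CD_ext_loc (fun w => DS (cD chi) (s0 + w)%C) f w _ (eta - Cmod w)); [lra| |].
      - intros v Hv. symmetry. apply (L_DS q chi L (s0 + v)%C); auto. apply Hre.
        generalize (Cmod_triangle_rev v w); lra.
      - apply CD_shift. apply DS_CD; auto; [now apply cD_bound|now apply dlog_cD_bound]. }
    rewrite (CD_unique _ _ _ _ D1 D2), DS_product by auto.
    assert (Hf : f w = DS (cD chi) (s0 + w)%C) by (apply (L_DS q chi L (s0 + w)%C); auto).
    rewrite Hf. field. rewrite DS_exp by auto. apply Cexp_neq_0. }
  intros e He.
  destruct (Tail_lim (eta - r) (e * r ^ k)) as [N [HN0 HN]]; [lra| |].
  { apply Rmult_lt_0_compat; auto. apply pow_lt; lra. }
  exists N. intros n Hn.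
  assert (E : Csum (fun i => RtoC (weight eta k i) * chi (S i))%C n =
     (RtoC ((-1) ^ k) * coef (fun w => Dpart (cP chi) n (s0 + w)%C) k r)%C).
  { unfold Dpart. rewrite (coef_Csum (fun i w => cP chi i * npow_opp (S i) (s0 + w))%C); [|lra|].
    - rewrite <- Csum_scal. apply Csum_ext. intros i _.
      rewrite coef_scal; [|lra|].
      + rewrite coef_npow by lra. unfold weight, cP.
        replace (npow_opp (S i) s0) with (RtoC (pw (1 + eta) (S i))).
        2:{ unfold npow_opp, pw, s0. rewrite <- RtoC_mult, <- RtoC_opp, Cexp_RtoC. reflexivity. }
        replace ((- ln (INR (S i))) ^ k) with ((-1) ^ k * ln (INR (S i)) ^ k)
          by (rewrite <- Rpow_mult_distr; f_equal; ring).
        assert (E1 : (-1) ^ k * (-1) ^ k = 1) by (rewrite <- Rpow_mult_distr, <- (pow1 k); f_equal; ring).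
        replace ((-1) ^ k * ln (INR (S i)) ^ k / INR (fact k)) with
          ((-1) ^ k * (ln (INR (S i)) ^ k / INR (fact k))) by (field; apply INR_fact_neq_0).
        set (X := ln (INR (S i)) ^ k / INR (fact k)).
        replace (RtoC ((-1) ^ k) * (RtoC (Lam (S i)) * chi (S i) * (RtoC (pw (1 + eta) (S i)) * RtoC ((-1) ^ k * X))))%C
          with (RtoC ((-1) ^ k * (-1) ^ k) * (RtoC (Lam (S i) * (pw (1 + eta) (S i) * X)) * chi (S i)))%C
          by (rewrite !RtoC_mult; ring).
        rewrite E1. ring.
      + apply ccirc_CD. intros w _. eexists. apply CD_shift, npow_CD.
    - intros i _. apply ccirc_CD. intros w _. eexists. apply CD_scal, CD_shift, npow_CD. }
  assert (Hcc1 : ccirc (fun w => Dpart (cP chi) n (s0 + w)%C) r).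
  { apply ccirc_CD. intros w _. eexists. apply CD_shift, Dpart_CD. }
  assert (Hcc2 : ccirc (fun z => Der f z / f z)%C r).
  { intros z Hz.
    assert (Hfz : exists l, CD f z l) by (destruct (proj1 HL (s0 + z)%C) as [l Hl]; exists l; now apply CD_shift).
    assert (HDf : forall w, CD f w (Der f w)).
    { intros w. apply Der_spec. destruct (proj1 HL (s0 + w)%C) as [l Hl]; exists l; now apply CD_shift. }
    destruct (holo_Der f (Der f) (r + 1) (fun w _ => HDf w) z ltac:(lra)) as [m Hm].
    assert (Hf0 : f z <> 0).
    { unfold f, shiftL. fold s0. rewrite (L_DS q chi L), DS_exp by (auto; apply Hre; lra). apply Cexp_neq_0. }
    apply (CD_ccont _ _ _ (CD_div _ _ z _ _ Hf0 Hm (HDf z))). }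
  rewrite E.
  replace (RtoC ((-1) ^ k) * coef (fun w => Dpart (cP chi) n (s0 + w)%C) k r -
     RtoC ((-1) ^ S k) * coef (fun z => Der f z / f z)%C k r)%C with
    (RtoC ((-1) ^ k) * (coef (fun w => Dpart (cP chi) n (s0 + w)%C) k r -
       coef (fun z => (- (1)) * (Der f z / f z))%C k r))%C.
  2:{ rewrite coef_scal by (auto; lra). replace ((-1) ^ S k) with (- (-1) ^ k) by (simpl; ring).
      rewrite RtoC_opp. ring. }
  rewrite Cmod_mult, Cmod_R.
  replace (Rabs ((-1) ^ k)) with 1 by (symmetry; apply pow_1_abs).
  rewrite Rmult_1_l. eapply Rle_lt_trans.
  - apply (coef_dist _ _ k r (Tail (eta - r) n)); [lra|auto| |].
    + apply ccirc_mult; auto. intros z _; apply ccont_const.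
    + intros w Hw. rewrite Hlog by lra. rewrite Cmod_minus_sym.
      replace (- (1) * - DS (cP chi) (s0 + w) - Dpart (cP chi) n (s0 + w))%C with
        (DS (cP chi) (s0 + w) - Dpart (cP chi) n (s0 + w))%C by ring.
      apply DS_tail; [now apply cP_bound|lra| |lia].
      rewrite re_plus. unfold s0. rewrite re_RtoC. assert (H := re_le_Cmod w).
      apply Rabs_le_between in H. lra.
  - apply Rlt_div_l; [apply pow_lt; lra|]. apply HN; auto.
Qed.

Lemma pw_1_INR (n : nat) : (0 < n)%nat -> pw 1 n = / INR n.
Proof. intros Hn. unfold pw. rewrite Rmult_1_l, exp_Ropp, exp_ln; auto. apply lt_0_INR; auto. Qed.

(** * Jensen's inequality and the contribution of a zero *)

(** After the leading 1, the term with [n = 2] has modulus at most [1 / 4], and the remaining ones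
    add up to at most [1 / 2]. *)
Lemma DS_lower (a : nat -> C) (s : C) : cmult a -> 2 <= Re s -> 1 / 4 <= Cmod (DS (cD a) s).
Proof.
  intros Ha Hs.
  assert (H : Cmod (DS (cD a) s - 1) <= 3 / 4).
  { apply (Clim_le (fun N => Dpart (cD a) N s)) with (N := 2%nat).
    - apply DS_lim; [now apply cD_bound|lra].
    - intros n Hn. replace n with (2 + (n - 2))%nat by lia. unfold Dpart. rewrite Csum_split.
      assert (Hterm : forall i, Cmod (cD a i * npow_opp (S i) s) <= pw 2 (S i)).
      { intros i. rewrite Cmod_mult, Cmod_npow. unfold cD.
        generalize (cm_bound a Ha (S i)) (Cmod_ge_0 (a (S i))) (pw_le 2 (Re s) (S i) Hs) (pw_pos (Re s) (S i)). nra. }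
      simpl (Csum _ 2). rewrite npow_1. unfold cD at 1. rewrite (cm_one a Ha).
      set (x := (cD a 1 * npow_opp 2 s)%C).
      set (y := Csum (fun i => cD a (2 + i) * npow_opp (S (2 + i)) s)%C (n - 2)).
      replace (0 + 1 * 1 + x + y - 1)%C with (x + y)%C by ring.
      eapply Rle_trans; [apply Cmod_triangle|].
      assert (E2 : pw 2 2 = 1 / 4).
      { replace (pw 2 2) with (pw 1 2 * pw 1 2) by (unfold pw; rewrite <- exp_plus; f_equal; ring).
        rewrite pw_1_INR by lia. simpl. field. }
      assert (B := pw_sum_bound 1 2 (n - 2) Rlt_0_1 ltac:(lia)). rewrite pw_1_INR in B by lia.
      replace (1 + 1) with 2 in B by ring. simpl (INR 2) in B.
      assert (T1 := Hterm 1%nat). rewrite E2 in T1.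
      assert (T2 : Cmod y <=
        Rsum (fun i => pw 2 (S (2 + i))) (n - 2)) by (apply Csum_le; intros; apply Hterm).
      fold x in T1. simpl in T2, B. lra. }
  assert (T := Cmod_triangle_minus 1 (1 - DS (cD a) s)).
  replace (1 - (1 - DS (cD a) s))%C with (DS (cD a) s) in T by ring.
  assert (T' := Cmod_triangle_rev 1 (1 - DS (cD a) s)).
  replace (1 - (1 - DS (cD a) s))%C with (DS (cD a) s) in T' by ring.
  rewrite Cmod_1, Cmod_minus_sym in T'. lra.
Qed.

(** Measures how far one Blaschke factor is from modulus 1 inside the disc. *)
Lemma blaschke_identity (R x : Rdefinitions.R) (rho : C) :
  Cmod (RtoC (R ^ 2) - Cconj rho * RtoC x) ^ 2 =
  Cmod (RtoC R * (RtoC x - rho)) ^ 2 + (R ^ 2 - x ^ 2) * (R ^ 2 - Cmod rho ^ 2).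
Proof.
  rewrite !Cmod2_alt. destruct rho as [a b].
  unfold Re, Im, RtoC, Cconj, Cminus, Cplus, Copp, Cmult; simpl. ring.
Qed.

(** The point [1 - eta] is [s = 2], and a zero at height [gamma] lies at a distance of order [sqrt
    (1 + gamma ^ 2)] from it. Relative to its denominator, the Blaschke factor therefore loses a
    proportion of order [1 / (1 + gamma ^ 2)]. *)
Lemma jensen_factor (eta : R) (rho : C) : 1 <= eta -> Cmod rho <= eta + 5 / 8 -> Re rho <= - eta ->
  Cmod (RtoC (eta + 3 / 4) * (RtoC (1 - eta) - rho)) * exp (1 / (128 * (1 + Im rho ^ 2))) <=
  Cmod (RtoC ((eta + 3 / 4) ^ 2) - Cconj rho * RtoC (1 - eta)).
Proof.
  intros He Hrho Hre.
  set (g2 := Im rho ^ 2). assert (Hg : 0 <= g2) by apply pow2_ge_0.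
  set (R := eta + 3 / 4). assert (HR : 0 < R) by (unfold R; lra).
  set (A := Cmod (RtoC R * (RtoC (1 - eta) - rho))).
  set (B := Cmod (RtoC (R ^ 2) - Cconj rho * RtoC (1 - eta))).
  assert (HA : 0 <= A) by apply Cmod_ge_0. assert (HB : 0 <= B) by apply Cmod_ge_0.
  assert (E := blaschke_identity R (1 - eta) rho). fold A B in E.
  assert (Hlow : - (eta + 5 / 8) <= Re rho).
  { assert (H := re_le_Cmod rho). apply Rabs_le_between in H. lra. }
  assert (EA : A ^ 2 = R ^ 2 * ((1 - eta - Re rho) ^ 2 + g2)).
  { unfold A. rewrite Cmod_mult, Rpow_mult_distr, Cmod_R, pow2_abs, Cmod2_alt. f_equal.
    destruct rho as [a b]. unfold g2. simpl. ring. }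
  assert (HA2 : A ^ 2 <= (49 / 16 * eta ^ 2) * (169 / 64 * (1 + g2))).
  { rewrite EA. apply Rmult_le_compat; [apply pow2_ge_0| | |].
    - generalize (pow2_ge_0 (1 - eta - Re rho)); lra.
    - unfold R. nra.
    - assert ((1 - eta - Re rho) ^ 2 <= (13 / 8) ^ 2) by (apply pow_incr; lra). lra. }
  assert (HD : 3 / 4 * eta ^ 2 <= (R ^ 2 - (1 - eta) ^ 2) * (R ^ 2 - Cmod rho ^ 2)).
  { replace (3 / 4 * eta ^ 2) with ((3 * eta) * (eta / 4)) by field.
    apply Rmult_le_compat; try lra.
    - unfold R. nra.
    - assert (Cmod rho ^ 2 <= (eta + 5 / 8) ^ 2) by (apply pow_incr; split; [apply Cmod_ge_0|auto]).
      unfold R. nra. }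
  set (y := 1 / (128 * (1 + g2))).
  assert (Hy : 0 < y <= 1 / 128).
  { unfold y. split; [apply Rdiv_lt_0_compat; lra|]. apply Rle_div_l; [lra|]. lra. }
  assert (Hy2 : y * (1 + g2) = 1 / 128) by (unfold y; field; lra).
  assert (HAD : A ^ 2 * (4 * y) <= 3 / 4 * eta ^ 2).
  { apply Rle_trans with ((49 / 16 * eta ^ 2) * (169 / 64 * (1 + g2)) * (4 * y)).
    - apply Rmult_le_compat_r; lra.
    - replace ((49 / 16 * eta ^ 2) * (169 / 64 * (1 + g2)) * (4 * y)) with
        ((49 / 16 * (169 / 64) * 4) * eta ^ 2 * (y * (1 + g2))) by ring. rewrite Hy2.
      generalize (pow2_ge_0 eta). lra. }
  assert (HAB : A ^ 2 * (1 + 4 * y) <= B ^ 2) by lra.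
  assert (Hexp : exp y * exp y <= 1 + 4 * y).
  { rewrite <- exp_plus. assert (T := exp_taylor1 (y + y) ltac:(rewrite Rabs_pos_eq; lra)). nra. }
  apply Rsqr_incr_0_var; auto. unfold Rsqr.
  assert (0 <= A ^ 2) by apply pow2_ge_0.
  replace (A * exp y * (A * exp y)) with (A ^ 2 * (exp y * exp y)) by ring.
  apply Rle_trans with (A ^ 2 * (1 + 4 * y)); [apply Rmult_le_compat_l; auto|].
  replace (B * B) with (B ^ 2) by ring. lra.
Qed.

Lemma jensen_list (eta : R) (l : list C) : 1 <= eta ->
  (forall rho, In rho l -> Cmod rho <= eta + 5 / 8 /\ Re rho <= - eta) ->
  Cmod (bnum (eta + 3 / 4) l (RtoC (1 - eta))) * exp (lsumR (fun rho => 1 / (128 * (1 + Im rho ^ 2))) l) <=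
  Cmod (bden (eta + 3 / 4) l (RtoC (1 - eta))).
Proof.
  intros He. induction l as [|rho l IH]; intros Hl.
  - simpl. rewrite exp_0, Rmult_1_r. lra.
  - assert (IH' := IH (fun r Hr => Hl r (or_intror Hr))).
    destruct (Hl rho (in_eq _ _)) as [H1 H2].
    assert (J := jensen_factor eta rho He H1 H2).
    rewrite bnum_cons, bden_cons, !(Cmod_mult _ (_ _ l _)).
    change (lsumR (fun rho => 1 / (128 * (1 + Im rho ^ 2))) (rho :: l)) with
      (1 / (128 * (1 + Im rho ^ 2)) + lsumR (fun rho => 1 / (128 * (1 + Im rho ^ 2))) l).
    rewrite exp_plus.
    match goal with |- ?a * ?b * (?c * ?d) <= _ => replace (a * b * (c * d)) with ((a * c) * (b * d)) by ring end.
    apply Rmult_le_compat; auto; apply Rmult_le_pos; try apply Cmod_ge_0; apply Rlt_le, exp_pos.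
Qed.

Lemma lsum_Re_le (F : C -> C) (G : C -> R) (c : C) (d : R) (l : list C) :
  (forall rho, In rho l -> Re (c * F rho) * d <= G rho) -> Re (c * lsum F l) * d <= lsumR G l.
Proof.
  induction l as [|rho l IH]; intros H.
  - change (lsum F nil) with (RtoC 0). rewrite Cmult_0_r. simpl. lra.
  - rewrite lsum_cons, Cmult_plus_distr_l, re_plus.
    change (lsumR G (rho :: l)) with (G rho + lsumR G l).
    generalize (H rho (in_eq _ _)) (IH (fun r Hr => H r (or_intror Hr))). lra.
Qed.

Lemma lsumR_scal (c : R) (G : C -> R) (l : list C) : lsumR (fun rho => c * G rho) l = c * lsumR G l.
Proof. unfold lsumR. induction l; simpl; [ring|]. rewrite IHl. ring. Qed.

Lemma exp_pow_nat (x : R) (n : nat) : exp x ^ n = exp (INR n * x).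
Proof.
  induction n; [simpl; rewrite Rmult_0_l, exp_0; auto|].
  rewrite S_INR. simpl. rewrite IHn, <- exp_plus. f_equal. ring.
Qed.

Lemma exp_ge_pow2 (n : nat) : 2 ^ n <= exp (INR n).
Proof.
  induction n as [|n IH]; [simpl; rewrite exp_0; lra|].
  rewrite S_INR, exp_plus. simpl. assert (H := exp_ineq1_le 1). assert (0 < 2 ^ n) by (apply pow_lt; lra). nra.
Qed.

(** Expand [ln (1 + d / eta)] to second order: as [k = eta U], the first-order term gives [- d U],
    and the second-order one at most [d ^ 2 * U / eta]. *)
Lemma ratio_pow_le (eta U d : R) (k : nat) : 0 < eta -> INR k = eta * U -> 0 <= d -> 0 <= U <= 64 * eta ->
  (eta / (eta + d)) ^ k <= exp (- (d * U) + 64 * d ^ 2).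
Proof.
  intros He Hk Hd HU.
  assert (Hq : 0 < eta / (eta + d)) by (apply Rdiv_lt_0_compat; lra).
  rewrite <- (exp_ln (eta / (eta + d))) by auto.
  rewrite exp_pow_nat. apply exp_le. rewrite Hk.
  set (x := d / eta). assert (Hx : 0 <= x) by (apply Rdiv_le_0_compat; lra).
  assert (L : ln (eta / (eta + d)) <= - x + x ^ 2).
  { replace (eta / (eta + d)) with (/ (1 + x)) by (unfold x; field; lra).
    rewrite ln_Rinv by lra. assert (H := ln_ge_1_minus_inv (1 + x) ltac:(lra)).
    assert (x - x ^ 2 <= 1 - / (1 + x)).
    { replace (1 - / (1 + x)) with (x / (1 + x)) by (field; lra). apply Rle_div_r; [lra|].
      generalize (pow2_ge_0 x). nra. }
    lra. }
  apply Rle_trans with (eta * U * (- x + x ^ 2)).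
  - apply Rmult_le_compat_l; auto. apply Rmult_le_pos; lra.
  - replace (eta * U * (- x + x ^ 2)) with (- (d * U) + d ^ 2 * (U / eta)) by (unfold x; field; lra).
    assert (U / eta <= 64) by (apply Rle_div_l; lra).
    generalize (pow2_ge_0 d). nra.
Qed.

Lemma lsumR_cons (G : C -> R) (rho : C) (l : list C) : lsumR G (rho :: l) = G rho + lsumR G l.
Proof. reflexivity. Qed.

(** The contribution of the zero [rho] in [log_deriv_coef]: from the pole of [f' / f] at [rho],
    and from the pole of the Blaschke factor at the reflected point [R ^ 2 / conj rho]. *)
Definition zero_term (R : R) (k : nat) (rho : C) : C :=
  (- / rho ^ S k + (Cconj rho / RtoC (R ^ 2)) ^ S k)%C.

(** The powers of [- eta] have the sign [(-1) ^ (k + 1)], so a zero at [s = 1] could only lower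
    the sum; the reflected point has the opposite sign but is farther away. *)
Lemma zero_term_at_1 (eta R : R) (k : nat) : 0 < eta < R ->
  Re (RtoC ((-1) ^ S k) * zero_term R k (RtoC (- eta))) <= 0.
Proof.
  intros He. unfold zero_term.
  assert (Hn : (- eta) ^ S k <> 0) by (apply pow_nonzero; lra).
  replace (Cconj (RtoC (- eta))) with (RtoC (- eta)) by (unfold Cconj, RtoC; simpl; f_equal; ring).
  rewrite <- RtoC_div by (apply pow_nonzero; lra).
  rewrite <- !RtoC_pow, <- RtoC_inv, <- RtoC_opp, <- RtoC_plus, <- RtoC_mult, re_RtoC by auto.
  assert (E1 : (- eta) ^ S k = (-1) ^ S k * eta ^ S k) by (rewrite <- Rpow_mult_distr; f_equal; ring).
  assert (E2 : (- eta / R ^ 2) ^ S k = (-1) ^ S k * (eta / R ^ 2) ^ S k)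
    by (rewrite <- Rpow_mult_distr; f_equal; field; lra).
  rewrite E1, E2. assert (E3 : (-1) ^ S k * (-1) ^ S k = 1).
  { rewrite <- Rpow_mult_distr. replace (-1 * -1) with 1 by ring. apply pow1. }
  set (c := (-1) ^ S k) in *.
  assert (Hc : c <> 0) by (intros F; rewrite F in E3; lra).
  assert (He0 : eta ^ S k <> 0) by (apply pow_nonzero; lra).
  replace (c * (- / (c * eta ^ S k) + c * (eta / R ^ 2) ^ S k)) with
    (c * c * (eta / R ^ 2) ^ S k - / eta ^ S k) by (field; auto).
  rewrite E3, <- pow_inv.
  assert ((eta / R ^ 2) ^ S k <= (/ eta) ^ S k).
  { apply pow_incr. split; [apply Rdiv_le_0_compat; [lra|apply pow_lt; lra]|].
    apply Rle_div_l; [apply pow_lt; lra|].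
    apply (Rmult_le_reg_l eta); [lra|]. replace (eta * (/ eta * R ^ 2)) with (R ^ 2) by (field; lra). nra. }
  lra.
Qed.

(** [Cmod rho ^ 2 >= (eta + d) ^ 2 * (1 + y)] with [y = gamma ^ 2 / (eta + d) ^ 2], and by
    Bernoulli's inequality the power [(1 + y) ^ (k / 2)] is at least [1 + gamma ^ 2], since [k] is
    large compared with [eta ^ 2]. *)
Lemma zero_power_bound (eta d : R) (k : nat) (rho : C) : 1 <= eta -> 0 <= d <= 1 / 2 ->
  8 * eta ^ 2 <= INR k -> Re rho <= - (eta + d) ->
  (eta / Cmod rho) ^ S k <= (eta / (eta + d)) ^ k * (1 / (1 + Im rho ^ 2)).
Proof.
  intros He Hd Hk Hre.
  set (g2 := Im rho ^ 2). assert (Hg : 0 <= g2) by apply pow2_ge_0.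
  set (b := eta / (eta + d)).
  assert (Hb : 0 < b <= 1).
  { unfold b. split; [apply Rdiv_lt_0_compat; lra|]. apply Rle_div_l; lra. }
  assert (Hrho : (eta + d) ^ 2 + g2 <= Cmod rho ^ 2).
  { rewrite Cmod2_alt. fold g2. assert ((eta + d) ^ 2 <= (- Re rho) ^ 2) by (apply pow_incr; lra).
    replace ((- Re rho) ^ 2) with (Re rho ^ 2) in H by ring. lra. }
  assert (Hr0 : 0 < Cmod rho).
  { destruct (Rle_lt_or_eq_dec 0 _ (Cmod_ge_0 rho)) as [H|H]; auto. rewrite <- H in Hrho.
    assert (0 < (eta + d) ^ 2) by (apply pow_lt; lra). lra. }
  set (y := g2 / (eta + d) ^ 2).
  assert (Hed : 0 < (eta + d) ^ 2) by (apply pow_lt; lra).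
  assert (Hy : 0 <= y) by (apply Rdiv_le_0_compat; lra).
  set (a := eta / Cmod rho). assert (Ha : 0 < a) by (apply Rdiv_lt_0_compat; lra).
  assert (Hab : a ^ 2 * (1 + y) <= b ^ 2).
  { unfold a, b, y. unfold Rdiv. rewrite !Rpow_mult_distr, !pow_inv.
    apply Rle_trans with (eta ^ 2 * / ((eta + d) ^ 2 + g2) * (1 + g2 * / (eta + d) ^ 2)).
    - apply Rmult_le_compat_r; [|apply Rmult_le_compat_l; [apply pow2_ge_0|]].
      + assert (0 <= g2 * / (eta + d) ^ 2) by (apply Rmult_le_pos; [lra|apply Rlt_le, Rinv_0_lt_compat; lra]). lra.
      + apply Rinv_le_contravar; lra.
    - right. field. lra. }
  set (j := (S k / 2)%nat).
  assert (Hj2 : (2 * j <= S k)%nat) by (unfold j; apply Nat.Div0.mul_div_le).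
  assert (Hjk : (k <= 2 * j)%nat).
  { unfold j. generalize (Nat.div_mod (S k) 2 ltac:(lia)) (Nat.mod_upper_bound (S k) 2 ltac:(lia)). lia. }
  assert (Hbern : 1 + g2 <= (1 + y) ^ j).
  { destruct (Req_dec y 0) as [Hy0|Hy0].
    - assert (g2 = 0) by (unfold y in Hy0; apply (Rmult_eq_reg_r (/ (eta + d) ^ 2)); [unfold Rdiv in Hy0; lra|apply Rinv_neq_0_compat; lra]).
      rewrite Hy0, H, !Rplus_0_r, pow1. lra.
    - apply Rle_trans with (1 + INR j * y); [|apply poly; lra].
      assert (INR k <= 2 * INR j).
      { apply le_INR in Hjk. rewrite mult_INR in Hjk. exact Hjk. }
      assert (g2 <= INR j * y); [|lra].
      assert ((eta + d) ^ 2 <= (2 * eta) ^ 2) by (apply pow_incr; lra).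
      apply (Rmult_le_reg_r ((eta + d) ^ 2)); auto. unfold y.
      replace (INR j * (g2 / (eta + d) ^ 2) * (eta + d) ^ 2) with (g2 * INR j) by (field; lra).
      apply Rmult_le_compat_l; lra. }
  apply Rle_trans with (b ^ S k * (1 / (1 + g2))).
  - assert (Hp : (a ^ S k) ^ 2 * (1 + g2) ^ 2 <= (b ^ S k) ^ 2).
    { rewrite <- !(pow_mult _ (S k) 2), !(Nat.mul_comm (S k) 2), !pow_mult.
      apply Rle_trans with ((a ^ 2) ^ S k * (1 + y) ^ S k).
      - apply Rmult_le_compat_l; [apply pow_le, pow2_ge_0|].
        apply Rle_trans with ((1 + y) ^ (2 * j)).
        + rewrite (Nat.mul_comm 2 j), pow_mult. apply pow_incr; lra.
        + apply Rle_pow; [lra|auto].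
      - rewrite <- Rpow_mult_distr. apply pow_incr. split; auto.
        apply Rmult_le_pos; [apply pow2_ge_0|lra]. }
    replace (b ^ S k * (1 / (1 + g2))) with (b ^ S k / (1 + g2)) by (field; lra).
    apply (proj1 (Rle_div_r (a ^ S k) (b ^ S k) (1 + g2) ltac:(lra))).
    apply Rsqr_incr_0_var; [|apply pow_le; lra]. unfold Rsqr. nra.
  - apply Rmult_le_compat_r; [apply Rdiv_le_0_compat; lra|].
    simpl. rewrite <- (Rmult_1_l (b ^ k)) at 2. apply Rmult_le_compat_r; [apply pow_le|]; lra.
Qed.

(** The reflected point is farther from the centre than the zero, so its power is no larger. *)
Lemma zero_term_bound (eta R d : R) (k : nat) (rho : C) : 1 <= eta -> 0 <= d <= 1 / 2 ->
  8 * eta ^ 2 <= INR k -> Cmod rho <= R -> Re rho <= - (eta + d) ->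
  Re (RtoC ((-1) ^ S k) * zero_term R k rho) * eta ^ S k <=
  2 * (eta / (eta + d)) ^ k * (1 / (1 + Im rho ^ 2)).
Proof.
  intros He Hd Hk HrR Hre.
  assert (Hr0 : 1 <= Cmod rho).
  { assert (H := re_le_Cmod rho). apply Rabs_le_between in H. lra. }
  assert (Hrho0 : rho <> 0) by (apply Cmod_gt_0; lra).
  assert (HR2 : RtoC (R ^ 2) <> 0) by (intros F; apply RtoC_inj in F; generalize (pow_lt R 2); lra).
  assert (He0 : 0 < eta ^ S k) by (apply pow_lt; lra).
  assert (P := zero_power_bound eta d k rho He Hd Hk Hre).
  apply Rle_trans with (2 * (eta / Cmod rho) ^ S k); [|lra].
  apply Rle_trans with ((/ Cmod rho ^ S k + / Cmod rho ^ S k) * eta ^ S k).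
  - apply Rmult_le_compat_r; [lra|].
    eapply Rle_trans; [apply Rle_abs|]. eapply Rle_trans; [apply re_le_Cmod|].
    rewrite Cmod_mult, Cmod_R, pow_1_abs, Rmult_1_l. unfold zero_term.
    eapply Rle_trans; [apply Cmod_triangle|].
    rewrite Cmod_opp, Cmod_inv, !Cmod_pow, Cmod_div, Cmod_conj, Cmod_R, (Rabs_pos_eq (R ^ 2))
      by (auto using pow2_ge_0; now apply Cpow_nz).
    apply Rplus_le_compat_l. rewrite <- pow_inv. apply pow_incr. split.
    + apply Rdiv_le_0_compat; [lra|apply pow_lt; lra].
    + apply Rle_div_l; [apply pow_lt; lra|].
      apply (Rmult_le_reg_l (Cmod rho)); [lra|].
      replace (Cmod rho * (/ Cmod rho * R ^ 2)) with (R ^ 2) by (field; lra). nra.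
  - right. unfold Rdiv. rewrite Rpow_mult_distr, pow_inv. ring.
Qed.

(** * The power sum over the zeros, bounded from above *)

(** Each zero contributes [O (exp (- delta U))] weighted by [1 / (1 + gamma ^ 2)], and Jensen's
    inequality at [s = 2] bounds the sum of the weights by [O (log q)]. The radii [eta + 9 / 16 <
    eta + 5 / 8 < eta + 3 / 4] all reach beyond the line [Re s = 1 / 2], so the error term, of
    order [log q * exp (- 9 / 16 * U)] up to powers of [U], is not larger than the main one. *)
Theorem power_sum_upper (q : nat) (chi : nat -> C) (L : C -> C) (U eta delta : R) (k : nat) :
  dirichlet_character q chi -> ~ principal q chi -> is_dirichlet_L chi L ->
  400 <= U <= ln (INR q) -> U ^ 2 / 64 <= INR k <= U ^ 2 / 64 + 1 -> eta = INR k / U ->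
  0 < delta <= 1 / 2 ->
  (forall sigma t, 1 - delta < sigma < 1 -> Rabs t <= 2 * ln (INR q) -> L (sigma, t) <> 0) ->
  Re (RtoC ((-1) ^ S k) * coef (fun z => Der (shiftL L eta) z / shiftL L eta z)%C k (eta / 2)) * eta ^ S k
  <= exp 40 * ln (INR q) * exp (- (delta * U)).
Proof.
  intros Hc Hnp HL HU Hk Heta Hd Hzf.
  set (Q := ln (INR q)) in *.
  assert (HkU : INR k = eta * U) by (rewrite Heta; field; lra).
  assert (He1 : U / 64 <= eta).
  { apply (Rmult_le_reg_r U); [lra|]. rewrite <- HkU. lra. }
  assert (He2 : eta <= U / 32).
  { apply (Rmult_le_reg_r U); [lra|]. rewrite <- HkU. nra. }
  assert (He : 6 <= eta) by lra.
  assert (Hk8 : 8 * eta ^ 2 <= INR k) by (rewrite HkU; nra).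
  assert (Hq0 : 0 < INR q).
  { apply Rnot_le_lt. intros N. assert (ln (INR q) = 0).
    { unfold ln. destruct (Rlt_dec 0 (INR q)); [exfalso|]; lra. } unfold Q in HU. lra. }
  assert (HqQ : Q + 1 <= INR q).
  { rewrite <- (exp_ln (INR q)) by auto. fold Q. generalize (exp_ineq1_le Q). lra. }
  set (f := shiftL L eta).
  set (R := eta + 3 / 4). set (M := 200 * INR q * (eta + 1) ^ 2).
  assert (Hent : ent f).
  { intros z. destruct (proj1 HL (RtoC (1 + eta) + z)%C) as [l Hl]. exists l. now apply CD_shift. }
  assert (Hnz : forall s, 1 < Re s -> L s <> 0).
  { intros s Hs. rewrite (L_DS q chi L s), DS_exp by (auto; now apply (char_cmult q)). apply Cexp_neq_0. }
  assert (Hf0 : 1 / 4 <= Cmod (f 0)).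
  { unfold f, shiftL. rewrite (L_DS q chi L) by (auto; rewrite re_plus, !re_RtoC; lra).
    apply DS_lower; [now apply (char_cmult q)|]. rewrite re_plus, !re_RtoC. lra. }
  assert (Hf1 : 1 / 4 <= Cmod (f (RtoC (1 - eta)))).
  { unfold f, shiftL. rewrite (L_DS q chi L) by (auto; rewrite re_plus, !re_RtoC; lra).
    apply DS_lower; [now apply (char_cmult q)|]. rewrite re_plus, !re_RtoC. lra. }
  assert (HM : forall z, Cmod z = R -> Cmod (f z) <= M).
  { intros z Hz. apply (L_growth q chi L eta z Hc Hnp HL); [lra|]. rewrite Hz. unfold R; lra. }
  assert (Hf0' : f 0 <> 0) by (apply Cmod_gt_0; lra).
  destruct (log_deriv_coef f (eta + 9 / 16) (eta + 5 / 8) R M Hent ltac:(lra) ltac:(unfold R; lra) Hf0' HM)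
    as [l [Hl [Hjen Hcoef]]].
  specialize (Hcoef k (eta / 2) ltac:(lra)).
  assert (Hnz' : forall z, Cmod z <= eta / 2 -> f z <> 0).
  { intros z Hz. apply Hnz. generalize (Re_shift_ge (RtoC (1 + eta)) z eta ltac:(lra)). rewrite re_RtoC. lra. }
  specialize (Hcoef Hnz').
  set (X := coef (fun z => Der f z / f z)%C k (eta / 2)) in *.
  change (fun rho : C => (- / rho ^ S k + (Cconj rho / RtoC (R ^ 2)) ^ S k)%C) with (zero_term R k) in Hcoef.
  assert (HlnM : forall B, 0 < B <= 2 ^ 16 -> ln (B * (INR q * (eta + 1) ^ 3)) <= 20 * Q).
  { intros B HB.
    assert (Hq3 : (eta + 1) ^ 3 <= INR q ^ 3) by (apply pow_incr; lra).
    apply Rle_trans with (ln (exp (INR 16) * exp Q ^ 4)).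
    - apply ln_le.
      + apply Rmult_lt_0_compat; [lra|]. apply Rmult_lt_0_compat; [lra|apply pow_lt; lra].
      + apply Rmult_le_compat; try lra.
        * apply Rmult_le_pos; [lra|apply pow_le; lra].
        * eapply Rle_trans; [apply HB|apply exp_ge_pow2].
        * unfold Q. rewrite exp_ln by auto. simpl in Hq3 |- *. nra.
    - rewrite exp_pow_nat, <- exp_plus, ln_exp. simpl. lra. }
  assert (Hleft : forall rho, In rho l -> Re rho <= - eta).
  { intros rho Hin. destruct (Hl rho Hin) as [_ H0]. apply Rnot_lt_le. intros N.
    apply (Hnz (RtoC (1 + eta) + rho)%C); [|exact H0]. rewrite re_plus, re_RtoC. lra. }
  assert (Hzero : forall rho, In rho l -> rho <> RtoC (- eta) -> Re rho <= - (eta + delta)).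
  { intros rho Hin Hne. destruct (Hl rho Hin) as [Hmod H0].
    assert (Hr := Hleft rho Hin). apply Rnot_lt_le. intros N.
    assert (Es : (RtoC (1 + eta) + rho)%C = (1 + eta + Re rho, Im rho)).
    { destruct rho as [a b]. unfold RtoC, Cplus; simpl. f_equal; ring. }
    unfold f, shiftL in H0. rewrite Es in H0.
    destruct (Req_dec (Re rho) (- eta)) as [E|E].
    - apply (L_nonzero_line q chi L (Im rho) Hc HL).
      + intros F. apply Hne. destruct rho as [a b]. simpl in E, F. subst. reflexivity.
      + rewrite <- H0. f_equal. rewrite E. f_equal. ring.
    - apply (Hzf (1 + eta + Re rho) (Im rho)); auto; [lra|].
      assert (Hm2 : Cmod rho ^ 2 <= (eta + 5 / 8) ^ 2) by (apply pow_incr; split; [apply Cmod_ge_0|auto]).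
      rewrite Cmod2_alt in Hm2.
      assert (eta ^ 2 <= (- Re rho) ^ 2) by (apply pow_incr; lra).
      assert (Im rho ^ 2 <= (2 * Q) ^ 2) by nra.
      rewrite <- (Rabs_pos_eq (2 * Q)) by lra. apply Rsqr_le_abs_0. unfold Rsqr. nra. }
  (* The point [1 - eta] is [s = 2], where [L] is bounded below. *)
  set (W := lsumR (fun rho => 1 / (1 + Im rho ^ 2)) l).
  assert (HW : W <= 128 * (20 * Q)).
  { assert (J := jensen_list eta l ltac:(lra) (fun rho Hin => conj (proj1 (Hl rho Hin)) (Hleft rho Hin))).
    fold R in J.
    assert (Hz1 : Cmod (RtoC (1 - eta)) = eta - 1) by (rewrite Cmod_R, Rabs_left; lra).
    specialize (Hjen (RtoC (1 - eta)) ltac:(rewrite Hz1; unfold R; lra)). rewrite Hz1 in Hjen.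
    set (bn := Cmod (bnum R l (RtoC (1 - eta)))) in *.
    set (bd := Cmod (bden R l (RtoC (1 - eta)))) in *.
    set (V := lsumR (fun rho => 1 / (128 * (1 + Im rho ^ 2))) l) in *.
    assert (Hbd : 0 < bd).
    { apply Cmod_gt_0, bden_neq; [unfold R; lra| |rewrite Hz1; unfold R; lra].
      intros rho Hin. generalize (proj1 (Hl rho Hin)). unfold R; lra. }
    assert (HbV : 1 / 4 * bd <= 4 * M * R / 4 * bn).
    { apply Rle_trans with (Cmod (f (RtoC (1 - eta))) * bd); [apply Rmult_le_compat_r; lra|].
      eapply Rle_trans; [exact Hjen|]. apply Rmult_le_compat_r; [apply Cmod_ge_0|].
      replace (4 * M * R / 4) with (M * R) by field. apply Rmult_le_compat_l.
      - unfold M. apply Rmult_le_pos; [lra|apply pow2_ge_0].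
      - apply Rle_div_l; unfold R; lra. }
    assert (HexpV : exp V <= 4 * M * R).
    { apply (Rmult_le_reg_r bd); auto.
      apply Rle_trans with (exp V * (4 * M * R * bn)); [apply Rmult_le_compat_l; [apply Rlt_le, exp_pos|lra]|].
      replace (exp V * (4 * M * R * bn)) with (4 * M * R * (bn * exp V)) by ring.
      apply Rmult_le_compat_l; auto. unfold M, R. apply Rmult_le_pos; [|lra].
      apply Rmult_le_pos; [lra|]. apply Rmult_le_pos; [lra|apply pow2_ge_0]. }
    assert (HV : V <= 20 * Q).
    { rewrite <- (ln_exp V). eapply Rle_trans; [apply ln_le; [apply exp_pos|exact HexpV]|].
      eapply Rle_trans; [|apply (HlnM 800); simpl; lra]. apply ln_le.
      - unfold M, R. apply Rmult_lt_0_compat; [|lra]. apply Rmult_lt_0_compat; [lra|].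
        apply Rmult_lt_0_compat; [lra|apply pow_lt; lra].
      - unfold M, R. replace (800 * (INR q * (eta + 1) ^ 3)) with (4 * (200 * INR q * (eta + 1) ^ 2) * (eta + 1)) by ring.
        apply Rmult_le_compat_l; [|lra]. apply Rmult_le_pos; [lra|].
        apply Rmult_le_pos; [lra|apply pow2_ge_0]. }
    assert (EW : W = 128 * V).
    { unfold W, V. clear. induction l as [|rho l IH]; [unfold lsumR; simpl; ring|].
      rewrite !lsumR_cons, IH. field. generalize (pow2_ge_0 (Im rho)); lra. }
    lra. }
  assert (Hzsum : Re (RtoC ((-1) ^ S k) * lsum (zero_term R k) l) * eta ^ S k <=
     2 * (eta / (eta + delta)) ^ k * W).
  { unfold W. rewrite <- lsumR_scal. apply lsum_Re_le. intros rho Hin.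
    assert (Hpos : 0 <= 2 * (eta / (eta + delta)) ^ k * (1 / (1 + Im rho ^ 2))).
    { apply Rmult_le_pos; [apply Rmult_le_pos; [lra|]|].
      - apply pow_le, Rdiv_le_0_compat; lra.
      - apply Rdiv_le_0_compat; [lra|]. generalize (pow2_ge_0 (Im rho)); lra. }
    destruct (Ceq_dec rho (RtoC (- eta))) as [->|Hne].
    - assert (H := zero_term_at_1 eta R k ltac:(unfold R; lra)).
      assert (0 < eta ^ S k) by (apply pow_lt; lra). nra.
    - apply zero_term_bound; auto; try lra.
      generalize (proj1 (Hl rho Hin)); unfold R; lra. }
  assert (Hb1 : (eta / (eta + delta)) ^ k <= exp (16 - delta * U)).
  { eapply Rle_trans; [apply (ratio_pow_le eta U); auto; lra|]. apply exp_le.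
    assert (delta ^ 2 <= (1 / 2) ^ 2) by (apply pow_incr; lra). lra. }
  set (A := ln (M * (R / (R - (eta + 9 / 16))) / Cmod (f 0))) in *.
  assert (HA : A <= 20 * Q).
  { unfold A. eapply Rle_trans; [|apply (HlnM 4800); simpl; lra].
    assert (HRd : R / (R - (eta + 9 / 16)) = 16 / 3 * R) by (unfold R; field; lra).
    assert (HMR : 0 < M * (16 / 3 * R)).
    { unfold M, R. apply Rmult_lt_0_compat; [|lra]. apply Rmult_lt_0_compat; [lra|apply pow_lt; lra]. }
    rewrite HRd. apply ln_le; [apply Rdiv_lt_0_compat; lra|].
    apply Rle_div_l; [lra|].
    apply Rle_trans with (4800 * (INR q * (eta + 1) ^ 3) * (1 / 4)).
    - unfold M, R. replace (4800 * (INR q * (eta + 1) ^ 3) * (1 / 4)) with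
        (200 * INR q * (eta + 1) ^ 2 * (6 * (eta + 1))) by field.
      apply Rmult_le_compat_l; [|lra]. apply Rmult_le_pos; [lra|apply pow2_ge_0].
    - apply Rmult_le_compat_l; [|lra]. apply Rmult_le_pos; [lra|]. apply Rmult_le_pos; [lra|apply pow_le; lra]. }
  assert (Hb2 : (eta / (eta + 9 / 16)) ^ k <= exp (21 - 9 / 16 * U)).
  { eapply Rle_trans; [apply (ratio_pow_le eta U); auto; lra|]. apply exp_le. lra. }
  assert (HE : INR (S k) * (2 * A / (eta + 9 / 16) ^ S k) * eta ^ S k <= 32 * 40 * Q * exp (21 - delta * U)).
  { set (b := eta / (eta + 9 / 16)) in *.
    replace (INR (S k) * (2 * A / (eta + 9 / 16) ^ S k) * eta ^ S k) with (INR (S k) * (2 * A) * b ^ S k).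
    2:{ unfold b, Rdiv. rewrite Rpow_mult_distr, pow_inv. ring. }
    assert (Hbb : 0 < b <= 1).
    { unfold b. split; [apply Rdiv_lt_0_compat; lra|]. apply Rle_div_l; lra. }
    assert (Hbk : b ^ S k <= exp (21 - 9 / 16 * U)).
    { eapply Rle_trans; [|exact Hb2]. simpl. assert (0 <= b ^ k) by (apply pow_le; lra). nra. }
    assert (HkU2 : INR (S k) <= U ^ 2 / 32) by (rewrite S_INR; nra).
    (* The margin between [9 / 16] and [delta <= 1 / 2] absorbs the factor [k + 1]. *)
    assert (HUe : U ^ 2 / 32 <= 32 * exp (U / 16)).
    { assert (H := exp_ineq1_le (U / 32)).
      replace (exp (U / 16)) with (exp (U / 32) * exp (U / 32)) by (rewrite <- exp_plus; f_equal; field).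
      assert (U / 32 * (U / 32) <= exp (U / 32) * exp (U / 32)) by (apply Rmult_le_compat; lra). nra. }
    assert (Hbk0 : 0 <= b ^ S k) by (apply pow_le; lra).
    apply Rle_trans with (32 * exp (U / 16) * (2 * (20 * Q)) * exp (21 - 9 / 16 * U)).
    - apply Rle_trans with (INR (S k) * (2 * (20 * Q)) * b ^ S k).
      + apply Rmult_le_compat_r; auto. apply Rmult_le_compat_l; [apply pos_INR|lra].
      + apply Rmult_le_compat; auto.
        * apply Rmult_le_pos; [apply pos_INR|lra].
        * apply Rmult_le_compat_r; lra.
    - replace (32 * exp (U / 16) * (2 * (20 * Q)) * exp (21 - 9 / 16 * U)) with
        (32 * 40 * Q * (exp (U / 16) * exp (21 - 9 / 16 * U))) by ring.
      apply Rmult_le_compat_l; [lra|]. rewrite <- exp_plus. apply exp_le. nra. }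
  assert (Hfin : Re (RtoC ((-1) ^ S k) * X) * eta ^ S k <=
     2 * exp (16 - delta * U) * (128 * (20 * Q)) + 32 * 40 * Q * exp (21 - delta * U)).
  { replace X with (lsum (zero_term R k) l + (X - lsum (zero_term R k) l))%C by ring.
    rewrite Cmult_plus_distr_l, re_plus, Rmult_plus_distr_r. apply Rplus_le_compat.
    - eapply Rle_trans; [exact Hzsum|].
      assert (0 <= W).
      { unfold W. clear. induction l as [|rho l IH]; [unfold lsumR; simpl; lra|].
        rewrite lsumR_cons.
        assert (0 <= 1 / (1 + Im rho ^ 2)); [|lra].
        apply Rdiv_le_0_compat; [lra|]. generalize (pow2_ge_0 (Im rho)); lra. }
      assert (0 <= (eta / (eta + delta)) ^ k) by (apply pow_le, Rdiv_le_0_compat; lra).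
      apply Rmult_le_compat; lra.
    - eapply Rle_trans; [|exact HE]. apply Rmult_le_compat_r; [apply pow_le; lra|].
      eapply Rle_trans; [|exact Hcoef].
      eapply Rle_trans; [apply Rle_abs|]. eapply Rle_trans; [apply re_le_Cmod|].
      rewrite Cmod_mult, Cmod_R, pow_1_abs. lra. }
  eapply Rle_trans; [exact Hfin|].
  assert (E1 : exp (16 - delta * U) <= exp 21 * exp (- (delta * U))) by (rewrite <- exp_plus; apply exp_le; lra).
  assert (E2 : exp (21 - delta * U) = exp 21 * exp (- (delta * U))) by (rewrite <- exp_plus; f_equal; ring).
  rewrite E2. set (Y := exp (- (delta * U))) in *. assert (0 < Y) by apply exp_pos.
  assert (E3 : 6400 * exp 21 <= exp 40).
  { replace (exp 40) with (exp (INR 19) * exp 21) by (rewrite <- exp_plus; f_equal; simpl; ring).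
    apply Rmult_le_compat_r; [apply Rlt_le, exp_pos|].
    eapply Rle_trans; [|apply exp_ge_pow2]. simpl. lra. }
  apply Rle_trans with (6400 * exp 21 * Q * Y).
  - assert (0 < exp 21) by apply exp_pos.
    assert (2 * exp (16 - delta * U) * (128 * (20 * Q)) <= 2 * (exp 21 * Y) * (128 * (20 * Q))).
    { apply Rmult_le_compat_r; lra. }
    assert (0 <= exp 21 * Q * Y) by (apply Rmult_le_pos; [apply Rmult_le_pos|]; lra). lra.
  - apply Rmult_le_compat_r; [lra|]. apply Rmult_le_compat_r; lra.
Qed.

(** * The power sum over the primes, bounded from below *)

(** Nonpositive, with a double zero at 1. *)
Definition log_gap (x : R) : R := ln x - x + 1.

(** With [u = ln m] and [log_gap] written out, this is [(u / U) ^ k * exp (k - k u / U) / m]: the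
    weight of [m] without [Lam m], normalised to its peak. *)
Definition bump (k : nat) (U : R) (m : nat) : R := exp (INR k * log_gap (ln (INR m) / U)) / INR m.

Lemma bump_nonneg (k : nat) (U : R) (m : nat) : 0 <= bump k U m.
Proof.
  unfold bump. destruct m as [|m].
  - simpl. unfold Rdiv. rewrite Rinv_0. lra.
  - apply Rlt_le, Rdiv_lt_0_compat; [apply exp_pos|apply lt_0_INR; lia].
Qed.

(** The height of the peak: [u ^ k * exp (- eta u) / k!] at [u = U], where [eta U = k]. *)
Definition amp (k : nat) (U : R) : R := U ^ k * exp (- INR k) / INR (fact k).

Lemma weight_bump (k : nat) (U eta : R) (i : nat) : 0 < U -> eta = INR k / U ->
  weight eta k i = amp k U * (Lam (S i) * bump k U (S i)).
Proof.
  intros HU Heta. unfold weight, amp, bump.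
  destruct i as [|i]; [rewrite Lam_1; ring|].
  set (m := S (S i)).
  assert (Hm : 0 < INR m) by (apply lt_0_INR; unfold m; lia).
  assert (Hu : 0 < ln (INR m)).
  { rewrite <- ln_1. apply ln_increasing; [lra|]. apply (lt_INR 1). unfold m; lia. }
  set (u := ln (INR m)) in *.
  assert (E1 : pw (1 + eta) m = exp (- (eta * u)) / INR m).
  { unfold pw. fold u. replace (- ((1 + eta) * u)) with (- (eta * u) + - u) by ring.
    rewrite exp_plus, (exp_Ropp u). unfold u. rewrite exp_ln; auto. }
  assert (E2 : exp (INR k * log_gap (u / U)) * (U ^ k * exp (- INR k)) = u ^ k * exp (- (eta * u))).
  { rewrite <- (exp_ln U) at 2 by auto. rewrite <- (exp_ln u) at 2 by auto.
    rewrite !exp_pow_nat, <- !exp_plus. f_equal. unfold log_gap. rewrite ln_div by auto.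
    rewrite Heta. field. lra. }
  rewrite E1. assert (Hf := INR_fact_neq_0 k).
  replace (U ^ k * exp (- INR k) / INR (fact k) * (Lam m * (exp (INR k * log_gap (u / U)) / INR m))) with
    (Lam m * (exp (INR k * log_gap (u / U)) * (U ^ k * exp (- INR k))) / INR m / INR (fact k))
    by (field; split; lra).
  rewrite E2. field. split; lra.
Qed.

(** The error is of third order at 1, which is the precision that one step of Stirling's formula
    requires. *)
Lemma ln_ge_pade (y : R) : 1 <= y -> 2 * (y - 1) / (y + 1) <= ln y.
Proof.
  intros Hy. set (h := fun t => ln t - 2 * (t - 1) / (t + 1)).
  destruct (MVT_gen h 1 y (fun t => (t - 1) ^ 2 / (t * (t + 1) ^ 2))) as [c [Hc E]].
  - intros x Hx. rewrite Rmin_left, Rmax_right in Hx by auto. unfold h. auto_derive; [lra|].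
    field. lra.
  - intros x Hx. rewrite Rmin_left, Rmax_right in Hx by auto.
    apply continuity_pt_filterlim. apply (@ex_derive_continuous R_AbsRing R_NormedModule).
    unfold h. auto_derive. lra.
  - rewrite Rmin_left, Rmax_right in Hc by auto. unfold h in E. rewrite ln_1 in E.
    assert (0 <= (c - 1) ^ 2 / (c * (c + 1) ^ 2)).
    { apply Rdiv_le_0_compat; [apply pow2_ge_0|]. apply Rmult_lt_0_compat; [lra|apply pow_lt; lra]. }
    replace (0 - 2 * (1 - 1) / (1 + 1)) with 0 in E by field. nra.
Qed.

Lemma stirling_upper (k : nat) : (0 < k)%nat ->
  ln (INR (fact k)) <= 1 + / 2 * ln (INR k) + INR k * ln (INR k) - INR k.
Proof.
  induction k as [|k IH]; [lia|]. intros _.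
  destruct (Nat.eq_dec k 0) as [->|Hk].
  { simpl. rewrite ln_1. lra. }
  specialize (IH ltac:(lia)).
  assert (HK : 0 < INR k) by (apply lt_0_INR; lia).
  rewrite fact_simpl, mult_INR, ln_mult by (try apply INR_fact_lt_0; apply lt_0_INR; lia).
  rewrite S_INR. set (x := INR k) in *.
  assert (P := ln_ge_pade ((x + 1) / x)).
  assert (H1 : 1 <= (x + 1) / x).
  { apply (Rmult_le_reg_r x); auto. replace ((x + 1) / x * x) with (x + 1) by (field; lra). lra. }
  specialize (P H1). rewrite ln_div in P by lra.
  replace (2 * ((x + 1) / x - 1) / ((x + 1) / x + 1)) with (2 / (2 * x + 1)) in P by (field; lra).
  assert (1 <= (x + / 2) * (ln (x + 1) - ln x)).
  { apply Rle_trans with ((x + / 2) * (2 / (2 * x + 1))); [right; field; lra|].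
    apply Rmult_le_compat_l; lra. }
  lra.
Qed.

(** By Stirling's formula the left-hand product is at least [sqrt k / (exp 1 * U)], and [k] is of
    the order of [U ^ 2]. *)
Lemma amp_lower (k : nat) (U eta : R) : 0 < U -> (0 < k)%nat -> eta = INR k / U -> U ^ 2 / 64 <= INR k ->
  / 24 <= amp k U * eta ^ S k.
Proof.
  intros HU Hk Heta HkU.
  assert (HK : 0 < INR k) by (now apply lt_0_INR).
  assert (Hf : 0 < INR (fact k)) by apply INR_fact_lt_0.
  assert (E : amp k U * eta ^ S k = (INR k ^ k * exp (- INR k) / INR (fact k)) * (INR k / U)).
  { unfold amp. rewrite Heta. simpl pow at 2. unfold Rdiv. rewrite !Rpow_mult_distr, !pow_inv. field.
    repeat split; try lra. apply pow_nonzero; lra. }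
  rewrite E.
  assert (St := stirling_upper k Hk).
  assert (S1 : exp (- (1 + / 2 * ln (INR k))) <= INR k ^ k * exp (- INR k) / INR (fact k)).
  { apply (Rmult_le_reg_r (INR (fact k))); auto.
    replace (INR k ^ k * exp (- INR k) / INR (fact k) * INR (fact k)) with (INR k ^ k * exp (- INR k)) by (field; lra).
    rewrite <- (exp_ln (INR (fact k))) by auto.
    rewrite <- (exp_ln (INR k)) at 2 by auto. rewrite exp_pow_nat, <- !exp_plus. apply exp_le. lra. }
  assert (Hs : sqrt (INR k) * sqrt (INR k) = INR k) by (apply sqrt_sqrt; lra).
  assert (Hs0 : 0 < sqrt (INR k)) by (now apply sqrt_lt_R0).
  assert (HsU : U / 8 <= sqrt (INR k)).
  { apply Rsqr_incr_0_var; [|lra]. unfold Rsqr. lra. }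
  assert (E2 : exp (- (1 + / 2 * ln (INR k))) = / (exp 1 * sqrt (INR k))).
  { rewrite exp_Ropp, exp_plus. do 2 f_equal.
    rewrite <- (exp_ln (sqrt (INR k))) by auto. f_equal.
    rewrite <- Hs at 1. rewrite ln_mult by auto. field. }
  rewrite E2 in S1.
  assert (He := exp_le_3). assert (He0 := exp_pos 1).
  apply Rle_trans with (/ (exp 1 * sqrt (INR k)) * (INR k / U)).
  - rewrite <- Hs at 2.
    replace (/ (exp 1 * sqrt (INR k)) * (sqrt (INR k) * sqrt (INR k) / U)) with (sqrt (INR k) / (exp 1 * U)) by (field; lra).
    apply (Rmult_le_reg_r (exp 1 * U)); [nra|].
    replace (sqrt (INR k) / (exp 1 * U) * (exp 1 * U)) with (sqrt (INR k)) by (field; lra). nra.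
  - apply Rmult_le_compat_r; auto. apply Rdiv_le_0_compat; lra.
Qed.

Lemma log_gap_window (x : R) : 1 / 2 <= x <= 1 -> - 2 * (1 - x) ^ 2 <= log_gap x.
Proof.
  intros Hx. unfold log_gap. assert (H := ln_ge_1_minus_inv x ltac:(lra)).
  assert (E : 1 - / x - x + 1 = - ((1 - x) ^ 2 * / x)) by (field; lra).
  assert (/ x <= 2) by (replace 2 with (/ (1 / 2)) by field; apply Rinv_le_contravar; lra).
  generalize (pow2_ge_0 (1 - x)). nra.
Qed.

Lemma ln_1_plus_upper (y : R) : 0 <= y <= 1 -> ln (1 + y) <= y - y ^ 2 / 6.
Proof.
  intros Hy.
  replace (1 + y) with ((1 + y / 2) * ((1 + y) / (1 + y / 2))) by (field; lra).
  rewrite ln_mult; [|lra|apply Rdiv_lt_0_compat; lra].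
  assert (H1 := ln_le_minus_1 (1 + y / 2) ltac:(lra)).
  assert (H2 := ln_le_minus_1 ((1 + y) / (1 + y / 2)) ltac:(apply Rdiv_lt_0_compat; lra)).
  replace ((1 + y) / (1 + y / 2) - 1) with (y / 2 - y ^ 2 / (4 + 2 * y)) in H2 by (field; lra).
  assert (y ^ 2 / 6 <= y ^ 2 / (4 + 2 * y)).
  { apply Rmult_le_compat_l; [apply pow2_ge_0|]. apply Rinv_le_contravar; lra. }
  lra.
Qed.

(** Meant for prime powers that share a factor with the modulus: there are so few that this crude
    bound makes them negligible. *)
Lemma bump_uniform (k : nat) (U : R) (m : nat) : 0 < U -> (2 <= m)%nat -> U ^ 2 / 64 <= INR k ->
  bump k U m <= exp (64 - U).
Proof.
  intros HU Hm Hk.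
  assert (HK : 0 < INR k) by (assert (0 < U ^ 2) by (apply pow_lt; auto); lra).
  assert (Hm0 : 0 < INR m) by (apply lt_0_INR; lia).
  assert (Hu : 0 < ln (INR m)).
  { rewrite <- ln_1. apply ln_increasing; [lra|]. apply (lt_INR 1). lia. }
  unfold bump. rewrite <- (exp_ln (INR m)) at 2 by auto. set (u := ln (INR m)) in *.
  unfold Rdiv at 1. rewrite <- exp_Ropp, <- exp_plus. apply exp_le.
  unfold log_gap. set (x := U / INR k). assert (Hx : 0 < x) by (apply Rdiv_lt_0_compat; auto).
  assert (H1 := ln_le_minus_1 (u / U * (1 + x)) ltac:(apply Rmult_lt_0_compat; [apply Rdiv_lt_0_compat; lra|lra])).
  rewrite ln_mult in H1 by (try apply Rdiv_lt_0_compat; lra).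
  assert (H2 := ln_ge_1_minus_inv (1 + x) ltac:(lra)).
  assert (H3 : x - x ^ 2 <= 1 - / (1 + x)).
  { replace (1 - / (1 + x)) with (x / (1 + x)) by (field; lra).
    apply (Rmult_le_reg_r (1 + x)); [lra|]. replace (x / (1 + x) * (1 + x)) with x by (field; lra).
    assert (0 <= x * x * x) by (apply Rmult_le_pos; [nra|lra]). nra. }
  assert (Ek : INR k * x = U) by (unfold x; field; lra).
  assert (Ek2 : INR k * x ^ 2 <= 64).
  { replace (INR k * x ^ 2) with (U ^ 2 / INR k) by (unfold x; field; lra).
    apply (Rmult_le_reg_r (INR k)); auto. replace (U ^ 2 / INR k * INR k) with (U ^ 2) by (field; lra). lra. }
  assert (Eu : INR k * (u / U * x) = u) by (unfold x; field; lra).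
  assert (INR k * ln (u / U) <= INR k * (u / U * (1 + x) - 1 - (x - x ^ 2))) by (apply Rmult_le_compat_l; lra).
  nra.
Qed.

(** As [k] is about [(U / 8) ^ 2], the peak has a width of about 8 in [ln m]. *)
Lemma bump_window (k : nat) (U : R) (m : nat) : 64 <= U -> INR k <= U ^ 2 / 64 + 1 ->
  U - 7 <= ln (INR m) <= U -> exp (- 2) / INR m <= bump k U m.
Proof.
  intros HU Hk Hm.
  assert (Hm0 : 0 < INR m).
  { apply Rnot_le_lt. intros N. assert (ln (INR m) = 0) by (unfold ln; destruct (Rlt_dec 0 (INR m)); [exfalso|]; lra). lra. }
  unfold bump. apply Rmult_le_compat_r; [apply Rlt_le, Rinv_0_lt_compat; auto|]. apply exp_le.
  set (u := ln (INR m)) in *. set (x := u / U).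
  assert (Ex : x * U = u) by (unfold x; field; lra).
  assert (Hx : 1 / 2 <= x <= 1).
  { split; apply (Rmult_le_reg_r U); lra. }
  assert (T := log_gap_window x Hx).
  assert (E1 : (1 - x) ^ 2 <= (7 / U) ^ 2).
  { apply pow_incr. split; [lra|]. apply (Rmult_le_reg_r U); [lra|].
    replace (7 / U * U) with 7 by (field; lra). nra. }
  assert (E2 : INR k * (7 / U) ^ 2 <= 1).
  { apply Rle_trans with ((U ^ 2 / 64 + 1) * (7 / U) ^ 2); [apply Rmult_le_compat_r; [apply pow2_ge_0|auto]|].
    apply (Rmult_le_reg_r (U ^ 2)); [apply pow_lt; lra|].
    replace ((U ^ 2 / 64 + 1) * (7 / U) ^ 2 * U ^ 2) with ((U ^ 2 / 64 + 1) * 49) by (field; lra). nra. }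
  assert (HK := pos_INR k). nra.
Qed.

(** The integer [n] lies 128 units beyond the peak, sixteen widths. There [k * log_gap] is already
    below [- 42], and from there on its slope in [ln m] is at most [- 1], which supplies the
    factor [n / m]. *)
Lemma bump_tail (k : nat) (U : R) (n j : nat) : 128 <= U -> U ^ 2 / 64 <= INR k -> (0 < n)%nat ->
  ln (INR n) = U + 128 -> bump k U (n + j) <= exp (- 42) * (INR n / INR (n + j) ^ 2).
Proof.
  intros HU Hk Hn Hl. set (l := ln (INR n)) in *.
  assert (Hn0 : 0 < INR n) by (now apply lt_0_INR).
  assert (Hm0 : 0 < INR (n + j)) by (apply lt_0_INR; lia).
  set (u := ln (INR (n + j))).
  assert (Hul : l <= u) by (apply ln_le; [auto|apply le_INR; lia]).
  assert (HK : 0 < INR k) by (assert (0 < U ^ 2) by (apply pow_lt; lra); lra).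
  assert (Key : INR k * log_gap (u / U) <= - 42 - (u - l)).
  { assert (E1 : ln (u / U) = ln (u / l) + ln (1 + 128 / U)).
    { rewrite <- ln_mult; [f_equal; field_simplify_eq; [|lra]; nra | |].
      - apply Rdiv_lt_0_compat; lra.
      - assert (0 < 128 / U) by (apply Rdiv_lt_0_compat; lra). lra. }
    assert (H1 := ln_le_minus_1 (u / l) ltac:(apply Rdiv_lt_0_compat; lra)).
    assert (Hy : 0 <= 128 / U <= 1).
    { split; [apply Rdiv_le_0_compat; lra|]. apply (Rmult_le_reg_r U); [lra|].
      replace (128 / U * U) with 128 by (field; lra). lra. }
    assert (H2 := ln_1_plus_upper (128 / U) Hy).
    unfold log_gap. rewrite E1.
    assert (S1 : ln (u / l) + ln (1 + 128 / U) - u / U + 1 <=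
      - ((128 / U) ^ 2 / 6) - (u - l) * (128 / (l * U))).
    { replace (- ((128 / U) ^ 2 / 6) - (u - l) * (128 / (l * U))) with
        ((u / l - 1) + (128 / U - (128 / U) ^ 2 / 6) - u / U + 1); [lra|].
      rewrite Hl. field. lra. }
    apply Rle_trans with (INR k * (- ((128 / U) ^ 2 / 6) - (u - l) * (128 / (l * U)))); [apply Rmult_le_compat_l; lra|].
    assert (S2 : 42 <= INR k * ((128 / U) ^ 2 / 6)).
    { apply Rle_trans with (U ^ 2 / 64 * ((128 / U) ^ 2 / 6)).
      - replace (U ^ 2 / 64 * ((128 / U) ^ 2 / 6)) with (256 / 6) by (field; lra). lra.
      - apply Rmult_le_compat_r; auto. apply Rdiv_le_0_compat; [apply pow2_ge_0|lra]. }
    assert (S3 : 1 <= INR k * (128 / (l * U))).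
    { assert (HlU : 0 < l * U) by (rewrite Hl; nra).
      apply (Rmult_le_reg_r (l * U)); auto.
      replace (INR k * (128 / (l * U)) * (l * U)) with (128 * INR k) by (field; rewrite Hl; lra).
      rewrite Hl. nra. }
    assert (0 <= u - l) by lra. nra. }
  unfold bump. fold u.
  apply Rle_trans with (exp (- 42 - (u - l)) / INR (n + j)).
  - apply Rmult_le_compat_r; [apply Rlt_le, Rinv_0_lt_compat; auto|]. now apply exp_le.
  - right. replace (- 42 - (u - l)) with (- 42 + (l + - u)) by ring.
    rewrite !exp_plus, exp_Ropp. unfold u, l. rewrite !exp_ln by auto. field. lra.
Qed.

Lemma Mert_shift (N : nat) : Mert N = Rsum (fun i => Lam (S i) / INR (S i)) N.
Proof.
  unfold Mert. change (S N) with (1 + N)%nat. rewrite Rsum_split. simpl (Rsum _ 1).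
  rewrite Lam_0. unfold Rdiv. rewrite Rmult_0_l, !Rplus_0_l. reflexivity.
Qed.

Definition shares_factor (q m : nat) : R := if Nat.eqb (Nat.gcd m q) 1 then 0 else 1.

(** A prime power below [2 ^ A] that shares a factor with [q] divides [q ^ A], and over the
    divisors of [q ^ A] the sum of [Lam] is [ln (q ^ A)]. *)
Lemma shared_prime_powers_sum (q n A : nat) : (0 < q)%nat -> (n <= 2 ^ A)%nat ->
  Rsum (fun d => shares_factor q d * Lam d) n <= INR A * ln (INR q).
Proof.
  intros Hq Hn.
  assert (HqA : (0 < q ^ A)%nat) by (assert (q ^ A <> 0)%nat by (apply Nat.pow_nonzero; lia); lia).
  apply Rle_trans with (Rsum (fun d => dv d (q ^ A) * Lam d) (n + q ^ A + 1)).
  - apply Rle_trans with (Rsum (fun d => dv d (q ^ A) * Lam d) n).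
    + apply Rsum_le. intros d Hd. unfold shares_factor.
      assert (HL := Lam_nonneg d).
      assert (Hdv : 0 <= dv d (q ^ A)) by (unfold dv; destruct (_ =? _)%nat; lra).
      destruct (Nat.eqb_spec (Nat.gcd d q) 1) as [E|E]; [nra|].
      destruct (classic (exists p, prime_power_of d p)) as [[p [Hp [j [Hj Ed]]]]|N].
      2:{ rewrite (Lam_not_pp d N). lra. }
      assert (Hd0 : (0 < d)%nat) by (rewrite Ed; now apply pow_pos_nat).
      rewrite dv_1; [lra|lia|].
      assert (Hpq : Nat.divide p q).
      { apply NNPP. intros F. apply E. rewrite Ed. clear - Hp F.
        assert (G : Nat.gcd p q = 1%nat) by (now apply nprime_gcd).
        induction j; [apply Nat.divide_1_r; simpl (p ^ 0)%nat; apply Nat.gcd_divide_l|rewrite Nat.pow_succ_r'].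
        apply Nat.divide_1_r. rewrite <- G. apply Nat.gcd_greatest; [|apply Nat.gcd_divide_r].
        apply (Nat.gauss _ (p ^ j)%nat).
        - rewrite Nat.mul_comm. apply Nat.gcd_divide_l.
        - apply Nat.divide_1_r. rewrite <- IHj.
          apply Nat.gcd_greatest; [apply Nat.gcd_divide_r|].
          eapply Nat.divide_trans; [apply Nat.gcd_divide_l|apply Nat.gcd_divide_r]. }
      assert (HjA : (j <= A)%nat).
      { destruct (le_lt_dec j A); auto. exfalso.
        assert (2 ^ A <= 2 ^ j)%nat by (apply Nat.pow_le_mono_r; lia).
        assert (2 ^ j <= p ^ j)%nat by (apply Nat.pow_le_mono_l; apply Hp). lia. }
      rewrite Ed. destruct Hpq as [c Hc].
      exists (c ^ A * p ^ (A - j))%nat.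
      rewrite <- Nat.mul_assoc, <- Nat.pow_add_r, Nat.sub_add by auto.
      rewrite <- Nat.pow_mul_l. f_equal. lia.
    + apply Rsum_mono; [lia|]. intros d _. apply Rmult_le_pos; [|apply Lam_nonneg].
      unfold dv. destruct (_ =? _)%nat; lra.
  - rewrite sum_Lam_divisors by lia. rewrite pow_INR. right.
    clear. induction A as [|A IH]; [simpl; rewrite ln_1; ring|].
    destruct (Nat.eq_dec q 0) as [->|Hq0].
    { simpl (INR 0). simpl pow. rewrite Rmult_0_l. replace (ln 0) with 0; [ring|].
      unfold ln. destruct (Rlt_dec 0 0); [exfalso|]; lra. }
    assert (0 < INR q) by (apply lt_0_INR; lia).
    simpl pow. rewrite ln_mult, IH, S_INR by (auto; now apply pow_lt). ring.
Qed.

(** Below [n] the real part of a term is its full weight unless the integer shares a factor with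
    [q]. The window just below the peak dominates both these exceptions and all terms beyond [n].
    *)
Theorem power_sum_lower (q n A : nat) (chi : nat -> C) (U eta : R) (k N : nat) :
  dirichlet_character q chi ->
  (forall m, (0 < m < n)%nat -> Nat.gcd m q = 1%nat -> chi m = 1) ->
  400 <= U -> ln (INR n) = U + 128 -> (0 < n <= 2 ^ A)%nat ->
  U ^ 2 / 64 <= INR k <= U ^ 2 / 64 + 1 -> eta = INR k / U -> (n <= N)%nat ->
  amp k U * (exp (- 2) - 16 * exp (- 42) - exp (64 - U) * (INR A * ln (INR q))) <=
  Re (Csum (fun i => RtoC (weight eta k i) * chi (S i))%C N).
Proof.
  intros Hc H1 HU Hl Hn Hk Heta HN.
  assert (Hq := dchar_modulus_pos q chi Hc). assert (Ha := char_cmult q chi Hc).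
  assert (Hamp : 0 <= amp k U).
  { unfold amp. apply Rdiv_le_0_compat; [|apply INR_fact_lt_0].
    apply Rmult_le_pos; [apply pow_le; lra|apply Rlt_le, exp_pos]. }
  set (g := fun i => Lam (S i) * bump k U (S i)).
  assert (Hg : forall i, 0 <= g i) by (intros; apply Rmult_le_pos; [apply Lam_nonneg|apply bump_nonneg]).
  assert (EN : Re (Csum (fun i => RtoC (weight eta k i) * chi (S i))%C N) =
     amp k U * Rsum (fun i => g i * Re (chi (S i))) N).
  { rewrite <- Rsum_scal. clear HN. induction N as [|N IH]; [reflexivity|].
    simpl Csum. simpl Rsum. rewrite re_plus, IH, re_scal_l, (weight_bump k U eta N) by (auto; lra).
    unfold g. ring. }
  rewrite EN. apply Rmult_le_compat_l; auto. clear EN.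
  replace N with ((n - 1) + (N - (n - 1)))%nat by lia. rewrite Rsum_split.
  assert (Tail : - (16 * exp (- 42)) <=
    Rsum (fun i => g (n - 1 + i)%nat * Re (chi (S (n - 1 + i)))) (N - (n - 1))).
  { apply Rle_trans with (Rsum (fun i => (- exp (- 42)) * (Lam (n + i) * (INR n / INR (n + i) ^ 2))) (N - (n - 1))).
    - rewrite Rsum_scal. assert (T := Lam_tail n (N - (n - 1)) ltac:(lia)).
      assert (0 < exp (- 42)) by apply exp_pos. nra.
    - apply Rsum_le. intros i _. unfold g. replace (S (n - 1 + i)) with (n + i)%nat by lia.
      assert (V := bump_tail k U n i ltac:(lra) (proj1 Hk) (proj1 Hn) Hl).
      assert (V0 := bump_nonneg k U (n + i)). assert (HL := Lam_nonneg (n + i)).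
      assert (Hr : -1 <= Re (chi (n + i)%nat)).
      { assert (B := cm_bound chi Ha (n + i)). assert (B2 := re_le_Cmod (chi (n + i)%nat)).
        apply Rabs_le_between in B2. lra. }
      assert (0 <= Lam (n + i) * bump k U (n + i)) by (now apply Rmult_le_pos).
      apply Rle_trans with (- (Lam (n + i) * bump k U (n + i))); [|nra].
      assert (Lam (n + i) * bump k U (n + i) <= Lam (n + i) * (exp (- 42) * (INR n / INR (n + i) ^ 2)))
        by (now apply Rmult_le_compat_l). lra. }
  assert (Head : Rsum g (n - 1) - exp (64 - U) * (INR A * ln (INR q)) <=
    Rsum (fun i => g i * Re (chi (S i))) (n - 1)).
  { assert (Bd : Rsum (fun i => shares_factor q (S i) * Lam (S i)) (n - 1) <= INR A * ln (INR q)).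
    { eapply Rle_trans; [|apply (shared_prime_powers_sum q n A Hq); lia].
      replace n with (1 + (n - 1))%nat at 2 by lia. rewrite Rsum_split. simpl (Rsum _ 1). rewrite Lam_0.
      simpl. lra. }
    apply Rle_trans with (Rsum (fun i => g i + (- exp (64 - U)) * (shares_factor q (S i) * Lam (S i))) (n - 1)).
    - rewrite Rsum_plus, Rsum_scal. assert (0 < exp (64 - U)) by apply exp_pos. nra.
    - apply Rsum_le. intros i Hi. unfold shares_factor. assert (HL := Lam_nonneg (S i)).
      destruct (Nat.eqb_spec (Nat.gcd (S i) q) 1) as [E|E].
      + rewrite (H1 (S i)) by (auto; lia). rewrite re_RtoC. lra.
      + assert (Hz : chi (S i) = 0).
        { apply NNPP. intros F. apply E. now apply (dchar_support q chi Hc). }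
        rewrite Hz, re_RtoC, Rmult_0_r, Rmult_1_l. unfold g.
        destruct i as [|i]; [rewrite Lam_1; lra|].
        assert (V := bump_uniform k U (S (S i)) ltac:(lra) ltac:(lia) (proj1 Hk)). nra. }
  (* Mertens' estimate loses at most 5 and the rounding at most 1, so that a window of length 7 has
     mass at least 1. *)
  assert (Hexp : 0 < exp U) by apply exp_pos.
  destruct (nfloor_ex (exp U) ltac:(lra)) as [N2 HN2].
  destruct (nfloor_ex (exp (U - 7)) ltac:(apply Rlt_le, exp_pos)) as [N1 HN1].
  assert (HexpB : 1 + U <= exp U) by apply exp_ineq1_le.
  assert (HexpB' : 1 + (U - 7) <= exp (U - 7)) by apply exp_ineq1_le.
  assert (HN1p : (0 < N1)%nat) by (apply INR_lt; simpl; lra).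
  assert (HN2p : 1 <= INR N2) by (assert (0 < N2)%nat by (apply INR_lt; simpl; lra); apply (le_INR 1); lia).
  assert (HN12 : (N1 <= N2)%nat).
  { apply Nat.lt_succ_r. apply INR_lt. rewrite S_INR. assert (exp (U - 7) < exp U) by (apply exp_increasing; lra). lra. }
  assert (HN2n : (N2 <= n - 1)%nat).
  { assert (N2 < n)%nat; [|lia]. apply INR_lt.
    assert (INR n = exp (U + 128)) by (rewrite <- Hl, exp_ln; [auto|apply lt_0_INR; lia]).
    assert (exp U < exp (U + 128)) by (apply exp_increasing; lra). lra. }
  assert (Win : exp (- 2) <= Rsum g (n - 1)).
  { apply Rle_trans with (Rsum g N2); [|apply Rsum_mono; auto].
    replace N2 with (N1 + (N2 - N1))%nat by lia. rewrite Rsum_split.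
    assert (0 <= Rsum g N1) by (apply Rsum_nonneg; auto).
    enough (exp (- 2) <= Rsum (fun i => g (N1 + i)%nat) (N2 - N1)) by lra.
    apply Rle_trans with (exp (- 2) * (Mert N2 - Mert N1)).
    - assert (M2 := proj1 (Mertens N2 ltac:(lia))). assert (M1 := proj2 (Mertens N1 HN1p)).
      assert (L1 : ln (INR N1) <= U - 7).
      { rewrite <- (ln_exp (U - 7)). apply ln_le; [apply lt_0_INR; auto|lra]. }
      assert (L2 : U - 1 <= ln (INR N2)).
      { assert (exp U <= 2 * INR N2) by lra. apply ln_le in H0; auto.
        rewrite ln_exp, ln_mult in H0 by lra. generalize ln2_bounds. lra. }
      assert (0 < exp (- 2)) by apply exp_pos. nra.
    - rewrite !Mert_shift. replace N2 with (N1 + (N2 - N1))%nat at 1 by lia.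
      rewrite Rsum_split.
      match goal with |- _ * (?a + ?b - ?a) <= _ => replace (a + b - a) with b by ring end.
      rewrite <- Rsum_scal. apply Rsum_le. intros i Hi. unfold g.
      assert (HL := Lam_nonneg (S (N1 + i))).
      assert (Hm : 0 < INR (S (N1 + i))) by (apply lt_0_INR; lia).
      assert (V := bump_window k U (S (N1 + i)) ltac:(lra) (proj2 Hk)).
      assert (HV : U - 7 <= ln (INR (S (N1 + i))) <= U).
      { split.
        - rewrite <- (ln_exp (U - 7)). apply ln_le; [apply exp_pos|].
          assert (INR (S N1) <= INR (S (N1 + i))) by (apply le_INR; lia). rewrite S_INR in H0. lra.
        - rewrite <- (ln_exp U). apply ln_le; auto.
          assert (INR (S (N1 + i)) <= INR N2) by (apply le_INR; lia). lra. }
      specialize (V HV). replace (exp (- 2) * (Lam (S (N1 + i)) / INR (S (N1 + i)))) with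
        (Lam (S (N1 + i)) * (exp (- 2) / INR (S (N1 + i)))) by (field; lra).
      now apply Rmult_le_compat_l. }
  lra.
Qed.

(** By periodicity, [n mod q] is a nonresidue as well. *)
Lemma least_nonresidue_lt (q n : nat) (chi : nat -> C) : dirichlet_character q chi -> (1 < q)%nat ->
  least_nonresidue q chi n -> (n < q)%nat.
Proof.
  intros Hc Hq [[Hn0 [Hg H1]] Hmin].
  destruct (le_lt_dec q n) as [Hle|]; auto. exfalso.
  assert (Hr := Nat.mod_upper_bound n q ltac:(lia)).
  assert (Hgr : Nat.gcd (n mod q) q = 1%nat).
  { rewrite <- Hg, (Nat.gcd_comm n q). apply Nat.gcd_mod. lia. }
  assert (n <= n mod q)%nat; [|lia].
  apply Hmin. split; [|split; auto].
  - destruct (n mod q) as [|r]; [|lia]. simpl in Hgr. lia.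
  - rewrite <- (periodic_mod q chi n (dchar_modulus_pos q chi Hc) (dchar_periodic q chi Hc)). exact H1.
Qed.

Lemma exp_neg_le (n : nat) (x : R) : x <= - INR n -> exp x <= / 2 ^ n.
Proof.
  intros Hx. apply Rle_trans with (exp (- INR n)); [now apply exp_le|].
  rewrite exp_Ropp. apply Rinv_le_contravar; [apply pow_lt; lra|apply exp_ge_pow2].
Qed.

Theorem theorem3 :
  exists C0 K1 : R, 0 < C0 /\ 0 < K1 /\
  forall (t0 : R) (q : nat) (chi : nat -> C) (L : C -> C) (delta : R) (n : nat),
    1 < Rabs t0 ->
    dirichlet_character q chi ->
    ~ principal q chi ->
    exp (Rabs t0) + 4 <= INR q ->
    is_dirichlet_L chi L ->
    least_nonresidue q chi n ->
    1 / ln (Rabs t0 + 4) <= delta <= 1 / 2 ->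
    (forall sigma t : R,
       1 - delta < sigma < 1 ->
       Rabs t <= K1 * Rabs t0 ^ 2 * ln (INR q) ->
       L (sigma, t) <> RtoC 0) ->
    INR n < C0 * Rpower (K1 * Rabs t0 ^ 2 * (ln (INR q) / delta)) (1 / delta).
Proof.
  (* [exp 300] exceeds the product of [exp 40] from the upper bound, [exp 64] from the shift by 128
     with [delta <= 1 / 2], and what the comparison with the lower bound requires. *)
  exists 1, (exp 300). split; [lra|]. split; [apply exp_pos|].
  intros t0 q chi L delta n Ht0 Hc Hnp Hq HL Hn Hd Hzf.
  set (T := Rabs t0) in *. set (Q := ln (INR q)) in *. set (K := exp 300) in *.
  assert (HK : 301 <= K) by (unfold K; generalize (exp_ineq1_le 300); lra).
  assert (Hdpos : 0 < delta).
  { eapply Rlt_le_trans; [|apply Hd]. apply Rdiv_lt_0_compat; [lra|].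
    rewrite <- ln_1. apply ln_increasing; lra. }
  assert (Hq5 : 5 <= INR q) by (generalize (exp_ineq1_le T); lra).
  assert (HQ : 1 <= Q).
  { unfold Q. rewrite <- (ln_exp 1). apply ln_le; [apply exp_pos|].
    assert (exp 1 <= exp T) by (apply exp_le; lra). lra. }
  assert (HT2 : 1 <= T ^ 2) by nra.
  set (X := K * T ^ 2 * (Q / delta)).
  assert (HX : K * Q <= X).
  { unfold X. rewrite Rmult_assoc. apply Rmult_le_compat_l; [lra|].
    assert (Q <= Q / delta).
    { apply (Rmult_le_reg_r delta); auto. replace (Q / delta * delta) with Q by (field; lra). nra. }
    nra. }
  apply Rnot_le_lt. intros Hge. rewrite Rmult_1_l in Hge. fold X in Hge.
  assert (HX0 : 0 < X) by nra.
  assert (Hn0 : (0 < n)%nat) by apply Hn.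
  assert (Hnr : 0 < INR n) by (now apply lt_0_INR).
  set (l := ln (INR n)).
  assert (Hl1 : ln X <= delta * l).
  { unfold Rpower in Hge. apply ln_le in Hge; [|apply exp_pos]. rewrite ln_exp in Hge. fold l in Hge.
    apply Rle_trans with (delta * (1 / delta * ln X)); [right; field; lra|]. apply Rmult_le_compat_l; lra. }
  assert (Hl2 : 300 <= ln X).
  { rewrite <- (ln_exp 300). apply ln_le; [apply exp_pos|]. fold K. nra. }
  assert (Hl : 600 <= l) by nra.
  assert (HdX : exp (- (delta * l)) * (K * Q) <= 1).
  { apply Rle_trans with (exp (- ln X) * X).
    - apply Rmult_le_compat; auto; [apply Rlt_le, exp_pos|nra|]. apply exp_le. lra.
    - rewrite exp_Ropp, exp_ln by auto. right. field. lra. }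
  assert (Hq2 : (1 < q)%nat) by (apply INR_lt; simpl; lra).
  assert (Hnq := least_nonresidue_lt q n chi Hc Hq2 Hn).
  assert (HlQ : l <= Q) by (apply ln_le; auto; apply le_INR; lia).
  assert (H1 : forall m, (0 < m < n)%nat -> Nat.gcd m q = 1%nat -> chi m = 1).
  { intros m Hm Hg. apply NNPP. intros F. assert (n <= m)%nat; [|lia]. apply Hn. repeat split; auto. lia. }
  (* The peak is placed at [ln m = U], a safe distance below [n]. *)
  set (U := l - 128). assert (HU : 400 <= U) by (unfold U; lra).
  destruct (nfloor_ex (U ^ 2 / 64)) as [k0 Hk0]; [nra|].
  set (k := S k0).
  assert (Hk : U ^ 2 / 64 <= INR k <= U ^ 2 / 64 + 1) by (unfold k; rewrite S_INR; lra).
  set (eta := INR k / U).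
  assert (Heta : 1 <= eta).
  { apply (Rmult_le_reg_r U); [lra|]. unfold eta. replace (INR k / U * U) with (INR k) by (field; lra). nra. }
  destruct (nfloor_ex (2 * l)) as [A0 HA0]; [lra|].
  set (A := S A0).
  assert (HA : 2 * l <= INR A <= 3 * l) by (unfold A; rewrite S_INR; lra).
  assert (HnA : (n <= 2 ^ A)%nat).
  { apply INR_le. rewrite pow_INR. change (INR 2) with 2.
    rewrite <- (exp_ln (INR n)), <- (exp_ln 2) by lra. rewrite exp_pow_nat. apply exp_le. fold l.
    assert (1 / 2 <= ln 2).
    { assert (H := ln_ge_1_minus_inv 2 ltac:(lra)). lra. }
    nra. }
  assert (Hup := power_sum_upper q chi L U eta delta k Hc Hnp HL ltac:(fold Q; unfold U; lra) Hk eq_refl ltac:(lra)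
    ltac:(intros s t Hs Ht; apply Hzf; auto; fold Q in Ht; eapply Rle_trans; [exact Ht|]; apply Rmult_le_compat_r; nra)).
  set (S0 := (RtoC ((-1) ^ S k) * coef (fun z => Der (shiftL L eta) z / shiftL L eta z)%C k (eta / 2))%C) in *.
  fold Q in Hup.
  set (LB := exp (- 2) - 16 * exp (- 42) - exp (64 - U) * (INR A * Q)).
  assert (Hlow : amp k U * LB <= Re S0).
  { apply Rnot_lt_le. intros N.
    destruct (coef_series q chi L eta (eta / 2) k Hc HL ltac:(lra) (amp k U * LB - Re S0) ltac:(lra)) as [N0 HN0].
    fold S0 in HN0. specialize (HN0 (N0 + n)%nat ltac:(lia)).
    assert (P := power_sum_lower q n A chi U eta k (N0 + n) Hc H1 HU ltac:(unfold U; fold l; lra) ltac:(lia) Hk eq_refl ltac:(lia)).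
    fold Q LB in P.
    assert (R := re_le_Cmod (Csum (fun i => RtoC (weight eta k i) * chi (S i))%C (N0 + n) - S0)).
    unfold Cminus in R at 1. rewrite re_plus, re_opp in R. apply Rabs_le_between in R. lra. }
  (* After multiplication by [eta ^ (k + 1)], [Re S0] is at least [LB / 24] with [LB] close to
     [exp (- 2)], and at most [2 ^ (- 10)]. *)
  assert (HKQ : 0 < K * Q) by nra.
  assert (Hd128 : exp (- (delta * U)) <= exp 64 * exp (- (delta * l))).
  { rewrite <- exp_plus. apply exp_le. unfold U. nra. }
  assert (EK : K = exp 40 * exp 64 * exp 196) by (unfold K; rewrite <- !exp_plus; f_equal; ring).
  assert (Up : exp 40 * Q * exp (- (delta * U)) <= / 2 ^ 10).
  { apply Rle_trans with (exp 40 * Q * (exp 64 * exp (- (delta * l)))).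
    - apply Rmult_le_compat_l; auto. apply Rmult_le_pos; [apply Rlt_le, exp_pos|lra].
    - apply Rle_trans with (exp (- 196)).
      + apply (Rmult_le_reg_r (exp 196)); [apply exp_pos|].
        rewrite <- (exp_plus (- 196)). replace (- 196 + 196) with 0 by ring. rewrite exp_0.
        rewrite EK in HdX. lra.
      + apply exp_neg_le. simpl. lra. }
  assert (Gb : exp (64 - U) * (INR A * Q) <= 6 * / 2 ^ 10).
  { assert (E1 : exp (64 - U) = exp 192 * (exp (- (l / 2)) * exp (- (l / 2)))).
    { rewrite <- !exp_plus. f_equal. unfold U. field. }
    assert (E2 : INR A * exp (- (l / 2)) <= 6).
    { assert (B := exp_ineq1_le (l / 2)). rewrite exp_Ropp.
      apply (Rmult_le_reg_r (exp (l / 2))); [apply exp_pos|].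
      replace (INR A * / exp (l / 2) * exp (l / 2)) with (INR A) by (field; generalize (exp_pos (l / 2)); lra). lra. }
    assert (E3 : exp (- (l / 2)) <= exp (- (delta * l))) by (apply exp_le; nra).
    assert (E4 : exp 192 * (exp (- (delta * l)) * Q) <= / 2 ^ 10).
    { apply Rle_trans with (exp (- 108)).
      - apply (Rmult_le_reg_r (exp 108)); [apply exp_pos|].
        rewrite <- (exp_plus (- 108)). replace (- 108 + 108) with 0 by ring. rewrite exp_0.
        assert (EK2 : K = exp 192 * exp 108) by (unfold K; rewrite <- exp_plus; f_equal; ring).
        rewrite EK2 in HdX. lra.
      - apply exp_neg_le. simpl. lra. }
    assert (P1 := exp_pos 192). assert (P2 := exp_pos (- (l / 2))). assert (P3 := pos_INR A).
    rewrite E1.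
    replace (exp 192 * (exp (- (l / 2)) * exp (- (l / 2))) * (INR A * Q)) with
      ((INR A * exp (- (l / 2))) * (exp 192 * (exp (- (l / 2)) * Q))) by ring.
    apply Rmult_le_compat; auto.
    - nra.
    - apply Rmult_le_pos; [lra|]. apply Rmult_le_pos; lra.
    - eapply Rle_trans; [|exact E4]. apply Rmult_le_compat_l; [lra|]. apply Rmult_le_compat_r; lra. }
  assert (G42 : exp (- 42) <= / 2 ^ 10) by (apply exp_neg_le; simpl; lra).
  assert (G2 : / 9 <= exp (- 2)).
  { replace (- 2) with (- (1 + 1)) by ring. rewrite exp_Ropp, exp_plus.
    apply Rinv_le_contravar; [apply Rmult_lt_0_compat; apply exp_pos|].
    generalize exp_le_3 (exp_pos 1). nra. }
  assert (HLB : / 9 - 22 * / 2 ^ 10 <= LB) by (unfold LB; lra).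
  assert (Am := amp_lower k U eta ltac:(lra) ltac:(unfold k; lia) eq_refl (proj1 Hk)).
  assert (Hek : 0 < eta ^ S k) by (apply pow_lt; lra).
  assert (Fin : amp k U * eta ^ S k * LB <= / 2 ^ 10).
  { apply Rle_trans with (Re S0 * eta ^ S k); [|lra].
    replace (amp k U * eta ^ S k * LB) with (amp k U * LB * eta ^ S k) by ring.
    apply Rmult_le_compat_r; lra. }
  assert (/ 24 * LB <= amp k U * eta ^ S k * LB) by (apply Rmult_le_compat_r; [simpl in HLB; lra|auto]).
  simpl in *. lra.
Qed.
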